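(* Let $m\ge 2$ be an integer and $K$ an algebraic number field. Let $a(z),b(z)\in K[z]$, with $a(z)$ monic of degree $m$ and $\deg b\le m-1$; let $b_{m-1}$ denote the coefficient of $z^{m-1}$ in $b(z)$ (possibly $0$). Assume $a(z)=\prod_{i=1}^m(z-\alpha_i)$ with $\alpha_1,\ldots,\alpha_m\in K$ pairwise distinct, that $s_i:=b(\alpha_i)/a'(\alpha_i)\in\mathbb{Q}\setminus\mathbb{Z}_{\le -1}$ for all $1\le i\le m$, and that $b_{m-1}\notin\mathbb{Z}_{<-1}$. For $0\le j\le m-2$ define the formal Laurent series \[ f_j(z)=\prod_{i=1}^m\Bigl(1-\frac{\alpha_i}{z}\Bigr)^{s_i}\cdot\frac{1}{z^{j+1}}\cdot F^{(m)}_D\Bigl(b_{m-1}+j+1,\,1+s_1,\ldots,1+s_m;\,b_{m-1}+j+2;\,\frac{\alpha_1}{z},\ldots,\frac{\alpha_m}{z}\Bigr)\in K((1/z)). \] Let $v_0$ be a place of $K$ and $\beta\in K\setminus\{0\}$, and assume $V_{v_0}(\beta)>0$. Then each series $f_j(z)$ converges at $z=\beta$ in $K_{v_0}$, and the $m$ elements $1,f_0(\beta),f_1(\beta),\ldots,f_{m-2}(\beta)$ of $K_{v_0}$ are linearly independent over $K$.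
   Context: $(x)_0=1$, $(x)_k=x(x+1)\cdots(x+k-1)$. The Lauricella series is $F^{(m)}_D(\alpha,\beta_1,\ldots,\beta_m,\gamma;z_1,\ldots,z_m)=\sum_{k_1,\ldots,k_m\ge0}\frac{(\alpha)_{k_1+\cdots+k_m}(\beta_1)_{k_1}\cdots(\beta_m)_{k_m}}{(\gamma)_{k_1+\cdots+k_m}k_1!\cdots k_m!}z_1^{k_1}\cdots z_m^{k_m}$, and $(1-\alpha/z)^{s}=\sum_{k\ge0}\frac{(-s)_k}{k!}\alpha^k z^{-k}$ as formal series in $1/z$. $\mathfrak{M}_K$ is the set of places of $K$, $K_v$ the completion at $v$; absolute values are normalized by $|p|_v=p^{-[K_v:\mathbb{Q}_p]/[K:\mathbb{Q}]}$ if $v\mid p$ and $|x|_v=|\iota_v(x)|^{[K_v:\mathbb{R}]/[K:\mathbb{Q}]}$ if $v\mid\infty$ ($\iota_v$ the corresponding embedding into $\mathbb{C}$). For $\boldsymbol{\gamma}=(\gamma_1,\ldots,\gamma_r)\in K^r$: $\mathrm{h}_v(\boldsymbol{\gamma})=\log\max\{1,|\gamma_1|_v,\ldots,|\gamma_r|_v\}$, $\mathrm{h}(\boldsymbol{\gamma})=\sum_{v\in\mathfrak{M}_K}\mathrm{h}_v(\boldsymbol{\gamma})$; $\mathrm{den}(\boldsymbol\gamma)$ is the least positive integer $n$ with all $n\gamma_i$ algebraic integers. For $x\in\mathbb{Q}$, $\mu(x)=\mathrm{den}(x)\prod_{q \text{ prime},\, q\mid\mathrm{den}(x)}q^{1/(q-1)}$.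 With $\boldsymbol\alpha=(\alpha_1,\ldots,\alpha_m)$, $\varphi$ Euler's totient, and $D=\mathrm{den}(b_{m-1})$, \[V_v(\beta)=m\,\mathrm{h}_v(\beta)-(m-1)\mathrm{h}(\beta)-\sum_{i=1}^m\mathrm{h}(\alpha_i)-m\Bigl(\mathrm{h}(\boldsymbol\alpha)+\sum_{i=1}^m\log\mu(s_i)+\log 4\Bigr)-(m-1)\frac{D}{\varphi(D)}\sum_{\substack{1\le j\le D\\ (j,D)=1}}\frac1j.\] A formal Laurent series $\sum_k c_k z^{-k}$ converges at $z=\beta$ in $K_{v_0}$ if $\sum_k c_k\beta^{-k}$ converges in $K_{v_0}$. *)

(* Defs.v *)
From HB Require Import structures.
From mathcomp Require Import all_boot all_order all_algebra all_field.
From mathcomp Require Import all_classical all_reals all_analysis.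
From mathcomp Require Import complex.
Set Implicit Arguments. Unset Strict Implicit. Unset Printing Implicit Defensive.
Import Order.TTheory GRing.Theory Num.Theory.
Local Open Scope ring_scope.

(* Formal series in 1/z, represented by their coefficient sequences:   *)
(* u : nat -> K stands for  sum_k u k z^{-k}.                          *)
Section Series.
Variable K : fieldType.

Definition pochK (x : K) (k : nat) : K := \prod_(i < k) (x + i%:R).

Definition sconv (u v : nat -> K) : nat -> K :=
  fun n => \sum_(i < n.+1) u i * v (n - i)%N.

Definition sone : nat -> K := fun n => (n == 0%N)%:R.

(* (1 - al/z)^s = sum_k (-s)_k/k! al^k z^{-k} *)
Definition binser (s al : K) : nat -> K :=
  fun k => pochK (- s) k / (k`!)%:R * al ^+ k.

(* coefficient of z^{-n} in F_D^{(m)}(A, B_1..B_m, C; x_1/z, ..., x_m/z) *)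
Definition lauricella_coef (m : nat) (A : K) (B : 'I_m -> K) (C : K)
    (x : 'I_m -> K) (n : nat) : K :=
  \sum_(k : {ffun 'I_m -> 'I_n.+1} | (\sum_i (k i : nat))%N == n)
     (pochK A n * \prod_i pochK (B i) (k i))
       / (pochK C n * \prod_i ((k i)`!)%:R)
     * \prod_i x i ^+ k i.

(* coefficient of z^{-k} in
   f_j(z) = prod_i (1 - al_i/z)^{s_i} * z^{-(j+1)} *
            F_D(bm + j + 1, 1 + s_1, ..., 1 + s_m; bm + j + 2; al_1/z, ..., al_m/z) *)
Definition fcoef (m : nat) (al s : 'I_m -> K) (bm : K) (j : nat) : nat -> K :=
  fun k => if (k < j.+1)%N then 0 else
    sconv (\big[sconv/sone]_(i < m) binser (s i) (al i))
          (lauricella_coef (bm + (j.+1)%:R) (fun i => 1 + s i)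
                           (bm + (j.+2)%:R) al)
          (k - j.+1)%N.

Definition algint (x : K) : Prop :=
  exists p : {poly int}, p \is monic /\ root (map_poly (fun z : int => z%:~R) p) x.

Definition is_den (x : K) (D : nat) : Prop :=
  [/\ (0 < D)%N, algint (D%:R * x) &
      forall n : nat, (0 < n)%N -> algint (n%:R * x) -> (D <= n)%N].
End Series.

Section Places.
Variable R : realType.

Definition absval (T : fieldType) (N : T -> R) : Prop :=
  [/\ N 0 = 0, forall x, x != 0 -> 0 < N x,
      forall x y, N (x * y) = N x * N y &
      forall x y, N (x + y) <= N x + N y].

Definition cvg_abs (T : fieldType) (N : T -> R) (u : nat -> T) (l : T) : Prop :=
  forall e, 0 < e -> exists n0, forall n, (n0 <= n)%N -> N (u n - l) < e.
Definition cauchy_abs (T : fieldType) (N : T -> R) (u : nat -> T) : Prop :=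
  forall e, 0 < e -> exists n0, forall n p, (n0 <= n)%N -> (n0 <= p)%N ->
    N (u n - u p) < e.

Variable K : fieldExtType rat.
Local Notation d := (\dim (fullv : {vspace K})).

(* Archimedean places: |x|_v = |iota_v x|^{[K_v:R]/[K:Q]},
   iota_v an embedding of K into C = R[i];
   [K_v:R] = 1 if iota_v(K) is real, 2 otherwise. *)
Definition place_inf (w : K -> R) : Prop :=
  exists (sigma : {rmorphism K -> complex R}) (n : nat),
    ((n = 1%N /\ forall x, complex.Im (sigma x) = 0) \/
     (n = 2%N /\ exists x, complex.Im (sigma x) != 0)) /\
    forall x, w x = ComplexField.Normc.normc (sigma x) `^ (n%:R / d%:R).

Definition residue_card (N : K -> R) (q : nat) : Prop :=
  exists r : seq K,
    [/\ size r = q, all (fun y => N y <= 1) r,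
        (forall i j, (i < q)%N -> (j < q)%N -> i != j ->
           N (nth 0 r i - nth 0 r j) = 1) &
        forall x, N x <= 1 -> exists2 y, y \in r & N (x - y) < 1].

(* Non-archimedean places, normalized: for v | p,
   |x|_v = N(P)^{-ord_P(x)/[K:Q]}, which gives |p|_v = p^{-[K_v:Q_p]/[K:Q]}.
   Here N is any representative absolute value, with discrete value group
   c^Z (0 < c < 1), residue field of cardinality q = N(P); then
   ord_P(x) = log N x / log c. *)
Definition place_fin (w : K -> R) : Prop :=
  exists (N : K -> R) (c : R) (q : nat),
    [/\ absval N /\ (forall x y, N (x + y) <= Num.max (N x) (N y)),
        0 < c < 1,
        (forall x, x != 0 -> exists k : int, N x = c ^ k) /\ (exists x, N x = c),
        residue_card N q &
        forall x, w x = N x `^ (ln (q%:R : R) / (- (d%:R * ln c)))].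

(* M_K, each place represented by its normalized absolute value |.|_v *)
Definition places : set (K -> R) := [set w | place_inf w \/ place_fin w].

Definition hv (w : K -> R) (g : seq K) : R :=
  ln (\big[Num.max/1]_(x <- g) w x).

Definition height (g : seq K) : R :=
  fine (\esum_(w in places) (hv w g)%:E).

Definition mu (x : rat) : R :=
  (denq x)%:~R * \prod_(q <- primes `|denq x|%N) (q%:R : R) `^ (1 / (q%:R - 1)).

Definition Vv (m : nat) (al : 'I_m -> K) (s : 'I_m -> rat) (D : nat)
    (w : K -> R) (beta : K) : R :=
  m%:R * hv w [:: beta] - (m%:R - 1) * height [:: beta]
  - \sum_(i < m) height [:: al i]
  - m%:R * (height [seq al i | i : 'I_m] + \sum_(i < m) ln (mu (s i)) + ln 4)
  - (m%:R - 1) * ((D%:R / (totient D)%:R)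
                   * \sum_(1 <= j < D.+1 | coprime j D) (j%:R)^-1).

Definition completion (w : K -> R) (L : fieldType) (NL : L -> R)
    (iota : {rmorphism K -> L}) : Prop :=
  [/\ absval NL, forall x, NL (iota x) = w x,
      (forall u : nat -> L, cauchy_abs NL u -> exists l, cvg_abs NL u l) &
      forall y e, 0 < e -> exists x, NL (y - iota x) < e].
End Places.

(* Main.v *)
(* Fix w with w'/w = b/a.  The moments phi_j(t^k) of f_j, i.e. the coefficients of its
   expansion, satisfy phi_j((a g)' + b g) = 0 for every polynomial g, so that Rodrigues' formula
   P_{n,l} = w^{-1} (d/dz)^n (w a^n z^l) / n!  (0 <= l < m)  yields simultaneous Pade
   denominators: phi_j(t^k P_{n,l}) = 0 for k < n.  Given a relation
   lam0 + sum_j lam_j f_j(beta) = 0, replace the f_j(beta) by their approximants: this gives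
   numbers x_{n,l} of K, not all zero for fixed n, which are small at v_0.  At every other place
   they grow at most geometrically in n, once one knows the denominators of the moments, namely
   the least common multiple of the numbers u + D k with b_{m-1} = u/D.  An elementary estimate in
   the style of Chebyshev, with ln 4 + log mu(D) per step, is enough: it replaces the prime number
   theorem for arithmetic progressions because D / phi(D) * sum_j 1/j >= 1 and the archimedean
   constant of the Pade approximants can be taken to be 4 e^(m-1).  The product formula applied
   to x_{n,l} then gives V_{v_0}(beta) <= 0 as n tends to infinity.

   For these normalized absolute values the product formula, in the direction needed, comes from
   Chevalley's theorem (there are enough valuation rings) and from counting residues of algebraic
   integers. *)

Require Import Defs.
From HB Require Import structures.
From mathcomp Require Import all_boot all_order all_algebra all_field.
From mathcomp Require Import all_classical all_reals all_analysis.
From mathcomp Require Import complex.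
From mathcomp Require Import ring lra zify.
Set Implicit Arguments. Unset Strict Implicit. Unset Printing Implicit Defensive.
Import Order.TTheory GRing.Theory Num.Theory.
Local Open Scope ring_scope.

(** * Chevalley's theorem on valuation rings *)

(** The budget explains the shape of the estimates. The Pade polynomials have degree about n (m -
    1), so moments up to that order occur and the lcm costs (m - 1)(log 4 + log mu(D)) per step,
    while all archimedean places together cost log 4 + (m - 1). At places above D the terms u + D k
    are units, and the moments are controlled instead by a recurrence with leading coefficient of
    absolute value 1/|D|; this saves (m - 1) log mu(D), the lcm surcharge. What is left is m log 4 +
    (m - 1), the most that V allows. Factors subexponential in n are free, so most local bounds can
    be crude and uniform in the place.

    Places are given only as real functions. Every finiteness statement about them (ramification,
    residue degree, number of places above p) comes from one source: d + 1 elements of K satisfy an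
    integral relation that is nontrivial modulo p. For the product formula an upper bound for
    algebraic integers and a lower bound for rational integers suffice; each is proved for n-th
    powers up to a constant factor, which disappears as n grows. *)

Section SubringsOfFields.
Variable K : fieldType.
Implicit Types (A B V : set K) (x y t : K).

Definition subring_set A :=
  [/\ A 1, forall x y, A x -> A y -> A (x - y) & forall x y, A x -> A y -> A (x * y)].

Lemma subring0 A : subring_set A -> A 0.
Proof. by case=> A1 AB _; have := AB _ _ A1 A1; rewrite subrr. Qed.

Lemma subringN A x : subring_set A -> A x -> A (- x).
Proof. by move=> sA Ax; rewrite -sub0r; case: (sA) => _ AB _; apply: AB => //; apply: subring0. Qed.

Lemma subringD A x y : subring_set A -> A x -> A y -> A (x + y).
Proof. by move=> sA Ax Ay; rewrite -[y]opprK; case: (sA) => _ AB _; apply: AB => //; apply: subringN. Qed.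

Lemma subring_sum A (I : Type) (r : seq I) (P : pred I) (F : I -> K) :
  subring_set A -> (forall i, P i -> A (F i)) -> A (\sum_(i <- r | P i) F i).
Proof.
by move=> sA AF; elim/big_ind: _ => //; [exact: subring0 | move=> ? ?; exact: subringD].
Qed.

Lemma subringX A x n : subring_set A -> A x -> A (x ^+ n).
Proof.
move=> sA Ax; elim: n => [|n IH]; first by rewrite expr0; case: sA.
by rewrite exprS; case: (sA) => _ _; apply.
Qed.

Lemma subring_nat A n : subring_set A -> A n%:R.
Proof.
move=> sA; elim: n => [|n IH]; first exact: subring0.
by rewrite -addn1 natrD; apply: subringD => //; case: sA.
Qed.

Lemma subring_int A (z : int) : subring_set A -> A z%:~R.
Proof.
move=> sA; case: z => n; first exact: (@subring_nat _ n).
by rewrite NegzE mulrNz; apply: subringN => //; apply: (@subring_nat _ n.+1).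
Qed.

Definition valuation_ring V := subring_set V /\ forall t, V t \/ V t^-1.

(** Multiplying by [x ^+ n] gives a monic equation. Contrapositively, a non-integral x lies outside
    Z[1/x], the subring from which Chevalley's argument starts. *)
Lemma algint_of_polyV x (n : nat) (c : nat -> int) :
  x != 0 -> x = \sum_(i < n) (c i)%:~R * x ^- i -> algint x.
Proof.
move=> x0 Ex.
pose p : {poly int} := 'X^(n.+1) - \sum_(i < n) (c i)%:P * 'X^(n - i).
have sz : (size (\sum_(i < n) (c i)%:P * 'X^(n - i) : {poly int})%R < n.+2)%N.
  rewrite ltnS; apply: (leq_trans (size_sum _ _ _)); apply/bigmax_leqP => i _.
  apply: (leq_trans (size_polyMleq _ _)); rewrite size_polyXn.
  by have := size_polyC_leq1 (c i); have := ltn_ord i; case: (size _) => [|[|?]]; lia.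
exists p; split.
  rewrite monicE lead_coefDl ?lead_coefXn // size_polyN size_polyXn //.
rewrite /root /p rmorphB /= map_polyXn hornerD hornerN hornerXn rmorph_sum /= horner_sum.
rewrite subr_eq0; apply/eqP; rewrite exprS {1}Ex mulr_suml; apply: eq_bigr => i _.
rewrite rmorphM /= map_polyC /= map_polyXn hornerM hornerC hornerXn -mulrA; congr (_ * _).
by rewrite -{2}(subnK (ltnW (ltn_ord i))) [in LHS]exprD mulrCA mulVf ?mulr1 // expf_neq0.
Qed.

(** Zorn is applied to the sets A whose union with B0 is a subring avoiding x: with the union built
    in, the empty chain has an upper bound as well. *)
Lemma maximal_subring (B0 : set K) x : subring_set B0 -> ~ B0 x ->
  exists V, [/\ subring_set V, forall y, B0 y -> V y, ~ V x &
    forall C, subring_set C -> (forall y, V y -> C y) -> ~ C x -> forall y, C y -> V y].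
Proof.
move=> sB0 B0x.
pose P (A : set K) := subring_set (A `|` B0)%classic /\ ~ (A `|` B0)%classic x.
have [|A [[sA Ax] Amax]] := @Zorn_bigcup K P.
  move=> F FP totF; set U := (\bigcup_(X in F) X)%classic.
  have in1 y : (U `|` B0)%classic y -> B0 y \/ exists2 X, F X & X y.
    by case=> [[X FX Xy]|]; [right; exists X | left].
  have inU X y : F X -> (X `|` B0)%classic y -> (U `|` B0)%classic y.
    by move=> FX [Xy|By]; [left; exists X | right].
  have in2 y z : (U `|` B0)%classic y -> (U `|` B0)%classic z ->
      (B0 y /\ B0 z) \/ exists2 X, F X & (X `|` B0)%classic y /\ (X `|` B0)%classic z.
    move=> /in1 [By|[X FX Xy]] /in1 [Bz|[Y FY Yz]].
    - by left.
    - by right; exists Y => //; split; [right|left].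
    - by right; exists X => //; split; [left|right].
    - right; have [XY|YX] := totF _ _ FX FY.
      + by exists Y => //; split; left => //; apply: XY.
      + by exists X => //; split; left => //; apply: YX.
  split; last first.
    move=> /in1 [//|[X FX Xx]]; have [_] := FP _ FX; apply; by left.
  split; first by right; case: sB0.
  - move=> y z Uy Uz; case: (in2 _ _ Uy Uz) => [[By Bz]|[X FX [Xy Xz]]].
      by right; case: sB0 => _ + _; apply.
    by have [[_ XB _] _] := FP _ FX; apply: inU (FX) _; apply: XB.
  - move=> y z Uy Uz; case: (in2 _ _ Uy Uz) => [[By Bz]|[X FX [Xy Xz]]].
      by right; case: sB0 => _ _; apply.
    by have [[_ _ XM] _] := FP _ FX; apply: inU (FX) _; apply: XM.
exists (A `|` B0)%classic; split=> // [y By|]; first by right.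
move=> C sC AC Cx y Cy.
have [CA|nCA] := pselect (forall y, C y -> A y); first by left; apply: CA.
exfalso; apply: (Amax C).
  by split; [move=> z Az; apply: AC; left | exact: nCA].
have E : (C `|` B0)%classic = C.
  by apply/seteqP; split=> z; [case=> // Bz; apply: AC; right | left].
by rewrite /P E.
Qed.

(** Here u is the inverse of the avoided element: if neither t nor its inverse lies in a maximal V,
    then 1 lies in u V[t] and in u V[1/t]. Descent on the sum of the two degrees: the constant term
    of the shorter relation is absorbed because 1 - u b_0 is a unit, and the resulting expression of
    1 in negative powers of t removes the top term of the longer relation. *)
Lemma chevalley_reduction V u t : subring_set V -> V u -> ~ V u^-1 ->
  (forall y, V y -> V (1 - u * y)^-1) ->
  forall N n m (a b : nat -> K), (n + m <= N)%N ->
  (forall i, V (a i)) -> (forall i, V (b i)) ->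
  1 = u * \sum_(i < n.+1) a i * t ^+ i -> 1 = u * \sum_(i < m.+1) b i * t ^- i -> False.
Proof.
move=> sV Vu Vu1 Vinv; have [V1 VB VM] := sV.
have u0 : u != 0 by apply/negP => /eqP u0; apply: Vu1; rewrite u0 invr0; apply: subring0.
have base a : V a -> 1 = u * a -> False.
  by move=> Va E; apply: Vu1; rewrite -[u^-1]mulr1 E mulKf.
move=> N; elim: N t => [|N IH] t n m a b nm Va Vb Ea Eb.
  move: nm; rewrite leqn0 addn_eq0 => /andP[/eqP n0 /eqP m0]; subst.
  by move: Ea; rewrite big_ord1 expr0 mulr1; apply: base.
wlog lemn : t n m a b nm Va Vb Ea Eb / (m <= n)%N.
  move=> H; have [mn|nm'] := leqP m n; first exact: (H t n m a b).
  apply: (H t^-1 m n b a) => //; last exact: ltnW; first by rewrite addnC.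
    by rewrite {1}Eb; congr (_ * _); apply: eq_bigr => i _; rewrite exprVn.
  by rewrite {1}Ea; congr (_ * _); apply: eq_bigr => i _; rewrite exprVn invrK.
case: m nm lemn b Vb Eb => [|m] nm lemn b Vb Eb.
  by move: Eb; rewrite big_ord1 expr0 invr1 mulr1; apply: base.
case: n nm lemn Ea => [//|n] nm lemn Ea.
have [t0|t0] := eqVneq t 0.
  move: Ea; rewrite t0 big_ord_recl expr0 mulr1 big1 ?addr0; first by apply: base.
  by move=> i _; rewrite expr0n mulr0.
pose e := (1 - u * b 0)^-1.
have Ve : V e by apply: Vinv.
have d0 : 1 - u * b 0 != 0.
  by rewrite subr_eq0; apply/negP => /eqP; apply: base.
pose c i := u * b i * e.
have Vc i : V (c i) by apply: (VM) => //; apply: (VM).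
have Ec : 1 = \sum_(i < m.+1) c i.+1 * t ^- i.+1.
  move: Eb; rewrite big_ord_recl expr0 invr1 mulr1 mulrDr => Eb.
  have : (1 - u * b 0) * e = 1 by rewrite mulfV.
  rewrite {1}Eb [u * b 0 + _]addrC addrK => <-.
  by rewrite mulr_sumr mulr_suml; apply: eq_bigr => i _; rewrite /c lift0; ring.
pose a' i := if (n - m <= i <= n)%N then a i + a n.+1 * c (n.+1 - i)%N else a i.
have Va' i : V (a' i).
  by rewrite /a'; case: ifP => // _; apply: subringD => //; apply: (VM).
apply: (IH t n m.+1 a' b) => //.
rewrite {1}Ea; congr (_ * _); rewrite big_ord_recr /=.
have -> : a n.+1 * t ^+ n.+1 = \sum_(i < m.+1) a n.+1 * c i.+1 * t ^+ (n - i).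
  rewrite -[LHS]mulr1 {1}Ec mulr_sumr; apply: eq_bigr => i _.
  have -> : n.+1 = (n - i + i.+1)%N by have := ltn_ord i; lia.
  rewrite [X in _ * X * _]exprD; field.
  by rewrite expf_neq0.
have -> : \sum_(i < m.+1) a n.+1 * c i.+1 * t ^+ (n - i) =
   \sum_(i < n.+1) (if (n - m <= i)%N then a n.+1 * c (n.+1 - i)%N * t ^+ i else 0).
  rewrite -big_mkcond /=.
  rewrite [RHS](reindex_inj rev_ord_inj) /=.
  rewrite (big_ord_widen n.+1 (fun i => a n.+1 * c i.+1 * t ^+ (n - i))) //.
  apply: eq_big => i; rewrite subSS; first by have := ltn_ord i; lia.
  by move=> _; congr (_ * c _ * t ^+ _); have := ltn_ord i; lia.
rewrite -big_split /=; apply: eq_bigr => i _; rewrite /a'.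
have -> : (i <= n)%N by rewrite -ltnS.
by rewrite andbT; case: ifP => _; rewrite ?addr0 // mulrDl.
Qed.

(** V is maximal among the subrings that contain Z[1/x] and avoid x. Maximality is used twice: to
    invert 1 - u y for y in V, and to find x in V[w] for every w outside V. *)
Lemma valuation_ring_exists x : ~ algint x -> exists2 V, valuation_ring V & ~ V x.
Proof.
move=> nx; have x0 : x != 0.
  apply/negP => /eqP x0; apply: nx; exists 'X; split; first exact: monicX.
  by rewrite map_polyX x0 /root hornerX.
pose u := x^-1.
pose gen (a : set K) t y := exists n (c : nat -> K), (forall i, a (c i)) /\ y = \sum_(i < n) c i * t ^+ i.
have genS A t : subring_set A -> subring_set (gen A t).
  move=> sA; have A0 := subring0 sA.
  have ext n (c : nat -> K) N : (n <= N)%N -> (forall i, A (c i)) -> exists c' : nat -> K,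
      (forall i, A (c' i)) /\ \sum_(i < n) c i * t ^+ i = \sum_(i < N) c' i * t ^+ i.
    move=> nN Ac; exists (fun i => if (i < n)%N then c i else 0); split.
      by move=> i; case: ifP.
    rewrite (big_ord_widen N (fun i => c i * t ^+ i)) // big_mkcond.
    by apply: eq_bigr => i _; case: ifP; rewrite ?mul0r.
  split.
  - exists 1%N, (fun _ => 1); split; first by case: sA.
    by rewrite big_ord1 mulr1.
  - move=> _ _ [n [c [Ac ->]]] [m [e [Ae ->]]].
    have [c' [Ac' ->]] := ext _ _ (maxn n m) (leq_maxl _ _) Ac.
    have [e' [Ae' ->]] := ext _ _ (maxn n m) (leq_maxr _ _) Ae.
    exists (maxn n m), (fun i => c' i - e' i); split.
      by move=> i; case: sA => _ + _; apply.
    by rewrite -sumrB; apply: eq_bigr => i _; rewrite mulrBl.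
  - move=> _ _ [n [c [Ac ->]]] [m [e [Ae ->]]].
    pose p := \poly_(i < n) c i; pose q := \poly_(i < m) e i.
    exists (size (p * q)), (fun i => (p * q)`_i); split.
      move=> i; rewrite coefM; apply: subring_sum => // j _.
      by rewrite !coef_poly; case: sA => _ _; apply; case: ifP.
    by rewrite -horner_coef hornerM !horner_poly.
have genI A t y : subring_set A -> A y -> gen A t y.
  by move=> sA Ay; exists 1%N, (fun _ => y); rewrite big_ord1 expr0 mulr1.
pose Z : set K := fun y => exists z : int, y = z%:~R.
have sZ : subring_set Z.
  split; first by exists 1.
  - by move=> _ _ [a ->] [b ->]; exists (a - b); rewrite rmorphB.
  - by move=> _ _ [a ->] [b ->]; exists (a * b); rewrite rmorphM.
have sB0 := genS _ u sZ.
have [|V [sV B0V Vx Vmax]] := @maximal_subring (gen Z u) x sB0.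
  move=> [n [c [cZ E]]]; apply: nx.
  pose c' i := projT1 (cid (cZ i)).
  apply: (@algint_of_polyV x n c' x0); rewrite {1}E; apply: eq_bigr => i _.
  by rewrite /c'; case: (cid _) => z /= ->; rewrite /u exprVn.
have [V1 VB VM] := sV.
have Vu : V u.
  apply: B0V; exists 2%N, (fun i => (i == 1%N)%:R); split.
    by move=> i; exists (i == 1%N)%:R; case: eqP.
  by rewrite big_ord_recr big_ord1 /= mul0r add0r mul1r.
have Vinv y : V y -> V (1 - u * y)^-1.
  move=> Vy; set d := 1 - u * y; have Vd : V d by apply: (VB) => //; apply: (VM).
  have d0 : d != 0.
    rewrite subr_eq0; apply/negP => /eqP E; apply: Vx.
    by rewrite -[x]mulr1 E mulVKf // .
  (* The localization of V at the powers of d. It avoids x: d^k has the form 1 - u y' with y' in V,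
     and u x = 1, so x d^k in V would give x = x d^k + y' in V. *)
  pose C : set K := fun z => exists k, V (z * d ^+ k).
  have sC : subring_set C.
    split; first by exists 0%N; rewrite mulr1.
    - move=> a b [k Va] [l Vb]; exists (k + l)%N; rewrite mulrBl exprD.
      apply: (VB); first by rewrite mulrA; apply: (VM) => //; apply: subringX.
      by rewrite [d ^+ k * _]mulrC mulrA; apply: (VM) => //; apply: subringX.
    - move=> a b [k Va] [l Vb]; exists (k + l)%N.
      by rewrite exprD mulrACA; apply: (VM).
  apply: (Vmax C) => //.
  - by move=> z Vz; exists 0%N; rewrite mulr1.
  - move=> [k Vxk].
    have [y' Vy' Ey'] : exists2 y', V y' & d ^+ k = 1 - u * y'.
      elim: k {Vxk} => [|k [y' Vy' E]].
        by exists 0; [apply: subring0 | rewrite mulr0 subr0].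
      exists (y + y' - u * y * y').
        by apply: (VB); [apply: subringD | apply: (VM) => //; apply: (VM)].
      by rewrite exprS E /d; ring.
    apply: Vx; rewrite (_ : x = x * d ^+ k + y'); first exact: subringD.
    by rewrite Ey' /u mulrBr mulr1 mulrA mulfV // mul1r subrK.
  - by exists 1%N; rewrite expr1 mulVf.
exists V => //; split=> // t.
have Vgen w : ~ V w -> gen V w x.
  move=> nw; apply: contrapT => ng; apply: nw; apply: (Vmax (gen V w)) => //.
  - exact: genS.
  - by move=> y; apply: genI.
  - exists 2%N, (fun i => (i == 1%N)%:R); split.
      by move=> i; case: eqP => _ //; apply: subring0.
    by rewrite big_ord_recr big_ord1 /= mul0r add0r mul1r.
have [Vt|/Vgen [n [a [Va Ea]]]] := pselect (V t); first by left.
have [Vt|/Vgen [m [b [Vb Eb]]]] := pselect (V t^-1); first by right.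
exfalso.
have Vu1 : ~ V u^-1 by rewrite /u invrK.
case: n Ea => [|n] Ea; first by rewrite big_ord0 in Ea; rewrite Ea eqxx in x0.
case: m Eb => [|m] Eb; first by rewrite big_ord0 in Eb; rewrite Eb eqxx in x0.
apply: (@chevalley_reduction V u t sV Vu Vu1 Vinv (n + m) n m a b) => //.
  by rewrite -Ea mulVf.
rewrite -{1}(mulVf x0) {2}Eb; congr (_ * _).
by apply: eq_bigr => i _; rewrite exprVn.
Qed.

End SubringsOfFields.

(** * Valuation rings of a number field *)

Section NumberFieldRelations.
Variable K : fieldExtType rat.
Local Notation d := (\dim (fullv : {vspace K})).

Lemma int_relation h (e : 'I_h -> K) : (d < h)%N ->
  exists c : 'I_h -> int, (exists i, c i != 0) /\ \sum_i (c i)%:~R * e i = 0.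
Proof.
move=> dh.
have nf : ~~ free [tuple e i | i < h].
  apply/negP => /eqP E; have := dimvS (subvf <<[tuple e i | i < h]>>).
  by rewrite E size_tuple leqNgt dh.
have [k [i0 ki0] Ek] : exists2 k : 'I_h -> rat, exists i, k i != 0 & \sum_i k i *: e i = 0.
  apply: contrapT => H; move/negP: nf; apply; apply/freeP => k Ek i.
  apply: contrapT => ki; apply: H; exists k; first by exists i; apply/eqP.
  by rewrite -[RHS]Ek; apply: eq_bigr => j _; rewrite -tnth_nth tnth_mktuple.
exists (fun i => numq (k i) * \prod_(j | j != i) denq (k j)); split.
  exists i0; rewrite mulf_neq0 ?numq_eq0 //.
  by apply/prodf_neq0 => j _; rewrite denq_neq0.
have E i : (numq (k i) * \prod_(j | j != i) denq (k j))%:~R * e i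
    = (\prod_j denq (k j))%:~R * (k i *: e i).
  rewrite -mulr_algl -!(rmorph_int (in_alg K)) mulrA -rmorphM /=; congr (_%:A * _).
  rewrite [in RHS](bigD1 i) //= !intrM -{3}[k i]divq_num_den.
  have := denq_neq0 (k i); rewrite -(@intr_eq0 rat) => ?.
  by field.
by rewrite (eq_bigr _ (fun i _ => E i)) -mulr_sumr Ek mulr0.
Qed.

(** Division by p as long as possible, by induction on the sum of the |c_i|. Nontriviality modulo p
    is what later bounds, by the degree d, ramification, residue degree and the number of places
    above p. *)
Lemma primitive_relation (p h : nat) (e : 'I_h -> K) : prime p -> (d < h)%N ->
  exists c : 'I_h -> int, (exists i, ~~ (p %| c i)%Z) /\ \sum_i (c i)%:~R * e i = 0.
Proof.
move=> pp /(@int_relation _ e) [c [nzc Ec]].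
have [n] := ubnP (\sum_i `|c i|)%N.
elim: n c nzc Ec => // n IH c [i0 ci0] Ec; rewrite ltnS => len.
have [[i Hi]|Hd] := pselect (exists i, ~~ (p %| c i)%Z); first by exists c; split=> //; exists i.
have Hdv i : (p %| c i)%Z.
  by apply: contrapT => /negP Hi; apply: Hd; exists i.
have p0 : p%:Z != 0 by have := prime_gt0 pp; lia.
pose c' i := (c i %/ p)%Z.
have Ec' i : c i = c' i * p by rewrite /c' divzK.
apply: (IH c').
- by exists i0; apply: contraNneq ci0 => E; rewrite Ec' E mul0r.
- have pK : (p%:Z%:~R : K) != 0.
    by rewrite -(rmorph_int (in_alg K)) fmorph_eq0 intr_eq0.
  apply: (mulfI pK); rewrite mulr0 mulr_sumr -[RHS]Ec; apply: eq_bigr => i _.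
  by rewrite [in RHS]Ec' rmorphM /= [RHS]mulrAC [RHS]mulrC.
- apply: leq_trans len; rewrite [X in (_ < X)%N](bigD1 i0) //= (bigD1 i0) //=.
  have h1 i : (`|c' i| <= `|c i|)%N.
    by rewrite [c i]Ec' abszM leq_pmulr // (prime_gt0 pp).
  have h2 : (`|c' i0| < `|c i0|)%N.
    rewrite [c i0]Ec' abszM -{1}[`|c' i0|%N]muln1 ltn_pmul2l ?(prime_gt1 pp) //.
    by rewrite absz_gt0; apply: contraNneq ci0 => E; rewrite Ec' E mul0r.
  by rewrite -addSn; apply: leq_add => //; apply: leq_sum => i _.
Qed.

End NumberFieldRelations.

Lemma coprimez_bezout (a b : int) : coprimez a b -> exists u v : int, u * a + v * b = 1.
Proof. by move=> /coprimezP [[u v] E]; exists u, v. Qed.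

Section NonUnits.
Variables (K : fieldType) (V : set K).
Hypothesis vV : valuation_ring V.

(** The maximal ideal of V. Zero is listed apart because its conventional inverse 0 does lie in
    V. *)
Definition nonunit x := x = 0 \/ ~ V x^-1.

Let sV : subring_set V. Proof. by case: vV. Qed.
Let Vor t : V t \/ V t^-1. Proof. by case: vV => _; apply. Qed.

Lemma valM x y : V x -> V y -> V (x * y). Proof. by case: sV => _ _; apply. Qed.

Lemma valX x n : V x -> V (x ^+ n). Proof. exact: subringX. Qed.

Lemma nonunit_val x : nonunit x -> V x.
Proof. by case=> [->|nx]; [exact: subring0 | case: (Vor x)]. Qed.

Lemma nonunit1 : ~ nonunit 1.
Proof.
by case=> [/eqP|]; rewrite ?oner_eq0 // invr1; apply; case: sV.
Qed.

Lemma nonunitM a x : V a -> nonunit x -> nonunit (a * x).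
Proof.
move=> Va Mx; have [->|ax0] := eqVneq (a * x) 0; first by left.
right=> Vax; have [x0|x0] := eqVneq x 0; first by rewrite x0 mulr0 eqxx in ax0.
have a0 : a != 0 by apply: contraNneq ax0 => ->; rewrite mul0r.
case: Mx => [/eqP|]; first by rewrite (negPf x0).
by apply; rewrite (_ : x^-1 = a * (a * x)^-1); [exact: valM | rewrite invfM mulrA mulfV ?mul1r].
Qed.

Lemma nonunitD x y : nonunit x -> nonunit y -> nonunit (x + y).
Proof.
wlog H : x y / x = 0 \/ V (y / x).
  move=> W Mx My; have [Vyx|Vxy] := Vor (y / x); first by apply: W => //; right.
  rewrite addrC; apply: W => //; right; by rewrite invfM invrK mulrC in Vxy.
move=> Mx My; case: H => [->|Vyx]; first by rewrite add0r.
have [x0|x0] := eqVneq x 0; first by rewrite x0 add0r.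
rewrite (_ : x + y = (1 + y / x) * x); last by field.
by apply: nonunitM => //; apply: subringD => //; case: sV.
Qed.

Lemma nonunit_sum (I : Type) (r : seq I) (P : pred I) (F : I -> K) :
  (forall i, P i -> nonunit (F i)) -> nonunit (\sum_(i <- r | P i) F i).
Proof. by move=> MF; elim/big_ind: _ => //; [left | exact: nonunitD]. Qed.

Lemma nonunitN x : nonunit x -> nonunit (- x).
Proof.
by rewrite -mulN1r; apply: nonunitM; apply: subringN => //; case: sV.
Qed.

Lemma nonunit_neg x : x != 0 -> ~ nonunit x -> V x^-1.
Proof. by move=> x0 nM; apply: contrapT => nV; apply: nM; right. Qed.

Lemma nonunit_notV x : ~ V x -> nonunit x^-1.
Proof. by move=> nV; right; rewrite invrK. Qed.

Lemma nonunitX x n : nonunit x -> (0 < n)%N -> nonunit (x ^+ n).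
Proof. by case: n => // n Mx _; rewrite exprSr; apply: nonunitM => //; apply/valX/nonunit_val. Qed.

Lemma nonunit_dvd_int (p : nat) (z : int) : nonunit p%:R -> (p %| z)%Z -> nonunit (z%:~R : K).
Proof.
by move=> Mp /dvdzP [q ->]; rewrite rmorphM /=; apply: nonunitM => //; exact: subring_int.
Qed.

Lemma nonunit_intP (p : nat) (z : int) : prime p -> nonunit p%:R ->
  nonunit (z%:~R : K) -> (p %| z)%Z.
Proof.
move=> pp Mp Mz; apply: contrapT => /negP npz.
have cop : coprimez z p by rewrite coprimezE coprime_sym prime_coprime.
have [u [v E]] := coprimez_bezout cop.
apply: nonunit1; rewrite (_ : 1 = (u * z + v * p)%:~R :> K); last by rewrite E.
rewrite intrD !intrM.
by apply: nonunitD; apply: nonunitM => //; exact: subring_int.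
Qed.

End NonUnits.

Section ValuationRingOfNumberField.
Variables (K : fieldExtType rat) (V : set K).
Hypothesis vV : valuation_ring V.
Local Notation d := (\dim (fullv : {vspace K})).
Local Notation M := (nonunit V).

Let sV : subring_set V. Proof. by case: vV. Qed.
Let Vor t : V t \/ V t^-1. Proof. by case: vV => _; apply. Qed.

Lemma natr_neq0 (n : nat) : (0 < n)%N -> (n%:R : K) != 0.
Proof. by rewrite lt0n -(rmorph_nat (in_alg K)) fmorph_eq0 pnatr_eq0. Qed.

Lemma intr_neq0 (n : int) : n != 0 -> (n%:~R : K) != 0.
Proof. by rewrite -(rmorph_int (in_alg K)) fmorph_eq0 intr_eq0. Qed.

(** The powers of y satisfy an integral relation; divided by its lowest power of y, it exhibits its
    lowest nonzero coefficient as a multiple of y. *)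
Lemma divides_int y : V y -> y != 0 ->
  exists (n : int) z, [/\ n != 0, V z & y * z = n%:~R].
Proof.
move=> Vy y0; have [c [[j cj] Ec]] := @int_relation K d.+1 (fun i => y ^+ i) (ltnSn _).
pose c' i := if insub i is Some j then c j else 0.
have c'E (i : 'I_d.+1) : c' i = c i by rewrite /c' valK.
have exi : exists i, c' i != 0 by exists j; rewrite c'E.
pose i0 := ex_minn exi.
have [ci0 i0min] : c' i0 != 0 /\ forall i, c' i != 0 -> (i0 <= i)%N by rewrite /i0; case: ex_minnP.
have li0 : (i0 < d.+1)%N.
  by move: ci0; rewrite /c'; case: insubP => [? -> //|]; rewrite eqxx.
exists (- c' i0), (\sum_(i < d - i0) (c' (i + i0.+1)%N)%:~R * y ^+ i); split.
- by rewrite oppr_eq0.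
- apply: subring_sum => // i _; apply: valM => //; [exact: subring_int | exact: valX].
- have E0 : \sum_(i < d.+1) (c' i)%:~R * y ^+ i = 0.
    by rewrite -[RHS]Ec; apply: eq_bigr => i _; rewrite c'E.
  have Ed : d.+1 = (i0 + (d - i0).+1)%N by lia.
  move: E0; rewrite Ed big_split_ord /= big1 ?add0r; last first.
    move=> i _; have [->|/i0min] := eqVneq (c' i) 0; first by rewrite mul0r.
    by rewrite leqNgt ltn_ord.
  rewrite big_ord_recl addn0 => /eqP.
  rewrite (eq_bigr (fun i : 'I_(d - i0) => (c' (i + i0.+1)%N)%:~R * y ^+ i * y * y ^+ i0)); last first.
    move=> i _; rewrite -!mulrA -exprS -exprD lift0; congr (_ * _); last by congr (_ ^+ _); lia.
    by congr ((c' _)%:~R); lia.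
  rewrite -!mulr_suml -mulrDl mulf_eq0 expf_eq0 (negPf y0) andbF orbF addrC addr_eq0 => /eqP.
  by rewrite rmorphN /= mulrC => ->.
Qed.

(** Otherwise V contains every 1/n, and then also the inverse of each of its nonzero elements, since
    such an element divides an integer. Applied to 1/x this puts x in V. *)
Lemma residue_prime x : ~ V x -> exists2 p, prime p & M p%:R.
Proof.
move=> nVx; apply: contrapT => H.
have Vp p : prime p -> V p%:R^-1.
  move=> pp; apply: contrapT => nV; apply: H; exists p => //; by right.
have Vn (n : nat) : (0 < n)%N -> V (n%:R)^-1.
  elim/ltn_ind: n => n IH n0; have [n1|n1] := leqP n 1.
    by rewrite (_ : n = 1%N) ?invr1; [case: sV | lia].
  have pp := pdiv_prime n1; have /dvdnP [k Ek] := pdiv_dvd n.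
  have k0 : (0 < k)%N by move: n0; rewrite {1}Ek muln_gt0 => /andP[].
  rewrite Ek natrM invfM; apply: valM => //; last exact: Vp.
  by apply: IH => //; rewrite {1}Ek ltn_Pmulr // prime_gt1.
have x0 : x != 0 by apply/eqP => x0; apply: nVx; rewrite x0; exact: subring0.
have Vx : V x^-1 by case: (Vor x).
have [n [z [n0 Vz E]]] := divides_int Vx (invr_neq0 x0).
apply: nVx; have -> : x = z * (n%:~R)^-1.
  by have := intr_neq0 n0; rewrite -E mulf_eq0 negb_or => /andP[_ z0]; field; rewrite x0.
apply: valM => //; case: n n0 {E} => n n0; first by apply: Vn; lia.
by rewrite NegzE mulrNz invrN; apply: subringN => //; exact: (Vn n.+1).
Qed.

(** The ramification bound e <= d in elementary form: elements of strictly increasing valuation, all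
    below that of p, satisfy no integral relation that is nontrivial modulo p. Divide such a
    relation by the first term whose coefficient is prime to p: earlier coefficients are multiples
    of p, and later elements are nonunit multiples of that term. *)
Lemma chain_bound (p h : nat) (g : 'I_h -> K) : prime p -> M p%:R ->
  (forall i, g i != 0) -> (forall i, V (g i)) ->
  (forall i j : 'I_h, (i < j)%N -> M (g j / g i)) -> (forall i, M (p%:R / g i)) -> (h <= d)%N.
Proof.
move=> pp Mp g0 Vg Mg Mpg; rewrite leqNgt; apply/negP => dh.
have [c [[i1 ci1] Ec]] := primitive_relation g pp dh.
have [i0 ci0 i0min] := arg_minnP (P := fun i => ~~ (p %| c i)%Z) (fun i : 'I_h => i : nat) ci1.
have E : (c i0)%:~R = - \sum_(i | i != i0) (c i)%:~R * (g i / g i0).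
  move: Ec; rewrite (bigD1 i0) //= => /(congr1 (fun x => x / g i0)).
  rewrite mulrDl mul0r mulfK // mulr_suml => /eqP; rewrite addr_eq0 => /eqP ->.
  by congr (- _); apply: eq_bigr => i _; rewrite mulrA.
move/negP: ci0; apply; apply: (nonunit_intP vV pp Mp); rewrite E.
apply: nonunitN => //; apply: nonunit_sum => // i ii0.
have [lt|gt] : (i < i0)%N \/ (i0 < i)%N by move: ii0; rewrite neq_ltn => /orP.
  have /dvdzP [q ->] : (p %| c i)%Z.
    by apply: contrapT => /negP /i0min; rewrite leqNgt lt.
  rewrite (_ : _ * _ = (q%:~R * g i) * (p%:R / g i0)); last by rewrite rmorphM /=; ring.
  by apply: nonunitM => //; apply: valM => //; exact: subring_int.
by apply: nonunitM => //; [exact: subring_int | exact: Mg].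
Qed.

(** If the maximal ideal had no generator, one could start from p and pass again and again to a
    nonunit of strictly smaller valuation; d + 1 steps contradict [chain_bound]. *)
Lemma uniformizer_exists p : prime p -> M p%:R ->
  exists pi, [/\ pi != 0, M pi & forall y, M y -> V (y / pi)].
Proof.
move=> pp Mp; apply: contrapT => H.
have step pi : exists y, pi != 0 -> M pi -> [/\ y != 0, M y & M (pi / y)].
  have [[pi0 Mpi]|H'] := pselect (pi != 0 /\ M pi); last by exists 0 => ? ?; case: H'.
  have [y Hy] : exists y, M y /\ ~ V (y / pi).
    apply: contrapT => H'; apply: H; exists pi; split=> // y My.
    by apply: contrapT => nV; apply: H'; exists y.
  exists y => _ _; case: Hy => My nV; split=> //.
    by apply/eqP => y0; apply: nV; rewrite y0 mul0r; exact: subring0.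
  by have := nonunit_notV nV; rewrite invfM invrK mulrC.
pose nxt pi := projT1 (cid (step pi)).
have nxtP pi : pi != 0 -> M pi -> [/\ nxt pi != 0, M (nxt pi) & M (pi / nxt pi)].
  by rewrite /nxt; case: cid.
pose y k := iter k nxt (p%:R : K).
have y0M k : y k != 0 /\ M (y k).
  elim: k => [|k [y0 My]]; first by split=> //; apply: natr_neq0; exact: prime_gt0.
  by have [? ? ?] := nxtP _ y0 My.
have yM a b : (b < a)%N -> M (y b / y a).
  elim: a => // a IH; rewrite ltnS leq_eqVlt => /orP[/eqP ->|/IH Mab].
    by have [y0 My] := y0M a; have [] := nxtP _ y0 My.
  have [y0 My] := y0M a; have [n0 Mn Mr] := nxtP _ y0 My.
  rewrite (_ : y b / y a.+1 = (y a / y a.+1) * (y b / y a)); last by rewrite [RHS]mulrC -mulrA mulKf.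
  by apply: nonunitM => //; exact: nonunit_val.
suff : (d.+1 <= d)%N by rewrite ltnn.
apply: (@chain_bound p d.+1 (fun i => y (d.+1 - i)%N)) => //.
- by move=> i; case: (y0M (d.+1 - i)%N).
- by move=> i; apply: (nonunit_val vV); case: (y0M (d.+1 - i)%N).
- by move=> i j ij; apply: yM; have := ltn_ord j; lia.
- by move=> i; apply: (yM _ 0%N); have := ltn_ord i; lia.
Qed.

Definition val_unit x := [/\ x != 0, V x & V x^-1].

Lemma val_unitM x y : val_unit x -> val_unit y -> val_unit (x * y).
Proof.
move=> [x0 Vx Vx'] [y0 Vy Vy']; split; first by rewrite mulf_neq0.
  exact: valM.
by rewrite invfM; exact: valM.
Qed.

Lemma val_unitV x : val_unit x -> val_unit x^-1.
Proof. by move=> [x0 Vx Vx']; split; rewrite ?invr_eq0 ?invrK. Qed.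

Lemma val_unitX x n : val_unit x -> val_unit (x ^+ n).
Proof.
move=> Ux; elim: n => [|n IH]; last by rewrite exprS; exact: val_unitM.
by rewrite expr0; split; rewrite ?oner_eq0 ?invr1 //; case: sV.
Qed.

Section Uniformizer.
Variables (p : nat) (pi : K).
Hypotheses (pp : prime p) (Mp : M p%:R) (pi0 : pi != 0) (Mpi : M pi)
  (pidiv : forall y, M y -> V (y / pi)).

Let npi k : (0 < k)%N -> ~ V (pi ^- k).
Proof.
move=> k0 Vk; have /(nonunitX vV) /(_ k0) [/eqP|//] := Mpi.
by rewrite expf_eq0 (negPf pi0) andbF.
Qed.

Lemma prime_pi_power : exists e, val_unit (p%:R / pi ^+ e).
Proof.
have bnd k : V (p%:R / pi ^+ k) -> (k <= d)%N.
  move=> Vk; apply: (@chain_bound p k (fun i => pi ^+ i)) => //.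
  - by move=> i; rewrite expf_neq0.
  - by move=> i; apply: valX => //; exact: nonunit_val.
  - move=> i j ij; rewrite (_ : pi ^+ j / pi ^+ i = pi ^+ (j - i)).
      by apply: nonunitX => //; rewrite subn_gt0.
    by rewrite -{1}(subnK (ltnW ij)) exprD mulfK // expf_neq0.
  - move=> i; rewrite (_ : _ / _ = (p%:R / pi ^+ k) * pi ^+ (k - i)).
      by apply: nonunitM => //; apply: nonunitX => //; rewrite subn_gt0.
    have -> : pi ^+ k = pi ^+ (k - i) * pi ^+ i by rewrite -exprD subnK // ltnW.
    by field; rewrite !expf_neq0.
pose P k := `[< V (p%:R / pi ^+ k) >].
have exP : exists k, P k.
  by exists 0%N; apply/asboolP; rewrite divr1; exact: nonunit_val.
have bP k : P k -> (k <= d)%N by move=> /asboolP /bnd.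
case: (ex_maxnP exP bP) => e /asboolP Ve emax; exists e.
have p0 := natr_neq0 (prime_gt0 pp).
have z0 : p%:R / pi ^+ e != 0 by rewrite mulf_neq0 ?invr_neq0 ?expf_neq0.
split=> //; apply: nonunit_neg => // Mz.
have : P e.+1 by apply/asboolP; rewrite exprSr invfM mulrA; exact: pidiv.
by move=> /emax; rewrite ltnn.
Qed.

(** For z in V choose a nonzero integer multiple p^a n' of z with n' prime to p. Since p is a unit
    times [pi ^+ e], only powers [pi ^+ k] with k <= e a can divide z, and for the largest one the
    quotient is no longer divisible by pi, hence a unit. *)
Lemma ord_exists y : exists k : int, y != 0 -> val_unit (y / pi ^ k).
Proof.
have [y0|y0] := eqVneq y 0; first by exists 0.
suff H z : V z -> z != 0 -> exists k : nat, val_unit (z / pi ^+ k).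
  case: (Vor y) => [Vy|Vy']; first by have [k Hk] := H _ Vy y0; exists k => _.
  have [|k /val_unitV Hk] := H _ Vy'; first by rewrite invr_neq0.
  exists (- k%:Z) => _; rewrite invfM invrK in Hk; by rewrite -invr_expz.
move=> {y0}Vz z0; have [e Ue] := prime_pi_power.
have [n [z' [n0 Vz' En]]] := divides_int Vz z0.
have [a [n' [npn' En']]] : exists a (n' : int), ~~ (p %| n')%Z /\ n = p%:Z ^+ a * n'.
  have [N] := ubnP `|n|%N; elim: N {En} n n0 => // N IH n n0; rewrite ltnS => nN.
  have [/dvdzP [q Eq]|npn] := boolP (p %| n)%Z; last first.
    by exists 0%N, n; rewrite expr0 mul1r.
  have q0 : q != 0 by apply: contraNneq n0 => q0; rewrite Eq q0 mul0r.
  have [|a [n' [H1 H2]]] := IH q q0.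
    apply: leq_trans nN; rewrite Eq abszM ltn_Pmulr ?absz_gt0 //.
    exact: prime_gt1.
  by exists a.+1, n'; split=> //; rewrite Eq H2 exprSr mulrAC.
have Un' : val_unit (n'%:~R : K).
  have nn : (n'%:~R : K) != 0 by apply: intr_neq0; apply: contraNneq npn' => ->; rewrite dvdz0.
  split=> //; first exact: subring_int.
  apply: nonunit_neg => // Mn'; move/negP: npn'; apply; exact: (nonunit_intP vV pp Mp).
have bnd k : V (z / pi ^+ k) -> (k <= e * a)%N.
  move=> Vk; rewrite leqNgt; apply/negP => lt; apply: (@npi (k - e * a)); first by rewrite subn_gt0.
  have [u0 Vu Vu'] := val_unitM (val_unitX a Ue) Un'.
  have E : pi ^- (k - e * a) = (z / pi ^+ k) * z' * ((p%:R / pi ^+ e) ^+ a * n'%:~R)^-1.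
    rewrite -[z / _ * z']mulrAC En En' rmorphM rmorphXn /=.
    rewrite -{2}(subnK (ltnW lt)) exprD exprM expr_div_n.
    have p0 := natr_neq0 (prime_gt0 pp).
    field; rewrite ?expf_neq0 //=; case: Un' => -> _ _.
    by rewrite ?expf_neq0 // -exprM expf_neq0.
  by rewrite E; do 2!apply: valM => //.
pose P k := `[< V (z / pi ^+ k) >].
have exP : exists k, P k by exists 0%N; apply/asboolP; rewrite divr1.
have bP k : P k -> (k <= e * a)%N by move=> /asboolP /bnd.
case: (ex_maxnP exP bP) => k /asboolP Vk kmax; exists k.
have zk0 : z / pi ^+ k != 0 by rewrite mulf_neq0 ?invr_neq0 ?expf_neq0.
split=> //; apply: nonunit_neg => // Mz.
have : P k.+1 by apply/asboolP; rewrite exprSr invfM mulrA; exact: pidiv.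
by move=> /kmax; rewrite ltnn.
Qed.

Lemma ord_unique y (k l : int) : val_unit (y / pi ^ k) -> val_unit (y / pi ^ l) -> k = l.
Proof.
wlog kl : k l / (k < l)%R.
  move=> W; case: (ltgtP k l) => // H; first exact: W.
  by move=> Uk Ul; apply/esym; apply: W.
move=> Uk /val_unitV Ul; exfalso.
have [z0 Vz _] := val_unitM Uk Ul.
have y0 : y != 0 by case: Uk => + _ _; rewrite mulf_eq0 negb_or => /andP[].
have [m Em] : exists m : nat, l = k + (m.+1)%:Z by exists (absz (l - k - 1)%R); lia.
have E : y / pi ^ k * (y / pi ^ l)^-1 = pi ^+ m.+1.
  rewrite Em expfzDr // invfM invrK mulrACA mulfV // mul1r mulrA mulVf ?mul1r //.
  exact: expfz_neq0.
have [_ _ V'] := val_unitM Uk Ul.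
by apply: (@npi m.+1) => //; rewrite -E.
Qed.

End Uniformizer.

Lemma equivalence_reps (T : eqType) (E : T -> T -> Prop) (l : seq T) :
  (forall x, E x x) -> (forall x y, E x y -> E y x) ->
  exists r : seq T, [/\ {subset r <= l}, forall y, y \in l -> exists2 z, z \in r & E y z &
    forall x0 i j, (i < size r)%N -> (j < size r)%N -> i != j -> ~ E (nth x0 r i) (nth x0 r j)].
Proof.
move=> Er Es; elim: l => [|a l [r [rl cov inc]]]; first by exists [::].
have [[z zr Eaz]|H] := pselect (exists2 z, z \in r & E a z).
  exists r; split=> //; first by move=> x /rl; rewrite inE => ->; rewrite orbT.
  by move=> y; rewrite inE => /orP[/eqP ->|/cov //]; exists z.
exists (a :: r); split.
- by move=> x; rewrite !inE => /orP[->//|/rl ->]; rewrite orbT.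
- move=> y; rewrite inE => /orP[/eqP ->|/cov [z zr Eyz]]; first by exists a; rewrite ?inE ?eqxx.
  by exists z => //; rewrite inE zr orbT.
move=> x0 [|i] [|j] //= ir jr ij.
- by move=> Ea; apply: H; exists (nth x0 r j) => //; exact: mem_nth.
- by move=> /Es Ea; apply: H; exists (nth x0 r i) => //; exact: mem_nth.
- exact: inc.
Qed.

(** A maximal family e that is independent modulo p and the maximal ideal has at most d members, and
    by maximality every element of V is congruent to a combination of e with digits 0, ..., p - 1.
    Representatives are selected among these finitely many combinations. *)
Lemma residue_system p : prime p -> M p%:R ->
  exists r : seq K, [/\ forall y, y \in r -> V y,
    forall i j, (i < size r)%N -> (j < size r)%N -> i != j -> ~ M (nth 0 r i - nth 0 r j) &
    forall x, V x -> exists2 y, y \in r & M (x - y)].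
Proof.
move=> pp Mp.
pose ind (e : seq K) := (forall y, y \in e -> V y) /\ forall c : nat -> int,
  M (\sum_(i < size e) (c i)%:~R * e`_i) -> forall i, (i < size e)%N -> (p %| c i)%Z.
pose P k := `[< exists2 e, ind e & size e = k >].
have exP : exists k, P k.
  by exists 0%N; apply/asboolP; exists [::] => //; split.
have bP k : P k -> (k <= d)%N.
  move=> /asboolP [e [Ve inde] <-]; rewrite leqNgt; apply/negP => dh.
  have [c [[i ci] Ec]] := primitive_relation (fun i : 'I_(size e) => e`_i) pp dh.
  move/negP: ci; apply.
  pose c' k := if insub k is Some j then c j else 0.
  have c'E (j : 'I_(size e)) : c' j = c j by rewrite /c' valK.
  rewrite -c'E; apply: inde => //; left; rewrite -[RHS]Ec.
  by apply: eq_bigr => j _; rewrite c'E.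
case: (ex_maxnP exP bP) => f /asboolP [e [Ve inde] <-] emax.
have cov y : V y -> exists g : {ffun 'I_(size e) -> 'I_p}, M (y - \sum_i (g i : nat)%:R * e`_i).
  move=> Vy; have : ~ ind (y :: e).
    move=> H; have : P (size e).+1 by apply/asboolP; exists (y :: e).
    by move=> /emax; rewrite ltnn.
  move=> nind.
  have [c [Mc [i [ie npc]]]] : exists c : nat -> int,
      M (\sum_(i < (size e).+1) (c i)%:~R * (y :: e)`_i) /\ exists i, (i < (size e).+1)%N /\ ~~ (p %| c i)%Z.
    apply: contrapT => H; apply: nind; split.
      by move=> z; rewrite inE => /orP[/eqP ->//|/Ve].
    move=> c Mc i ie; apply: contrapT => npc; apply: H; exists c; split=> //; exists i; split=> //.
    exact/negP.
  move: Mc; rewrite big_ord_recl /= => Mc.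
  have npc0 : ~~ (p %| c 0%N)%Z.
    apply/negP => pc0; move/negP: npc; apply.
    case: i ie => // i; rewrite ltnS => ie.
    apply: (inde (fun i => c i.+1)) => //.
    have -> : \sum_(i0 < size e) (c i0.+1)%:~R * e`_i0 =
      ((c 0%N)%:~R * y + \sum_(i0 < size e) (c (bump 0 i0))%:~R * e`_i0) + - ((c 0%N)%:~R * y).
      by rewrite addrAC subrr add0r.
    apply: nonunitD => //; apply: nonunitN => //; rewrite mulrC; apply: nonunitM => //.
    exact: nonunit_dvd_int pc0.
  (* The coefficient of y is inverted modulo p; the other coefficients are then reduced to
     digits. *)
  have cop : coprimez (c 0%N) p by rewrite coprimezE coprime_sym prime_coprime.
  have [u [v Euv]] := coprimez_bezout cop.
  have pz : p%:Z != 0 by have := prime_gt0 pp; lia.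
  have rlt i0 : (`|(- (u * c i0.+1) %% p)%Z| < p)%N.
    have := ltz_pmod (- (u * c i0.+1)) (_ : 0 < p%:Z).
    have := modz_ge0 (- (u * c i0.+1)) pz; have := prime_gt0 pp; lia.
  exists [ffun i0 : 'I__ => Ordinal (rlt i0)].
  have E : y - \sum_i0 ([ffun i0 : 'I_(size e) => Ordinal (rlt i0)] i0 : nat)%:R * e`_i0
     = u%:~R * ((c 0%N)%:~R * y + \sum_(i0 < size e) (c (bump 0 i0))%:~R * e`_i0)
      + (p%:R * (v%:~R * y + \sum_(i0 < size e) ((- (u * c i0.+1) %/ p)%Z)%:~R * e`_i0)).
    have Ey : y = u%:~R * ((c 0%N)%:~R * y) + p%:R * (v%:~R * y).
      have E1 : (u * c 0%N + v * p)%:~R = 1 :> K by rewrite Euv.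
      have Ep : (p%:Z)%:~R = p%:R :> K by [].
      have Ey : (u * c 0%N + v * p)%:~R * y = u%:~R * ((c 0%N)%:~R * y) + p%:R * (v%:~R * y).
        by rewrite intrD !intrM Ep; ring.
      by rewrite -Ey E1 mul1r.
    rewrite {1}Ey !mulrDr [RHS]addrACA -!addrA; do 2!congr (_ + _).
    rewrite !mulr_sumr -big_split /= -sumrN; apply: eq_bigr => i0 _; rewrite ffunE /=.
    have Em := divz_eq (- (u * c i0.+1)) p.
    have -> : (`|(- (u * c i0.+1) %% p)%Z|%N%:R : K) = (- (u * c i0.+1) - (- (u * c i0.+1) %/ p)%Z * p)%:~R.
      have /(congr1 (fun z : int => z%:~R : K)) : (absz (- (u * c i0.+1) %% p)%Z)%:Z = - (u * c i0.+1) - (- (u * c i0.+1) %/ p)%Z * p.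
        by rewrite {2}Em addrAC subrr add0r gez0_abs // modz_ge0.
      by [].
    by rewrite rmorphB rmorphN /= !intrM; ring.
  rewrite E; apply: nonunitD => //; first by apply: nonunitM => //; exact: subring_int.
  rewrite mulrC; apply: nonunitM => //; apply: subringD => //; first by apply: valM => //; exact: subring_int.
  by apply: subring_sum => // j _; apply: valM => //; [exact: subring_int | apply: Ve; exact: mem_nth].
have [||r [rl rcov rinc]] := @equivalence_reps K (fun x y => M (x - y))
  [seq \sum_i (g i : nat)%:R * e`_i | g : {ffun 'I_(size e) -> 'I_p}].
- by move=> x; left; rewrite subrr.
- by move=> x y /(nonunitN vV); rewrite opprB.
exists r; split.
- move=> y yr; have /mapP [g _ ->] := rl _ yr; apply: subring_sum => // j _; apply: valM => //.
    exact: subring_nat.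
  by apply: Ve; exact: mem_nth.
- by move=> i j; exact: rinc.
- move=> x /cov [g Mg]; have [|z zr Mz] := rcov (\sum_i (g i : nat)%:R * e`_i).
    by apply/mapP; exists g; rewrite ?mem_enum.
  exists z => //; rewrite -(subrK (\sum_i (g i : nat)%:R * e`_i) x) -addrA.
  exact: nonunitD.
Qed.

End ValuationRingOfNumberField.

(** * Absolute values, and the place attached to a valuation ring *)

Section AbsoluteValues.
Variables (R : realType) (T : fieldType) (N : T -> R).
Hypothesis aN : absval N.

Lemma absval0 : N 0 = 0. Proof. by case: aN. Qed.

Lemma absval_gt0 x : x != 0 -> 0 < N x. Proof. by case: aN => _ + _ _; apply. Qed.

Lemma absvalM x y : N (x * y) = N x * N y. Proof. by case: aN. Qed.

Lemma absval_le_add x y : N (x + y) <= N x + N y. Proof. by case: aN. Qed.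

Lemma absval_ge0 x : 0 <= N x.
Proof. by have [->|/absval_gt0/ltW //] := eqVneq x 0; rewrite absval0. Qed.

Lemma absval_eq0 x : (N x == 0) = (x == 0).
Proof.
have [->|x0] := eqVneq x 0; first by rewrite absval0 eqxx.
by rewrite gt_eqF // absval_gt0.
Qed.

Lemma absval1 : N 1 = 1.
Proof.
have := absvalM 1 1; rewrite mulr1 -{1}[N 1]mulr1 => /mulfI -> //.
by rewrite absval_eq0 oner_eq0.
Qed.

Lemma absvalN x : N (- x) = N x.
Proof.
have h : N (-1) = 1.
  have : N (-1) ^+ 2 = 1 by rewrite expr2 -absvalM mulrNN mulr1 absval1.
  by move/eqP; rewrite sqrf_eq1 => /orP[/eqP //|/eqP E]; have := absval_ge0 (-1); rewrite E; lra.
by rewrite -mulN1r absvalM h mul1r.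
Qed.

Lemma absvalX x n : N (x ^+ n) = N x ^+ n.
Proof. by elim: n => [|n IH]; rewrite ?expr0 ?absval1 // !exprS absvalM IH. Qed.

Lemma absvalV x : N x^-1 = (N x)^-1.
Proof.
have [->|x0] := eqVneq x 0; first by rewrite invr0 absval0 invr0.
have Nx0 : N x != 0 by rewrite absval_eq0.
by apply: (mulfI Nx0); rewrite -absvalM !mulfV // absval1.
Qed.

Lemma absval_prod (I : Type) (r : seq I) (P : pred I) (F : I -> T) :
  N (\prod_(i <- r | P i) F i) = \prod_(i <- r | P i) N (F i).
Proof. exact: (big_morph N absvalM absval1). Qed.

End AbsoluteValues.

Section PlaceOfValuationRing.
Variables (R : realType) (K : fieldExtType rat).
Local Notation d := (\dim (fullv : {vspace K})).

Lemma residue_card_ge2 (N : K -> R) q : absval N ->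
  (forall x y, N (x + y) <= Num.max (N x) (N y)) -> residue_card N q -> (1 < q)%N.
Proof.
move=> aN Nu [r [<- _ _ cov]].
have [y yr Hy] : exists2 y, y \in r & N (0 - y) < 1 by apply: cov; rewrite (absval0 aN) ler01.
have [z zr Hz] : exists2 y, y \in r & N (1 - y) < 1 by apply: cov; rewrite (absval1 aN) lexx.
case: r yr zr {cov} => [|a [|b r]] //=; rewrite !inE => /eqP Ey /eqP Ez; subst.
have := Nu (1 - a) a; rewrite subrK (absval1 aN) le_max.
by rewrite sub0r (absvalN aN) in Hy; rewrite !leNgt Hy Hz.
Qed.

Lemma place_of_valuation_ring (V : set K) x : valuation_ring V -> ~ V x ->
  exists2 w : K -> R, place_fin w & 1 < w x.
Proof.
move=> vV nVx; have [p pp Mp] := residue_prime vV nVx.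
have [pi [pi0 Mpi pidiv]] := uniformizer_exists vV pp Mp.
have sV : subring_set V by case: vV.
pose o (y : K) := projT1 (cid (ord_exists vV pp Mp pi0 Mpi pidiv y)).
have oP (y : K) : y != 0 -> val_unit V (y / pi ^ o y) by rewrite /o; case: cid.
have oU (y : K) k : y != 0 -> val_unit V (y / pi ^ k) -> o y = k.
  by move=> y0 Uk; apply: (ord_unique vV pp pi0 Mpi (oP _ y0) Uk).
have oM (y z : K) : y != 0 -> z != 0 -> o (y * z) = o y + o z.
  move=> y0 z0; apply: oU; first exact: mulf_neq0.
  rewrite exprzDr ?unitfE // invfM mulrACA; apply: val_unitM => //; exact: oP.
have V_o (y : K) : y != 0 -> V y -> (0 <= o y)%R.
  move=> y0 Vy; rewrite leNgt; apply/negP => olt.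
  have [m Em] : exists m : nat, o y = - (m.+1)%:Z by exists (absz (o y + 1)); lia.
  have [_ _] := oP _ y0; rewrite invfM invrK => V1.
  have : V (pi ^ o y) by rewrite -(mulVKf y0 (pi ^ o y)); exact: (valM vV).
  rewrite Em -invr_expz => V2; have := nonunitX vV Mpi (ltn0Sn m).
  by case=> [/eqP|]; [rewrite expf_eq0 (negPf pi0) andbF | apply].
have o_V (y : K) : y != 0 -> (0 <= o y)%R -> V y.
  move=> y0 oy; have [m Em] : exists m : nat, o y = m%:Z by exists (absz (o y)); lia.
  have [_ Vy _] := oP _ y0; rewrite -(divfK (_ : pi ^ o y != 0) y); last exact: expfz_neq0.
  by apply: (valM vV) => //; rewrite Em; apply: (valX vV); exact: (nonunit_val vV).
(* Any base in (0, 1) would do, because the normalizing exponent divides by ln c. *)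
pose c : R := 2^-1.
have c01 : 0 < c < 1 by rewrite /c; lra.
have c0 : 0 < c by case/andP: c01.
pose N (y : K) : R := if y == 0 then 0 else c ^ o y.
have Npos (y : K) : y != 0 -> 0 < N y by move=> y0; rewrite /N (negPf y0) exprz_gt0.
have NV y : N y <= 1 <-> V y.
  have [->|y0] := eqVneq y 0; first by rewrite /N eqxx ler01; split=> // _; exact: subring0.
  rewrite /N (negPf y0); split=> [|Vy]; last first.
    have [m Em] : exists m : nat, o y = m%:Z by exists (absz (o y)); have := V_o _ y0 Vy; lia.
    by rewrite Em -exprnP exprn_ile1 //; lra.
  move=> Ny; apply: o_V => //; rewrite leNgt; apply/negP => olt; move: Ny.
  have [m Em] : exists m : nat, o y = - (m.+1)%:Z by exists (absz (o y + 1)); lia.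
  rewrite Em -invr_expz leNgt -exprnP invf_gt1 ?exprn_gt0 // exprn_ilt1 //; lra.
have NM : {morph N : y z / y * z}.
  move=> y z; rewrite /N mulf_eq0.
  have [y0|y0] := eqVneq y 0; first by rewrite mul0r.
  have [z0|z0] := eqVneq z 0; first by rewrite mulr0.
  by rewrite /= oM // exprzDr // unitfE gt_eqF.
have Nu y z : N (y + z) <= Num.max (N y) (N z).
  wlog H : y z / N y <= N z.
    move=> W; have [H|H] : N y <= N z \/ N z <= N y by apply/orP; exact: le_total.
      exact: W _ _ H.
    by rewrite addrC maxC; exact: W _ _ H.
  rewrite (le_trans _ (_ : N z <= _)) ?le_max ?lexx ?orbT //; have [z0|z0] := eqVneq z 0.
    have [y0|y0] := eqVneq y 0; first by rewrite y0 z0 addr0.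
    by have := Npos _ y0; rewrite ltNge (le_trans H) // z0 /N eqxx.
  have Nyz : N (y / z) <= 1.
    rewrite -(ler_pM2r (Npos _ z0)) -NM mul1r divfK //.
  rewrite (_ : y + z = (y / z + 1) * z); last by field.
  rewrite NM -[leRHS]mul1r ler_pM2r ?Npos //; apply/NV; apply: subringD => //; first exact/NV.
  by case: sV.
have N0 : N 0 = 0 by rewrite /N eqxx.
have aN : absval N.
  split=> // y z; apply: (le_trans (Nu y z)); rewrite ge_max lerDl lerDr.
  have Nge u : 0 <= N u by have [->|/Npos/ltW //] := eqVneq u 0; rewrite N0.
  by rewrite !Nge.
have NMu y : N y < 1 <-> nonunit V y.
  have [->|y0] := eqVneq y 0; first by rewrite N0 ltr01; split=> // _; left.
  have -> : (N y < 1) = ~~ (N y^-1 <= 1).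
    rewrite -ltNge -[in RHS](ltr_pM2l (Npos _ y0)) -NM mulfV // mulr1.
    by rewrite (absval1 aN).
  split=> [/negP H|]; first by right=> /NV.
  by case=> [/eqP|nV]; [rewrite (negPf y0) | apply/negP => /NV].
have [r [rV rinc rcov]] := residue_system vV pp Mp.
have rc : residue_card N (size r).
  exists r; split=> //.
  - by apply/allP => y /rV /NV.
  - move=> i j ir jr ij; apply/eqP; rewrite eq_le; apply/andP; split.
      apply/NV; have Vi := rV _ (mem_nth 0 ir); have Vj := rV _ (mem_nth 0 jr).
      by case: (sV) => _ VB _; exact: VB.
    by rewrite leNgt; apply/negP => /NMu; exact: rinc.
  - by move=> y /NV /rcov [z zr /NMu Hz]; exists z.
have q2 := residue_card_ge2 aN Nu rc.
have d0 : (0 < d)%N by exact: adim_gt0.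
pose e : R := ln (size r)%:R / (- (d%:R * ln c)).
have lc : ln c < 0 by rewrite ln_lt0.
have e0 : 0 < e.
  rewrite /e divr_gt0 ?ln_gt0 ?ltr1n // -mulrN mulr_gt0 ?ltr0n ?oppr_gt0 //.
exists (fun y => N y `^ e).
  exists N, c, (size r); split=> //.
  split; first by move=> y y0; exists (o y); rewrite /N (negPf y0).
  exists pi; rewrite /N (negPf pi0) (oU _ 1) // expr1z mulfV //.
  by split; rewrite ?oner_eq0 ?invr1 //; case: sV.
have Nx : 1 < N x by rewrite ltNge; apply/negP => /NV.
rewrite -(powRr1 ler01); have -> : 1 `^ 1 = 1 `^ e :> R by rewrite !powR1.
by rewrite gt0_ltr_powR // ?nnegrE ?ler01 // ltW // (lt_trans ltr01).
Qed.

Lemma place_not_algint x : ~ algint x -> exists2 w : K -> R, place_fin w & 1 < w x.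
Proof. by move=> /valuation_ring_exists [V vV]; exact: place_of_valuation_ring. Qed.

End PlaceOfValuationRing.

(** * Finite places *)

Section PowersOfReals.
Variable R : realType.
Implicit Types (a t : R) (z : int).

Lemma expRz a z : expR a ^ z = expR (z%:~R * a).
Proof. by rewrite -powR_intmul ?expR_ge0 // /powR gt_eqF ?expR_gt0 // expRK. Qed.

Lemma lnz a z : 0 < a -> ln (a ^ z) = z%:~R * ln a.
Proof. by move=> a0; rewrite -powR_intmul ?ltW // ln_powR. Qed.

Lemma exprz_le_lt1 t z1 z2 : 0 < t < 1 -> (t ^ z1 <= t ^ z2) = (z2 <= z1).
Proof.
move=> /andP[t0 t1]; have lt : ln t < 0 by rewrite ln_lt0 // t0.
rewrite -ler_ln ?posrE ?exprz_gt0 // !lnz // ler_nM2r // ler_int //.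
Qed.

End PowersOfReals.

Section FinitePlaceData.
Variables (R : realType) (K : fieldExtType rat).
Local Notation d := (\dim (fullv : {vspace K})).

Lemma dim_gt0 : (0 < d)%N. Proof. exact: adim_gt0. Qed.

Lemma intr_inj_K : injective (fun z : int => z%:~R : K).
Proof.
move=> x y /eqP; rewrite -subr_eq0 -rmorphB => xy; apply/eqP; rewrite -subr_eq0.
by apply: contraLR xy; exact: intr_neq0.
Qed.

(** A finite place after elimination of the auxiliary N and c of [place_fin]: a uniformizer has
    absolute value q^(-1/d), so the order o and the residue cardinality q determine w. *)
Definition fin_data (w : K -> R) (o : K -> int) (q : nat) :=
  [/\ absval w, (forall x y, w (x + y) <= Num.max (w x) (w y)), (1 < q)%N,
    (forall x, x != 0 -> w x = expR (- (ln q%:R / d%:R)) ^ o x) /\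
      (exists2 pi, pi != 0 & o pi = 1) &
    exists r : seq K, [/\ uniq r, size r = q, (forall y, y \in r -> w y <= 1),
      (forall y z, y \in r -> z \in r -> w (y - z) < 1 -> y = z) &
      forall x, w x <= 1 -> exists2 y, y \in r & w (x - y) < 1]].

Lemma fin_dataP (w : K -> R) : place_fin w -> exists o q, fin_data w o q.
Proof.
move=> [N [c [q [[aN Nu] /andP[c0 c1] [Nc [x0 Nx0]] rc wE]]]].
have q1 := residue_card_ge2 aN Nu rc.
have d0 := dim_gt0.
have lc : ln c < 0 by rewrite ln_lt0 // c0.
pose e : R := ln q%:R / (- (d%:R * ln c)).
have e0 : 0 < e.
  by rewrite /e divr_gt0 ?ln_gt0 ?ltr1n // -mulrN mulr_gt0 ?ltr0n ?oppr_gt0.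
have Nge := absval_ge0 aN.
have wE' x : w x = N x `^ e by rewrite wE.
have w_le x y : (w x <= w y) = (N x <= N y).
  by rewrite !wE'; apply: (le_mono_in (gt0_ltr_powR e0)); rewrite nnegrE.
have w1 : w 1 = 1 by rewrite wE' (absval1 aN) powR1.
have w_le1 x : (w x <= 1) = (N x <= 1) by rewrite -[X in w x <= X]w1 w_le (absval1 aN).
have w_lt1 x : (w x < 1) = (N x < 1).
  by rewrite -[X in w x < X]w1 -[X in N x < X](absval1 aN) !ltNge w_le.
have w0 : w 0 = 0 by rewrite wE' (absval0 aN) powR0 // gt_eqF.
have wge x : 0 <= w x by rewrite wE' powR_ge0.
have wu x y : w (x + y) <= Num.max (w x) (w y).
  have := Nu x y; rewrite !le_max => /orP[|] H; apply/orP; [left|right]; by rewrite w_le.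
have aw : absval w.
  split=> //.
  - by move=> x xn0; rewrite wE' powR_gt0 // absval_gt0.
  - by move=> x y; rewrite !wE' (absvalM aN) powRM.
  - by move=> x y; rewrite (le_trans (wu x y)) // ge_max lerDl lerDr !wge.
pose o (x : K) : int := if pselect (x != 0) is left h then projT1 (cid (Nc x h)) else 0.
have oE (x : K) : x != 0 -> N x = c ^ o x.
  by move=> xn0; rewrite /o; case: pselect => // h; case: cid.
exists o, q; split=> //.
  split.
    move=> x xn0; rewrite wE' oE // /powR gt_eqF ?exprz_gt0 // expRz lnz //.
    congr expR; rewrite /e; field.
    by rewrite pnatr_eq0 -lt0n d0 lt_eqF.
  have x0n : x0 != 0 by rewrite -(absval_eq0 aN) Nx0 gt_eqF.
  exists x0 => //; have := oE _ x0n; rewrite Nx0 -{1}[c]expr1z => E.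
  have lc0 : ln c != 0 by rewrite lt_eqF.
  by have := congr1 (@ln R) E; rewrite !lnz // => /(mulIf lc0) /intr_inj.
case: rc => r [sz rle rinc rcov].
have inj i j : (i < size r)%N -> (j < size r)%N -> i != j -> N (nth 0 r i - nth 0 r j) = 1.
  by rewrite sz; exact: rinc.
exists r; split=> //.
- apply/(uniqP 0) => i j; rewrite !inE => ir jr E; apply/eqP; apply: contraT => ij.
  by have := inj _ _ ir jr ij; rewrite E subrr (absval0 aN) => /eqP; rewrite eq_sym oner_eq0.
- by move=> y /(allP rle); rewrite w_le1.
- move=> y z /(nthP 0) [i ir <-] /(nthP 0) [j jr <-]; have [->//|ij] := eqVneq i j.
  by rewrite w_lt1 inj // ltxx.
- by move=> x; rewrite w_le1 => /rcov [y yr H]; exists y => //; rewrite w_lt1.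
Qed.

Definition ordv (w : K -> R) : K -> int :=
  if pselect (place_fin w) is left h then projT1 (cid (fin_dataP h)) else fun=> 0.
Definition resq (w : K -> R) : nat :=
  if pselect (place_fin w) is left h then projT1 (cid (projT2 (cid (fin_dataP h)))) else 0%N.

Lemma ordvP w : place_fin w -> fin_data w (ordv w) (resq w).
Proof. by rewrite /ordv /resq => h; case: pselect => // h'; exact: projT2 (cid (projT2 (cid (fin_dataP h')))). Qed.

Definition piw (w : K -> R) : R := expR (- (ln (resq w)%:R / d%:R)).

Section OnePlace.
Variable w : K -> R.
Hypothesis pw : place_fin w.

Lemma fin_absval : absval w. Proof. by case: (ordvP pw). Qed.
Let aw := fin_absval.

Lemma fin_ultra x y : w (x + y) <= Num.max (w x) (w y). Proof. by case: (ordvP pw). Qed.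

Lemma resq_gt1 : (1 < resq w)%N. Proof. by case: (ordvP pw). Qed.

Lemma ordvE x : x != 0 -> w x = piw w ^ ordv w x.
Proof. by case: (ordvP pw) => _ _ _ [+ _] _; apply. Qed.

Lemma ln_resq_gt0 : 0 < ln (resq w)%:R :> R.
Proof. by rewrite ln_gt0 // ltr1n resq_gt1. Qed.

Lemma piw_gt0 : 0 < piw w. Proof. exact: expR_gt0. Qed.

Lemma piw_lt1 : piw w < 1.
Proof.
by rewrite -expR0 ltr_expR oppr_lt0 divr_gt0 ?ln_resq_gt0 // ltr0n dim_gt0.
Qed.

Lemma ln_fin x : x != 0 -> ln (w x) = - ((ordv w x)%:~R * ln (resq w)%:R / d%:R).
Proof.
by move=> x0; rewrite ordvE // lnz ?piw_gt0 // expRK; ring.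
Qed.

Lemma fin_uniformizer : exists2 pi, pi != 0 & w pi = piw w.
Proof.
by case: (ordvP pw) => _ _ _ [_ [pi pi0 E]] _; exists pi => //; rewrite ordvE // E.
Qed.

Lemma fin_le_ord x y : x != 0 -> y != 0 -> (w x <= w y) = (ordv w y <= ordv w x).
Proof. by move=> x0 y0; rewrite !ordvE // exprz_le_lt1 // piw_gt0 piw_lt1. Qed.

Lemma fin0 : w 0 = 0. Proof. exact: absval0. Qed.
Lemma fin1 : w 1 = 1. Proof. exact: absval1. Qed.
Lemma fin_ge0 x : 0 <= w x. Proof. exact: absval_ge0. Qed.
Lemma finM x y : w (x * y) = w x * w y. Proof. exact: absvalM. Qed.
Lemma finN x : w (- x) = w x. Proof. exact: absvalN. Qed.
Lemma finV x : w x^-1 = (w x)^-1. Proof. exact: absvalV. Qed.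
Lemma finX x n : w (x ^+ n) = w x ^+ n. Proof. exact: absvalX. Qed.
Lemma fin_gt0 x : x != 0 -> 0 < w x. Proof. exact: absval_gt0. Qed.
Lemma fin_eq0 x : (w x == 0) = (x == 0). Proof. exact: absval_eq0. Qed.

Lemma fin_le_add x y c : w x <= c -> w y <= c -> w (x + y) <= c.
Proof. by move=> h1 h2; rewrite (le_trans (fin_ultra _ _)) // ge_max h1. Qed.

Lemma fin_lt_add x y c : w x < c -> w y < c -> w (x + y) < c.
Proof. by move=> h1 h2; rewrite (le_lt_trans (fin_ultra _ _)) // gt_max h1. Qed.

Lemma fin_le_sub x y c : w x <= c -> w y <= c -> w (x - y) <= c.
Proof. by move=> h1 h2; rewrite fin_le_add // finN. Qed.

Lemma fin_sum_le (I : Type) (r : seq I) (P : pred I) (F : I -> K) c : 0 <= c ->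
  (forall i, P i -> w (F i) <= c) -> w (\sum_(i <- r | P i) F i) <= c.
Proof.
by move=> c0 H; elim/big_ind: _ => //; [rewrite fin0 | move=> x y; exact: fin_le_add].
Qed.

Lemma fin_sum_lt (I : Type) (r : seq I) (P : pred I) (F : I -> K) c : 0 < c ->
  (forall i, P i -> w (F i) < c) -> w (\sum_(i <- r | P i) F i) < c.
Proof.
by move=> c0 H; elim/big_ind: _ => //; [rewrite fin0 | move=> x y; exact: fin_lt_add].
Qed.

Lemma fin_addl x y : w x < w y -> w (x + y) = w y.
Proof.
move=> xy; apply: le_anti; rewrite fin_le_add ?(ltW xy) //=.
rewrite leNgt; apply/negP => H.
by have := fin_lt_add H (_ : w (- x) < w y); rewrite finN addrAC subrr add0r ltxx => /(_ xy).
Qed.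

Lemma fin_int_le1 (z : int) : w z%:~R <= 1.
Proof.
have H (n : nat) : w n%:R <= 1.
  elim: n => [|n IH]; first by rewrite fin0 ler01.
  by rewrite -addn1 natrD fin_le_add // fin1.
by case: z => n; [exact: (H n) | rewrite NegzE mulrNz finN; exact: (H n.+1)].
Qed.

Lemma fin_nat_le1 (n : nat) : w n%:R <= 1.
Proof. exact: (fin_int_le1 n). Qed.

Lemma fin_valuation_ring : valuation_ring [set x | w x <= 1].
Proof.
split.
  split=> /=; first by rewrite fin1.
    by move=> x y; exact: fin_le_sub.
  by move=> x y hx hy; rewrite finM mulr_ile1 ?fin_ge0.
move=> t /=; have [->|t0] := eqVneq t 0; first by left; rewrite fin0.
by case: (leP (w t) 1) => h; [left | right; rewrite finV invf_le1 ?fin_gt0 // ltW].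
Qed.

Lemma fin_nonunit x : nonunit [set x | w x <= 1] x <-> w x < 1.
Proof.
have [->|x0] := eqVneq x 0; first by rewrite fin0 ltr01; split=> // _; left.
split.
  case=> [/eqP|/= /negP]; first by rewrite (negPf x0).
  by rewrite finV invf_le1 ?fin_gt0 // -ltNge.
by move=> h; right; apply/negP; rewrite finV invf_le1 ?fin_gt0 // -ltNge.
Qed.

Lemma fin_above : exists2 p, prime p & w p%:R < 1.
Proof.
have [pi pi0 Epi] := fin_uniformizer.
have [|p pp Mp] := residue_prime fin_valuation_ring (x := pi^-1).
  by rewrite /= finV Epi; apply/negP; rewrite -ltNge invf_gt1 ?piw_gt0 ?piw_lt1.
by exists p => //; apply/fin_nonunit.
Qed.

Lemma fin_int_lt1 p (z : int) : prime p -> w p%:R < 1 -> (w z%:~R < 1) = (p %| z)%Z.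
Proof.
move=> pp wp; apply/idP/idP.
  by move=> /fin_nonunit wz; apply: (nonunit_intP fin_valuation_ring pp) => //; apply/fin_nonunit.
by move=> pz; apply/fin_nonunit; apply: (nonunit_dvd_int fin_valuation_ring) pz; apply/fin_nonunit.
Qed.

Lemma fin_nat_lt1 p (n : nat) : prime p -> w p%:R < 1 -> (w n%:R < 1) = (p %| n)%N.
Proof. by move=> pp wp; exact: (fin_int_lt1 n pp wp). Qed.

(** If |x| > 1, the leading term of a monic integral equation of x would dominate all the others
    strictly. *)
Lemma fin_algint x : algint x -> w x <= 1.
Proof.
move=> [p [/monicP lp /eqP px]]; rewrite leNgt; apply/negP => wx.
have x0 : x != 0 by rewrite -fin_eq0 gt_eqF // (lt_trans ltr01).
have sp : (0 < size p)%N by rewrite lt0n size_poly_eq0; apply/eqP => p0; move: lp; rewrite p0 lead_coef0.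
pose n := (size p).-1; have En : size p = n.+1 by rewrite /n prednK.
move: px; rewrite horner_coef size_map_inj_poly ?rmorph0 //; last exact: intr_inj_K.
rewrite En big_ord_recr /= !coef_map /= -/n.
have -> : p`_n = 1 by rewrite -lp lead_coefE.
rewrite mul1r => /eqP; rewrite addr_eq0 => /eqP E.
have : w (x ^+ n) < w (x ^+ n).
  rewrite -{1}[x ^+ n]opprK -E finN; apply: fin_sum_lt; first by rewrite fin_gt0 // expf_neq0.
  move=> i _; rewrite coef_map finM !finX.
  apply: (le_lt_trans (_ : _ <= 1 * w x ^+ i)); first by rewrite ler_wpM2r ?exprn_ge0 ?fin_ge0 ?fin_int_le1.
  by rewrite mul1r ltr_eXn2l.
by rewrite ltxx.
Qed.

Lemma fin_lt_piw x k : w x < piw w ^+ k -> w x <= piw w ^+ k.+1.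
Proof.
have [->|x0] := eqVneq x 0; first by rewrite fin0 exprn_ge0 // ltW ?piw_gt0.
have t01 : 0 < piw w < 1 by rewrite piw_gt0 piw_lt1.
rewrite ordvE // !exprnP ltNge !exprz_le_lt1 // -ltNge; lia.
Qed.

Lemma ordvM x y : x != 0 -> y != 0 -> ordv w (x * y) = ordv w x + ordv w y.
Proof.
move=> x0 y0; have := finM x y; rewrite !ordvE ?mulf_neq0 // -expfzDr ?gt_eqF ?piw_gt0 //.
have t01 : 0 < piw w < 1 by rewrite piw_gt0 piw_lt1.
by move=> E; apply: le_anti; rewrite -!(exprz_le_lt1 _ _ t01) E lexx.
Qed.

Lemma ordv1 : ordv w 1 = 0.
Proof.
have /eqP := ordvM (oner_neq0 K) (oner_neq0 K).
by rewrite mulr1 -subr_eq0 opprD addNKr oppr_eq0 => /eqP.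
Qed.

Lemma ordvX x n : x != 0 -> ordv w (x ^+ n) = ordv w x *+ n.
Proof.
move=> x0; elim: n => [|n IH]; first by rewrite expr0 mulr0n ordv1.
by rewrite exprS ordvM ?expf_neq0 // IH mulrS.
Qed.

Lemma ordv_ge0 x : x != 0 -> (0 <= ordv w x) = (w x <= 1).
Proof. by move=> x0; rewrite -fin1 fin_le_ord ?oner_eq0 // ordv1. Qed.

Lemma ordv_gt0 x : x != 0 -> (0 < ordv w x) = (w x < 1).
Proof. by move=> x0; rewrite -fin1 ltNge [in RHS]ltNge fin_le_ord ?oner_eq0 // ordv1. Qed.

Lemma residues : exists r : seq K, [/\ uniq r, size r = resq w, (forall y, y \in r -> w y <= 1),
  (forall y z, y \in r -> z \in r -> w (y - z) < 1 -> y = z) &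
  forall x, w x <= 1 -> exists2 y, y \in r & w (x - y) < 1].
Proof. by case: (ordvP pw). Qed.

End OnePlace.

Lemma resq_le (w w' : K -> R) : place_fin w -> place_fin w' ->
  (forall x, (w x < 1) = (w' x < 1)) -> (forall x, (w x <= 1) = (w' x <= 1)) -> (resq w <= resq w')%N.
Proof.
move=> pw pw' Elt Ele.
have [r [ur sr rV rinj rcov]] := residues pw.
have [r' [ur' sr' rV' rinj' rcov']] := residues pw'.
have f y : exists z, y \in r -> z \in r' /\ w (y - z) < 1.
  have [yr|] := boolP (y \in r); last by exists 0.
  by have [|z zr H] := rcov' y; [rewrite -Ele rV | exists z => _; rewrite Elt].
pose g y := projT1 (cid (f y)).
have gP y : y \in r -> g y \in r' /\ w (y - g y) < 1 by rewrite /g; case: cid.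
rewrite -sr -sr' -(size_map g); apply: uniq_leq_size.
  rewrite map_inj_in_uniq // => y z yr zr E; apply: rinj => //.
  have [_ h1] := gP _ yr; have [_ h2] := gP _ zr.
  rewrite (_ : y - z = (y - g y) - (z - g z)); last by rewrite E; ring.
  by apply: fin_lt_add => //; rewrite finN.
by move=> _ /mapP [y yr ->]; case: (gP _ yr).
Qed.

(** A discrete valuation ring has no proper overring except the field, so an inclusion of valuation
    rings is an equality. The residue cardinality then fixes the normalization, and w and w' agree
    on a uniformizer. *)
Lemma place_fin_eq (w w' : K -> R) : place_fin w -> place_fin w' ->
  (forall x, w x <= 1 -> w' x <= 1) -> w = w'.
Proof.
move=> pw pw' sub.
have lt1 x : w x < 1 -> w' x < 1.
  move=> wx; have [->|x0] := eqVneq x 0; first by rewrite fin0.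
  rewrite lt_neqAle sub ?ltW // andbT; apply/eqP => E.
  have [pi pi0 Epi] := fin_uniformizer pw'.
  pose y := pi^-1; have y0 : y != 0 by rewrite invr_eq0.
  have w'y : 1 < w' y by rewrite finV // Epi invf_gt1 ?piw_gt0 ?piw_lt1.
  have ox : 0 < ordv w x by rewrite ordv_gt0.
  (* If x were small at w but a unit at w', a power of x would make y integral at w without changing
     |y| at w', which exceeds 1. *)
  have : w' (x ^+ absz (ordv w y) * y) <= 1.
    apply: sub; rewrite -ordv_ge0 ?mulf_neq0 ?expf_neq0 // ordvM ?expf_neq0 // ordvX // -mulr_natr.
    move: ox; move: (ordv w x) (ordv w y) => a b a0; nia.
  by rewrite finM // finX // E expr1n mul1r leNgt w'y.
have eq1 x : w x = 1 -> w' x = 1.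
  move=> wx; apply: le_anti; rewrite sub ?wx //=.
  have x0 : x != 0 by rewrite -(fin_eq0 pw) wx oner_eq0.
  by have := sub x^-1; rewrite finV // wx invr1 finV // invf_le1 ?fin_gt0 // lexx => /(_ isT).
have Ele x : (w x <= 1) = (w' x <= 1).
  apply/idP/idP; first exact: sub.
  rewrite !leNgt; apply: contra => wx.
  have x0 : x != 0 by rewrite -(fin_eq0 pw) gt_eqF // (lt_trans ltr01).
  by have := lt1 x^-1; rewrite !finV // !invf_lt1 ?fin_gt0 //; apply.
have Elt x : (w x < 1) = (w' x < 1).
  apply/idP/idP; first exact: lt1.
  move=> w'x; rewrite lt_neqAle Ele (ltW w'x) andbT; apply/eqP => /eq1 E.
  by rewrite E ltxx in w'x.
have Eq : resq w = resq w'.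
  apply/eqP; rewrite eqn_leq !resq_le //.
have Epi : piw w = piw w' by rewrite /piw Eq.
have [pi pi0 E1] := fin_uniformizer pw; have [pi' pi0' E2] := fin_uniformizer pw'.
have t0 := piw_gt0 w; have t1 := piw_lt1 pw.
have o x : x != 0 -> w' x = w' pi ^ ordv w x.
  move=> x0; have : w' (x / pi ^ ordv w x) = 1.
    apply: eq1; rewrite (absvalM (fin_absval pw)) (absvalV (fin_absval pw)).
    have -> n : w (pi ^ n) = piw w ^ n.
      case: n => n; first by rewrite -!exprnP finX // E1.
      by rewrite !NegzE -!invr_expz finV // -!exprnP finX // E1.
    by rewrite ordvE // mulfV // expfz_neq0 // gt_eqF.
  rewrite finM // finV //.
  have -> n : w' (pi ^ n) = w' pi ^ n.
    case: n => n; first by rewrite -!exprnP finX.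
    by rewrite !NegzE -!invr_expz finV // -!exprnP finX.
  have nz : w' pi ^ ordv w x != 0 by rewrite expfz_neq0 // fin_eq0.
  by move=> /(canRL (mulfVK nz)); rewrite mul1r.
have E3 : w' pi = piw w.
  have := o _ pi0'; rewrite E2 -Epi => E3.
  have w'pi : w' pi < 1 by rewrite -Elt E1.
  have op : 0 < ordv w' pi.
    rewrite ltNge; apply/negP => H.
    by move: w'pi; rewrite -ordv_gt0 // ltNge H.
  move: E3; rewrite (ordvE pw' pi0) -Epi -{1}[piw w]expr1z exprz_exp => E3.
  have h : 1 = ordv w' pi * ordv w pi'.
    by apply: le_anti; rewrite -!(@exprz_le_lt1 _ (piw w)) ?t0 ?t1 // -E3 lexx.
  rewrite (_ : ordv w' pi = 1) ?expr1z //.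
  move: op h; move: (ordv w' pi) (ordv w pi') => u v u0 h.
  have [v0|v0] : v <= 0 \/ 1 <= v by lia.
    nia.
  nia.
apply/funext => x; have [->|x0] := eqVneq x 0; first by rewrite !fin0.
by rewrite o // E3 ordvE.
Qed.

Lemma fin_dominate (w : K -> R) (s : seq (K -> R)) (a b : K) : place_fin w -> 1 < w b ->
  (forall w', w' \in s -> place_fin w') ->
  exists N, forall w', w' \in s -> w' a < 1 -> forall n, (N <= n)%N -> w' (a ^+ n * b) < 1.
Proof.
move=> pw wb ps; exists (\sum_(w' <- s) absz (ordv w' b)).+1%N => w' w's w'a n Nn.
have pw' := ps _ w's.
have b0 : b != 0 by rewrite -(fin_eq0 pw) gt_eqF // (lt_trans ltr01).
have [->|a0] := eqVneq a 0.
  by rewrite expr0n (_ : (n == 0%N) = false) ?mul0r ?fin0 //; lia.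
rewrite -ordv_gt0 ?mulf_neq0 ?expf_neq0 // ordvM ?expf_neq0 // ordvX // -mulr_natr.
have : 0 < ordv w' a by rewrite ordv_gt0.
have : (absz (ordv w' b) < n)%N.
  by apply: leq_trans Nn; rewrite ltnS (big_rem w') //= leq_addr.
by move: (ordv w' a) (ordv w' b) => u v; nia.
Qed.

(** The induction of Artin and Whaples: a separates w from s, and b separates w from the new place
    w1. If |a| <= 1 at w1, then a^N b works. Otherwise b is corrected by a^n / (1 + a^n), which has
    absolute value 1 at w and w1 and is small on s. *)
Lemma fin_separate (w : K -> R) (s : seq (K -> R)) : place_fin w ->
  (forall w', w' \in s -> place_fin w' /\ w' <> w) ->
  exists2 a, 1 < w a & forall w', w' \in s -> w' a < 1.
Proof.
move=> pw; elim: s => [|w1 s IH] ps.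
  have [pi pi0 Epi] := fin_uniformizer pw.
  by exists pi^-1 => //; rewrite finV // Epi invf_gt1 ?piw_gt0 ?piw_lt1.
have [|a wa sa] := IH; first by move=> w' w's; apply: ps; rewrite inE w's orbT.
have [pw1 w1w] := ps w1 (mem_head _ _).
have psf w' : w' \in w1 :: s -> place_fin w' by move=> /ps [].
have [b wb w1b] : exists2 b, 1 < w b & w1 b < 1.
  have [x wx w1x] : exists2 x, w x <= 1 & 1 < w1 x.
    apply: contrapT => H; apply: w1w; apply/esym/place_fin_eq => // x wx.
    by rewrite leNgt; apply/negP => w1x; apply: H; exists x.
  have [y w1y wy] : exists2 y, w1 y <= 1 & 1 < w y.
    apply: contrapT => H; apply: w1w; apply: place_fin_eq => // y w1y.
    by rewrite leNgt; apply/negP => wy; apply: H; exists y.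
  have x0 : x != 0 by rewrite -(fin_eq0 pw1) gt_eqF // (lt_trans ltr01).
  exists (y / x); rewrite finM // finV //.
    by rewrite (lt_le_trans wy) // ler_pMr ?(lt_trans ltr01) // invf_ge1 ?fin_gt0.
  rewrite (@le_lt_trans _ _ (1 / w1 x)) ?ler_wpM2r ?invr_ge0 ?fin_ge0 //.
  by rewrite mul1r invf_lt1 // (lt_trans ltr01).
have [N HN] := @fin_dominate w (w1 :: s) a b pw wb psf.
have wX n : 1 <= w a ^+ n by rewrite exprn_ege1 // ltW.
have [w1a|w1a] := leP (w1 a) 1.
  exists (a ^+ N * b).
    by rewrite finM // finX // (lt_le_trans wb) // ler_peMl // fin_ge0.
  move=> w'; rewrite inE => /orP[/eqP ->|w's]; last by apply: HN => //; [rewrite inE w's orbT | exact: sa].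
  rewrite finM // finX // (le_lt_trans _ w1b) // ler_piMl ?fin_ge0 //.
  by rewrite exprn_ile1 ?fin_ge0.
pose n := N.+1.
have gt (w' : K -> R) : place_fin w' -> 1 < w' a -> w' (a ^+ n / (1 + a ^+ n)) = 1.
  move=> pw' w'a; have h : w' 1 < w' (a ^+ n) by rewrite fin1 // finX // exprn_egt1.
  by rewrite finM // finV // fin_addl // mulfV // gt_eqF // (lt_trans _ h) // fin1.
exists (a ^+ n / (1 + a ^+ n) * b); first by rewrite finM // gt // mul1r.
move=> w'; rewrite inE => /orP[/eqP ->|w's]; first by rewrite finM // gt // mul1r.
have pw' : place_fin w' by apply: psf; rewrite inE w's orbT.
have h : w' (a ^+ n) < w' 1 by rewrite finX // fin1 // exprn_ilt1 ?fin_ge0 ?sa.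
rewrite mulrAC finM // finV // addrC fin_addl // fin1 // invr1 mulr1.
by apply: HN => //; [rewrite inE w's orbT | exact: sa].
Qed.

(** With a large at w and small at the other places, a / (1 + a) is close to 1 at w and to 0
    elsewhere. *)
Lemma fin_approx (w : K -> R) (s : seq (K -> R)) : place_fin w ->
  (forall w', w' \in s -> place_fin w') ->
  exists2 z, w (z - 1) < 1 & forall w', w' \in s -> w' <> w -> w' z < 1.
Proof.
move=> pw ps; have [|a wa sa] := @fin_separate w [seq w' <- s | w' != w] pw.
  by move=> w'; rewrite mem_filter => /andP[/eqP ww w's]; split=> //; exact: ps.
have a1 (w' : K -> R) (pw' : place_fin w') : w' a < 1 -> w' (1 + a) = 1.
  by move=> w'a; rewrite addrC fin_addl ?fin1.
have wa1 : w (1 + a) = w a by rewrite fin_addl // fin1.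
have a0 : 1 + a != 0 by rewrite -(fin_eq0 pw) wa1 gt_eqF // (lt_trans ltr01).
exists (a / (1 + a)).
  rewrite (_ : a / (1 + a) - 1 = - (1 + a)^-1); last by field.
  by rewrite finN // finV // wa1 invf_lt1 // (lt_trans ltr01).
move=> w' w's ww; have pw' := ps _ w's.
have w'a : w' a < 1 by apply: sa; rewrite mem_filter w's andbT; apply/eqP.
by rewrite finM // finV // a1 // invr1 mulr1.
Qed.

(** Elements z_i congruent to 1 at the i-th place and to 0 at the others satisfy no integral
    relation that is nontrivial modulo p. *)
Lemma size_places_above p (s : seq (K -> R)) : prime p -> uniq s ->
  (forall w, w \in s -> place_fin w /\ w p%:R < 1) -> (size s <= d)%N.
Proof.
move=> pp us ps; rewrite leqNgt; apply/negP => ds.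
have psf w : w \in s -> place_fin w by move=> /ps [].
have H (i : 'I_(size s)) : exists z, forall w, w \in s ->
    if w == tnth (in_tuple s) i then w (z - 1) < 1 else w z < 1.
  have [z h1 h2] := fin_approx (psf _ (mem_tnth i (in_tuple s))) psf.
  by exists z => w ws; case: eqP => [->|/h2]; last exact.
pose z i := projT1 (cid (H i)).
have zP i w : w \in s -> if w == tnth (in_tuple s) i then w (z i - 1) < 1 else w (z i) < 1.
  by rewrite /z; case: cid => /= ? ?; auto.
have [c [[i ci] Ec]] := primitive_relation z pp ds.
pose w := tnth (in_tuple s) i; have ws : w \in s by exact: mem_tnth.
have [pw wp] := ps _ ws.
have wz : w (z i) = 1.
  have := zP i _ ws; rewrite eqxx => h.
  by rewrite -(subrK 1 (z i)) fin_addl ?fin1.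
have wc : w (c i)%:~R = 1.
  apply: le_anti; rewrite fin_int_le1 //= leNgt; apply/negP.
  by rewrite (fin_int_lt1 pw _ pp wp); apply/negP.
have : w ((c i)%:~R * z i) < 1.
  move: Ec; rewrite (bigD1 i) //= => /eqP; rewrite addr_eq0 => /eqP ->.
  rewrite finN //; apply: fin_sum_lt => // j ji; rewrite finM //.
  rewrite (@le_lt_trans _ _ (1 * w (z j))) ?ler_wpM2r ?fin_ge0 ?fin_int_le1 // mul1r.
  have := zP j _ ws; rewrite (_ : (w == _) = false) //.
  apply/negbTE; rewrite /w !(tnth_nth w) /= nth_uniq //; by rewrite eq_sym.
by rewrite finM // wc wz mulr1 ltxx.
Qed.

Lemma places_above_prime p : prime p ->
  exists S : seq (K -> R), uniq S /\ forall w, w \in S <-> place_fin w /\ w p%:R < 1.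
Proof.
move=> pp.
pose P k := `[< exists s : seq (K -> R), [/\ uniq s, forall w, w \in s -> place_fin w /\ w p%:R < 1 & size s = k] >].
have exP : exists k, P k by exists 0%N; apply/asboolP; exists [::].
have bP k : P k -> (k <= d)%N.
  by move=> /asboolP [s [us ps <-]]; exact: (size_places_above pp).
case: (ex_maxnP exP bP) => k /asboolP [s [us ps sk]] kmax; exists s; split=> // w.
split=> [/ps //|[pw wp]]; apply: contrapT => /negP ws.
have : P k.+1.
  apply/asboolP; exists (w :: s); split; rewrite /= ?us ?ws ?sk //.
  by move=> w'; rewrite inE => /orP[/eqP ->|/ps].
by move=> /kmax; rewrite ltnn.
Qed.

Lemma places_dividing m : (0 < m)%N ->
  exists S : seq (K -> R), uniq S /\ forall w, w \in S <-> place_fin w /\ w m%:R < 1.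
Proof.
move=> m0.
have H (p : nat) : exists S : seq (K -> R), prime p -> forall w, w \in S <-> place_fin w /\ w p%:R < 1.
  have [pp|_] := boolP (prime p); last by exists [::].
  by have [S [_ HS]] := places_above_prime pp; exists S.
pose S p := projT1 (cid (H p)).
have SP p w : prime p -> w \in S p <-> place_fin w /\ w p%:R < 1.
  by rewrite /S; case: cid => /= s hs /hs.
exists (undup (flatten [seq S p | p <- primes m])); split; first exact: undup_uniq.
move=> w; rewrite mem_undup; split.
  move=> /flattenP [_ /mapP [p pm ->]]; move: pm; rewrite mem_primes => /and3P[pp _ pm].
  by move=> /(SP _ _ pp) [pw wp]; split=> //; rewrite (fin_nat_lt1 pw _ pp wp).
move=> [pw wm]; have [p pp wp] := fin_above pw.
apply/flattenP; exists (S p); last by apply/SP.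
by apply: map_f; rewrite mem_primes pp m0 -(fin_nat_lt1 pw _ pp wp).
Qed.

(** * Chinese remainders: counting residues at several places *)

Section Residues.
Variable S : seq (K -> R).
Hypotheses (uS : uniq S) (pS : forall w, w \in S -> place_fin w).

Definition deep (k : (K -> R) -> nat) x := forall w, w \in S -> w x <= piw w ^+ k w.

(** One more digit at w0. The element u has exact order [k w0] at w0 and order at least k at the
    other places of S, so x + u a, with x in X and a in a system of residues at w0, runs through the
    refined classes. *)
Lemma residues_step (k : (K -> R) -> nat) w0 (X : seq K) : w0 \in S -> uniq X ->
  (forall x, x \in X -> forall w, w \in S -> w x <= 1) ->
  (forall x y, x \in X -> y \in X -> deep k (x - y) -> x = y) ->
  (forall x, (forall w, w \in S -> w x <= 1) -> exists2 y, y \in X & deep k (x - y)) ->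
  let k' w := (k w + (w == w0))%N in
  exists Y : seq K, [/\ uniq Y, size Y = (size X * resq w0)%N,
    (forall x, x \in Y -> forall w, w \in S -> w x <= 1),
    (forall x y, x \in Y -> y \in Y -> deep k' (x - y) -> x = y) &
    (forall x, (forall w, w \in S -> w x <= 1) -> exists2 y, y \in Y & deep k' (x - y))].
Proof.
move=> w0S uX OX incX covX k'.
have pw0 := pS w0S.
have [z wz sz] := fin_approx pw0 pS.
have [pi pi0 Epi] := fin_uniformizer pw0.
have wz1 : w0 z = 1 by rewrite -(subrK 1 z) fin_addl // ?fin1.
have z0 : z != 0 by rewrite -(fin_eq0 pw0) wz1 oner_eq0.
have zsmall y c : exists n, forall w, w \in S -> w <> w0 -> w (z ^+ n * y) <= piw w ^+ c w.
  pose N := (\sum_(w <- S) (absz (ordv w y) + c w))%N; exists N => w wS ww.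
  have pw := pS wS; have [->|y0] := eqVneq y 0.
    by rewrite mulr0 fin0 // exprn_ge0 // ltW ?piw_gt0.
  rewrite ordvE ?mulf_neq0 ?expf_neq0 // [X in _ <= X]exprnP exprz_le_lt1 ?piw_gt0 ?piw_lt1 //.
  rewrite ordvM ?expf_neq0 // ordvX // -mulr_natr.
  have : 0 < ordv w z by rewrite ordv_gt0 // sz.
  have : (absz (ordv w y) + c w <= N)%N by rewrite /N (big_rem w) //= leq_addr.
  by move: (ordv w z) (ordv w y) => u v; nia.
have [n1 Hn1] := zsmall (pi ^+ k w0) k.
pose u := z ^+ n1 * pi ^+ k w0.
have wu : w0 u = piw w0 ^+ k w0 by rewrite /u finM // !finX // wz1 expr1n mul1r Epi.
have u0 : u != 0 by rewrite mulf_neq0 ?expf_neq0.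
have [r [ur sr rV rinj rcov]] := residues pw0.
have zn1 n : w0 (z ^+ n - 1) < 1.
  elim: n => [|n IH]; first by rewrite expr0 subrr fin0.
  rewrite exprS (_ : z * z ^+ n - 1 = z * (z ^+ n - 1) + (z - 1)); last by ring.
  by rewrite fin_lt_add // finM // wz1 mul1r.
(* Residue representatives at w0 are replaced, within their class, by elements integral at all of S:
   multiplication by a power of z does it. *)
have lift y : exists y', y \in r -> w0 (y - y') < 1 /\ forall w, w \in S -> w y' <= 1.
  have [yr|] := boolP (y \in r); last by exists 0.
  have [n Hn] := zsmall y (fun=> 0%N); exists (z ^+ n * y) => _; split.
    rewrite (_ : y - z ^+ n * y = - ((z ^+ n - 1) * y)); last by ring.
    rewrite finN // finM // (@le_lt_trans _ _ (w0 (z ^+ n - 1) * 1)) ?ler_wpM2l ?fin_ge0 ?rV //.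
    by rewrite mulr1.
  move=> w wS; have [->|/eqP ww] := eqVneq w w0; last by have := Hn w wS ww.
  by rewrite finM // finX // wz1 expr1n mul1r rV.
pose l y := projT1 (cid (lift y)).
have lP y : y \in r -> w0 (y - l y) < 1 /\ forall w, w \in S -> w (l y) <= 1.
  by rewrite /l; case: cid.
have uO w : w \in S -> w u <= piw w ^+ k w.
  by move=> wS; have [->|/eqP ww] := eqVneq w w0; [rewrite wu | exact: Hn1].
have tle1 w n : w \in S -> piw w ^+ n <= 1.
  by move=> wS; rewrite exprn_ile1 ?ltW ?piw_gt0 ?piw_lt1 //; exact: pS.
have uldeep y : y \in r -> deep k (u * l y).
  move=> yr w wS; have pw := pS wS; rewrite finM // -[leRHS]mulr1 ler_pM ?fin_ge0 ?uO //.
  by case: (lP _ yr) => _; apply.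
have deepB x y : deep k x -> deep k y -> deep k (x - y).
  by move=> hx hy w wS; apply: (fin_le_sub (pS wS)); [exact: hx | exact: hy].
have k'k x : deep k' x -> deep k x.
  move=> hx w wS; apply: (le_trans (hx w wS)); rewrite /k' exprD ler_piMr ?tle1 //.
  by rewrite exprn_ge0 // ltW ?piw_gt0.
have inj x y a b : x \in X -> y \in X -> a \in r -> b \in r ->
    deep k' (x + u * l a - (y + u * l b)) -> x = y /\ a = b.
  move=> xX yX ar br H.
  have Exy : x = y.
    apply: incX => //; rewrite (_ : x - y = (x + u * l a - (y + u * l b)) - (u * l a - u * l b)); last by ring.
    by apply: (deepB); [exact: k'k | apply: (deepB); exact: uldeep].
  split=> //; apply: rinj => //.
  have : w0 (l a - l b) < 1.
    have := H _ w0S; rewrite Exy (_ : y + u * l a - (y + u * l b) = u * (l a - l b)); last by ring.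
    rewrite finM // wu /k' eqxx addn1 exprSr ler_pM2l ?exprn_gt0 ?piw_gt0 // => h.
    by rewrite (le_lt_trans h) // piw_lt1.
  have [h1 _] := lP _ ar; have [h2 _] := lP _ br.
  move=> h3; rewrite (_ : a - b = (a - l a) + ((l a - l b) - (b - l b))); last by ring.
  by apply: fin_lt_add => //; apply: fin_lt_add => //; rewrite finN.
have deep0 kk : deep kk 0.
  by move=> w wS; rewrite (fin0 (pS wS)) exprn_ge0 // ltW ?piw_gt0.
exists [seq x + u * l a | x <- X, a <- r]; split.
- apply: allpairs_uniq => // -[x a] [y b] /allpairsP [[x1 a1] /= [xX ar [-> ->]]]
    /allpairsP [[y1 b1] /= [yX br [-> ->]]] /= E.
  by have [|-> ->] := inj _ _ _ _ xX yX ar br; first by rewrite E subrr.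
- by rewrite size_allpairs sr.
- move=> _ /allpairsP [[x a] /= [xX ar ->]] w wS; apply: fin_le_add; [exact: pS | exact: OX |].
  by apply: (le_trans (uldeep _ ar _ wS)); exact: tle1.
- move=> _ _ /allpairsP [[x a] /= [xX ar ->]] /allpairsP [[y b] /= [yX br ->]] H.
  by have [-> ->] := inj _ _ _ _ xX yX ar br H.
move=> x Ox; have [y yX Hy] := covX _ Ox.
have wt : w0 ((x - y) / u) <= 1.
  rewrite finM // finV // wu ler_pdivrMr ?exprn_gt0 ?piw_gt0 // mul1r; exact: Hy.
have [a ar wa] := rcov _ wt; have [h1 h2] := lP _ ar.
exists (y + u * l a); first by apply/allpairsP; exists (y, a).
move=> w wS; have pw := pS wS; have [Ew|ww] := eqVneq w w0; last first.
  rewrite /k' (negPf ww) addn0 opprD addrA; apply: fin_le_sub => //; first exact: Hy.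
  exact: uldeep.
rewrite Ew /k' eqxx addn1; apply: fin_lt_piw => //.
rewrite (_ : x - (y + u * l a) = u * (((x - y) / u - a) + (a - l a))); last by field.
by rewrite finM // wu gtr_pMr ?exprn_gt0 ?piw_gt0 // fin_lt_add.
Qed.

Lemma residues_exist (k : (K -> R) -> nat) :
  exists X : seq K, [/\ uniq X, size X = (\prod_(w <- S) resq w ^ k w)%N,
    (forall x, x \in X -> forall w, w \in S -> w x <= 1),
    (forall x y, x \in X -> y \in X -> deep k (x - y) -> x = y) &
    (forall x, (forall w, w \in S -> w x <= 1) -> exists2 y, y \in X & deep k (x - y))].
Proof.
have [n] := ubnP (\sum_(w <- S) k w)%N; elim: n k => // n IH k; rewrite ltnS => len.
have [[w0 w0S kw0]|H] := pselect (exists2 w, w \in S & (0 < k w)%N); last first.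
  have k0 w : w \in S -> k w = 0%N.
    by move=> wS; apply/eqP; rewrite -leqn0 leqNgt; apply/negP => ?; apply: H; exists w.
  have tle (x : K) w : w \in S -> (w x <= piw w ^+ k w) = (w x <= 1) by move=> wS; rewrite k0 // expr0.
  exists [:: 0]; split=> //.
  - by rewrite big_seq big1 // => w wS; rewrite k0 // expn0.
  - by move=> x; rewrite inE => /eqP -> w wS; rewrite (fin0 (pS wS)).
  - by move=> x y; rewrite !inE => /eqP -> /eqP ->.
  - by move=> x Ox; exists 0; rewrite ?inE // subr0 => w wS; rewrite tle // Ox.
pose k1 w := (k w - (w == w0))%N.
have Ek : (fun w => k1 w + (w == w0))%N = k.
  by apply/funext => w; rewrite /k1; case: eqP => [->|_]; lia.
have [|X [uX sX OX incX covX]] := IH k1.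
  apply: leq_trans len; rewrite !(big_rem w0 w0S) /= /k1 eqxx -addSn; apply: leq_add; first by lia.
  by apply: leq_sum => w _; lia.
have := residues_step w0S uX OX incX covX; rewrite /= Ek => -[Y [uY sY OY incY covY]].
exists Y; split=> //; rewrite sY sX !(big_rem w0 w0S) /= /k1 eqxx.
rewrite mulnAC -expnSr (_ : (k w0 - true).+1 = k w0); last by lia.
congr (_ * _)%N; apply: eq_big_seq => w; rewrite mem_rem_uniq // inE => /andP[/negPf -> _].
by rewrite subn0.
Qed.

End Residues.

End FinitePlaceData.

(** * Algebraic integers and complex embeddings *)

Section AlgebraicIntegers.

Section Closure.
Variable F : fieldType.
Implicit Types x y : F.

Lemma algintE x : algint x <-> integralOver (intmul (1 : F)) x.
Proof. by split=> [[p [mp rp]]|[p mp rp]]; exists p. Qed.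

Lemma algint_int (z : int) : algint (z%:~R : F).
Proof.
exists ('X - z%:P); split; first exact: monicXsubC.
by rewrite rmorphB /= map_polyX map_polyC /= root_XsubC.
Qed.

Lemma algintM x y : algint x -> algint y -> algint (x * y).
Proof. by move=> /algintE hx /algintE hy; apply/algintE; exact: integral_mul. Qed.

Lemma algintD x y : algint x -> algint y -> algint (x + y).
Proof. by move=> /algintE hx /algintE hy; apply/algintE; exact: integral_add. Qed.

Lemma algintN x : algint x -> algint (- x).
Proof. by move=> /algintE hx; apply/algintE; exact: integral_opp. Qed.

Lemma algintX x n : algint x -> algint (x ^+ n).
Proof.
move=> hx; elim: n => [|n IH]; first exact: (algint_int 1).
by rewrite exprS; exact: algintM.
Qed.

Lemma algint_sum (I : Type) (r : seq I) (P : pred I) (E : I -> F) :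
  (forall i, P i -> algint (E i)) -> algint (\sum_(i <- r | P i) E i).
Proof. by move=> H; elim/big_ind: _ => //; [exact: (algint_int 0) | exact: algintD]. Qed.

Lemma algint_prod (I : Type) (r : seq I) (P : pred I) (E : I -> F) :
  (forall i, P i -> algint (E i)) -> algint (\prod_(i <- r | P i) E i).
Proof. by move=> H; elim/big_ind: _ => //; [exact: (algint_int 1) | exact: algintM]. Qed.

Lemma algint_det n (A : 'M[F]_n) : (forall i j, algint (A i j)) -> algint (\det A).
Proof.
move=> H; apply: algint_sum => s _; apply: algintM; last exact: algint_prod.
by apply: algintX; apply: algintN; exact: (algint_int 1).
Qed.

End Closure.

Lemma algint_rmorph (F E : fieldType) (f : {rmorphism F -> E}) x : algint x -> algint (f x).
Proof.
move=> [p [mp rp]]; exists p; split=> //.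
rewrite (eq_map_poly (g := f \o intmul (1 : F))) ?map_poly_comp; last by move=> z /=; rewrite rmorph_int.
exact: rmorph_root.
Qed.

Lemma algint_rmorph_inj (F E : fieldType) (f : {rmorphism F -> E}) x : algint (f x) -> algint x.
Proof.
move=> [p [mp rp]]; exists p; split=> //; rewrite -(fmorph_root f) -map_poly_comp.
by rewrite (eq_map_poly (g := intmul (1 : E))) // => z /=; rewrite rmorph_int.
Qed.

Lemma algint_rat (r : rat) : algint r -> exists z : int, r = z%:~R.
Proof.
move=> [p [/monicP lp /rootP pr]].
have sp : (0 < size p)%N.
  by rewrite lt0n size_poly_eq0; apply/eqP => p0; move: lp; rewrite p0 lead_coef0.
pose n := (size p).-1; have En : size p = n.+1 by rewrite /n prednK.
pose a := numq r; pose b := denq r.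
have Er : r = a%:~R / b%:~R by rewrite divq_num_den.
have b0 : b%:~R != 0 :> rat by rewrite intr_eq0 denq_neq0.
have E : \sum_(i < n) p`_i * a ^+ i * b ^+ (n - i) = - a ^+ n.
  apply/eqP; rewrite -addr_eq0 -(intr_eq0 rat) rmorphD rmorph_sum rmorphXn /=; apply/eqP.
  transitivity (b%:~R ^+ n * (map_poly intr p).[r] : rat); last by rewrite pr mulr0.
  rewrite horner_coef size_map_inj_poly ?rmorph0 //; last exact: intr_inj.
  rewrite En big_ord_recr /= !coef_map /= -/n.
  have -> : p`_n = 1 by rewrite -lp lead_coefE.
  rewrite mul1r mulrDr mulr_sumr; congr (_ + _); last first.
    by rewrite -exprMn mulrC -numqE.
  apply: eq_bigr => i _; rewrite coef_map /= !rmorphM !rmorphXn /= {1}Er.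
  rewrite expr_div_n.
  have -> : b%:~R ^+ n = b%:~R ^+ (n - i) * b%:~R ^+ i :> rat by rewrite -exprD subnK // ltnW.
  by field; rewrite expf_neq0.
have dv : (b %| a ^+ n)%Z.
  rewrite -rpredN -E; apply: rpred_sum.
  move=> i _; rewrite dvdz_mull // -[X in (X %| _)%Z]expr1 dvdz_exp2l // subn_gt0 //.
have cop : coprimez b (a ^+ n).
  by rewrite coprimezE abszX; apply: coprimeXr; rewrite coprime_sym coprime_num_den.
have : (b %| 1)%Z by rewrite -(Gauss_dvdzr _ cop) mulr1.
rewrite dvdz1 /b => /eqP b1; exists a; rewrite Er /b.
by rewrite (_ : denq r = 1) ?divr1 //; have := denq_gt0 r; lia.
Qed.

Section NumberFieldIntegers.
Variable K : fieldExtType rat.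

(** If l is the leading coefficient of an integral polynomial of degree m killing x, then l^(m-1)
    times that polynomial is a monic integral polynomial in l x. *)
Lemma algint_multiple (x : K) : exists2 n : nat, (0 < n)%N & algint (n%:R * x).
Proof.
have [c [[j cj] Ec]] := @int_relation K _ (fun i : 'I_(\dim {:K}).+1 => x ^+ i) (ltnSn _).
pose c' i := if insub i is Some j then c j else 0.
have c'E (i : 'I_(\dim {:K}).+1) : c' i = c i by rewrite /c' valK.
pose p : {poly int} := \poly_(i < (\dim {:K}).+1) c' i.
have p0 : p != 0.
  apply/eqP => /polyP /(_ j); rewrite coef_poly ltn_ord c'E coef0; move/eqP; by rewrite (negPf cj).
have px : (map_poly intr p).[x] = 0.
  rewrite (horner_coef_wide (n := (\dim {:K}).+1)); last first.
    by rewrite (leq_trans (size_poly _ _)) // size_poly.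
  by rewrite -[RHS]Ec; apply: eq_bigr => i _; rewrite coef_map coef_poly ltn_ord c'E.
pose l := lead_coef p; have l0 : l != 0 by rewrite lead_coef_eq0.
pose m := (size p).-1.
have Em : size p = m.+1 by rewrite /m prednK // lt0n size_poly_eq0.
have mpos : (0 < m)%N.
  rewrite lt0n; apply/eqP => m0.
  have Ep : p = l%:P by rewrite /l lead_coefE Em m0 /=; apply: size1_polyC; rewrite Em m0.
  by move: px; rewrite Ep map_polyC hornerC /= => /eqP; rewrite (negPf (intr_neq0 _ l0)).
have al : algint (l%:~R * x).
  pose q : {poly int} := \poly_(i < m.+1) (if i == m then 1 else p`_i * l ^+ (m.-1 - i)).
  exists q; split.
    by rewrite monicE lead_coef_poly ?eqxx // oner_eq0.
  apply/rootP; rewrite (horner_coef_wide (n := m.+1)); last first.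
    by rewrite (leq_trans (size_poly _ _)) // size_poly.
  transitivity (l%:~R ^+ m.-1 * (map_poly intr p).[x] : K); last by rewrite px mulr0.
  rewrite horner_coef size_map_inj_poly ?rmorph0 //; last exact: intr_inj_K.
  rewrite Em mulr_sumr; apply: eq_bigr => i _; rewrite !coef_map coef_poly ltn_ord /= exprMn.
  have [->|im] := eqVneq (i : nat) m.
    have -> : p`_m = l by rewrite /l lead_coefE.
    by rewrite mul1r mulrA -exprSr prednK.
  rewrite rmorphM rmorphXn /=.
  have -> : (m.-1 = (m.-1 - i) + i)%N by have := ltn_ord i; move/eqP: im; lia.
  by rewrite addnK exprD [RHS]mulrACA; congr (_ * _); exact: mulrC.
exists (absz l); first by rewrite absz_gt0.
case: l l0 al => l l0 al //=; rewrite NegzE mulrNz mulNr in al.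
by have := algintN al; rewrite opprK.
Qed.

End NumberFieldIntegers.
End AlgebraicIntegers.

Section Embeddings.
Variable K : fieldExtType rat.
Local Notation d := (\dim (fullv : {vspace K})).

Lemma integral_generator : exists2 th : K, algint th & (<<1; th>> = fullv)%VS.
Proof.
pose th0 := separable_generator 1 (fullv : {vspace K}).
have E0 : (<<1; th0>> = fullv)%VS.
  rewrite -eq_adjoin_separable_generator ?sub1v //.
  by apply/separableP=> u _; apply: pcharf0_separable; apply: (ftrans (pchar_lalg K) (pchar_num _)).
have [n n0 an] := algint_multiple th0.
exists (n%:R * th0) => //; apply/eqP; rewrite eqEsubv subvf /= -E0.
apply/FadjoinP; split; first exact: sub1v.
have nz : (n%:R : K) != 0 by exact: natr_neq0.
rewrite -[X in X \in _](mulKf nz); apply: rpredM; last exact: memv_adjoin.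
by rewrite rpredV rpredMn // rpred1.
Qed.

Definition gen : K := s2val (cid2 integral_generator).

Lemma algint_gen : algint gen. Proof. exact: s2valP (cid2 integral_generator). Qed.
Lemma gen_full : (<<1; gen>> = fullv)%VS. Proof. exact: s2valP' (cid2 integral_generator). Qed.

Local Notation up := (map_poly (in_alg K)).

Lemma gen_minpoly : exists f : {poly rat}, [/\ f \is monic, size f = d.+1, separable_poly f,
  root (up f) gen & forall q, root (up q) gen -> f %| q].
Proof.
have /polyOver1P [f Ef] := minPolyOver 1%AS gen.
exists f; split.
- by rewrite -(map_monic (in_alg K)) -Ef monic_minPoly.
- by rewrite -(size_map_poly (in_alg K)) -Ef size_minPoly adjoin_degreeE gen_full dimv1 divn1.
- rewrite -(separable_map (in_alg K)) -Ef; apply: pcharf0_separable.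
  exact: (ftrans (pchar_lalg K) (pchar_num _)).
- by rewrite -Ef root_minPoly.
- move=> q rq; rewrite -(dvdp_map (in_alg K)) -Ef; apply: minPoly_dvdp => //.
  by apply/polyOver1P; exists q.
Qed.

Lemma gen_poly_exists (x : K) : exists q : {poly rat}, (size q <= d)%N /\ x = (up q).[gen].
Proof.
have xin : x \in (<<1; gen>>)%VS by rewrite gen_full memvf.
have /polyOver1P [q Eq] := Fadjoin_polyOver 1 gen x.
exists q; rewrite -(size_map_poly (in_alg K)) -Eq Fadjoin_poly_eq //; split=> //.
by rewrite (leq_trans (size_Fadjoin_poly _ _ _)) // adjoin_degreeE gen_full dimv1 divn1.
Qed.

Definition gpoly (x : K) : {poly rat} := projT1 (cid (gen_poly_exists x)).

Lemma size_gpoly x : (size (gpoly x) <= d)%N.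
Proof. by rewrite /gpoly; case: cid => q [/=]. Qed.
Lemma gpolyE x : (up (gpoly x)).[gen] = x.
Proof. by rewrite /gpoly; case: cid => q [/=]. Qed.

Lemma gpoly_unique (q : {poly rat}) : (size q <= d)%N -> gpoly (up q).[gen] = q.
Proof.
move=> sq; have [f [mf sf _ _ fmin]] := gen_minpoly.
apply/eqP; rewrite -subr_eq0; apply: contraTT (leqnn d) => nz.
have : f %| gpoly (up q).[gen] - q.
  by apply: fmin; rewrite /root rmorphB hornerD hornerN gpolyE subrr.
move=> /(dvdp_leq nz); rewrite sf => /leq_trans/(_ (size_polyD _ _)).
by rewrite size_polyN -ltnNge => h; rewrite (leq_trans h) // geq_max size_gpoly.
Qed.

Section IntoClosedField.
Variable C : numClosedFieldType.

(** The embeddings send [gen] to the d distinct roots of its minimal polynomial. Evaluating the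
    representing polynomial at a root is multiplicative because the choice of representative does
    not matter: two of them differ by a multiple of the minimal polynomial. *)
Lemma embeddings : exists s : 'I_d -> {rmorphism K -> C},
  injective (fun i => s i gen) /\ forall t : {rmorphism K -> C}, exists i, t =1 s i.
Proof.
have [f [mf sf sepf rf fmin]] := gen_minpoly.
pose rp : {poly rat} -> {poly C} := map_poly ratr.
have [r Er] := closed_field_poly_normal (rp f).
have lf : lead_coef (rp f) = 1 by apply/monicP; rewrite map_monic.
have ur : uniq r.
  rewrite -separable_prod_XsubC -(scale1r (\prod_(z <- r) _)) -lf -Er.
  by rewrite separable_map.
have szr : size r = d.
  apply/succn_inj; rewrite -sf -(size_map_poly (ratr : {rmorphism rat -> C})) -/rp Er lf scale1r.
  by rewrite size_prod_XsubC.
have rr z : z \in r -> root (rp f) z.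
  by move=> zr; rewrite Er lf scale1r root_prod_XsubC.
have H (z : C) : z \in r -> exists s : {rmorphism K -> C}, s gen = z.
  move=> zr; pose s x := (rp (gpoly x)).[z].
  have sE q x : (up q).[gen] = x -> s x = (rp q).[z].
    move=> E; have /fmin : root (up (gpoly x - q)) gen.
      by rewrite /root rmorphB hornerD hornerN gpolyE E subrr.
    move=> /dvdpP [g Eg]; apply/eqP; rewrite -subr_eq0 /s -hornerN -hornerD -rmorphB Eg.
    by rewrite /rp rmorphM hornerM (rootP (rr _ zr)) mulr0.
  have sB : zmod_morphism s.
    move=> x y; rewrite (sE (gpoly x - gpoly y)); first by rewrite /rp rmorphB hornerD hornerN.
    by rewrite rmorphB hornerD hornerN !gpolyE.
  have sM : monoid_morphism s.
    split; first by rewrite (sE 1) ?/rp ?rmorph1 ?hornerC.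
    move=> x y; rewrite (sE (gpoly x * gpoly y)); first by rewrite /rp rmorphM hornerM.
    by rewrite rmorphM hornerM !gpolyE.
  pose fA := GRing.isZmodMorphism.Build _ _ _ sB.
  pose fM := GRing.isMonoidMorphism.Build _ _ _ sM.
  pose S : {rmorphism _ -> _} := HB.pack s fA fM.
  exists S; rewrite /= (sE 'X) ?/rp ?map_polyX ?hornerX //.
have gz (i : 'I_d) : exists s : {rmorphism K -> C}, s gen = nth 0 r i.
  by apply: H; rewrite mem_nth // szr.
pose s i := projT1 (cid (gz i)).
have sP i : s i gen = nth 0 r i by rewrite /s; case: cid.
exists s; split.
  move=> i j /=; rewrite !sP => /eqP; rewrite nth_uniq ?szr // => /eqP; exact: val_inj.
move=> t; have tr : t gen \in r.
  rewrite -root_prod_XsubC -(scale1r (\prod_(z <- r) _)) -lf -Er.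
  have -> : rp f = map_poly t (up f).
    rewrite -map_poly_comp; apply: eq_map_poly => x.
    by rewrite -[RHS]/((t \o in_alg K) x) [RHS]fmorph_eq_rat.
  exact: rmorph_root.
have tlt : (index (t gen) r < d)%N by rewrite -szr index_mem.
exists (Ordinal tlt) => x.
have E : t gen = s (Ordinal tlt) gen by rewrite sP /= nth_index.
move: (s (Ordinal tlt)) E => s0 E.
rewrite -(gpolyE x) -!horner_map E -!map_poly_comp; congr (_.[_]).
apply: eq_map_poly => y.
by rewrite -[LHS]/((t \o in_alg K) y) -[RHS]/((s0 \o in_alg K) y) !fmorph_eq_rat.
Qed.

Definition emb : 'I_d -> {rmorphism K -> C} := projT1 (cid embeddings).

Lemma emb_inj : injective (fun i => emb i gen).
Proof. by rewrite /emb; case: cid => s [/=]. Qed.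

Lemma emb_all (t : {rmorphism K -> C}) : exists i, t =1 emb i.
Proof. by rewrite /emb; case: cid => s [/=]. Qed.

Definition coords (x : K) : 'rV[rat]_d := \row_j (gpoly x)`_j.

Lemma coordsE x : x = \sum_j (coords x 0 j)%:A * gen ^+ j.
Proof.
rewrite -{1}(gpolyE x) (horner_coef_wide (n := d)) ?size_map_poly ?size_gpoly //.
by apply: eq_bigr => j _; rewrite coef_map mxE.
Qed.

Lemma coords_unique (c : 'I_d -> rat) j : coords (\sum_i (c i)%:A * gen ^+ i) 0 j = c j.
Proof.
pose c' k := if insub k is Some i then c i else 0.
have c'E (i : 'I_d) : c' i = c i by rewrite /c' valK.
rewrite mxE -c'E; pose q := \poly_(i < d) c' i.
have -> : \sum_i (c i)%:A * gen ^+ i = (up q).[gen].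
  rewrite (horner_coef_wide (n := d)) ?size_map_poly ?size_poly //.
  by apply: eq_bigr => i _; rewrite coef_map coef_poly ltn_ord c'E.
by rewrite gpoly_unique ?size_poly // coef_poly ltn_ord.
Qed.

Lemma emb_coords i x : emb i x = \sum_j ratr (coords x 0 j) * emb i gen ^+ j.
Proof.
rewrite {1}(coordsE x) rmorph_sum; apply: eq_bigr => j _.
by rewrite rmorphM rmorphXn /= -[emb i _]/((emb i \o in_alg K) _) fmorph_eq_rat.
Qed.

Definition mulmat (x : K) : 'M[rat]_d := \matrix_(j, k) coords (x * gen ^+ j) 0 k.
Definition vmat : 'M[C]_d := Vandermonde d (\row_i emb i gen).

Lemma det_vmat : \det vmat != 0.
Proof.
rewrite det_Vandermonde; apply/prodf_neq0 => i _; apply/prodf_neq0 => j ij.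
by rewrite !mxE subr_eq0; apply/eqP => /emb_inj E; rewrite E ltnn in ij.
Qed.

(** The Vandermonde matrix of the conjugates of [gen] diagonalizes multiplication by x. Norm and
    trace, defined over Q, thereby become the product and the sum over the embeddings. *)
Lemma mulmat_vmat x : map_mx ratr (mulmat x) *m vmat = vmat *m diag_mx (\row_i emb i x).
Proof.
apply/matrixP => j i; rewrite mul_mx_diag !mxE.
transitivity (emb i (x * gen ^+ j)); last by rewrite rmorphM rmorphXn mulrC.
by rewrite emb_coords; apply: eq_bigr => k _; rewrite !mxE.
Qed.

Definition Nm (x : K) : rat := \det (mulmat x).

Lemma NmE x : ratr (Nm x) = \prod_i emb i x :> C.
Proof.
have := congr1 determinant (mulmat_vmat x); rewrite !det_mulmx det_map_mx mulrC => /(mulfI det_vmat) ->.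
by rewrite det_diag; apply: eq_bigr => i _; rewrite mxE.
Qed.

Lemma trE x : ratr (\tr (mulmat x)) = \sum_i emb i x :> C.
Proof.
have vu : vmat \in unitmx by rewrite unitmxE unitfE det_vmat.
rewrite -trace_map_mx -[map_mx _ _](mulmxK vu) mulmat_vmat -mulmxA mxtrace_mulC mulmxKV //.
by rewrite mxtrace_diag; apply: eq_bigr => i _; rewrite mxE.
Qed.

(** D is the discriminant det(V)^2 of the powers of [gen], an integer because it is rational and
    integral. By Cramer's rule det(V)^2 times a coordinate of an algebraic integer is integral, and
    it is rational too. *)
Lemma index_exists : exists2 D : int, D != 0 &
  forall x : K, algint x -> forall j, exists z : int, D%:~R * coords x 0 j = z%:~R.
Proof.
pose T : 'M[rat]_d := \matrix_(j, k) \tr (mulmat (gen ^+ j * gen ^+ k)).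
have ET : map_mx ratr T = vmat *m vmat^T :> 'M[C]_d.
  apply/matrixP => j k; rewrite !mxE trE; apply: eq_bigr => i _.
  by rewrite !mxE rmorphM !rmorphXn.
have EdT : ratr (\det T) = \det vmat ^+ 2 :> C by rewrite -det_map_mx ET det_mulmx det_tr.
have agen i : algint (emb i gen) by apply: algint_rmorph; exact: algint_gen.
have aV : algint (\det vmat) by apply: algint_det => i j; rewrite !mxE; exact: algintX.
have [D ED] : exists z : int, \det T = z%:~R.
  apply: algint_rat; apply: (@algint_rmorph_inj _ _ (ratr : {rmorphism rat -> C})).
  by rewrite /= EdT; exact: algintX.
have D0 : D != 0.
  by rewrite -(intr_eq0 rat) -ED -(fmorph_eq0 (ratr : {rmorphism rat -> C})) /= EdT expf_neq0 // det_vmat.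
exists D => // x ax j; apply: algint_rat.
apply: (@algint_rmorph_inj _ _ (ratr : {rmorphism rat -> C})); rewrite /= rmorphM /= -ED EdT.
pose c := map_mx ratr (coords x) : 'rV[C]_d.
have Es : c *m vmat = \row_i emb i x.
  by apply/matrixP => i0 i; rewrite !mxE emb_coords; apply: eq_bigr => k _; rewrite !mxE.
have Ec : \det vmat *: c = (\row_i emb i x) *m \adj vmat.
  by rewrite -Es -mulmxA mul_mx_adj mul_mx_scalar.
have -> : ratr (coords x 0 j) = c 0 j by rewrite /c [RHS]mxE.
have -> : \det vmat ^+ 2 * c 0 j = \det vmat * (\det vmat *: c) 0 j by rewrite [in RHS]mxE mulrA.
rewrite Ec mxE; apply: algintM => //; apply: algint_sum => i _; rewrite !mxE.
apply: algintM; first exact: algint_rmorph.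
apply: algintM; first by apply: algintX; apply: algintN; exact: (algint_int _ 1).
by apply: algint_det => k l; rewrite !mxE; exact: algintX.
Qed.

End IntoClosedField.
End Embeddings.

(** * Norms and finite places *)

Section Pigeonhole.

Lemma pigeonhole_seq (T U : eqType) (f : T -> U) (X : seq T) (Y : seq U) :
  uniq X -> (forall x, x \in X -> f x \in Y) -> (size Y < size X)%N ->
  exists x y, [/\ x \in X, y \in X, x != y & f x = f y].
Proof.
move=> uX fX lt; apply: contrapT => H.
suff : (size X <= size Y)%N by rewrite leqNgt lt.
rewrite -(size_map f); apply: uniq_leq_size; last by move=> _ /mapP [x /fX h ->].
rewrite map_inj_in_uniq // => x y xX yX E; apply: contrapT => /eqP xy.
by apply: H; exists x, y.
Qed.

(** The row lattice of B has index |det B| in Z^n. Smith normal form makes the count explicit: after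
    unimodular changes of basis a class is a tuple of residues modulo the diagonal entries, whose
    product is det B up to sign. *)
Lemma lattice_pigeonhole (T : eqType) n (B : 'M[int]_n) (X : seq T) (v : T -> 'rV[int]_n) :
  uniq X -> \det B != 0 -> (absz (\det B) < size X)%N ->
  exists x y, [/\ x \in X, y \in X, x != y & exists z, v x - v y = z *m B].
Proof.
move=> uX dB lt.
have [L uL [Q uQ [e _ EB]]] := int_Smith_normal_form B.
pose Dg : 'M[int]_n := diag_mx (\row_i e`_i).
have EB' : B = L *m Dg *m Q.
  rewrite EB; congr (_ *m _ *m _); apply/matrixP => i j; rewrite !mxE.
  by rewrite (_ : (i == j :> nat) = (i == j)).
have unit1 (A : 'M[int]_n) : A \in unitmx -> absz (\det A) = 1%N.
  by rewrite unitmxE => /mulrV /(congr1 absz); rewrite abszM => /eqP; rewrite muln_eq1 => /andP[/eqP].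
pose c i : int := e`_i.
have EdB : absz (\det B) = (\prod_(i < n) absz (c i))%N.
  rewrite EB' !det_mulmx !abszM (unit1 _ uL) (unit1 _ uQ) mul1n muln1 det_diag.
  by rewrite (big_morph absz abszM (erefl : absz 1 = 1%N)); apply: eq_bigr => i _; rewrite mxE.
have e0 (i : 'I_n) : c i != 0.
  have : (0 < absz (\det B))%N by rewrite absz_gt0.
  rewrite EdB lt0n; apply: contraNneq => ei.
  by rewrite (bigD1 i) //= ei mul0n.
pose M := (\sum_(i < n) absz (c i))%N.
have eM (i : 'I_n) : (absz (c i) <= M)%N by rewrite /M (bigD1 i) //= leq_addr.
pose u x := v x *m invmx Q.
pose w x i : int := u x 0 i.
have modlt x (i : 'I_n) : (absz (w x i %% c i)%Z < absz (c i))%N.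
  by have := modz_ge0 (w x i) (e0 i); have := ltz_mod (w x i) (e0 i); lia.
have modM x (i : 'I_n) : (absz (w x i %% c i)%Z < M)%N by apply: leq_trans (eM i).
pose f x : {ffun 'I_n -> 'I_M} := [ffun i => Ordinal (modM x i)].
pose F (i : 'I_n) : pred 'I_M := [pred k : 'I_M | (k < absz (c i))%N].
have [||x [y [xX yX xy Efxy]]] := @pigeonhole_seq _ _ f X (enum (family F)) uX.
- by move=> x _; rewrite mem_enum; apply/familyP => i; rewrite ffunE /F inE /=; exact: modlt.
- rewrite -cardE card_family foldrE big_map big_enum /=.
  rewrite (eq_bigr (fun i : 'I_n => absz (c i))) -?EdB // => i _.
  by rewrite -sum1_card (eq_bigl (fun k : 'I_M => (k < absz (c i))%N)) // -(big_ord_widen M (fun=> 1%N)) // sum1_card card_ord.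
exists x, y; split=> //.
pose dw i : int := (u x - u y) 0 i.
have dwE i : dw i = w x i - w y i by rewrite /dw [LHS]mxE [(- u y) 0 i]mxE.
have dv i : (c i %| dw i)%Z.
  have : f x i = f y i by rewrite Efxy.
  rewrite !ffunE => /(congr1 val) /= E.
  have {}E : (w x i %% c i)%Z = (w y i %% c i)%Z.
    have := modz_ge0 (w x i) (e0 i); have := modz_ge0 (w y i) (e0 i); lia.
  by rewrite dwE -eqz_mod_dvd; apply/eqP.
pose z' := \row_i ((dw i) %/ c i)%Z.
have Ez : u x - u y = z' *m Dg.
  apply/matrixP => i0 i; rewrite mul_mx_diag [i0]ord1 [in RHS]mxE [z' 0 i]mxE [(\row_i0 c i0) 0 i]mxE divzK //.
exists (z' *m invmx L); rewrite EB' !mulmxA mulmxKV // -Ez /u -mulmxBl mulmxKV //.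
Qed.

End Pigeonhole.

Lemma int_ge0_nat (z : int) : 0 <= z -> exists v : nat, z = v%:Z.
Proof. by move=> z0; exists (absz z); lia. Qed.

Section CompareGrowth.
Variable R : realType.

(** The passage to the limit in n: an estimate that holds for all large n up to an additive constant
    loses the constant. It serves the counting arguments below and again the final comparison with
    V. *)
Lemma le_of_linear_bound (a b c : R) (n0 : nat) :
  (forall n : nat, (n0 <= n)%N -> n%:R * a <= c + n%:R * b) -> a <= b.
Proof.
move=> H; rewrite leNgt; apply/negP => ab.
have ab0 : 0 < a - b by rewrite subr_gt0.
pose n := (n0 + (Num.truncn (`|c| / (a - b))%R).+1)%N.
have := H n (leq_addr _ _).
have h1 : `|c| / (a - b) < n%:R.
  apply: (lt_le_trans (truncnS_gt _)); rewrite ler_nat leq_addl //.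
rewrite ltr_pdivrMr // mulrBr in h1.
by have := ler_norm c; lra.
Qed.

End CompareGrowth.

Section NormProperties.
Variables (C : numClosedFieldType) (K : fieldExtType rat).
Local Notation d := (\dim (fullv : {vspace K})).
Local Notation rat_inj := (fmorph_inj (ratr : {rmorphism rat -> C})).

Lemma NmM (x y : K) : Nm (x * y) = Nm x * Nm y.
Proof.
apply: rat_inj; rewrite /= rmorphM /= !NmE -big_split /=.
by apply: eq_bigr => i _; rewrite rmorphM.
Qed.

Lemma NmX (x : K) n : Nm (x ^+ n) = Nm x ^+ n.
Proof.
apply: rat_inj; rewrite /= rmorphXn /= !NmE -prodrXl.
by apply: eq_bigr => i _; rewrite rmorphXn.
Qed.

Lemma Nm_nat n : Nm (n%:R : K) = n%:R ^+ d.
Proof.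
apply: rat_inj; rewrite /= rmorphXn /= NmE (eq_bigr (fun _ => n%:R)).
  by rewrite prodr_const card_ord rmorph_nat.
by move=> i _; rewrite rmorph_nat.
Qed.

Lemma Nm_neq0 (x : K) : x != 0 -> Nm x != 0.
Proof.
move=> x0; rewrite -(fmorph_eq0 (ratr : {rmorphism rat -> C})) /= NmE.
by apply/prodf_neq0 => i _; rewrite fmorph_eq0.
Qed.

(** In the basis of powers of [gen], the elements D y^n gen^j span a lattice of determinant D^d
    Nm(y)^n. Among more algebraic integers than that, two satisfy D (x - x') in this lattice, so x -
    x' lies in y^n Z[gen]. The factor D is needed because Z[gen] need not contain all algebraic
    integers of K. *)
Lemma counting_bound : exists2 D : int, D != 0 & 
 (forall x : K, algint x -> forall j, exists z : int, D%:~R * coords x 0 j = z%:~R) /\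
  forall (y : K) n (X : seq K), y != 0 -> algint y -> uniq X -> (forall x, x \in X -> algint x) ->
  (forall x x', x \in X -> x' \in X -> (exists2 t, algint t & x - x' = y ^+ n * t) -> x = x') ->
  (size X)%:R <= (absz D ^ d)%:R * `|Nm y| ^+ n :> rat.
Proof.
have [D D0 HD] := index_exists K C; exists D => //; split=> // y n X y0 ay uX aX incX.
have vH x : exists v : 'rV[int]_d, algint x -> forall j, D%:~R * coords x 0 j = (v 0 j)%:~R.
  have [ax|nax] := pselect (algint x); last by exists 0.
  exists (\row_j projT1 (cid (HD x ax j))) => _ j; rewrite [in RHS]mxE; exact: projT2 (cid (HD x ax j)).
pose v x := projT1 (cid (vH x)).
have vP x : algint x -> forall j, D%:~R * coords x 0 j = (v x 0 j)%:~R by rewrite /v; case: cid.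
have vS x : algint x -> D%:~R * x = \sum_j (v x 0 j)%:~R * gen K ^+ j.
  move=> ax; rewrite {1}(coordsE x) mulr_sumr; apply: eq_bigr => j _.
  rewrite mulrA -(rmorph_int (in_alg K)) -[RHS]/((v x 0 j)%:~R * _) -(rmorph_int (in_alg K) (v x 0 j)) -(vP x ax).
  by rewrite rmorphM.
have ag j : algint (y ^+ n * gen K ^+ j).
  by apply: algintM; apply: algintX => //; exact: algint_gen.
pose B : 'M[int]_d := \matrix_(j, k) v (y ^+ n * gen K ^+ j) 0 k.
have EB : (\det B)%:~R = D%:~R ^+ d * Nm y ^+ n :> rat.
  rewrite -NmX /Nm -detZ -det_map_mx; congr (\det _); apply/matrixP => j k.
  by rewrite [LHS]mxE [B j k]mxE [RHS]mxE [mulmat _ j k]mxE /= -vP.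
have dB0 : \det B != 0.
  by rewrite -(intr_eq0 rat) EB mulf_neq0 ?expf_neq0 ?intr_eq0 // Nm_neq0.
have EaB : (absz (\det B))%:R = (absz D ^ d)%:R * `|Nm y| ^+ n :> rat.
  by rewrite natr_absz intr_norm EB normrM !normrX natrX natr_absz intr_norm.
rewrite -EaB ler_nat leqNgt; apply/negP => lt.
have [x [x' [xX x'X xx' [z Ez]]]] := lattice_pigeonhole v uX dB0 lt.
move/eqP: xx'; apply; apply: incX => //.
exists (\sum_j (z 0 j)%:~R * gen K ^+ j).
  apply: algint_sum => j _; apply: algintM; first exact: algint_int.
  by apply: algintX; exact: algint_gen.
have DK : (D%:~R : K) != 0 by exact: intr_neq0.
apply: (mulfI DK); rewrite mulrBr (vS x (aX _ xX)) (vS x' (aX _ x'X)) -sumrB.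
transitivity (\sum_k \sum_j (z 0 j)%:~R * (B j k)%:~R * gen K ^+ k).
  apply: eq_bigr => k _; rewrite -mulrBl -rmorphB -mulr_suml; congr (_ * _).
  have -> : v x 0 k - v x' 0 k = (z *m B) 0 k by rewrite -Ez !mxE.
  by rewrite mxE rmorph_sum; apply: eq_bigr => j _; rewrite rmorphM.
rewrite exchange_big /= mulr_sumr mulr_sumr; apply: eq_bigr => j _.
transitivity ((z 0 j)%:~R * (D%:~R * (y ^+ n * gen K ^+ j))); last by rewrite !mulrA [_%:~R * _%:~R]mulrC; ring.
rewrite vS // mulr_sumr; apply: eq_bigr => k _; by rewrite mulrA mxE.
Qed.

End NormProperties.

Section PlacesAndNorm.
Variables (R : realType) (K : fieldExtType rat).
Local Notation d := (\dim (fullv : {vspace K})).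
Implicit Types (w : K -> R) (S : seq (K -> R)).

(** The converse direction is where Chevalley's theorem enters: a non-integral element is large at
    some finite place. *)
Lemma algint_placesP (x : K) : algint x <-> forall w : K -> R, place_fin w -> w x <= 1.
Proof.
split=> [ax w pw|H]; first exact: fin_algint.
apply: contrapT => /(@place_not_algint R) [w pw]; rewrite ltNge => /negP; apply; exact: H.
Qed.

(** Take the least positive t with t x integral. A prime p dividing both t and m could be removed
    from t: above p the element x is already integral, and elsewhere p is a unit. *)
Lemma integral_lift m S (x : K) : (0 < m)%N ->
  (forall w, place_fin w -> w m%:R < 1 -> w \in S) -> (forall w, w \in S -> w x <= 1) ->
  exists2 t : nat, coprime t m & (0 < t)%N /\ algint (t%:R * x).
Proof.
move=> m0 HS xS; have [M M0 aM] := algint_multiple x.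
pose P t := `[< (0 < t)%N /\ algint (t%:R * x) >].
have exP : exists t, P t by exists M; apply/asboolP.
case: (ex_minnP exP) => t /asboolP [t0 at_] tmin; exists t => //.
rewrite /coprime eqn_leq gcdn_gt0 t0 orTb andbT leqNgt; apply/negP => g1.
pose p := pdiv (gcdn t m); have pp : prime p by exact: pdiv_prime.
have pt : (p %| t)%N by apply: dvdn_trans (pdiv_dvd _) (dvdn_gcdl _ _).
have pm : (p %| m)%N by apply: dvdn_trans (pdiv_dvd _) (dvdn_gcdr _ _).
have : P (t %/ p)%N.
  apply/asboolP; split; first by rewrite divn_gt0 ?prime_gt0 // dvdn_leq.
  apply/algint_placesP => w pw; have [wp|wp] := ltP (w p%:R) 1.
    rewrite finM // mulr_ile1 ?fin_ge0 ?fin_nat_le1 //; apply: xS; apply: HS => //.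
    by rewrite (fin_nat_lt1 pw _ pp wp).
  have wp1 : w p%:R = 1 by apply: le_anti; rewrite fin_nat_le1.
  have -> : w ((t %/ p)%:R * x) = w (t%:R * x).
    by rewrite -[LHS]mul1r -wp1 -finM // mulrA -natrM mulnC divnK.
  by move/algint_placesP: at_; apply.
by move=> /tmin; rewrite leqNgt ltn_Pdiv // prime_gt1.
Qed.

Lemma sum_subseq_le (T : eqType) (s s' : seq T) (f : T -> R) : uniq s -> uniq s' ->
  {subset s <= s'} -> (forall x, x \in s' -> 0 <= f x) -> \sum_(x <- s) f x <= \sum_(x <- s') f x.
Proof.
move=> us us' ss' f0.
have -> : \sum_(x <- s) f x = \sum_(x <- s' | x \in s) f x.
  rewrite -[RHS]big_filter; apply: perm_big; apply: uniq_perm => //; first exact: filter_uniq.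
  by move=> x; rewrite mem_filter; apply/idP/andP => [xs|[]//]; split=> //; exact: ss'.
rewrite big_mkcond big_seq [leRHS]big_seq; apply: ler_sum => x xs.
by case: ifP => // _; exact: f0.
Qed.

(** Modulo y^n there are prod_w q_w^(n ord_w y) residues at the places of S'. Multiplied by an
    integer T that is a unit at these places they become algebraic integers, still incongruent
    modulo y^n, so their number is at most a constant times |Nm y|^n; then n grows. S is enlarged to
    all places above the primes below S, as [integral_lift] requires. *)
Lemma norm_bound (y : K) S : y != 0 -> algint y -> uniq S -> (forall w, w \in S -> place_fin w) ->
  \sum_(w <- S) (ordv w y)%:~R * ln (resq w)%:R <= ln (ratr `|Nm y|) :> R.
Proof.
move=> y0 ay uS pS.
have Hp w : exists p, place_fin w -> prime p /\ w p%:R < 1.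
  have [pw|] := pselect (place_fin w); last by exists 0%N.
  by have [p pp wp] := fin_above pw; exists p.
pose p w := projT1 (cid (Hp w)).
have pP w : place_fin w -> prime (p w) /\ w (p w)%:R < 1 by rewrite /p; case: cid.
pose m := (\prod_(w <- S) p w)%N.
have m0 : (0 < m)%N.
  by rewrite /m big_seq prodn_cond_gt0 // => w /pS /pP [/prime_gt0].
have [S' [uS' S'P]] := places_dividing R K m0.
have pS' w : w \in S' -> place_fin w by move=> /S'P [].
have SS' : {subset S <= S'}.
  move=> w wS; apply/S'P; have pw := pS _ wS; split=> //.
  have [pp wp] := pP _ pw; rewrite (fin_nat_lt1 pw _ pp wp) /m (big_rem w) //=.
  exact: dvdn_mulr.
have o0 w : place_fin w -> 0 <= ordv w y by move=> pw; rewrite ordv_ge0 // fin_algint.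
apply: (le_trans (sum_subseq_le uS uS' SS' _)).
  move=> w /pS' pw; rewrite mulr_ge0 ?ler0z ?o0 //; exact/ltW/ln_resq_gt0.
have [D D0 [_ HD]] := counting_bound R[i] K.
have Ny : 0 < `|Nm y| by rewrite normr_gt0 (Nm_neq0 R[i]).
have NyR : 0 < ratr `|Nm y| :> R by rewrite ltr0q.
apply: (@le_of_linear_bound R _ _ (ln ((absz D ^ d)%:R)) 0) => n _.
pose k w := (n * absz (ordv w y))%N.
have [X [uX sX OX incX _]] := residues_exist uS' pS' k.
have Ht x : exists t : nat, x \in X -> [/\ coprime t m, (0 < t)%N & algint (t%:R * x)].
  have [xX|_] := boolP (x \in X); last by exists 0%N.
  have [||t ct [t0 at_]] := @integral_lift m S' x m0; last by exists t.
    by move=> w pw wm; apply/S'P.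
  exact: OX.
pose t x := projT1 (cid (Ht x)).
have tP x : x \in X -> [/\ coprime (t x) m, (0 < t x)%N & algint ((t x)%:R * x)].
  by rewrite /t; case: cid.
pose T := (\prod_(x <- X) t x)%N.
have T0 : (T%:R : K) != 0.
  by apply: natr_neq0; rewrite /T big_seq prodn_cond_gt0 // => x /tP [].
have cT : coprime T m.
  rewrite /T big_seq; apply: (big_ind (fun z => coprime z m)); first exact: coprime1n.
    by move=> a b ca cb; rewrite coprimeMl ca cb.
  by move=> x /tP [].
have wT w : w \in S' -> w T%:R = 1.
  move=> /S'P [pw wm]; apply: le_anti; rewrite fin_nat_le1 //= leNgt; apply/negP => wT.
  have [q qp wq] := fin_above pw.
  rewrite (fin_nat_lt1 pw _ qp wq) in wT; rewrite (fin_nat_lt1 pw _ qp wq) in wm.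
  by have := dvdn_gcd q T m; rewrite wT wm (eqP cT) dvdn1 => /eqP q1; rewrite q1 in qp.
have injT : injective (fun x : K => T%:R * x) by exact: mulfI.
have : (size X)%:R <= (absz D ^ d)%:R * `|Nm y| ^+ n :> rat.
  rewrite -(size_map (fun x => T%:R * x)); apply: HD => //; first by rewrite map_inj_uniq.
- move=> _ /mapP [x xX ->]; rewrite /T (big_rem x) //= mulnC natrM -mulrA.
  by apply: algintM; [exact: (algint_int _ (Posz _)) | case: (tP _ xX)].
- move=> _ _ /mapP [x xX ->] /mapP [x' x'X ->] [s as_ E]; congr (_ * _).
  apply: incX => // w wS'; have pw := pS' _ wS'.
  rewrite -[w _]mul1r -(wT _ wS') -finM // mulrBr E finM // finX // ordvE // /k.
  have [v Eo] := int_ge0_nat (o0 _ pw).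
  rewrite Eo -exprnP -exprM mulnC ler_piMr ?exprn_ge0 ?(ltW (piw_gt0 w)) //.
  exact: fin_algint.
rewrite -(ler_rat R) [ratr (_ * _)]rmorphM /= !ratr_nat [ratr (_ ^+ _)]rmorphXn /= => le1.
have X0 : 0 < (size X)%:R :> R.
  rewrite ltr0n sX big_seq prodn_cond_gt0 // => w /pS' pw.
  by rewrite expn_gt0 (ltnW (resq_gt1 pw)).
have Dd : 0 < ((absz D ^ d)%:R : R) by rewrite ltr0n expn_gt0 absz_gt0 D0.
rewrite -ler_ln ?posrE ?mulr_gt0 ?exprn_gt0 // lnM ?posrE ?exprn_gt0 // lnXn // in le1.
move: le1; rewrite !mulr_natl; apply: le_trans; rewrite sX natr_prod.
have : (forall w, w \in S' -> 0 < (resq w ^ k w)%:R :> R).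
  by move=> w /pS' pw; rewrite ltr0n expn_gt0 (ltnW (resq_gt1 pw)).
rewrite -sumrMnl.
elim: (S') pS' => [|w s IH] psf pos; first by rewrite !big_nil ln1.
have pw : place_fin w by apply: psf; exact: mem_head.
have q0 : 0 < (resq w)%:R :> R by rewrite ltr0n ltnW ?resq_gt1.
rewrite !big_cons lnM ?posrE; last 2 first.
- by apply: pos; exact: mem_head.
- by rewrite big_seq prodr_gt0 // => w' w's; apply: pos; rewrite inE w's orbT.
apply: lerD; last by apply: IH => w' w's; [apply: psf | apply: pos]; rewrite inE w's orbT.
rewrite natrX lnXn // /k; have [v Eo] := int_ge0_nat (o0 _ pw).
by rewrite Eo /= mulnC mulrnA -[X in _ <= X *+ _]mulr_natl lexx.
Qed.

(** The reverse count. Combinations of the powers of [gen] with coefficients below p^(N-a) are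
    pairwise incongruent modulo p^N: since S contains all places above p, a congruent pair would
    give an algebraic integer after division by p^N, so D times a coefficient difference would be a
    multiple of p^N, although |D| <= p^a makes it too small. *)
Lemma prime_places_bound p S : prime p -> uniq S ->
  (forall w, w \in S <-> place_fin w /\ w p%:R < 1) ->
  d%:R * ln p%:R <= \sum_(w <- S) (ordv w p%:R)%:~R * ln (resq w)%:R :> R.
Proof.
move=> pp uS SP.
have pS w : w \in S -> place_fin w by move=> /SP [].
have [D D0 [HD _]] := counting_bound R[i] K.
have p0 : (p%:R : K) != 0 by apply: natr_neq0; exact: prime_gt0.
have o0 w : place_fin w -> 0 <= ordv w p%:R by move=> pw; rewrite ordv_ge0 // fin_nat_le1.
have lp : 0 < ln p%:R :> R by rewrite ln_gt0 // ltr1n prime_gt1.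
pose a := absz D.
have Da : (absz D <= p ^ a)%N by rewrite -/a ltnW // ltn_expl // prime_gt1.
apply: (@le_of_linear_bound R _ _ (a%:R * (d%:R * ln p%:R)) a) => N aN.
pose k w := (N * absz (ordv w p%:R))%N.
have [X [uX sX OX _ covX]] := residues_exist uS pS k.
pose e (f : {ffun 'I_d -> 'I_(p ^ (N - a))}) : K := \sum_j ((f j : nat)%:R : rat)%:A * gen K ^+ j.
have ae f : algint (e f).
  apply: algint_sum => j _; apply: algintM; last by apply: algintX; exact: algint_gen.
  by rewrite -in_algE rmorph_nat; exact: (algint_int _ (Posz _)).
have Hc f : exists y, y \in X /\ deep S k (e f - y).
  by have [|y yX Hy] := covX (e f); [move=> w /pS pw; exact: fin_algint | exists y].
pose c f := projT1 (cid (Hc f)).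
have cP f : c f \in X /\ deep S k (e f - c f) by rewrite /c; case: cid.
have cinj : (#|{: {ffun 'I_d -> 'I_(p ^ (N - a))}}| <= size X)%N.
  rewrite leqNgt cardE; apply/negP => lt.
  have [||f [g [_ _ fg Efg]]] := @pigeonhole_seq _ _ c (enum {: {ffun 'I_d -> 'I_(p ^ (N - a))}}) X _ _ lt.
  - exact: enum_uniq.
  - by move=> f _; case: (cP f).
  have ai : algint ((e f - e g) / p%:R ^+ N).
    apply/algint_placesP => w pw; have [wp|wp] := ltP (w p%:R) 1; last first.
      have wp1 : w p%:R = 1 by apply: le_anti; rewrite fin_nat_le1.
      rewrite finM // finV // finX // wp1 expr1n invr1 mulr1.
      by apply: fin_algint => //; apply: algintD => //; exact: algintN.
    have wS : w \in S by apply/SP.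
    have : w (e f - e g) <= piw w ^+ k w.
      rewrite (_ : e f - e g = (e f - c f) - (e g - c g)); last by rewrite Efg; ring.
      by apply: fin_le_sub => //; [case: (cP f) | case: (cP g)] => _; apply.
    rewrite finM // finV // finX // ler_pdivrMr ?exprn_gt0 ?fin_gt0 // mul1r.
    have [v Eo] := int_ge0_nat (o0 _ pw).
    by rewrite (ordvE pw p0) /k Eo -exprnP -exprM mulnC.
  move/eqP: fg; apply; apply/ffunP => j; apply: val_inj => /=.
  have [z Ez] := HD _ ai j.
  have Ec : coords ((e f - e g) / p%:R ^+ N) 0 j = ((f j : nat)%:R - (g j : nat)%:R) / p%:R ^+ N.
    rewrite -(coords_unique (fun j => ((f j : nat)%:R - (g j : nat)%:R) / p%:R ^+ N) j).
    congr (coords _ 0 j); rewrite /e -sumrB mulr_suml; apply: eq_bigr => i _.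
    by rewrite -mulrBl -!in_algE -rmorphB mulrAC -(rmorph_nat (in_alg K) p) -rmorphXn -fmorphV -rmorphM.
  have pN : (p%:R ^+ N : rat) != 0 by rewrite expf_neq0 // pnatr_eq0 -lt0n prime_gt0.
  have Ei : D * ((f j : nat)%:Z - (g j : nat)%:Z) = z * p%:Z ^+ N.
    apply: (@intr_inj rat); rewrite !rmorphM rmorphB rmorphXn /= -Ez Ec mulrA mulfVK //.
  have bf := ltn_ord (f j); have bg := ltn_ord (g j).
  have [z0|z0] := eqVneq z 0.
    by move/eqP: Ei; rewrite z0 mul0r mulf_eq0 (negPf D0) /= subr_eq0 => /eqP [].
  exfalso; have := congr1 absz Ei; rewrite !abszM abszX /= => E.
  have h1 : (absz ((f j : nat)%:Z - (g j : nat)%:Z)%R < p ^ (N - a))%N by lia.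
  have h2 : (p ^ N <= absz z * p ^ N)%N by rewrite leq_pmull // absz_gt0.
  have : (absz D * absz ((f j : nat)%:Z - (g j : nat)%:Z)%R < p ^ N)%N.
    rewrite -[in X in (_ < X)%N](subnKC aN) expnD.
    apply: (@leq_ltn_trans (p ^ a * absz ((f j : nat)%:Z - (g j : nat)%:Z)%R)); first by rewrite leq_mul2r Da orbT.
    by rewrite ltn_pmul2l // expn_gt0 prime_gt0.
  by rewrite E ltnNge h2.
move: cinj; rewrite card_ffun !card_ord -expnM sX -(ler_nat R) natrX natr_prod => le1.
have q0 w : place_fin w -> 0 < (resq w)%:R :> R by move=> pw; rewrite ltr0n ltnW ?resq_gt1.
have pR : 0 < p%:R :> R by rewrite ltr0n prime_gt0.
have prod0 : 0 < \prod_(w <- S) (resq w ^ k w)%:R :> R.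
  by rewrite big_seq prodr_gt0 // => w /pS pw; rewrite natrX exprn_gt0 // q0.
rewrite -ler_ln ?posrE ?exprn_gt0 // lnXn // in le1.
have E : ln (\prod_(w <- S) (resq w ^ k w)%:R) = N%:R * \sum_(w <- S) (ordv w p%:R)%:~R * ln (resq w)%:R :> R.
  elim: (S) pS => [|w s IH] psf; first by rewrite !big_nil ln1 mulr0.
  have pw : place_fin w by apply: psf; exact: mem_head.
  have psf' w' : w' \in s -> place_fin w' by move=> w's; apply: psf; rewrite inE w's orbT.
  rewrite !big_cons lnM ?posrE; last 2 first.
  - by rewrite natrX exprn_gt0 // q0.
  - by rewrite big_seq prodr_gt0 // => w' /psf' pw'; rewrite natrX exprn_gt0 // q0.
  rewrite IH // mulrDr; congr (_ + _); rewrite natrX lnXn ?q0 // /k.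
  have [v Eo] := int_ge0_nat (o0 _ pw).
  by rewrite Eo /= -[LHS]mulr_natl natrM -mulrA.
rewrite -E -lerBlDl; apply: le_trans le1.
rewrite -[X in _ <= X]mulr_natl natrM natrB //.
by rewrite le_eqVlt; apply/orP; left; apply/eqP; ring.
Qed.

Lemma ln_placeE w x : place_fin w -> x != 0 -> (ordv w x)%:~R * ln (resq w)%:R = - (d%:R * ln (w x)).
Proof.
move=> pw x0; rewrite ln_fin //; field.
by rewrite pnatr_eq0 -lt0n dim_gt0.
Qed.

Lemma ln_nat_place_le M S : (0 < M)%N -> uniq S -> (forall w, w \in S -> place_fin w) ->
  \sum_(w <- S) - ln (w M%:R) <= ln M%:R.
Proof.
move=> M0 uS pS; have MK : (M%:R : K) != 0 by exact: natr_neq0.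
have := @norm_bound M%:R S MK (algint_int _ (Posz M)) uS pS.
rewrite (Nm_nat R[i]) normrX normr_nat rmorphXn /= ratr_nat lnXn ?ltr0n // => h.
rewrite -(@ler_pM2l _ d%:R) ?ltr0n ?dim_gt0 // mulr_sumr mulr_natl.
apply: le_trans h; rewrite big_seq [leRHS]big_seq; apply: ler_sum => w /pS pw.
by rewrite ln_placeE // mulrN.
Qed.

Lemma ln_nat_place_ge M S : (0 < M)%N -> uniq S -> (forall w, w \in S -> place_fin w) ->
  (forall w, place_fin w -> w M%:R < 1 -> w \in S) ->
  ln M%:R <= \sum_(w <- S) - ln (w M%:R).
Proof.
elim/ltn_ind: M => M IH M0 uS pS HS; have [M1|M1] := leqP M 1.
  have -> : M = 1%N by lia.
  rewrite ln1 big_seq big1 // => w /pS pw; by rewrite fin1 // ln1 oppr0.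
have pp := pdiv_prime M1; have /dvdnP [q Eq] := pdiv_dvd M.
have q0 : (0 < q)%N by move: M0; rewrite {1}Eq muln_gt0 => /andP[].
have qM : (q < M)%N by rewrite [in X in (_ < X)%N]Eq ltn_Pmulr // prime_gt1.
set p := pdiv M in pp Eq.
have p0 := prime_gt0 pp.
have qK : (q%:R : K) != 0 by exact: natr_neq0.
have pK : (p%:R : K) != 0 by exact: natr_neq0.
have H1 w : place_fin w -> w p%:R < 1 -> w \in S.
  by move=> pw wp; apply: HS => //; rewrite (fin_nat_lt1 pw _ pp wp) Eq dvdn_mull.
have H2 w : place_fin w -> w q%:R < 1 -> w \in S.
  move=> pw wq; apply: HS => //; rewrite Eq natrM finM //.
  by rewrite (le_lt_trans _ wq) // ler_piMr ?fin_ge0 ?fin_nat_le1.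
rewrite Eq natrM lnM ?posrE ?ltr0n // (eq_big_seq (fun w => - ln (w q%:R) + - ln (w p%:R))); last first.
  by move=> w /pS pw; rewrite natrM finM // lnM ?posrE ?fin_gt0 // opprD.
rewrite big_split /=; apply: lerD; first exact: IH.
have [S' [uS' S'P]] := places_above_prime R K pp.
have := prime_places_bound pp uS' S'P.
rewrite -(@ler_pM2l _ d%:R) ?ltr0n ?dim_gt0 // => h; apply: (le_trans h).
rewrite mulr_sumr; apply: (le_trans (_ : _ <= \sum_(w <- S') d%:R * - ln (w p%:R))).
  by rewrite big_seq [leRHS]big_seq; apply: ler_sum => w /S'P [pw _]; rewrite ln_placeE // mulrN.
apply: sum_subseq_le => //.
  by move=> w /S'P [pw wp]; exact: H1.
move=> w /pS pw; rewrite mulr_ge0 ?ler0n // oppr_ge0 ln_le0 //; exact: fin_nat_le1.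
Qed.

(** Write x = y / M with y integral: the upper bound for y and the lower bound for the rational
    integer M combine as soon as S contains every place dividing M. *)
Lemma product_formula_fin (x : K) : x != 0 -> exists2 M : nat, (0 < M)%N &
  forall S, uniq S -> (forall w, w \in S -> place_fin w) ->
  (forall w, place_fin w -> w M%:R < 1 -> w \in S) ->
  - ln (ratr `|Nm x|) / d%:R <= \sum_(w <- S) ln (w x) :> R.
Proof.
move=> x0; have [M M0 aM] := algint_multiple x; exists M => // S uS pS HS.
have MK : (M%:R : K) != 0 by exact: natr_neq0.
have y0 : M%:R * x != 0 by rewrite mulf_neq0.
have h1 := norm_bound y0 aM uS pS.
have h2 := ln_nat_place_ge M0 uS pS HS.
have d0 : 0 < d%:R :> R by rewrite ltr0n dim_gt0.
rewrite ler_pdivrMr // mulrC.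
have Nx : 0 < ratr `|Nm x| :> R by rewrite ltr0q normr_gt0 (Nm_neq0 R[i]).
have E : \sum_(w <- S) (ordv w (M%:R * x))%:~R * ln (resq w)%:R =
   - (d%:R * \sum_(w <- S) ln (w x)) + d%:R * \sum_(w <- S) - ln (w M%:R).
  rewrite !mulr_sumr -sumrN -big_split /=; apply: eq_big_seq => w /pS pw.
  by rewrite ln_placeE // finM // lnM ?posrE ?fin_gt0 //; ring.
rewrite E (NmM R[i]) (Nm_nat R[i]) normrM normrX normr_nat rmorphM rmorphXn /= ratr_nat in h1.
rewrite lnM ?posrE ?exprn_gt0 ?ltr0n // lnXn ?ltr0n // in h1.
have : d%:R * ln M%:R <= d%:R * \sum_(w <- S) - ln (w M%:R) by rewrite ler_pM2l.
move: h1; rewrite -mulr_natl => h1 h3.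
by lra.
Qed.

End PlacesAndNorm.

(** * Archimedean places and the product formula *)

Lemma ln_prod (R : realType) (I : eqType) (r : seq I) (f : I -> R) :
  (forall i, i \in r -> 0 < f i) -> ln (\prod_(i <- r) f i) = \sum_(i <- r) ln (f i).
Proof.
elim: r => [|i r IH] f0; first by rewrite !big_nil ln1.
have f0r j : j \in r -> 0 < f j by move=> jr; apply: f0; rewrite inE jr orbT.
rewrite !big_cons lnM ?posrE; last 2 first.
- by apply: f0; exact: mem_head.
- by rewrite big_seq prodr_gt0.
by rewrite IH.
Qed.

Section ComplexModulus.
Variable R : realType.
Local Notation nc := (@ComplexField.Normc.normc R).
Implicit Types z : R[i].

Lemma ncE z : nc z = Num.sqrt (complex.Re z ^+ 2 + complex.Im z ^+ 2).
Proof. by case: z. Qed.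

Lemma absval_nc : absval nc.
Proof.
split.
- exact: ComplexField.Normc.normc0.
- move=> z z0; rewrite lt_neqAle ncE sqrtr_ge0 andbT eq_sym -ncE.
  by apply: contraNneq z0 => /ComplexField.Normc.eq0_normc ->.
- exact: ComplexField.Normc.normcM.
- move=> x y; have := le_normcD x y; exact.
Qed.

Lemma nc_real (r : R) : nc (real_complex R r) = `|r|.
Proof. by rewrite ncE /= expr0n addr0 sqrtr_sqr. Qed.

Lemma nc_rat (q : rat) : nc (ratr q) = `|ratr q|.
Proof. by rewrite -nc_real fmorph_rat. Qed.

Lemma nc_nat n : nc n%:R = n%:R.
Proof. by rewrite -[n%:R in LHS](rmorph_nat (real_complex R)) nc_real normr_nat. Qed.

(** The moduli of z and z + 1 determine the real part of z, and then its imaginary part up to sign.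
    Equality of two archimedean absolute values can thus be tested at [gen] and gen + 1. *)
Lemma nc_eq_conj z1 z2 : nc z1 = nc z2 -> nc (z1 + 1) = nc (z2 + 1) ->
  z2 = z1 \/ z2 = conjc z1.
Proof.
case: z1 => a b; case: z2 => c e.
have sq (x y x' y' : R) : nc (x +i* y)%C = nc (x' +i* y')%C -> x ^+ 2 + y ^+ 2 = x' ^+ 2 + y' ^+ 2.
  rewrite !ncE /= => /(congr1 (fun t => t ^+ 2)).
  by rewrite !sqr_sqrtr ?addr_ge0 ?sqr_ge0.
move=> /sq h1; rewrite /GRing.add /= => /sq h2.
have Ea : a = c by rewrite !addr0 in h2; nra.
have /eqP : b ^+ 2 = e ^+ 2 by rewrite Ea in h1; lra.
rewrite eqf_sqr => /orP[/eqP ->|/eqP ->]; rewrite Ea; first by left.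
by right; rewrite /= opprK.
Qed.

End ComplexModulus.

Section ArchimedeanPlaces.
Variables (R : realType) (K : fieldExtType rat).
Local Notation d := (\dim (fullv : {vspace K})).
Local Notation nc := (@ComplexField.Normc.normc R).
Local Notation sg := (@emb K R[i]).
Implicit Types (w : K -> R) (i j : 'I_d).

Definition arch_abs i (x : K) : R := nc (sg i x).
Definition arch_deg i : nat := if `[< forall x, complex.Im (sg i x) = 0 >] then 1 else 2.
Definition arch_place i (x : K) : R := arch_abs i x `^ ((arch_deg i)%:R / d%:R).

Lemma conj_exists i : exists j, forall x, sg j x = conjc (sg i x).
Proof.
have [j Ej] := emb_all (conjc \o sg i : {rmorphism K -> R[i]}).
by exists j => x; rewrite -Ej.
Qed.

Definition conj_index i := projT1 (cid (conj_exists i)).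

Lemma conj_indexE i x : sg (conj_index i) x = conjc (sg i x).
Proof. by rewrite /conj_index; case: cid => j /=. Qed.

Lemma nc_conj (z : R[i]) : nc (conjc z) = nc z.
Proof. by case: z => a b; rewrite !ncE /= sqrrN. Qed.

Lemma arch_abs_eq i j : arch_abs i = arch_abs j <-> (j == i) || (j == conj_index i).
Proof.
split=> [E|/orP[/eqP ->//|/eqP ->]]; last first.
  by apply/funext => x; rewrite /arch_abs conj_indexE nc_conj.
have h x : nc (sg i x) = nc (sg j x) by exact: (congr1 (fun f => f x) E).
have [||H|H] := @nc_eq_conj R (sg i (gen K)) (sg j (gen K)).
- exact: h.
- by have := h (gen K + 1); rewrite !rmorphD !rmorph1.
- by apply/orP; left; apply/eqP; apply: (@emb_inj K R[i]).
- by apply/orP; right; apply/eqP; apply: (@emb_inj K R[i]); rewrite /= conj_indexE.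
Qed.

Lemma arch_deg_conj i : arch_deg i = if conj_index i == i then 1%N else 2%N.
Proof.
rewrite /arch_deg; case: asboolP => [H|H]; case: eqP => // E.
- exfalso; apply: E; apply: (@emb_inj K R[i]); rewrite /= conj_indexE.
  by have := H (gen K); case: (sg i (gen K)) => a b /= ->; rewrite oppr0.
- exfalso; apply: H => x; have := conj_indexE i x; rewrite E.
  by case: (sg i x) => a b /= [] h; lra.
Qed.

Lemma arch_deg_abs i j : arch_abs i = arch_abs j -> arch_deg i = arch_deg j.
Proof.
move=> /arch_abs_eq /orP[/eqP ->//|/eqP ->].
rewrite /arch_deg; congr (if _ then _ else _); apply/asboolP/asboolP => H x.
  by have := H x; rewrite conj_indexE; case: (sg i x) => a b /= ->; rewrite oppr0.
by have := H x; rewrite conj_indexE; case: (sg i x) => a b /= /eqP; rewrite oppr_eq0 => /eqP.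
Qed.

Lemma arch_abs_nat i n : arch_abs i n%:R = n%:R.
Proof. by rewrite /arch_abs rmorph_nat nc_nat. Qed.

Lemma absval_arch_abs i : absval (arch_abs i).
Proof.
have [h0 h1 h2 h3] := absval_nc R; split; rewrite /arch_abs.
- by rewrite rmorph0 h0.
- by move=> x x0; apply: h1; rewrite fmorph_eq0.
- by move=> x y; rewrite rmorphM h2.
- by move=> x y; rewrite rmorphD h3.
Qed.

Lemma arch_deg_gt0 i : (0 < arch_deg i)%N.
Proof. by rewrite /arch_deg; case: ifP. Qed.

Lemma dimK_gt0 : 0 < d%:R :> R. Proof. by rewrite ltr0n dim_gt0. Qed.

(** The exponent of a place is recovered from its value at 2, so the place determines the
    unnormalized absolute value. *)
Lemma arch_place_eq i j : arch_place i = arch_place j <-> arch_abs i = arch_abs j.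
Proof.
split=> [E|E]; last by apply/funext => x; rewrite /arch_place E (arch_deg_abs E).
have Ed : arch_deg i = arch_deg j.
  have := congr1 (fun f => ln (f 2%:R)) E; rewrite /arch_place /= !arch_abs_nat !ln_powR.
  have l2 : ln (2%:R : R) != 0 by rewrite gt_eqF // ln_gt0 // ltr1n.
  move=> /(mulIf l2) /mulIf H; apply/eqP; rewrite -(eqr_nat R); apply/eqP; apply: H.
  by rewrite invr_neq0 // gt_eqF // dimK_gt0.
apply/funext => x; have := congr1 (fun f => f x) E; rewrite /arch_place /= Ed => H.
have ge0 k : 0 <= arch_abs k x by apply: absval_ge0; exact: absval_arch_abs.
have r0 : 0 < (arch_deg j)%:R / d%:R :> R by rewrite divr_gt0 ?dimK_gt0 // ltr0n arch_deg_gt0.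
by apply: (inc_inj_in (le_mono_in (gt0_ltr_powR r0))) => //; rewrite nnegrE.
Qed.

Lemma place_infP w : place_inf w <-> exists i, w = arch_place i.
Proof.
split=> [[s [n [Hn Hw]]]|[i ->]].
  have [i Ei] := emb_all s; exists i; apply/funext => x.
  have En : arch_deg i = n.
    rewrite /arch_deg; case: asboolP => H; case: Hn => -[-> Him] //.
      by case: Him => y; rewrite Ei H eqxx.
    by exfalso; apply: H => y; rewrite -Ei.
  by rewrite Hw /arch_place /arch_abs Ei En.
exists (sg i), (arch_deg i); split=> //; rewrite /arch_deg.
case: asboolP => H; [by left | right; split=> //].
by apply: contrapT => H'; apply: H => x; apply: contrapT => /eqP h; apply: H'; exists x.
Qed.

Definition Sinf : seq (K -> R) := undup [seq arch_place i | i : 'I_d].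

Lemma uniq_Sinf : uniq Sinf. Proof. exact: undup_uniq. Qed.

Lemma mem_Sinf w : w \in Sinf <-> place_inf w.
Proof.
rewrite mem_undup place_infP; split=> [/mapP [i _ ->]|[i ->]]; first by exists i.
by apply: map_f; rewrite mem_enum.
Qed.

Lemma arch_index_exists w : exists i, place_inf w -> w = arch_place i.
Proof.
have [/place_infP [i ->]|H] := pselect (place_inf w); first by exists i.
by exists (Ordinal (dim_gt0 K)).
Qed.

Definition arch_index w : 'I_d := projT1 (cid (arch_index_exists w)).

Lemma arch_indexE w : place_inf w -> w = arch_place (arch_index w).
Proof. by rewrite /arch_index; case: cid. Qed.

(** A place of local degree 2 comes from exactly two conjugate embeddings, a place of local degree 1
    from a single one. *)
Lemma sum_over_arch_places (G : (K -> R) -> R) :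
  \sum_(w <- Sinf) (arch_deg (arch_index w))%:R * G (arch_abs (arch_index w)) =
  \sum_i G (arch_abs i).
Proof.
transitivity (\sum_i \sum_(w <- Sinf | w == arch_place i) G (arch_abs i)); last first.
  apply: eq_bigr => i _; rewrite -big_filter (_ : [seq w <- Sinf | w == arch_place i] = [:: arch_place i]) ?big_seq1 //.
  apply: (perm_small_eq (s2 := [:: _])) => //.
  apply: uniq_perm => //; first by rewrite filter_uniq // uniq_Sinf.
  move=> w; rewrite mem_filter inE; case: eqP => // ->.
  by apply/mem_Sinf/place_infP; exists i.
rewrite (exchange_big_dep xpredT) //=; apply: eq_big_seq => w /mem_Sinf pw.
set i0 := arch_index w; have Ew : w = arch_place i0 by exact: arch_indexE.
rewrite (eq_bigl (fun i => i \in [set i0; conj_index i0])); last first.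
  move=> i; rewrite !inE Ew; apply/eqP/idP => [/arch_place_eq/arch_abs_eq //|].
  by move=> /arch_abs_eq/arch_place_eq.
rewrite (eq_bigr (fun _ => G (arch_abs i0))); last first.
  move=> i; rewrite !inE => /arch_abs_eq -> //.
rewrite sumr_const mulr_natl cards2 arch_deg_conj eq_sym.
by case: eqP.
Qed.

Lemma ln_arch_place w x : place_inf w ->
  ln (w x) = (arch_deg (arch_index w))%:R / d%:R * ln (arch_abs (arch_index w) x).
Proof. by move=> pw; rewrite {1}(arch_indexE pw) /arch_place ln_powR. Qed.

Lemma ln_norm_arch x : x != 0 -> \sum_(w <- Sinf) ln (w x) = ln (ratr `|Nm x|) / d%:R :> R.
Proof.
move=> x0.
have -> : ratr `|Nm x| = \prod_i arch_abs i x :> R.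
  rewrite -(@absval_prod _ _ _ (absval_nc R)) -NmE nc_rat.
  by rewrite ratr_norm.
have pos i : 0 < arch_abs i x by apply: absval_gt0 => //; exact: absval_arch_abs.
have -> : ln (\prod_i arch_abs i x) = \sum_i ln (arch_abs i x).
  by rewrite ln_prod // => i _.
rewrite -(sum_over_arch_places (fun f => ln (f x))) mulr_suml.
by apply: eq_big_seq => w /mem_Sinf pw; rewrite ln_arch_place // mulrAC.
Qed.

Lemma arch_weights : \sum_(w <- Sinf) (arch_deg (arch_index w))%:R / d%:R = 1 :> R.
Proof.
rewrite -mulr_suml; have := sum_over_arch_places (fun _ => 1).
rewrite sumr_const card_ord (eq_bigr (fun w => (arch_deg (arch_index w))%:R)) => [->|w _]; last by rewrite mulr1.
by rewrite mulfV // gt_eqF // dimK_gt0.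
Qed.

Lemma product_formula (x : K) : x != 0 -> exists2 M : nat, (0 < M)%N &
  forall S : seq (K -> R), uniq S -> (forall w, w \in S -> place_fin w) ->
  (forall w, place_fin w -> w M%:R < 1 -> w \in S) ->
  0 <= \sum_(w <- Sinf) ln (w x) + \sum_(w <- S) ln (w x).
Proof.
move=> x0; have [M M0 HM] := product_formula_fin R x0; exists M => // S uS pS HS.
by rewrite ln_norm_arch //; have := HM S uS pS HS; rewrite mulNr; lra.
Qed.

Lemma place_inf_not_fin w : place_inf w -> place_fin w -> False.
Proof.
move=> /place_infP [i ->] pw; have := fin_nat_le1 pw 2.
rewrite /arch_place arch_abs_nat leNgt => /negP; apply.
rewrite /powR gt_eqF ?ltr0n // expR_gt1 mulr_gt0 ?ln_gt0 ?ltr1n //.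
by rewrite divr_gt0 ?dimK_gt0 // ltr0n arch_deg_gt0.
Qed.

Lemma bigmax_ge1 w (g : seq K) : 1 <= \big[Num.max/1]_(x <- g) w x.
Proof. by elim: g => [|x g IH]; rewrite ?big_nil // big_cons le_max IH orbT. Qed.

Lemma bigmax_ge w (g : seq K) x : x \in g -> w x <= \big[Num.max/1]_(y <- g) w y.
Proof.
elim: g => // y g IH; rewrite inE big_cons le_max => /orP[/eqP ->|/IH ->]; first by rewrite lexx.
by rewrite orbT.
Qed.

Lemma bigmax_le w (g : seq K) c : 1 <= c -> (forall x, x \in g -> w x <= c) ->
  \big[Num.max/1]_(y <- g) w y <= c.
Proof.
move=> c1; elim: g => [|y g IH] H; first by rewrite big_nil.
rewrite big_cons ge_max H ?mem_head //=; apply: IH => x xg; apply: H; by rewrite inE xg orbT.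
Qed.

Lemma hv_ge0 w g : 0 <= hv w g.
Proof. by rewrite /hv ln_ge0 // bigmax_ge1. Qed.

(** [height] is [fine] of a supremum of finite sums, and [fine] sends infinity to 0, so finiteness
    must be shown first. A common denominator M of g gives h_v(g) <= -log |M|_v at each finite v;
    hence all finite sums are at most the archimedean part plus log M. *)
Lemma height_ge (g : seq K) (S : seq (K -> R)) : uniq S -> (forall w, w \in S -> place_fin w) ->
  \sum_(w <- Sinf) hv w g + \sum_(w <- S) hv w g <= height R g.
Proof.
move=> uS pS.
have [M M0 aM] : exists2 M : nat, (0 < M)%N & forall x, x \in g -> algint (M%:R * x).
  elim: g => [|x g [M M0 IH]]; first by exists 1%N.
  have [n n0 an] := algint_multiple x; exists (M * n)%N; first by rewrite muln_gt0 M0.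
  move=> y; rewrite inE => /orP[/eqP ->|/IH h]; rewrite natrM.
    by rewrite -mulrA; apply: algintM => //; exact: (algint_int _ (Posz M)).
  by rewrite mulrAC mulrC; apply: algintM => //; exact: (algint_int _ (Posz n)).
have MK : (M%:R : K) != 0 by exact: natr_neq0.
have hfin w : place_fin w -> hv w g <= - ln (w M%:R).
  move=> pw; have wM : 0 < w M%:R by rewrite fin_gt0.
  rewrite /hv -lnV ?posrE // ler_ln ?posrE ?invr_gt0 ?(lt_le_trans ltr01 (bigmax_ge1 _ _)) //.
  apply: bigmax_le => [|x xg]; first by rewrite invf_ge1 // fin_nat_le1.
  rewrite -[_^-1]mul1r ler_pdivlMr // mulrC -finM //; apply: fin_algint => //; exact: aM.
pose B := \sum_(w <- Sinf) hv w g + ln M%:R.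
have bound (s : seq (K -> R)) : uniq s -> (forall w, w \in s -> places w) ->
    \sum_(w <- s) hv w g <= B.
  move=> us ps; rewrite (bigID (mem Sinf)) /= -[X in X + _]big_filter -[X in _ + X]big_filter.
  apply: lerD.
    apply: sum_subseq_le; [exact: filter_uniq | exact: uniq_Sinf | | by move=> *; exact: hv_ge0].
    by move=> w; rewrite mem_filter => /andP[].
  have pf w : w \in [seq w <- s | w \notin Sinf] -> place_fin w.
    rewrite mem_filter => /andP[/negP nw /ps [|//]] => pw; exfalso; apply: nw; exact/mem_Sinf.
  apply: le_trans (ln_nat_place_le M0 (filter_uniq _ us) pf).
  by rewrite big_seq [leRHS]big_seq; apply: ler_sum => w /pf; exact: hfin.
have fsE (A : set (K -> R)) : finite_set A -> exists2 s : seq (K -> R), uniq s & A = [set` s]%classic.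
  by move=> /finite_seqP [s Es]; exists (undup s); rewrite ?undup_uniq // Es; apply/seteqP; split=> w /=; rewrite mem_undup.
have le_esum_B : (\esum_(w in @places R K) (hv w g)%:E <= B%:E)%E.
  apply: ge_ereal_sup => _ [A [finA sA] <-].
  have [s us Es] := fsE _ finA; rewrite Es -fsbig_seq //= sumEFin lee_fin.
  by apply: bound => // w ws; apply: sA; rewrite Es.
have ge_esum_S : ((\sum_(w <- Sinf ++ S) hv w g)%:E <= \esum_(w in @places R K) (hv w g)%:E)%E.
  have u : uniq (Sinf ++ S).
    rewrite cat_uniq uniq_Sinf uS andbT /=; apply/hasPn => w /pS pw; apply/negP => /mem_Sinf.
    by move=> /place_inf_not_fin /(_ pw).
  apply: esum_ge; exists [set` Sinf ++ S]%classic.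
    split; first exact: finite_seq.
    by move=> w /=; rewrite mem_cat => /orP[/mem_Sinf|/pS]; [left | right].
  by rewrite -fsbig_seq // sumEFin.
rewrite -big_cat /height -lee_fin fineK // ge0_fin_numE.
  by apply: le_lt_trans le_esum_B _; rewrite ltry.
by apply: esum_ge0 => w _; rewrite lee_fin hv_ge0.
Qed.

End ArchimedeanPlaces.

(** * Coefficients of the functions f_j *)

Section Convolution.
Variable R : comNzRingType.
Implicit Types u v w : nat -> R.

(** The convolution [sconv] again, over a commutative ring, since it will also be applied to
    sequences of polynomials. Its laws are inherited from truncations to polynomials. *)
Definition sprod u v : nat -> R := fun n => \sum_(i < n.+1) u i * v (n - i)%N.
Definition sunity : nat -> R := fun n => (n == 0%N)%:R.

Lemma sprod_coef N u v n : (n <= N)%N ->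
  sprod u v n = ((\poly_(i < N.+1) u i) * (\poly_(i < N.+1) v i))`_n.
Proof.
move=> nN; rewrite coefM; apply: eq_bigr => i _; rewrite !coef_poly.
by rewrite !ifT //; have := ltn_ord i; lia.
Qed.

Lemma poly_coef_conv N u v n : (n <= N)%N ->
  (\poly_(i < N.+1) sprod u v i)`_n = ((\poly_(i < N.+1) u i) * (\poly_(i < N.+1) v i))`_n.
Proof. by move=> nN; rewrite coef_poly ltnS nN -sprod_coef. Qed.

Lemma sprodC : commutative sprod.
Proof. by move=> u v; apply/funext => n; rewrite !(sprod_coef _ _ (leqnn n)) mulrC. Qed.

Lemma sprodA : associative sprod.
Proof.
move=> u v w; apply/funext => n.
rewrite !(sprod_coef _ _ (leqnn n)) !coefM.
transitivity (((\poly_(i < n.+1) u i) * ((\poly_(i < n.+1) v i) * (\poly_(i < n.+1) w i)))`_n).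
  by rewrite coefM; apply: eq_bigr => i _; rewrite poly_coef_conv // leq_subr.
rewrite mulrA coefM; apply: eq_bigr => i _; rewrite poly_coef_conv //.
by rewrite -ltnS.
Qed.

Lemma sprod1s : left_id sunity sprod.
Proof.
move=> u; apply/funext => n; rewrite /sprod big_ord_recl /sunity eqxx mul1r subn0 big1 ?addr0 //.
by move=> i _; rewrite lift0 mul0r.
Qed.

HB.instance Definition _ := Monoid.isComLaw.Build (nat -> R) sunity sprod sprodA sprodC sprod1s.

Lemma sprodDl u v w : sprod (u \+ v) w = sprod u w \+ sprod v w.
Proof. by apply/funext => n; rewrite /= -big_split /=; apply: eq_bigr => i _; rewrite mulrDl. Qed.

Lemma sprodDr u v w : sprod u (v \+ w) = sprod u v \+ sprod u w.
Proof. by rewrite sprodC sprodDl ![sprod _ u]sprodC. Qed.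

Lemma sprodZl c u v : sprod (c \*o u) v = c \*o sprod u v.
Proof. by apply/funext => n; rewrite /= mulr_sumr; apply: eq_bigr => i _; rewrite mulrA. Qed.

Lemma sprodZr c u v : sprod u (c \*o v) = c \*o sprod u v.
Proof. by rewrite sprodC sprodZl sprodC. Qed.

Lemma sprodNl u v : sprod (fun n => - u n) v = (fun n => - sprod u v n).
Proof. by apply/funext => n; rewrite /sprod -sumrN; apply: eq_bigr => i _; rewrite mulNr. Qed.

Lemma sprodBr u v w : sprod u (v \- w) = sprod u v \- sprod u w.
Proof. by apply/funext => n; rewrite /= /sprod -sumrB; apply: eq_bigr => i _; rewrite mulrBr. Qed.

Definition euler u : nat -> R := fun n => n%:R * u n.
Definition sderiv u : nat -> R := fun n => n.+1%:R * u n.+1.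

Lemma euler_conv u v : euler (sprod u v) = sprod (euler u) v \+ sprod u (euler v).
Proof.
apply/funext => n; rewrite /euler /sprod /= mulr_sumr -big_split /=; apply: eq_bigr => i _.
have -> : n%:R = i%:R + (n - i)%:R :> R by rewrite -natrD subnKC // -ltnS.
ring.
Qed.

Lemma sderiv_conv u v : sderiv (sprod u v) = sprod (sderiv u) v \+ sprod u (sderiv v).
Proof.
apply/funext => n; have := congr1 (fun f => f n.+1) (euler_conv u v).
rewrite /sderiv {1}/euler /= => ->; congr (_ + _).
  by rewrite /sprod big_ord_recl /euler mul0r mul0r add0r; apply: eq_bigr => i _; rewrite lift0 subSS.
rewrite /sprod big_ord_recr /= subnn /euler mul0r mulr0 addr0; apply: eq_bigr => i _.
by rewrite subSn // -ltnS.
Qed.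

Lemma big_conv_coef (I : finType) (F : I -> nat -> R) n :
  (\big[sprod/sunity]_i F i) n =
  \sum_(k : {ffun I -> 'I_n.+1} | (\sum_i (k i : nat))%N == n) \prod_i F i (k i).
Proof.
have H (r : seq I) N k : (k <= N)%N ->
    (\big[sprod/sunity]_(i <- r) F i) k = (\prod_(i <- r) \poly_(j < N.+1) F i j)`_k.
  elim: r k => [|i r IH] k kN; first by rewrite !big_nil coef1.
  rewrite !big_cons coefM; apply: eq_bigr => j _.
  by rewrite IH ?coef_poly ?ifT //; have := ltn_ord j; lia.
rewrite (H _ n) // (eq_bigr (fun i => \sum_(j < n.+1) F i j *: 'X^j)); last first.
  by move=> i _; rewrite poly_def.
rewrite bigA_distr_bigA /= coef_sum [RHS]big_mkcond /=; apply: eq_bigr => k _.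
rewrite (eq_bigr (fun i => (F i (k i))%:P * 'X^(k i))); last by move=> i _; rewrite mul_polyC.
rewrite big_split /= prodrXr -rmorph_prod coefCM coefXn eq_sym.
by case: eqP; rewrite ?mulr1 ?mulr0.
Qed.

(** As c has no constant term, the equation expresses n u_n through earlier coefficients. Identities
    between binomial series are then proved by comparing logarithmic derivatives. *)
Lemma first_order_unique (c u v : nat -> R) : (forall n, GRing.lreg (n.+1%:R : R)) -> c 0 = 0 ->
  euler u = sprod c u -> euler v = sprod c v -> u 0 = v 0 -> u = v.
Proof.
move=> reg c0 Eu Ev E0; apply/funext => n; elim/ltn_ind: n => -[//|n] IH.
apply: (reg n); have := congr1 (fun f => f n.+1) Eu; have := congr1 (fun f => f n.+1) Ev.
rewrite /euler => -> ->; rewrite /sprod big_ord_recl [in RHS]big_ord_recl c0 !mul0r; congr (_ + _).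
by apply: eq_bigr => i _; rewrite IH // lift0; lia.
Qed.

End Convolution.

Section BinomialSeries.
Variable F : fieldType.
Hypothesis charF : forall n, n.+1%:R != 0 :> F.

Lemma fact_neq0 n : (n`!)%:R != 0 :> F.
Proof.
elim: n => [|n IH]; first by rewrite oner_eq0.
by rewrite factS natrM mulf_neq0.
Qed.

Lemma pochK0 (x : F) : pochK x 0 = 1. Proof. by rewrite /pochK big_ord0. Qed.
Lemma pochKS (x : F) k : pochK x k.+1 = pochK x k * (x + k%:R).
Proof. by rewrite /pochK big_ord_recr. Qed.

Lemma binser0 (s al : F) : binser s al 0 = 1.
Proof. by rewrite /binser pochK0 fact0 divr1 mulr1. Qed.

Lemma binserS (s al : F) k : k.+1%:R * binser s al k.+1 = (k%:R - s) * al * binser s al k.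
Proof.
rewrite /binser pochKS factS natrM exprS; field.
by rewrite fact_neq0 nat1r charF.
Qed.

(** The series (al/z) / (1 - al/z). Since [euler] is -z d/dz, the logarithmic derivative of (1 -
    al/z)^s for it is -s times this series. *)
Definition geomtail (al : F) : nat -> F := fun n => if n is n'.+1 then al ^+ n else 0.

Lemma sprod_geomtailS al u n : sprod (geomtail al) u n.+1 = al * (u n + sprod (geomtail al) u n).
Proof.
rewrite /sprod big_ord_recl mul0r add0r big_ord_recl [in RHS]big_ord_recl mul0r add0r.
rewrite mulrDr mulr_sumr; congr (_ + _).
  by rewrite lift0 /= expr1 subSS subn0.
by apply: eq_bigr => i _; rewrite !lift0 /= subSS exprS mulrA.
Qed.

Lemma euler_binser (s al : F) : euler (binser s al) = sprod ((- s) \*o geomtail al) (binser s al).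
Proof.
rewrite sprodZl; apply/funext => n; elim: n => [|n IH].
  by rewrite /euler mul0r /= /sprod big_ord1 mul0r mulr0.
rewrite /= sprod_geomtailS; move: IH; rewrite /euler /= => IH.
rewrite binserS; set c := sprod _ _ _ in IH *.
have -> : - s * (al * (binser s al n + c)) = al * (- s * binser s al n) + al * (- s * c) by ring.
by rewrite -IH; ring.
Qed.

Lemma binserD (s t al : F) : sprod (binser s al) (binser t al) = binser (s + t) al.
Proof.
apply: (@first_order_unique _ ((- (s + t)) \*o geomtail al)).
- by move=> n; apply/lregP.
- by rewrite /= mulr0.
- rewrite euler_conv !euler_binser [sprod (binser s al) (sprod _ _)]Monoid.mulmCA /=.
  rewrite -sprodA !sprodZl; apply/funext => n /=; ring.
- by rewrite euler_binser.
- by rewrite /sprod big_ord1 !binser0 mulr1.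
Qed.

Lemma binser_s0 (al : F) : binser 0 al = @sunity F.
Proof.
apply/funext => -[|n]; first by rewrite binser0.
by rewrite /binser /pochK big_ord_recl oppr0 addr0 !mul0r.
Qed.

Lemma binser1 (al : F) n : binser 1 al n = if n is n'.+1 then (if n' is 0%N then - al else 0) else 1.
Proof.
case: n => [|[|n]]; first exact: binser0.
  by rewrite /binser /pochK big_ord1 addr0 (_ : 1`! = 1%N) // divr1 mulN1r expr1.
by rewrite /binser /pochK !big_ord_recl lift0 addNr mul0r mulr0 !mul0r.
Qed.

Lemma binserN1 (al : F) n : binser (-1) al n = al ^+ n.
Proof.
rewrite /binser opprK (_ : pochK 1 n = n`!%:R) ?mulfV ?mul1r ?fact_neq0 //.
elim: n => [|n IH]; first by rewrite pochK0.
by rewrite pochKS IH factS natrM nat1r mulrC.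
Qed.

Section ManyVariables.
Variables (m : nat) (al s : 'I_m -> F).

Definition bigbin (e : 'I_m -> F) := \big[@sprod F/@sunity F]_(i < m) binser (e i) (al i).

Lemma bigbinD e e' : sprod (bigbin e) (bigbin e') = bigbin (fun i => e i + e' i).
Proof. by rewrite /bigbin -big_split /=; apply: eq_bigr => i _; rewrite binserD. Qed.

Lemma bigbin_s0 : bigbin (fun=> 0) = @sunity F.
Proof. by rewrite /bigbin big1 // => i _; rewrite binser_s0. Qed.

Lemma eq_bigbin e e' : e =1 e' -> bigbin e = bigbin e'.
Proof. by move=> E; apply: eq_bigr => i _; rewrite E. Qed.

Lemma bigbin0 e : bigbin e 0 = 1.
Proof.
rewrite /bigbin; elim/big_ind: _ => //= [u v u0 v0|i _]; last exact: binser0.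
by rewrite /sprod big_ord1 u0 v0 mulr1.
Qed.

Lemma euler_bigbin e : euler (bigbin e) =
  sprod (fun n => - \sum_i e i * geomtail (al i) n) (bigbin e).
Proof.
rewrite /bigbin.
have H (r : seq 'I_m) : euler (\big[@sprod F/@sunity F]_(i <- r) binser (e i) (al i)) =
  sprod (fun n => - \sum_(i <- r) e i * geomtail (al i) n) (\big[@sprod F/@sunity F]_(i <- r) binser (e i) (al i)).
  elim: r => [|i r IH].
    apply/funext => n; rewrite big_nil /sprod big1.
      by rewrite /euler /sunity; case: n => [|n]; rewrite ?mul0r ?mulr0.
    by move=> j _; rewrite big_nil oppr0 mul0r.
  rewrite !big_cons euler_conv IH euler_binser.
  rewrite [sprod (binser _ _) (sprod _ _)]Monoid.mulmCA /= -sprodA -sprodDl; congr sprod.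
  by apply/funext => n; rewrite big_cons /= opprD mulNr.
exact: H.
Qed.

(** The Pochhammer symbols of A and C depend on the total degree only and factor out of the multiple
    sum; the rest is a coefficient of prod_i (1 - al_i/z)^(-1-s_i). *)
Lemma lauricella_coefE A C n : lauricella_coef A (fun i => 1 + s i) C al n =
  pochK A n / pochK C n * bigbin (fun i => - (1 + s i)) n.
Proof.
rewrite /bigbin big_conv_coef mulr_sumr; apply: eq_bigr => k _.
rewrite /binser !big_split /= prodfV.
rewrite [in RHS](eq_bigr (fun i => pochK (1 + s i) (k i))) => [|i _]; last by rewrite opprK.
by rewrite invfM -!mulrA; congr (_ * _); rewrite [RHS]mulrCA; congr (_ * _); rewrite mulrCA.
Qed.

(** The telescoping (A)_n / (A + 1)_n = A / (A + n), in a multiplied form that allows A = 0. The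
    numbers u + D k in the denominators of the moments come from here. *)
Lemma pochK_ratio (A : F) n : (forall k, (0 < k)%N -> A + k%:R != 0) ->
  (A + n%:R) * (pochK A n / pochK (A + 1) n) = A.
Proof.
move=> HA; elim: n => [|n IH]; first by rewrite !pochK0 addr0 divr1 mulr1.
rewrite !pochKS; have An : A + 1 + n%:R != 0 by rewrite -addrA nat1r HA.
have := HA n.+1 isT; rewrite -nat1r addrA => An1.
have P0 : pochK (A + 1) n != 0.
  by apply/prodf_neq0 => i _; rewrite -addrA nat1r HA.
by rewrite -[RHS]IH; field; rewrite P0.
Qed.

End ManyVariables.

Section RevPoly.

Lemma size_prod_1subX (r : seq F) : (size (\prod_(x <- r) (1 - x *: 'X))%R <= (size r).+1)%N.
Proof.
elim: r => [|x r IH]; first by rewrite big_nil size_poly1.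
rewrite big_cons (leq_trans (size_polyMleq _ _)) //.
have : (size (1 - x *: 'X : {poly F})%R <= 2)%N.
  rewrite (leq_trans (size_polyD _ _)) // geq_max size_poly1 size_polyN.
  by rewrite (leq_trans (size_scale_leq _ _)) // size_polyX.
by move: IH => /=; case: (size (1 - x *: 'X : {poly F})%R) => [|k] /=; lia.
Qed.

Lemma rev_prod_XsubC (r : seq F) k l : (k + l)%N = size r ->
  (\prod_(x <- r) (1 - x *: 'X))`_k = (\prod_(x <- r) ('X - x%:P))`_l.
Proof.
elim: r k l => [|x r IH] k l /=.
  by move/eqP; rewrite addn_eq0 => /andP[/eqP -> /eqP ->]; rewrite !big_nil.
move=> kl; rewrite !big_cons !mulrBl mul1r !coefB -scalerAl coefZ !coefXM coefCM.
case: k kl => [|k] kl.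
  rewrite /= mulr0 subr0; have -> : l = (size r).+1 by lia.
  rewrite /= (IH 0%N (size r)) // [X in _ * X]nth_default ?mulr0 ?subr0 //.
  by rewrite size_prod_XsubC.
case: l kl => [|l] kl /=.
  rewrite sub0r nth_default ?sub0r; last by rewrite (leq_trans (size_prod_1subX _)) //; lia.
  by rewrite (IH k 0%N) //; lia.
by rewrite (IH k.+1 l) ?(IH k l.+1) //; lia.
Qed.

End RevPoly.

Section LinearFunctional.
Variable u : nat -> F.
Implicit Types P Q : {poly F}.

Definition phi P := \sum_(i < size P) P`_i * u i.

Lemma phi_wide n P : (size P <= n)%N -> phi P = \sum_(i < n) P`_i * u i.
Proof.
move=> sP; rewrite /phi (big_ord_widen n (fun i => P`_i * u i)) // big_mkcond.
apply: eq_bigr => i _; case: ltnP => // h; by rewrite nth_default // mul0r.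
Qed.

Lemma phiD P Q : phi (P + Q) = phi P + phi Q.
Proof.
pose n := maxn (size P) (size Q).
rewrite !(@phi_wide n) ?leq_maxl ?leq_maxr ?size_polyD // -big_split /=.
by apply: eq_bigr => i _; rewrite coefD mulrDl.
Qed.

Lemma phiZ c P : phi (c *: P) = c * phi P.
Proof.
rewrite (@phi_wide (size P)) ?size_scale_leq // /phi mulr_sumr.
by apply: eq_bigr => i _; rewrite coefZ mulrA.
Qed.

Lemma phi0 : phi 0 = 0.
Proof. by rewrite /phi size_poly0 big_ord0. Qed.

Lemma phiN P : phi (- P) = - phi P.
Proof. by rewrite -scaleN1r phiZ mulN1r. Qed.

Lemma phiB P Q : phi (P - Q) = phi P - phi Q.
Proof. by rewrite phiD phiN. Qed.

Lemma phi_sum (I : Type) (r : seq I) (p : pred I) (G : I -> {poly F}) :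
  phi (\sum_(i <- r | p i) G i) = \sum_(i <- r | p i) phi (G i).
Proof. exact: (big_morph phi phiD phi0). Qed.

Lemma phiXn k : phi 'X^k = u k.
Proof.
rewrite /phi size_polyXn big_ord_recr /= coefXn eqxx mul1r big1 ?add0r // => i _.
by rewrite coefXn (ltn_eqF (ltn_ord i)) mul0r.
Qed.

End LinearFunctional.

Lemma big_binser1 (r : seq F) :
  \big[@sprod F/@sunity F]_(x <- r) binser 1 x = fun n => (\prod_(x <- r) (1 - x *: 'X))`_n.
Proof.
elim: r => [|x r IH]; first by apply/funext => n; rewrite !big_nil coef1.
rewrite !big_cons IH; apply/funext => n; rewrite coefM; apply: eq_bigr => i _.
congr (_ * _); rewrite binser1 coefB coef1 coefZ coefX.
by case: (i : nat) => [|[|k]] /=; rewrite ?mulr0 ?mulr1 ?subr0 ?sub0r ?oppr0.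
Qed.

(** * The first-order differential equation of f_j *)

Section FcoefEquation.
Variables (m : nat) (al s : 'I_m -> F) (j : nat).
Hypothesis jm : (j.+1 < m)%N.
Let bm := \sum_i s i.
Hypothesis bmj : forall n, bm != - (n.+2)%:R.

Definition apol : {poly F} := \prod_(i < m) ('X - (al i)%:P).
(** The Lagrange form of b, that is b / a = sum_i s_i / (z - al_i). *)
Definition bpol : {poly F} := \sum_(i < m) s i *: \prod_(l < m | l != i) ('X - (al l)%:P).

Lemma size_index_enum_ord : size (index_enum 'I_m) = m.
Proof. by rewrite -sum1_size (eq_bigl (mem 'I_m)) // sum1_card card_ord. Qed.

Lemma card_other (i : 'I_m) : size [seq al l | l <- index_enum 'I_m & l != i] = m.-1.
Proof.
rewrite size_map -sum1_size big_filter sum1_card.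
by have := cardC1 i; rewrite card_ord => <-; apply: eq_card => l; rewrite !inE.
Qed.

Lemma prod_other (G : F -> {poly F}) (i : 'I_m) :
  \prod_(l < m | l != i) G (al l) = \prod_(x <- [seq al l | l <- index_enum 'I_m & l != i]) G x.
Proof. by rewrite big_map big_filter. Qed.

Let A := bm + j.+1%:R.
Let h := sprod (bigbin al s) (lauricella_coef A (fun i => 1 + s i) (bm + j.+2%:R) al).

Lemma fcoefE k : fcoef al s bm j k = if (k < j.+1)%N then 0 else h (k - j.+1)%N.
Proof. by []. Qed.

(** In powers of 1/z: [AS] is a(z) / z^m, [Lsum] is sum_i s_i (al_i/z) / (1 - al_i/z), and [BS]
    below is b(z) / z^(m-1). *)
Let AS := bigbin al (fun=> 1).
Let Lsum n := \sum_i s i * geomtail (al i) n.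

Lemma bm_neq k : (0 < k)%N -> A + k%:R != 0.
Proof.
move=> k0; rewrite /A -addrA -natrD addSn -addnS -(prednK k0) !addnS.
by rewrite addr_eq0 bmj.
Qed.

(** Because the third parameter is A + 1, the telescoping of the Pochhammer symbols gives the
    first-order equation (euler + A) F_D = A prod_i (1 - al_i/z)^(-1-s_i). *)
Lemma euler_lauricella : euler (lauricella_coef A (fun i => 1 + s i) (bm + j.+2%:R) al) =
  A \*o (bigbin al (fun i => - (1 + s i)) \- lauricella_coef A (fun i => 1 + s i) (bm + j.+2%:R) al).
Proof.
apply/funext => n; rewrite /euler /= lauricella_coefE.
have -> : bm + j.+2%:R = A + 1 by rewrite /A -[j.+2]addn1 natrD addrA.
have := pochK_ratio n bm_neq; set r := _ / _; set g := bigbin _ _ _ => E.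
have -> : A * (g - r * g) = (A - A * r) * g by ring.
by rewrite -{1}E; ring.
Qed.

(** With f_j = z^(-j-1) h this is b f_j - a f_j' = A z^(m-2-j), rewritten in powers of 1/z. The two
    binomial products multiply to the inverse of [AS], which the factor [AS] cancels; so the right
    side is constant, and each coefficient with n > 0 is a linear relation between moments. *)
Lemma h_equation n : sprod AS (fun n => (n + j.+1)%:R * h n) n +
   sprod (fun n => bm * AS n + sprod AS Lsum n) h n = A * sunity F n.
Proof.
pose Q := bigbin al (fun=> -1).
have ASQ : sprod AS Q = @sunity F.
  by rewrite bigbinD -[RHS](bigbin_s0 al); apply: eq_bigbin => i; rewrite subrr.
have WH : sprod (bigbin al s) (bigbin al (fun i => - (1 + s i))) = Q.
  by rewrite bigbinD; apply: eq_bigbin => i; ring.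
have -> : (fun n => (n + j.+1)%:R * h n) = ((fun n => - sprod Lsum h n) \+ (A \*o Q)) \- (bm \*o h).
  have Eh : euler h = (fun n => - sprod Lsum h n) \+ (A \*o (Q \- h)).
    by rewrite /h euler_conv euler_bigbin euler_lauricella -sprodA sprodNl sprodZr sprodBr WH.
  apply/funext => k; have := congr1 (fun f => f k) Eh; rewrite natrD mulrDl /euler /= => ->.
  by rewrite /A; ring.
rewrite sprodBr sprodDr !sprodZr ASQ.
have -> : sprod AS (fun n => - sprod Lsum h n) = (fun n => - sprod (sprod AS Lsum) h n).
  by rewrite [sprod AS (fun=> _)]sprodC sprodNl [sprod (sprod Lsum h) AS]sprodC sprodA.
have -> : (fun n => bm * AS n + sprod AS Lsum n) = (bm \*o AS) \+ sprod AS Lsum by [].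
by rewrite sprodDl sprodZl /=; ring.
Qed.

Lemma AS_list : AS = fun n => (\prod_(x <- [seq al i | i <- index_enum 'I_m]) (1 - x *: 'X))`_n.
Proof. by rewrite -big_binser1 big_map. Qed.

Lemma AS_coef k l : (k + l)%N = m -> AS k = apol`_l.
Proof.
move=> kl; rewrite AS_list (rev_prod_XsubC (l := l)) ?size_map ?size_index_enum_ord //.
by rewrite big_map.
Qed.

Lemma AS_coef0 k : (m < k)%N -> AS k = 0.
Proof.
move=> mk; rewrite AS_list nth_default // (leq_trans (size_prod_1subX _)) //.
by rewrite size_map size_index_enum_ord.
Qed.

Let BS n := bm * AS n + sprod AS Lsum n.

Lemma BS_list n : BS n = \sum_(i < m) s i * (\prod_(l < m | l != i) (1 - al l *: 'X))`_n.
Proof.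
rewrite /BS /bm mulr_suml.
have -> : sprod AS Lsum n = \sum_i s i * sprod AS (geomtail (al i)) n.
  rewrite /sprod /Lsum; under eq_bigr do rewrite mulr_sumr.
  rewrite exchange_big; apply: eq_bigr => i _; rewrite mulr_sumr.
  by apply: eq_bigr => k _; rewrite mulrCA.
rewrite -big_split; apply: eq_bigr => i _; rewrite /= -mulrDr; congr (_ * _).
have -> : AS n + sprod AS (geomtail (al i)) n = sprod AS (binser (-1) (al i)) n.
  have -> : binser (-1) (al i) = @sunity F \+ geomtail (al i).
    by apply/funext => -[|k]; rewrite binserN1 /sunity /= ?addr0 ?add0r.
  by rewrite sprodDr /= [sprod AS (@sunity F)]sprodC sprod1s.
rewrite /AS /bigbin (bigD1 i) //= [sprod (binser _ _) _]sprodC -sprodA binserD subrr.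
rewrite binser_s0 sprodC sprod1s (prod_other (fun x => 1 - x *: 'X)) -(big_filter _ (fun l => l != i)).
by rewrite -(big_map al xpredT (fun x => binser 1 x)) big_binser1.
Qed.

Lemma BS_coef k l : (k + l)%N = m.-1 -> BS k = bpol`_l.
Proof.
move=> kl; rewrite BS_list coef_sum; apply: eq_bigr => i _; rewrite coefZ; congr (_ * _).
by rewrite (prod_other (fun x => 1 - x *: 'X)) (prod_other (fun x => 'X - x%:P)) (rev_prod_XsubC (l := l)) ?card_other.
Qed.

Lemma BS_coef0 k : (m.-1 < k)%N -> BS k = 0.
Proof.
move=> mk; rewrite BS_list big1 // => i _; rewrite (prod_other (fun x => 1 - x *: 'X)) nth_default ?mulr0 //.
by rewrite (leq_trans (size_prod_1subX _)) // card_other.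
Qed.

Lemma size_apol : size apol = m.+1.
Proof. by rewrite /apol -(big_map al xpredT (fun x => 'X - x%:P)) size_prod_XsubC size_map size_index_enum_ord. Qed.

Lemma size_bpol : (size bpol <= m)%N.
Proof.
rewrite (leq_trans (size_sum _ _ _)) //; apply/bigmax_leqP => i _.
rewrite (leq_trans (size_scale_leq _ _)) // (prod_other (fun x => 'X - x%:P)) size_prod_XsubC card_other.
by rewrite prednK //; lia.
Qed.

(** The shift makes f_j = sum_k ([moment] k) z^(-k-1), the Cauchy transform of the functional
    sending X^k to [moment] k. *)
Definition moment k := fcoef al s bm j k.+1.

Lemma moment_low k : (k < j)%N -> moment k = 0.
Proof. by move=> kj; rewrite /moment fcoefE ltnS kj. Qed.

Lemma moment_diag : moment j = 1.
Proof.
rewrite /moment fcoefE ltnn subnn /h /sprod big_ord1 bigbin0 lauricella_coefE bigbin0.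
by rewrite !pochK0 divr1 !mulr1.
Qed.

(** After reversal of the summation order the left side is coefficient N = k + m - j - 1 of
    [h_equation]; j + 1 < m makes N positive, where the right side vanishes. *)
Lemma phi_stokes_monomial k : phi moment ((apol * 'X^k)^`() + bpol * 'X^k) = 0.
Proof.
have sz : (size ((apol * 'X^k)^`() + bpol * 'X^k)%R <= k + m)%N.
  rewrite (leq_trans (size_polyD _ _)) // geq_max; apply/andP; split.
    rewrite (leq_trans (size_poly _ _)) //.
    by have := size_polyMleq apol 'X^k; rewrite size_apol size_polyXn; case: (size _) => /= *; lia.
  have := size_polyMleq bpol 'X^k; rewrite size_polyXn; have := size_bpol.
  by case: (size bpol) => /= *; lia.
rewrite (phi_wide _ sz) (reindex_inj rev_ord_inj) /=.
set M := (k + m)%N.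
pose N := (M - j.+1)%N.
have E := h_equation N; rewrite (_ : sunity F N = 0) ?mulr0 in E; last first.
  by rewrite /sunity (_ : (N == 0%N) = false) //; rewrite /N /M; lia.
rewrite -[RHS]E /sprod -big_split /= (big_ord_widen M (fun i => AS i * ((N - i + j.+1)%:R * h (N - i)%N) + (bm * AS i + sprod AS Lsum i) * h (N - i)%N)); last first.
  by rewrite /N /M; lia.
rewrite [RHS]big_mkcond /=; apply: eq_bigr => i _; have iM := ltn_ord i.
rewrite coefD coef_deriv !coefMXn -/(BS i).
have -> : (M - i.+1).+1 = (M - i)%N by lia.
have -> : (if (M - i < k)%N then 0 else apol`_(M - i - k)) = AS i.
  case: ifP => h1; first by rewrite AS_coef0 //; rewrite /M in h1 iM *; lia.
  by rewrite (AS_coef (l := M - i - k)) //; rewrite /M in h1 iM *; lia.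
have -> : (if (M - i <= k)%N then 0 else bpol`_(M - i.+1 - k)) = BS i.
  case: ifP => h1; first by rewrite BS_coef0 //; rewrite /M in h1 iM *; lia.
  by rewrite (BS_coef (l := M - i.+1 - k)) //; rewrite /M in h1 iM *; lia.
rewrite /moment fcoefE (_ : (M - i.+1).+1 = M - i)%N; last by lia.
have -> : (M - i < j.+1)%N = ~~ (i < N.+1)%N by rewrite /N; lia.
case: (ltnP i N.+1) => h1 /=; last by rewrite mulr0.
have -> : (M - i - j.+1 = N - i)%N by rewrite /N; lia.
have -> : (N - i + j.+1 = M - i)%N by rewrite /N /M in h1 *; lia.
by rewrite -mulr_natr; ring.
Qed.

Lemma phi_stokes g : phi moment ((apol * g)^`() + bpol * g) = 0.
Proof.
rewrite -[g]coefK poly_def !mulr_sumr raddf_sum /= -big_split phi_sum big1 //= => i _.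
by rewrite -!scalerAr derivZ -scalerDr phiZ phi_stokes_monomial mulr0.
Qed.

End FcoefEquation.
End BinomialSeries.

(** * Simultaneous Pade approximants *)

Section Pade.
Variable F : fieldType.
Hypothesis charF : forall n, n.+1%:R != 0 :> F.
Variables (m : nat) (al s : 'I_m -> F).
Hypothesis m2 : (2 <= m)%N.
Hypothesis al_inj : injective al.
Hypothesis s_neq : forall i n, s i != - (n.+1)%:R.
Let bm := \sum_i s i.
Hypothesis bm_neq : forall n, bm != - (n.+2)%:R.
Local Notation a := (apol al).
Local Notation b := (bpol al s).

Implicit Types g h G : {poly F}.

Definition stokes g : {poly F} := (a * g)^`() + b * g.

Lemma bpol_coef : b`_m.-1 = bm.
Proof.
rewrite /bpol coef_sum; apply: eq_bigr => i _; rewrite coefZ (prod_other al (fun x => 'X - x%:P)).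
rewrite -[X in _`_X](card_other al i).
have := monicP (monic_prod_XsubC [seq al l | l <- index_enum 'I_m & l != i] xpredT id).
by rewrite lead_coefE size_prod_XsubC => ->; rewrite mulr1.
Qed.

Lemma apol_monic : a \is monic.
Proof. exact: monic_prod_XsubC. Qed.

Lemma size_stokes_le g : (size (stokes g) <= (size g + m).-1)%N.
Proof.
rewrite (leq_trans (size_polyD _ _)) // geq_max; apply/andP; split.
  rewrite (leq_trans (size_poly _ _)) //.
  by have := size_polyMleq a g; rewrite size_apol; case: (size _) => //= *; lia.
have := size_polyMleq b g; have : (size b <= m)%N by apply: size_bpol (0%N) _; lia.
by lia.
Qed.

(** The factor deg g + m + b_{m-1} is nonzero by the assumption on b_{m-1}, so [stokes] raises the
    degree by exactly m - 1. *)
Lemma stokes_lead g : g != 0 ->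
  (stokes g)`_(size g + m).-2 = ((size g).-1 + m)%:R * lead_coef g + bm * lead_coef g.
Proof.
rewrite -size_poly_gt0 => g0; rewrite /stokes coefD coef_deriv; congr (_ + _).
  have -> : (size g + m).-2.+1 = ((size g).-1 + m)%N by lia.
  rewrite -[LHS]mulr_natl; congr (_ * _).
  have -> : (((size g).-1 + m) = (size (a * g)%R).-1)%N.
    by rewrite size_monicM ?size_apol ?apol_monic // -?size_poly_gt0 //; lia.
  by rewrite -lead_coefE lead_coefM (monicP apol_monic) mul1r.
rewrite coefM (bigD1 (inord m.-1)) //=.
rewrite inordK; last by move: g0; move: (size g) => k k0; lia.
rewrite bpol_coef (_ : (size g + m).-2 - m.-1 = (size g).-1)%N -?lead_coefE; last by lia.
rewrite big1 ?addr0 // => i ii.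
case: (ltnP i m.-1) => h.
  by rewrite [X in _ * X]nth_default ?mulr0 //; lia.
rewrite [X in X * _]nth_default ?mul0r //.
have : (size b <= m)%N by apply: size_bpol (0%N) _; lia.
move=> sb; apply: (leq_trans sb).
have : (i : nat) != m.-1 by apply: contra ii => /eqP <-; rewrite inord_val.
by lia.
Qed.

Lemma size_stokes g : g != 0 -> size (stokes g) = (size g + m).-1.
Proof.
move=> g0; apply/eqP; rewrite eqn_leq size_stokes_le /=.
have sg : (0 < size g)%N by rewrite size_poly_gt0.
have := stokes_lead g0; rewrite -mulrDl => E.
have : (stokes g)`_(size g + m).-2 != 0.
  rewrite E mulf_neq0 ?lead_coef_eq0 //.
  have -> : ((size g).-1 + m = ((size g).-1 + m).-2.+2)%N by lia.
  by rewrite addrC addr_eq0.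
case: (leqP (size g + m).-1 (size (stokes g))) => // h.
rewrite nth_default ?eqxx //; move: h; move: (size (stokes g)) (size g) => k1 k2 *; lia.
Qed.

Lemma stokesD g h : stokes (g + h) = stokes g + stokes h.
Proof. by rewrite /stokes !mulrDr derivD; ring. Qed.

Lemma stokes0 : stokes 0 = 0.
Proof. by rewrite /stokes !mulr0 derivC addr0. Qed.

Lemma stokes_scale c g : stokes (c *: g) = c *: stokes g.
Proof. by rewrite /stokes -!scalerAr derivZ scalerDr. Qed.

Lemma stokes_remainder G : exists g, (size (G - stokes g)%R <= m.-1)%N.
Proof.
have [k] := ubnP (size G); elim: k G => // k IH G sG.
case: (leqP (size G) m.-1) => h; first by exists 0; rewrite stokes0 subr0.
pose g0 : {poly F} := 'X^(size G - m).
have sg0 : size g0 = (size G - m).+1 by rewrite size_polyXn.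
have g00 : g0 != 0 by rewrite -size_poly_gt0 sg0.
have sT := size_stokes g00; rewrite sg0 in sT.
have T0 : lead_coef (stokes g0) != 0 by rewrite lead_coef_eq0 -size_poly_gt0 sT; lia.
pose c := lead_coef G / lead_coef (stokes g0).
have sG1 : (size (G - c *: stokes g0)%R < size G)%N.
  have sz : (size (G - c *: stokes g0)%R <= size G)%N.
    rewrite (leq_trans (size_polyD _ _)) // size_polyN geq_max leqnn /=.
    rewrite (leq_trans (size_scale_leq _ _)) //.
    by rewrite sT; move: h; move: (size G) => k1 *; lia.
  rewrite ltn_neqAle sz andbT; apply/eqP => E.
  have : lead_coef (G - c *: stokes g0) != 0.
    by rewrite lead_coef_eq0 -size_poly_gt0 E; lia.
  rewrite lead_coefE E coefB coefZ -lead_coefE.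
  have -> : (size G).-1 = (size (stokes g0)).-1 by rewrite sT; lia.
  by rewrite -lead_coefE /c divfK // subrr eqxx.
have [|g sg] := IH (G - c *: stokes g0); first by lia.
exists (c *: g0 + g); rewrite stokesD stokes_scale.
by rewrite opprD addrA.
Qed.

Local Notation mom j := (moment al s j).

Lemma phi_stokes0 j g : (j.+1 < m)%N -> phi (mom j) (stokes g) = 0.
Proof. by move=> jm; apply: phi_stokes. Qed.

(** Modulo the image of [stokes] every polynomial has degree at most m - 2, and there the m - 1
    functionals are triangular: the j-th one vanishes on X^k for k < j and is 1 on X^j. *)
Lemma phi_mom_kernel G : (forall j, (j.+1 < m)%N -> phi (mom j) G = 0) -> exists g, G = stokes g.
Proof.
move=> HG; have [g sg] := stokes_remainder G; exists g.
apply/eqP; rewrite -subr_eq0; apply/negPn/negP => H0.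
set H : {poly F} := G - _ in sg H0.
have sH : (0 < size H)%N by rewrite size_poly_gt0.
pose j := (size H).-1.
have jm : (j.+1 < m)%N by rewrite /j; lia.
have : phi (mom j) H = 0 by rewrite phiB HG // phi_stokes0 // subr0.
rewrite /phi; have -> : size H = j.+1 by rewrite /j; lia.
rewrite big_ord_recr /= moment_diag mulr1 big1 ?add0r; last first.
  by move=> i _; rewrite moment_low ?mulr0.
by move/eqP; rewrite /j -lead_coefE lead_coef_eq0 (negPf H0).
Qed.

Lemma deriv_apol_root i : a^`().[al i] = \prod_(l < m | l != i) (al i - al l).
Proof.
rewrite /apol (bigD1 i) //= derivM derivXsubC mul1r hornerD hornerM !hornerXsubC subrr mul0r addr0.
by rewrite horner_prod; apply: eq_bigr => l _; rewrite hornerXsubC.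
Qed.

Lemma deriv_apol_neq0 i : a^`().[al i] != 0.
Proof.
rewrite deriv_apol_root; apply/prodf_neq0 => l li.
by rewrite subr_eq0; apply: contra li => /eqP /al_inj ->.
Qed.

Lemma apol_root i : a.[al i] = 0.
Proof. by rewrite /apol horner_prod (bigD1 i) //= hornerXsubC subrr mul0r. Qed.

Lemma bpol_root i : b.[al i] = s i * a^`().[al i].
Proof.
rewrite /bpol horner_sum (bigD1 i) //= [X in _ + X]big1 ?addr0.
  rewrite hornerZ deriv_apol_root horner_prod; congr (_ * _).
  by apply: eq_bigr => l _; rewrite hornerXsubC.
move=> l li; rewrite hornerZ horner_prod (bigD1 i) /=; last by rewrite eq_sym.
by rewrite hornerXsubC subrr mul0r mulr0.
Qed.

Lemma apol_dvd G : (forall i, G.[al i] = 0) -> a %| G.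
Proof.
move=> HG; rewrite /apol -(big_map al xpredT (fun x => 'X - x%:P)).
apply: uniq_roots_dvdp; first by apply/allP => x /mapP[i _ ->]; rewrite /root HG.
by rewrite uniq_rootsE map_inj_uniq // index_enum_uniq.
Qed.

Lemma stokes_apolM r h : stokes (a ^+ r * h) = a ^+ r * (r.+1%:R *: a^`() * h + a * h^`() + b * h).
Proof.
rewrite /stokes mulrA -exprS derivM deriv_exp -[_ *+ r.+1]mulr_natl -mul_polyC.
by rewrite polyC_natr [r.+1.-1]/=; move: (_%:R : {poly F}) => c; rewrite exprS; ring.
Qed.

(** At al_i the cofactor of a^r in [stokes (a ^+ r * h)] equals (r + 1 + s_i) a'(al_i) h(al_i), and
    s_i is not a negative integer. If one more power of a divides the image, then h vanishes at
    every al_i, so a divides h. *)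
Lemma apol_dvd_stokes r g : a ^+ r %| stokes g -> a ^+ r %| g.
Proof.
elim: r => [|r IH] H; first by rewrite expr0 dvd1p.
have /IH /dvdpP[h Eg] : a ^+ r %| stokes g by apply: dvdp_trans H; rewrite exprS dvdp_mull.
have a0 : a != 0 by rewrite monic_neq0 // apol_monic.
move: H; rewrite Eg mulrC stokes_apolM exprS [a * a ^+ r]mulrC !dvdp_mul2l ?expf_neq0 //.
move=> /dvdpP[q Eq]; apply: apol_dvd => i.
have := congr1 (fun p => p.[al i]) Eq.
rewrite !(hornerD, hornerM, hornerZ) apol_root mul0r mulr0 addr0 bpol_root => /eqP.
rewrite -!mulrDl !mulf_eq0 (negPf (deriv_apol_neq0 i)) orbF.
have -> : (r.+1%:R + s i == 0) = false by rewrite addrC addr_eq0 (negPf (s_neq i r)).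
by move=> /eqP.
Qed.

Lemma phi_apolM j g k : (j.+1 < m)%N ->
  phi (mom j) ('X^k * stokes g) = - (k%:R * phi (mom j) ('X^(k.-1) * (a * g))).
Proof.
move=> jm; have := phi_stokes0 ('X^k * g) jm.
have -> : stokes ('X^k * g) = ('X^k : {poly F}) * stokes g + k%:R *: ('X^(k.-1) * (a * g)).
  rewrite /stokes [a * _]mulrCA [('X^k * _)^`()]derivM derivXn -mulr_natl -mul_polyC polyC_natr; ring.
by rewrite phiD phiZ => /eqP; rewrite addr_eq0 => /eqP ->.
Qed.

(** Normality: (n + 1)(m - 1) orthogonality conditions against as many coefficients. The conditions
    for k = 0 give a^r G = stokes(a^r h); partial integration turns the others into the conditions k
    <= n - 1 on a^(r+1) h, where h has m - 1 coefficients fewer than G. The exponent r serves this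
    induction. *)
Lemma pade_normal n r G : (size G <= n.+1 * m.-1)%N ->
  (forall j k, (j.+1 < m)%N -> (k <= n)%N -> phi (mom j) ('X^k * (a ^+ r * G)) = 0) -> G = 0.
Proof.
elim: n r G => [|n IH] r G sG HG; apply/eqP; apply/negPn/negP => G0.
all: have [j jm|g Eg] := @phi_mom_kernel (a ^+ r * G); [by have := HG j 0%N jm isT; rewrite expr0 mul1r|].
all: have /apol_dvd_stokes /dvdpP[h Eh] : a ^+ r %| stokes g by rewrite -Eg dvdp_mulr.
all: have ar : a ^+ r \is monic by rewrite monic_exp // apol_monic.
all: have g0 : g != 0 by apply: contra_neq G0 => gE; apply: (mulfI (monic_neq0 ar)); rewrite Eg gE stokes0 mulr0.
all: have h0 : h != 0 by apply: contra_neq g0 => hE; rewrite Eh hE mul0r.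
all: have := congr1 (fun p : {poly F} => size p) Eg; rewrite (size_stokes g0) {1}Eh mulrC.
all: rewrite (size_Mmonic G0 ar) (size_Mmonic h0 ar).
all: have sh : (0 < size h)%N by rewrite size_poly_gt0.
all: have s1 : (0 < size (a ^+ r)%R)%N by rewrite size_poly_gt0 monic_neq0.
  by lia.
move=> E; move: h0; rewrite (IH r.+1 h) ?eqxx //; first by lia.
move=> j k jm kn; have := HG j k.+1 jm kn; rewrite Eg phi_apolM // Eh => /eqP.
rewrite oppr_eq0 mulf_eq0 (negPf (charF k)) /= => /eqP <-; congr (phi _ (_ * _)).
by rewrite exprS -mulrA [_ ^+ r * h]mulrC.
Qed.

Section Rodrigues.
Variables (n l : nat).

(** By the product rule this is w^(-1) a^(k-n) (d/dz)^k (w a^n z^l). *)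
Fixpoint rodrigues k : {poly F} :=
  if k is k'.+1 then ((n - k')%:R *: a^`() + b) * rodrigues k' + a * (rodrigues k')^`() else 'X^l.

Definition pade : {poly F} := (n`!%:R)^-1 *: rodrigues n.

Lemma rodrigues_stokes k : (k < n)%N ->
  stokes (a ^+ (n - k.+1) * rodrigues k) = a ^+ (n - k.+1) * rodrigues k.+1.
Proof. by move=> kn; rewrite stokes_apolM /= -subSn // subSS; ring. Qed.

Lemma phi_rodrigues j k i : (j.+1 < m)%N -> (k <= n)%N ->
  phi (mom j) ('X^i * (a ^+ (n - k) * rodrigues k)) =
  (-1) ^+ k * (i ^_ k)%:R * phi (mom j) ('X^(i - k) * (a ^+ n * 'X^l)).
Proof.
move=> jm; elim: k i => [|k IH] i kn.
  by rewrite expr0 ffactn0 !mul1r !subn0.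
rewrite -rodrigues_stokes // phi_apolM // [a * _]mulrA -exprS -subSn // subSS IH; last by lia.
case: i => [|i]; first by rewrite mul0r oppr0 ffact0n /= mulr0 mul0r.
by rewrite /= ffactSS natrM exprS subSS; ring.
Qed.

(** An n-fold partial integration. The binomial coefficient, all that remains of the factorials,
    vanishes for i < n, which is the orthogonality, and is at most 2^i otherwise, which keeps the
    remainder small. *)
Lemma phi_pade j i : (j.+1 < m)%N ->
  phi (mom j) ('X^i * pade) =
  (-1) ^+ n * 'C(i, n)%:R * phi (mom j) ('X^(i - n + l) * a ^+ n).
Proof.
move=> jm; rewrite /pade -scalerAr phiZ.
have := phi_rodrigues i jm (leqnn n); rewrite subnn expr0 mul1r => ->.
rewrite -bin_ffact natrM exprD -['X^(i - n) * _ * _]mulrA [_ ^+ n * 'X^l]mulrC.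
by field; apply: fact_neq0.
Qed.

Lemma size_rodrigues k : (k <= n)%N -> size (rodrigues k) = (k * m.-1 + l).+1.
Proof.
elim: k => [|k IH] kn; first by rewrite size_polyXn.
have E := rodrigues_stokes kn.
have r0 : rodrigues k != 0 by rewrite -size_poly_gt0 IH // ltnW.
have ar : a ^+ (n - k.+1) \is monic by rewrite monic_exp // apol_monic.
have := congr1 (fun p : {poly F} => size p) E.
rewrite size_stokes; last by rewrite mulf_neq0 // monic_neq0.
rewrite !(size_monicM ar) //.
  have s1 : (0 < size (a ^+ (n - k.+1))%R)%N by rewrite size_poly_gt0 monic_neq0.
  rewrite IH; last by lia.
  by lia.
apply: contra_neq r0 => R0.
have /eqP := E; rewrite R0 mulr0 => /eqP Z.
have [//|X] := eqVneq (rodrigues k) 0.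
have := size_stokes (g := a ^+ (n - k.+1) * rodrigues k).
rewrite Z size_poly0 (size_monicM ar X) mulf_neq0 ?X ?(monic_neq0 ar) // => /(_ isT).
have : (0 < size (rodrigues k))%N by rewrite size_poly_gt0.
have s1 : (0 < size (a ^+ (n - k.+1))%R)%N by rewrite size_poly_gt0 monic_neq0.
by lia.
Qed.

Lemma size_pade : size pade = (n * m.-1 + l).+1.
Proof. by rewrite /pade size_scale ?size_rodrigues // invr_eq0 fact_neq0. Qed.

End Rodrigues.

End Pade.

Section DividedDifference.
Variable F : fieldType.
Implicit Types (u : nat -> F) (x : F).

(* [phi (dseq u x) P] is the value of [phi u] on the divided difference
   [(P - P.[x]) / ('X - x)]. *)
Definition dseq u x : nat -> F := fun i => \sum_(h < i) u h * x ^+ (i.-1 - h).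

Lemma dseqS u x i : dseq u x i.+1 = u i + x * dseq u x i.
Proof.
rewrite /dseq big_ord_recr /= subnn expr0 mulr1 addrC mulr_sumr; congr (_ + _).
apply: eq_bigr => h _; rewrite mulrCA -exprS; congr (_ * _ ^+ _).
by have := ltn_ord h; lia.
Qed.

Lemma phi_dseq u x P : phi (dseq u x) (('X - x%:P) * P) = phi u P.
Proof.
rewrite -[P]coefK poly_def mulr_sumr !phi_sum; apply: eq_bigr => i _.
rewrite -scalerAr !phiZ mulrBl -exprS mul_polyC phiB phiZ !phiXn dseqS.
by rewrite addrK.
Qed.

End DividedDifference.

Section Nonvanishing.
Variable F : fieldType.
Hypothesis charF : forall n, n.+1%:R != 0 :> F.
Variables (m : nat) (al s : 'I_m -> F).
Hypothesis m2 : (2 <= m)%N.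
Hypothesis al_inj : injective al.
Hypothesis s_neq : forall i n, s i != - (n.+1)%:R.
Hypothesis bm_neq : forall n, \sum_i s i != - (n.+2)%:R.
Local Notation mom j := (moment al s j).

(** Put Q = P / (X - x). The functionals kill Q by assumption, and X^(k+1) Q = X^k P + x X^k Q
    extends this to all k <= n, as P is orthogonal to the powers below n. Dividing out one linear
    factor thus gains one order of orthogonality, and [pade_normal] applies to Q. *)
Lemma pade_combination n x (c : 'I_m -> F) : 
  let P : {poly F} := \sum_l c l *: pade al s n l in
  P.[x] = 0 -> (forall j, (j.+1 < m)%N -> phi (dseq (mom j) x) P = 0) -> P = 0.
Proof.
move=> P /eqP Px HQ.
have /dvdpP[Q EQ] : 'X - x%:P %| P by rewrite dvdp_XsubCl.
rewrite /= in Q EQ.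
suff : Q = 0 by move=> Q0; rewrite EQ Q0 mul0r.
apply: (@pade_normal _ charF m al s m2 al_inj s_neq bm_neq n 0).
  have sP : (size P <= n * m.-1 + m)%N.
    rewrite (leq_trans (size_sum _ _ _)) //; apply/bigmax_leqP => l _.
    by rewrite (leq_trans (size_scale_leq _ _)) // size_pade //; have := ltn_ord l; lia.
  have [->|Q0] := eqVneq Q 0; first by rewrite size_poly0.
  by move: sP; rewrite EQ size_Mmonic ?monicXsubC // size_XsubC; lia.
move=> j k jm; rewrite expr0 mul1r.
elim: k => [|k IH] kn.
  by rewrite expr0 mul1r -(phi_dseq _ x) mulrC -EQ HQ.
have -> : 'X^(k.+1) * Q = 'X^k * P + x *: ('X^k * Q).
  by rewrite EQ -mul_polyC exprSr; ring.
rewrite phiD phiZ IH ?mulr0 ?addr0; last by lia.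
rewrite mulr_sumr phi_sum big1 // => l _.
by rewrite -scalerAr phiZ phi_pade // bin_small // mulr0 mul0r mulr0.
Qed.

Lemma pade_independent n (c : 'I_m -> F) : \sum_l c l *: pade al s n l = 0 -> forall l, c l = 0.
Proof.
move=> H; have K (k : nat) (km : (k <= m)%N) : forall l : 'I_m, (k <= l)%N -> c l = 0.
  rewrite -(subKn km); elim: (m - k)%N (leq_subr k m) => [|d IH] dm l.
    by rewrite subn0; have := ltn_ord l; lia.
  rewrite leq_eqVlt => /orP[/eqP El|]; last by move=> hl; apply: IH; lia.
  have := congr1 (fun p : {poly F} => p`_(n * m.-1 + l)) H.
  rewrite coef0 coef_sum (bigD1 l) //= big1 ?addr0.
    rewrite coefZ => /eqP; rewrite mulf_eq0 => /orP[/eqP //|].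
    have sz : size (pade al s n l) = (n * m.-1 + l).+1 by exact: size_pade.
    have -> : (n * m.-1 + l = (size (pade al s n l)).-1)%N by rewrite sz.
    by rewrite -lead_coefE lead_coef_eq0 -size_poly_eq0 sz.
  move=> i il; rewrite coefZ; case: (ltnP i l) => h.
    by rewrite nth_default ?mulr0 // size_pade //; lia.
  rewrite IH ?mul0r //; first by lia.
  have : (i : nat) != l by [].
  by lia.
by move=> l; apply: (K 0%N).
Qed.

(** The square matrix of the values P_{n,l}(x) and of the divided-difference values has independent
    rows, so it cannot kill the nonzero column (lam0, lam). *)
Lemma pade_nonvanishing n x (lam0 : F) (lam : 'I_m.-1 -> F) :
  ~ (lam0 = 0 /\ forall j, lam j = 0) ->
  exists l : 'I_m, lam0 * (pade al s n l).[x] +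
    \sum_j lam j * phi (dseq (mom j) x) (pade al s n l) != 0.
Proof.
move=> Hlam; apply: contrapT => Hno.
pose M : 'M[F]_(m, 1 + m.-1) := row_mx (\col_l (pade al s n l).[x])
  (\matrix_(l, j) phi (dseq (mom j) x) (pade al s n l)).
pose L : 'cV[F]_(1 + m.-1) := col_mx (\col_(_ < 1) lam0) (\col_j lam j).
have ML : M *m L = 0.
  apply/matrixP => l k; rewrite mul_row_col !mxE big_ord1 !mxE.
  under eq_bigr do rewrite !mxE.
  apply/eqP; apply/negPn/negP => h; apply: Hno; exists l.
  by rewrite mulrC; under eq_bigr do rewrite mulrC.
have rM : row_free M.
  apply/row_freeP; apply: contrapT => H; apply: H; apply/row_freeP.
  rewrite -kermx_eq0; apply/rowV0P => v /sub_kermxP vM.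
  have E : \sum_l v 0 l *: pade al s n l = 0.
    apply: (@pade_combination n x (fun l => v 0 l)).
      have := congr1 (fun (A : 'M[F]_(1, 1 + m.-1)) => A 0 (lshift _ 0)) vM.
      rewrite mul_mx_row row_mxEl !mxE horner_sum => E.
      by rewrite -[RHS]E; apply: eq_bigr => l _; rewrite !mxE hornerZ.
    move=> j jm; have jm' : (j < m.-1)%N by lia.
    have := congr1 (fun (A : 'M[F]_(1, 1 + m.-1)) => A 0 (rshift _ (Ordinal jm'))) vM.
    rewrite mul_mx_row row_mxEr !mxE phi_sum => E.
    by rewrite -[RHS]E; apply: eq_bigr => l _; rewrite !mxE phiZ.
  by apply/rowP => l; rewrite [RHS]mxE (pade_independent E).
have L0 : L = 0.
  have m1 : (1 + m.-1 = m)%N by lia.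
  have rk : \rank M = (1 + m.-1)%N by rewrite (eqP rM) m1.
  have : row_full M by rewrite /row_full rk.
  by move=> /row_fullP[B BM]; rewrite -[L]mul1mx -BM -mulmxA ML mulmx0.
apply: Hlam; split=> [|j].
  have := congr1 (fun A : 'cV_(1 + m.-1) => A (lshift _ 0) 0) L0.
  by rewrite col_mxEu !mxE.
have := congr1 (fun A : 'cV_(1 + m.-1) => A (rshift _ j) 0) L0.
by rewrite col_mxEd !mxE.
Qed.

End Nonvanishing.

(** * Size of the Pade denominators *)

Section Interpolation.
Variables (F : fieldType) (m : nat) (al : 'I_m -> F).
Hypothesis al_inj : injective al.

Lemma poly_vanish_on_roots (G : {poly F}) :
  (size G <= m)%N -> (forall i, G.[al i] = 0) -> G = 0.
Proof.
move=> sG HG; apply/eqP; apply/negPn/negP => G0.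
by have := dvdp_leq G0 (apol_dvd al_inj HG); rewrite size_apol leqNgt ltnS sG.
Qed.

Lemma bpol_unique (s : 'I_m -> F) (b : {poly F}) : (0 < m)%N -> (size b <= m)%N ->
  (forall i, b.[al i] / (apol al)^`().[al i] = s i) -> b = bpol al s.
Proof.
move=> m0 sb Hb; apply/eqP; rewrite -subr_eq0; apply/eqP; apply: poly_vanish_on_roots.
  rewrite (leq_trans (size_polyD _ _)) // size_polyN geq_max sb /=.
  rewrite /bpol (leq_trans (size_sum _ _ _)) //; apply/bigmax_leqP => i _.
  rewrite (leq_trans (size_scale_leq _ _)) // (prod_other al (fun x => 'X - x%:P)) size_prod_XsubC card_other.
  by rewrite prednK.
move=> i; rewrite hornerD hornerN bpol_root -Hb divfK ?subrr //.
exact: deriv_apol_neq0.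
Qed.

Lemma deriv_apolE : (apol al)^`() = bpol al (fun=> 1).
Proof.
case: (posnP m) => [m0|m0].
  rewrite /apol /bpol !big1 ?derivC // => i _; have := ltn_ord i; by rewrite [X in (_ < X)%N]m0.
apply: bpol_unique => // [|i]; last by rewrite divff // deriv_apol_neq0.
by rewrite (leq_trans (size_poly _ _)) // size_apol.
Qed.

End Interpolation.

(** * Rodrigues polynomials as Taylor coefficients *)

Section GeneratingSeries.
Variable F : fieldType.
Hypothesis charF : forall n, n.+1%:R != 0 :> F.
Variables (m : nat) (al s : 'I_m -> F).
Hypothesis m2 : (2 <= m)%N.
Hypothesis al_inj : injective al.
Variable n : nat.
Local Notation a := (apol al).
Local Notation b := (bpol al s).
Implicit Types u v : nat -> {poly F}.

(* In terms of the generating series u(eps) = sum_k u_k eps^k, this is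
   (1 + a' eps) d/d(eps) - a d/dX. *)
Definition rderiv u : nat -> {poly F} :=
  fun k => k.+1%:R * u k.+1 + a^`() * (k%:R * u k) - a * (u k)^`().

(** g is the logarithmic derivative of u for this derivation, so it is additive on products; given
    g, the equation determines every u_k from u_0. *)
Definition log_rderiv u g := forall k, rderiv u k = g * u k.

Lemma log_rderiv_conv u v g h : log_rderiv u g -> log_rderiv v h -> log_rderiv (sprod u v) (g + h).
Proof.
move=> Hu Hv k.
have -> : (g + h) * sprod u v k = sprod (rderiv u) v k + sprod u (rderiv v) k.
  rewrite mulrDl /sprod !mulr_sumr; congr (_ + _); apply: eq_bigr => i _.
    by rewrite Hu mulrA.
  by rewrite Hv mulrCA.
have E1 := congr1 (fun f => f k) (sderiv_conv u v).
have E2 := congr1 (fun f => f k) (euler_conv u v).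
rewrite /rderiv; rewrite /sderiv /= in E1; rewrite /euler /= in E2; rewrite E1 E2.
have -> : (sprod u v k)^`() = \sum_(i < k.+1) ((u i)^`() * v (k - i)%N + u i * (v (k - i)%N)^`()).
  by rewrite /sprod raddf_sum; apply: eq_bigr => i _ /=; rewrite derivM.
rewrite /sprod mulrDr !mulr_sumr -!big_split -sumrB /=; apply: eq_bigr => i _.
ring.
Qed.

Lemma log_rderiv_sunity : log_rderiv (@sunity _) 0.
Proof.
by move=> [|k]; rewrite /rderiv /sunity /= mul0r !(mulr0, mul0r) ?derivC ?(derivC 1) ?mulr0 subr0 addr0.
Qed.

Lemma log_rderiv_big (I : Type) (r : seq I) (u : I -> nat -> {poly F}) (g : I -> {poly F}) :
  (forall i, log_rderiv (u i) (g i)) ->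
  log_rderiv (\big[@sprod _/@sunity _]_(i <- r) u i) (\sum_(i <- r) g i).
Proof.
move=> H; elim: r => [|i r IH]; first by rewrite !big_nil; apply: log_rderiv_sunity.
by rewrite !big_cons; apply: log_rderiv_conv.
Qed.

(** The series X + eps a, along which the derivation vanishes. *)
Definition shift_seq : nat -> {poly F} := fun k => if k is k'.+1 then (if k' is 0%N then a else 0) else 'X.

Lemma log_rderiv_shift : log_rderiv shift_seq 0.
Proof.
move=> [|[|k]]; rewrite /rderiv /= mul0r.
- by rewrite derivX mulr0 mul1r mulr1 addr0 subrr.
- by rewrite mulr0 add0r mul1r mulrC subrr.
- by rewrite !mulr0 derivC mulr0 subr0 addr0.
Qed.

Definition cofactor_pol i : {poly F} := \prod_(l < m | l != i) ('X - (al l)%:P).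

Lemma apol_cofactor i : a = ('X - (al i)%:P) * cofactor_pol i.
Proof. by rewrite /apol (bigD1 i). Qed.

(** The series (1 + eps a / (X - al_i))^(s_i + n); the argument -1 of [binser] yields the usual
    binomial coefficients of s_i + n. *)
Definition factor_seq i : nat -> {poly F} :=
  fun k => (binser (s i + n%:R) (-1) k)%:P * cofactor_pol i ^+ k.

Lemma log_rderiv_factor i : log_rderiv (factor_seq i) ((s i + n%:R)%:P * cofactor_pol i).
Proof.
move=> k; rewrite /rderiv /factor_seq.
have E : k.+1%:R * (binser (s i + n%:R) (-1) k.+1)%:P =
    (s i + n%:R - k%:R)%:P * (binser (s i + n%:R) (-1) k)%:P.
  by rewrite -polyC_natr -!polyCM binserS //; congr (_%:P); ring.
rewrite mulrA E deriv_mulC.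
have -> : a * ((binser (s i + n%:R) (-1) k)%:P * (cofactor_pol i ^+ k)^`()) =
    (binser (s i + n%:R) (-1) k)%:P * (k%:R * (a^`() - cofactor_pol i) * cofactor_pol i ^+ k).
  rewrite mulrCA; congr (_ * _); case: k {E} => [|k]; first by rewrite expr0 derivC mul0r mul0r mulr0.
  rewrite {1 2}(apol_cofactor i) derivM derivXsubC deriv_exp -mulr_natl [k.+1.-1]/= [in RHS]exprS.
  ring.
rewrite exprS !polyCB !polyCD !polyC_natr; ring.
Qed.

(** Taylor's formula for w a^n z^l at X + eps a(X), divided by (w a^n)(X). In this form the division
    by n! in [pade] has disappeared, and the factors can be estimated one by one at every place. *)
Definition rodrigues_seq l : nat -> {poly F} :=
  sprod (\big[@sprod _/@sunity _]_(i < l) shift_seq) (\big[@sprod _/@sunity _]_i factor_seq i).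

Lemma log_rderiv_rodrigues l : log_rderiv (rodrigues_seq l) (b + n%:R * a^`()).
Proof.
have -> : b + n%:R * a^`() = \sum_(i < l) 0 + \sum_i (s i + n%:R)%:P * cofactor_pol i.
  rewrite big1 // add0r deriv_apolE // /bpol mulr_sumr -big_split; apply: eq_bigr => i _ /=.
  by rewrite scale1r polyCD polyC_natr mulrDl mul_polyC.
apply: log_rderiv_conv; apply: log_rderiv_big => ?; first exact: log_rderiv_shift.
exact: log_rderiv_factor.
Qed.

Lemma rodrigues_seq0 l : rodrigues_seq l 0 = 'X^l.
Proof.
have H (I : Type) (r : seq I) (u : I -> nat -> {poly F}) :
    (\big[@sprod _/@sunity _]_(i <- r) u i) 0 = \prod_(i <- r) u i 0.
  by elim: r => [|i r IH]; rewrite ?big_nil // !big_cons /sprod big_ord1 -IH.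
rewrite /rodrigues_seq /sprod big_ord1 !H /= prodr_const card_ord big1 ?mulr1 // => i _.
by rewrite /factor_seq binser0 expr0 mulr1.
Qed.

Lemma rodriguesE l k : (k <= n)%N -> rodrigues al s n l k = k`!%:R * rodrigues_seq l k.
Proof.
elim: k => [|k IH] kn /=; first by rewrite rodrigues_seq0 fact0 mul1r.
rewrite IH ?(ltnW kn) //.
have := log_rderiv_rodrigues l k; rewrite /rderiv => /eqP.
rewrite subr_eq => /eqP /(canRL (addrK _)) => E.
rewrite factS mulnC natrM -mulrA E -mul_polyC polyC_natr natrB ?(ltnW kn) //.
rewrite -polyC_natr deriv_mulC; ring.
Qed.

Lemma padeE l : pade al s n l = rodrigues_seq l n.
Proof.
rewrite /pade rodriguesE // -mul_polyC -polyC_natr mulrA -polyCM mulVf ?mul1r //.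
exact: fact_neq0.
Qed.

End GeneratingSeries.

(** * Estimates common to archimedean and finite places *)

Section ConvolutionBounds.
Variables (R : realType) (A : comNzRingType) (bd : A -> R -> Prop) (kap : nat -> R).
Hypothesis kap_ge1 : forall k, 1 <= kap k.+1.
Hypothesis kap_mono : forall i j, (i <= j)%N -> kap i <= kap j.
Hypothesis bdM : forall x y r t, 0 <= r -> 0 <= t -> bd x r -> bd y t -> bd (x * y) (r * t).
Hypothesis bd_sum : forall k (x : 'I_k -> A) c, 0 <= c -> (forall i, bd (x i) c) ->
  bd (\sum_i x i) (kap k * c).
Hypothesis bd_le : forall x r t, bd x r -> r <= t -> bd x t.
Hypothesis bd0 : bd 0 0.
Hypothesis bd1 : bd 1 1.
Variables (n : nat) (rho : R).
Hypothesis rho0 : 0 <= rho.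

(** [bd] is used with two meanings: the operator bound [pbound] on polynomials, and an absolute
    value on the field. *)
Definition seq_bound (u : nat -> A) c := forall k, (k <= n)%N -> bd (u k) (c * rho ^+ k).

Lemma seq_bound_conv u v c c' : 0 <= c -> 0 <= c' -> seq_bound u c -> seq_bound v c' ->
  seq_bound (sprod u v) (kap n.+1 * (c * c')).
Proof.
move=> c0 c'0 Hu Hv k kn.
have cc : 0 <= c * c' * rho ^+ k by rewrite !mulr_ge0 // exprn_ge0.
apply: (bd_le (r := kap k.+1 * (c * c' * rho ^+ k))).
  apply: bd_sum => // i.
  have -> : c * c' * rho ^+ k = (c * rho ^+ i) * (c' * rho ^+ (k - i)).
    by rewrite mulrACA -exprD subnKC // -ltnS.
  have ik : (i <= k)%N by rewrite -ltnS.
  by apply: bdM; rewrite ?mulr_ge0 ?exprn_ge0 //; [apply: Hu|apply: Hv]; lia.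
by rewrite -[leRHS]mulrA ler_wpM2r // kap_mono.
Qed.

Lemma seq_bound_big (I : Type) (r : seq I) (u : I -> nat -> A) (c : I -> R) :
  (forall i, 0 <= c i) -> (forall i, seq_bound (u i) (c i)) ->
  seq_bound (\big[@sprod _/@sunity _]_(i <- r) u i) (kap n.+1 ^+ size r * \prod_(i <- r) c i).
Proof.
move=> c0 H; elim: r => [|i r IH].
  rewrite !big_nil => -[|k] _; first by rewrite /= !mul1r expr0.
  by apply: bd_le bd0 _; rewrite mulr1 mul1r exprn_ge0.
rewrite !big_cons /=; have k0 : 0 <= kap n.+1 by rewrite (le_trans ler01).
have -> : kap n.+1 ^+ (size r).+1 * (c i * \prod_(j <- r) c j) =
    kap n.+1 * (c i * (kap n.+1 ^+ size r * \prod_(j <- r) c j)) by rewrite exprS; ring.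
apply: seq_bound_conv => //.
by rewrite mulr_ge0 ?exprn_ge0 // prodr_ge0.
Qed.

End ConvolutionBounds.

(* The factor lost when bounding a sum of k terms by its largest term. *)
Definition kap (R : realType) (ult : bool) (k : nat) : R := if ult then 1 else k%:R.

Section PolynomialNorm.
Variables (R : realType) (F : fieldType) (N : F -> R) (ult : bool).
Hypothesis aN : absval N.
Hypothesis Nult : ult -> forall x y, N (x + y) <= Num.max (N x) (N y).

Lemma kapS_ge1 k : 1 <= kap R ult k.+1.
Proof. by rewrite /kap; case: ult; rewrite // ler1n. Qed.

Lemma kap_ge0 k : 0 <= kap R ult k.
Proof. by rewrite /kap; case: ult; rewrite // ler0n. Qed.

Lemma kap_le i j : (i <= j)%N -> kap R ult i <= kap R ult j.
Proof. by rewrite /kap; case: ult; rewrite // ler_nat. Qed.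

Lemma absval_sum k (x : 'I_k -> F) c : 0 <= c -> (forall i, N (x i) <= c) ->
  N (\sum_i x i) <= kap R ult k * c.
Proof.
move=> c0; rewrite /kap; case: (boolP ult) => u.
  move=> H; rewrite mul1r; elim/big_ind: _ => [|y z yc zc|i _]; rewrite ?absval0 //.
  by rewrite (le_trans (Nult u _ _)) // ge_max yc.
elim: k x => [|k IH] x H; first by rewrite big_ord0 absval0 // mul0r.
rewrite big_ord_recr /= (le_trans (absval_le_add aN _ _)) //.
by rewrite mulrSr mulrDl mul1r lerD // IH.
Qed.

Variable B : R.
Hypothesis B1 : 1 <= B.

(* Operator norm of P in the dual of the functionals [phi u] with N (u i) = O(B ^ i):
   it is submultiplicative in the archimedean and in the ultrametric case alike. *)
Definition pbound (P : {poly F}) (r : R) :=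
  forall u C, 0 <= C -> (forall i, N (u i) <= C * B ^+ i) -> N (phi u P) <= C * r.

Lemma phi_mul u (P Q : {poly F}) : phi u (P * Q) = phi (fun i => phi (fun h => u (i + h)%N) Q) P.
Proof.
rewrite -{1}[P]coefK poly_def mulr_suml phi_sum /phi; apply: eq_bigr => i _.
rewrite -scalerAl -/(phi _ _) phiZ; congr (_ * _).
rewrite -{1}[Q]coefK poly_def mulr_sumr phi_sum; apply: eq_bigr => h _.
by rewrite -scalerAr phiZ -exprD phiXn.
Qed.

Lemma pboundM P Q r t : 0 <= r -> 0 <= t -> pbound P r -> pbound Q t -> pbound (P * Q) (r * t).
Proof.
move=> r0 t0 HP HQ u C C0 Hu; have -> : C * (r * t) = C * t * r by ring.
rewrite phi_mul; apply: (HP _ (C * t)) => [|i]; first exact: mulr_ge0.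
rewrite mulrAC; apply: (HQ _ (C * B ^+ i)) => [|h]; first by rewrite mulr_ge0 // exprn_ge0 // (le_trans ler01).
by rewrite -mulrA -exprD.
Qed.

Lemma pbound_le P r t : pbound P r -> r <= t -> pbound P t.
Proof. by move=> HP rt u C C0 Hu; rewrite (le_trans (HP u C C0 Hu)) // ler_wpM2l. Qed.

Lemma pbound_sum k (P : 'I_k -> {poly F}) c : 0 <= c -> (forall i, pbound (P i) c) ->
  pbound (\sum_i P i) (kap R ult k * c).
Proof.
move=> c0 H u C C0 Hu; rewrite phi_sum mulrCA; apply: absval_sum; first exact: mulr_ge0.
by move=> i; apply: H.
Qed.

Lemma pboundC c : pbound c%:P (N c).
Proof.
move=> u C C0 Hu; have -> : c%:P = c *: 'X^0 by rewrite expr0 alg_polyC.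
rewrite phiZ absvalM // mulrC ler_wpM2r ?absval_ge0 // phiXn.
by have := Hu 0%N; rewrite expr0 mulr1.
Qed.

Lemma pbound0 : pbound 0 0.
Proof. by have := pboundC 0; rewrite absval0. Qed.

Lemma pbound1 : pbound 1 1.
Proof. by have := pboundC 1; rewrite absval1. Qed.

Lemma pboundX : pbound 'X B.
Proof. by move=> u C C0 Hu; rewrite -['X]expr1 phiXn; have := Hu 1%N; rewrite expr1. Qed.

Lemma pboundXsubC c A : 1 <= A -> N c <= A -> pbound ('X - c%:P) (kap R ult 2 * (B * A)).
Proof.
move=> A1 cA u C C0 Hu; rewrite mulrCA.
have -> : 'X - c%:P = \sum_(i < 2) [:: 'X; - c%:P]`_i :> {poly F} by rewrite !big_ord_recr big_ord0 /= add0r.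
have B0 := le_trans ler01 B1; have A0 := le_trans ler01 A1.
rewrite phi_sum; apply: absval_sum => [|[[|[|//]] i2] /=]; first by rewrite !mulr_ge0.
  by rewrite (le_trans (pboundX C0 Hu)) // ler_wpM2l // ler_peMr.
rewrite phiN absvalN // (le_trans (pboundC _ C0 Hu)) // ler_wpM2l //.
by rewrite (le_trans cA) // ler_peMl.
Qed.

Lemma pbound_prod (I : Type) (r : seq I) (p : pred I) (P : I -> {poly F}) (c : I -> R) :
  (forall i, p i -> 0 <= c i) -> (forall i, p i -> pbound (P i) (c i)) ->
  pbound (\prod_(i <- r | p i) P i) (\prod_(i <- r | p i) c i).
Proof.
move=> c0 H; elim: r => [|i r IH]; first by rewrite !big_nil; apply: pbound1.
rewrite !big_cons; case: ifP => // pi; apply: pboundM => //; [exact: c0|exact: prodr_ge0|exact: H].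
Qed.

Lemma pboundXn P r k : 0 <= r -> pbound P r -> pbound (P ^+ k) (r ^+ k).
Proof.
move=> r0 HP; elim: k => [|k IH]; first by rewrite !expr0; apply: pbound1.
by rewrite !exprS; apply: pboundM => //; apply: exprn_ge0.
Qed.

(** Only the moments that P meets have to be bounded; at finite places the bound available involves
    an lcm that grows with the order. *)
Lemma pboundW P r u C : pbound P r -> 0 <= C ->
  (forall i, (i < size P)%N -> N (u i) <= C * B ^+ i) -> N (phi u P) <= C * r.
Proof.
move=> HP C0 Hu; have -> : phi u P = phi (fun i => if (i < size P)%N then u i else 0) P.
  by apply: eq_bigr => i _; rewrite ltn_ord.
apply: HP => // i; case: ifP => [|_]; first exact: Hu.
by rewrite absval0 // mulr_ge0 // exprn_ge0 // (le_trans ler01).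
Qed.

Lemma dseq_bound u x C X k : 0 <= C -> 1 <= X -> N x <= B ->
  (forall h, (h < k)%N -> N (u h) <= C * X ^+ h) ->
  N (dseq u x k) <= (kap R ult k * C * X ^+ k) * B ^+ k.
Proof.
move=> C0 X1 xB Hu; have X0 := le_trans ler01 X1; have B0 := le_trans ler01 B1.
rewrite -!mulrA; apply: absval_sum => [|h]; first by rewrite !mulr_ge0 // exprn_ge0.
rewrite absvalM // absvalX // mulrA; apply: ler_pM; rewrite ?exprn_ge0 ?(absval_ge0 aN) //.
  by rewrite (le_trans (Hu _ (ltn_ord h))) // ler_wpM2l // ler_weXn2l // ltnW.
apply: (@le_trans _ _ (B ^+ (k.-1 - h))); first by rewrite lerXn2r ?nnegrE ?absval_ge0.
by apply: ler_weXn2l => //; lia.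
Qed.

Section PadeBound.
Hypothesis charF : forall n, n.+1%:R != 0 :> F.
Variables (m : nat) (al s : 'I_m -> F) (A : 'I_m -> R).
Hypothesis m2 : (2 <= m)%N.
Hypothesis al_inj : injective al.
Hypothesis A_ge1 : forall i, 1 <= A i.
Hypothesis al_le : forall i, N (al i) <= A i.

Definition cofactor_bound := (kap R ult 2 * B) ^+ m.-1 * \prod_i A i.

Lemma cofactor_bound_ge1 : 1 <= cofactor_bound.
Proof.
rewrite /cofactor_bound mulr_ege1 // ?exprn_ege1 // ?mulr_ege1 ?kapS_ge1 //.
by elim/big_ind: _ => // x y x1 y1; rewrite mulr_ege1.
Qed.

Lemma pbound_cofactor i : pbound (cofactor_pol al i) cofactor_bound.
Proof.
have k2 := kapS_ge1 1; have B0 := le_trans ler01 B1.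
have H l : 0 <= kap R ult 2 * (B * A l) by rewrite !mulr_ge0 ?kap_ge0 // (le_trans ler01).
apply: (pbound_le (r := \prod_(l < m | l != i) (kap R ult 2 * (B * A l)))).
  by apply: pbound_prod => l _; [exact: H|exact: pboundXsubC].
under eq_bigr do rewrite mulrA; rewrite big_split /= prodr_const.
rewrite (_ : #|_| = m.-1); last by rewrite (cardC1 i) card_ord.
rewrite /cofactor_bound ler_wpM2l ?exprn_ge0 ?mulr_ge0 ?kap_ge0 // [leRHS](bigD1 i) //= ler_peMl //.
by apply: prodr_ge0 => l _; rewrite (le_trans ler01).
Qed.

Lemma pbound_apol : pbound (apol al) (kap R ult 2 * B * cofactor_bound).
Proof.
have k2 := kapS_ge1 1; have B0 := le_trans ler01 B1.
have H l : 0 <= kap R ult 2 * (B * A l) by rewrite !mulr_ge0 ?kap_ge0 // (le_trans ler01).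
apply: (pbound_le (r := \prod_(l < m) (kap R ult 2 * (B * A l)))).
  by apply: pbound_prod => l _; [exact: H|exact: pboundXsubC].
under eq_bigr do rewrite mulrA; rewrite big_split /= prodr_const card_ord.
by rewrite /cofactor_bound mulrA -exprS prednK //; lia.
Qed.

(** [rho] is a common growth rate in eps: the coefficients X and a of the shift are at most E and E
    rho, those of the i-th binomial factor at most G_i rho^k. There are l + m factors, a number
    independent of n, so the [kap] factors stay polynomial in n. *)
Lemma pade_bound n l (rho E : R) (G : 'I_m -> R) : 0 < rho -> B <= E ->
  kap R ult 2 * B * cofactor_bound <= E * rho -> (forall i, 0 <= G i) ->
  (forall i k, (k <= n)%N -> N (binser (s i + n%:R) (-1) k) * cofactor_bound ^+ k <= G i * rho ^+ k) ->
  pbound (pade al s n l)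
    (kap R ult n.+1 * ((kap R ult n.+1 ^+ l * E ^+ l) * (kap R ult n.+1 ^+ m * \prod_i G i)) * rho ^+ n).
Proof.
move=> rho0 BE aE G0 HG; rewrite padeE //.
have E0 : 0 <= E by rewrite (le_trans _ BE) // (le_trans ler01).
have C0 : 0 <= cofactor_bound by rewrite (le_trans ler01) // cofactor_bound_ge1.
have rho0' := ltW rho0.
apply: (seq_bound_conv (bd := pbound) kap_le pboundM pbound_sum pbound_le (n := n) rho0') => //.
- by rewrite mulr_ge0 ?exprn_ge0 ?kap_ge0.
- by rewrite mulr_ge0 ?exprn_ge0 ?kap_ge0 // prodr_ge0.
- have -> : kap R ult n.+1 ^+ l * E ^+ l = kap R ult n.+1 ^+ size (index_enum 'I_l) * \prod_(i < l) E.
    by rewrite size_index_enum_ord prodr_const card_ord.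
  apply: (seq_bound_big (bd := pbound) kapS_ge1 kap_le pboundM pbound_sum pbound_le pbound0 pbound1) => // i [|[|k]] kn /=.
  + by apply: pbound_le pboundX _; rewrite expr0 mulr1.
  + by apply: pbound_le pbound_apol _; rewrite expr1.
  + by apply: pbound_le pbound0 _; rewrite mulr_ge0 // exprn_ge0.
- have -> : kap R ult n.+1 ^+ m = kap R ult n.+1 ^+ size (index_enum 'I_m).
    by rewrite size_index_enum_ord.
  apply: (seq_bound_big (bd := pbound) kapS_ge1 kap_le pboundM pbound_sum pbound_le pbound0 pbound1) => // i k kn /=.
  apply: pbound_le (HG i k kn); apply: pboundM; rewrite ?(absval_ge0 aN) ?exprn_ge0 //.
    exact: pboundC.
  by apply: pboundXn => //; apply: pbound_cofactor.
Qed.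

End PadeBound.
End PolynomialNorm.

(** * Size of the moments *)

Section Progression.

Lemma dvdz_sub_prod (d : int) (I : Type) (r : seq I) (f g : I -> int) :
  (forall i, (d %| f i - g i)%Z) -> (d %| \prod_(i <- r) f i - \prod_(i <- r) g i)%Z.
Proof.
move=> H; elim: r => [|i r IH]; first by rewrite !big_nil subrr dvdz0.
rewrite !big_cons; set x := \prod_(j <- r) f j in IH *; set y := \prod_(j <- r) g j in IH *.
have -> : f i * x - g i * y = f i * (x - y) + (f i - g i) * y by ring.
by apply: rpredD; [apply: dvdz_mull | apply: dvdz_mulr].
Qed.

(* Modulo a power of a prime not dividing q, the progression z + q i becomes q times
   a block of consecutive integers. *)
Lemma dvdz_prod_progression (p : nat) (z q : int) k : prime p -> coprimez p q ->
  (p%:Z ^+ logn p k`! %| \prod_(i < k) (z + q * i%:Z))%Z.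
Proof.
move=> pp cpq; set P := p%:Z ^+ _.
have cPq : coprimez P q by rewrite /P coprimezXl.
have P0 : P != 0 by rewrite expf_neq0 // eqz_nat -lt0n prime_gt0.
have [u [v uv]] := Bezoutz P q; rewrite (eqP cPq) in uv.
pose t := ((v * z) %% P)%Z.
have [t' Et] : exists t' : nat, t = t'%:Z.
  by exists `|t|%N; rewrite gez0_abs // modz_ge0.
have Ht : (P %| z - q * t)%Z.
  rewrite /t {1}(_ : z = (u * P + v * q) * z); last by rewrite uv mul1r.
  have -> : (u * P + v * q) * z - q * ((v * z) %% P)%Z = P * (u * z) + q * (v * z - (v * z %% P)%Z) by ring.
  apply: rpredD; first by rewrite dvdz_mulr.
  rewrite dvdz_mull // {1}(divz_eq (v * z) P) addrK; exact: dvdz_mull.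
have H : (P %| \prod_(i < k) (z + q * i%:Z) - \prod_(i < k) (q * (t'%:Z + i%:Z)))%Z.
  apply: dvdz_sub_prod => i; rewrite -Et.
  by have -> : z + q * i%:Z - q * (t + i%:Z) = z - q * t by ring.
rewrite -(subrK (\prod_(i < k) (q * (t'%:Z + i%:Z))) (\prod_(i < k) (z + q * i%:Z))).
apply: rpredD => //; rewrite big_split /=; apply: dvdz_mull.
have -> : \prod_(i < k) (t'%:Z + i%:Z) = ((\prod_(i < k) (t' + i))%N)%:Z.
  by rewrite [RHS](big_morph Posz PoszM (erefl _)); apply: eq_bigr => i _.
have -> : P = ((p ^ logn p k`!)%N)%:Z by rewrite /P -natz -natrX natz.
rewrite dvdzE /=; apply: (@dvdn_trans (k`!)).
  by rewrite pfactor_dvdn ?fact_gt0.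
case: k {P cPq P0 uv t Et Ht H u v} => [|k]; first by rewrite big_ord0.
have -> : (\prod_(i < k.+1) (t' + i) = (t' + k) ^_ k.+1)%N.
  rewrite ffact_prod (reindex_inj rev_ord_inj) /=; apply: eq_bigr => i _.
  by have := ltn_ord i; lia.
by rewrite -bin_ffact dvdn_mull.
Qed.

Lemma logn_fact_le p k : prime p -> (p.-1 * logn p k`! <= k)%N.
Proof.
move=> pp; have p1 := prime_gt1 pp.
have H (N k' : nat) : (\sum_(i < N) k' %/ p ^ i.+1 * p.-1 <= k')%N.
  elim: N k' => [|N IH] k'; first by rewrite big_ord0.
  rewrite big_ord_recl expn1.
  apply: (@leq_trans (k' %/ p * p.-1 + k' %/ p)).
    rewrite leq_add2l; apply: leq_trans _ (IH (k' %/ p)%N).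
    by apply: leq_sum => i _; rewrite lift0 expnS divnMA.
  by rewrite -mulnSr prednK ?(ltnW p1) // leq_trunc_div.
by rewrite logn_fact // mulnC big_distrl /= big_add1 big_mkord; apply: H.
Qed.

End Progression.

Section ArchimedeanBinomial.
Variables (R : realType) (F : fieldType) (N : F -> R).
Hypothesis aN : absval N.
Hypothesis Nnat : forall n, N n%:R = n%:R.

Lemma arch_charF n : n.+1%:R != 0 :> F.
Proof. by rewrite -(absval_eq0 aN) Nnat pnatr_eq0. Qed.

(** Factor by factor, |s + n - i| <= sig + n - i, where k <= n keeps n - i nonnegative. *)
Lemma arch_binser_le (s : F) n k sig : N s <= sig%:R -> (k <= n)%N ->
  N (binser (s + n%:R) (-1) k) <= 'C(n + sig, k)%:R.
Proof.
move=> ss kn; rewrite /binser !absvalM // absvalX // absvalN // (absval1 aN) expr1n mulr1.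
rewrite absvalV // Nnat ler_pdivrMr ?ltr0n ?fact_gt0 // -natrM bin_ffact ffact_prod natr_prod.
rewrite /pochK absval_prod //; apply: ler_prod => i _; rewrite absval_ge0 //=.
have -> : - (s + n%:R) + i%:R = - (s + (n - i)%:R).
  by rewrite natrB; [ring|have := ltn_ord i; lia].
rewrite absvalN // (le_trans (absval_le_add aN _ _)) // Nnat.
have -> : (n + sig - i = sig + (n - i))%N by have := ltn_ord i; lia.
by rewrite natrD lerD2r.
Qed.

Lemma bin_le_exp (M k : nat) (t : R) : 0 < t -> 'C(M, k)%:R * t ^+ k <= (1 + t) ^+ M.
Proof.
move=> t0; case: (leqP k M) => kM; last by rewrite bin_small // mul0r exprn_ge0 // addr_ge0 // ltW.
rewrite exprDn (bigD1 (inord k)) //= inordK ?ltnS // expr1n mul1r -[X in _ <= X + _]mulr_natl lerDl.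
by apply: sumr_ge0 => i _; rewrite expr1n mul1r mulrn_wge0 // exprn_ge0 // ltW.
Qed.

(** All k <= n are covered by one geometric sequence of ratio W / t; the free parameter t is fixed
    only in [arch_constant]. *)
Lemma arch_binser_exp (s : F) n k sig (t W : R) : 0 < t -> 0 <= W -> N s <= sig%:R -> (k <= n)%N ->
  N (binser (s + n%:R) (-1) k) * W ^+ k <= (1 + t) ^+ (n + sig) * (W / t) ^+ k.
Proof.
move=> t0 W0 ss kn; rewrite exprMn mulrCA [leLHS]mulrC ler_wpM2l ?exprn_ge0 //.
rewrite exprVn ler_pdivlMr ?exprn_gt0 //.
by rewrite (le_trans _ (bin_le_exp _ k t0)) // ler_wpM2r ?exprn_ge0 ?(ltW t0) // arch_binser_le.
Qed.

End ArchimedeanBinomial.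

Section Subexponential.
Variable R : realType.
Implicit Types x y : nat -> R.

Lemma ratio_bound x (r : R) k0 : 0 < r -> (forall k, 0 <= x k) ->
  (forall k, (k0 <= k)%N -> x k.+1 <= r * x k) -> exists2 E, 0 <= E & forall k, x k <= E * r ^+ k.
Proof.
move=> r0 x0 H; exists (\sum_(i < k0.+1) x i / r ^+ i).
  by apply: sumr_ge0 => i _; rewrite divr_ge0 // exprn_ge0 // ltW.
have Hi k : (k <= k0)%N -> x k <= (\sum_(i < k0.+1) x i / r ^+ i) * r ^+ k.
  move=> kk; rewrite -ler_pdivrMr ?exprn_gt0 // (bigD1 (inord k)) //= inordK ?ltnS // lerDl.
  by apply: sumr_ge0 => i _; rewrite divr_ge0 // exprn_ge0 // ltW.
elim=> [|k IH]; first exact: Hi.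
case: (leqP k.+1 k0) => h; first exact: Hi.
by rewrite (le_trans (H _ _)) // exprS mulrCA ler_wpM2l // ltW.
Qed.

Lemma real_root (r : R) e : 1 < r -> exists2 q : R, 1 < q & q ^+ e.+1 = r.
Proof.
move=> r1; exists (expR (ln r / e.+1%:R)).
  by rewrite expR_gt1 divr_gt0 // ln_gt0.
by rewrite -expRM_natl mulrC divfK ?pnatr_eq0 // lnK // posrE (lt_trans ltr01).
Qed.

(** Bernoulli's inequality for an (e + 1)-st root q of r bounds a linear factor by a constant times
    q^k. *)
Lemma poly_subexp (e : nat) (a b r : R) : 0 <= a -> 0 <= b -> 1 < r ->
  exists2 E, 0 <= E & forall k, (a * k%:R + b) ^+ e <= E * r ^+ k.
Proof.
move=> a0 b0 r1; have [q q1 Eq] := real_root e r1.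
have q0 : 0 < q - 1 by rewrite subr_gt0.
pose c := b + a / (q - 1); have c0 : 0 <= c by rewrite addr_ge0 // divr_ge0 // ltW.
have bern k : 1 + k%:R * (q - 1) <= q ^+ k.
  elim: k => [|k IH]; first by rewrite mul0r addr0 expr0.
  rewrite exprS -[k.+1%:R]natr1.
  apply: (@le_trans _ _ (q * (1 + k%:R * (q - 1)))); last by rewrite ler_pM2l // (lt_trans ltr01).
  rewrite -subr_ge0.
  have -> : q * (1 + k%:R * (q - 1)) - (1 + (k%:R + 1) * (q - 1)) = k%:R * (q - 1) ^+ 2 by ring.
  by rewrite mulr_ge0 // exprn_ge0 // ltW.
have lin k : a * k%:R + b <= c * q ^+ k.
  apply: (@le_trans _ _ (c * (1 + k%:R * (q - 1)))); last by rewrite ler_wpM2l.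
  have -> : c * (1 + k%:R * (q - 1)) = a * k%:R + b + (b * k%:R * (q - 1) + a / (q - 1)).
    by rewrite /c; field; rewrite gt_eqF.
  by rewrite lerDl addr_ge0 ?divr_ge0 ?mulr_ge0 // ltW.
have lin1 k : a * k%:R + b <= (c + 1) * q ^+ k.
  by rewrite (le_trans (lin k)) // ler_wpM2r ?lerDl // exprn_ge0 // ltW // (lt_trans ltr01).
exists ((c + 1) ^+ e); first by rewrite exprn_ge0 // addr_ge0.
move=> k; have q00 : 0 <= q by rewrite ltW // (lt_trans ltr01).
have c10 : 0 <= c + 1 by rewrite addr_ge0.
have qk0 : 0 <= (c + 1) * q ^+ k by rewrite mulr_ge0 // exprn_ge0.
apply: (@le_trans _ _ (((c + 1) * q ^+ k) ^+ e)).
  by rewrite lerXn2r ?nnegrE // ?addr_ge0 ?mulr_ge0.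
rewrite exprMn ler_wpM2l ?exprn_ge0 // -Eq -!exprM.
by apply: ler_weXn2l; [exact: ltW|rewrite mulnC leq_mul2r leqnSn orbT].
Qed.

End Subexponential.

Section MomentBound.
Variables (R : realType) (F : fieldType) (N : F -> R) (ult : bool).
Hypothesis aN : absval N.
Hypothesis Nult : ult -> forall x y, N (x + y) <= Num.max (N x) (N y).
Hypothesis charF : forall n, n.+1%:R != 0 :> F.
Variables (m : nat) (al s : 'I_m -> F) (j : nat).
Let bm := \sum_i s i.
Let A := bm + j.+1%:R.

Lemma absval_sprod_bound n (rho e1 e2 : R) (u v : nat -> F) : 0 <= rho -> 0 <= e1 -> 0 <= e2 ->
  (forall k, (k <= n)%N -> N (u k) <= e1 * rho ^+ k) ->
  (forall k, (k <= n)%N -> N (v k) <= e2 * rho ^+ k) ->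
  forall k, (k <= n)%N -> N (sprod u v k) <= kap R ult n.+1 * (e1 * e2) * rho ^+ k.
Proof.
move=> r0 e10 e20 Hu Hv.
apply: (seq_bound_conv (bd := fun x r => N x <= r) (kap_le R ult)) => //.
- by move=> x y r t r0' t0 xr yt; rewrite absvalM // ler_pM // absval_ge0.
- by move=> k x c c0 H; apply: absval_sum.
- by move=> x r t h1 h2; apply: le_trans h2.
Qed.

Lemma absval_bigbin_bound n (rho : R) (c : 'I_m -> R) (e : 'I_m -> F) : 0 <= rho ->
  (forall i, 0 <= c i) ->
  (forall i k, (k <= n)%N -> N (binser (e i) (al i) k) <= c i * rho ^+ k) ->
  forall k, (k <= n)%N -> N (bigbin al e k) <= kap R ult n.+1 ^+ m * \prod_i c i * rho ^+ k.
Proof.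
move=> r0 c0 He.
have -> : kap R ult n.+1 ^+ m = kap R ult n.+1 ^+ size (index_enum 'I_m) by rewrite size_index_enum_ord.
apply: (seq_bound_big (bd := fun x r => N x <= r) (kapS_ge1 R ult) (kap_le R ult)) => //.
- by move=> x y r t r0' t0 xr yt; rewrite absvalM // ler_pM // absval_ge0.
- by move=> k x c' c0' H; apply: absval_sum.
- by move=> x r t h1 h2; apply: le_trans h2.
- by rewrite absval0.
- by rewrite absval1.
Qed.

(** A moment is a convolution of the 2 m binomial series of the two products, weighted by a
    Pochhammer ratio. Bounds are assumed only up to order n, because at a finite place c depends on
    n through an lcm. *)
Lemma moment_bound n (rho c : R) (e e' : 'I_m -> R) : 1 <= rho -> 0 <= c ->
  (forall i, 0 <= e i) -> (forall i, 0 <= e' i) ->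
  (forall i k, (k <= n)%N -> N (binser (s i) (al i) k) <= e i * rho ^+ k) ->
  (forall i k, (k <= n)%N -> N (binser (- (1 + s i)) (al i) k) <= e' i * rho ^+ k) ->
  (forall k, (j + k <= n)%N -> N (pochK A k / pochK (A + 1) k) <= c) ->
  N (moment al s j n) <= kap R ult n.+1 ^+ (m + m).+1 * (\prod_i e i * \prod_i e' i * c) * rho ^+ n.
Proof.
move=> r1 c0 e0 e'0 He He' Hc; have r0 := le_trans ler01 r1.
have P0 : 0 <= \prod_i e i by exact: prodr_ge0.
have P'0 : 0 <= \prod_i e' i by exact: prodr_ge0.
have K0 : 0 <= kap R ult n.+1 by exact: kap_ge0.
rewrite /moment /fcoef; case: ltnP => [_|jn].
  by rewrite absval0 // !mulr_ge0 ?exprn_ge0.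
rewrite subSS; set k := (n - j)%N; have kn : (k <= n)%N by exact: leq_subr.
pose v i := pochK A i / pochK (A + 1) i * bigbin al (fun i => - (1 + s i)) i.
have Ev : lauricella_coef (bm + j.+1%:R) (fun i => 1 + s i) (bm + j.+2%:R) al = v.
  apply/funext => i; rewrite lauricella_coefE /v; congr (_ / pochK _ _ * _).
  by rewrite /A -addrA natr1.
have Hv i : (i <= k)%N -> N (v i) <= c * (kap R ult n.+1 ^+ m * \prod_i e' i) * rho ^+ i.
  move=> ik; rewrite /v absvalM // -mulrA ler_pM ?absval_ge0 //; first by apply: Hc; lia.
  by apply: absval_bigbin_bound => //; lia.
have Hu i : (i <= k)%N -> N (bigbin al s i) <= kap R ult n.+1 ^+ m * \prod_i e i * rho ^+ i.
  by move=> ik; apply: absval_bigbin_bound => //; lia.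
apply: (@le_trans _ _ (kap R ult k.+1 * (kap R ult n.+1 ^+ m * \prod_i e i *
    (c * (kap R ult n.+1 ^+ m * \prod_i e' i))) * rho ^+ k)).
  rewrite -Ev in Hv.
  by apply: (absval_sprod_bound r0 _ _ Hu Hv) => //; rewrite !mulr_ge0 ?exprn_ge0.
have -> : kap R ult n.+1 ^+ (m + m).+1 * (\prod_i e i * \prod_i e' i * c) * rho ^+ n =
  kap R ult n.+1 * (kap R ult n.+1 ^+ m * \prod_i e i * (c * (kap R ult n.+1 ^+ m * \prod_i e' i))) * rho ^+ n.
  by rewrite exprS exprD; ring.
apply: ler_pM; rewrite ?exprn_ge0 ?mulr_ge0 ?exprn_ge0 ?kap_ge0 //.
  by apply: ler_wpM2r; [rewrite !mulr_ge0 ?exprn_ge0|exact: kap_le].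
by apply: ler_weXn2l.
Qed.

End MomentBound.

Section ArchimedeanMoment.
Variables (R : realType) (F : fieldType) (N : F -> R).
Hypothesis aN : absval N.
Hypothesis Nnat : forall n, N n%:R = n%:R.

Lemma nat_above (x : R) : exists k : nat, x <= k%:R.
Proof. by exists (Num.truncn `|x|).+1; rewrite (le_trans (ler_norm x)) // ltW // truncnS_gt. Qed.

(** Ratio test: for al = 1 consecutive coefficients have quotient |k - s| / (k + 1), which tends to
    1. *)
Lemma arch_binser_subexp (s al : F) (A r : R) : N al <= A -> 1 < r ->
  exists2 E, 0 <= E & forall k, N (binser s al k) <= E * (r * A) ^+ k.
Proof.
move=> alA r1; have A0 : 0 <= A by rewrite (le_trans _ alA) // absval_ge0.
have [E E0 HE] : exists2 E, 0 <= E & forall k, N (binser s 1 k) <= E * r ^+ k.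
  have [k0 Hk0] := nat_above ((N s) / (r - 1)).
  apply: (@ratio_bound _ (fun k => N (binser s 1 k)) r k0); first exact: lt_trans r1.
    by move=> k; apply: absval_ge0.
  move=> k kk0; have := congr1 N (binserS (arch_charF aN Nnat) s 1 k).
  move: (binser s 1 k.+1) (binser s 1 k) => y z; rewrite mulr1 !(absvalM aN) Nnat => E.
  have k1 : 0 < k.+1%:R :> R by [].
  rewrite -(ler_pM2l k1) E mulrA ler_wpM2r ?absval_ge0 //.
  rewrite (le_trans (absval_le_add aN _ _)) // absvalN // Nnat.
  have r0 : 0 < r - 1 by rewrite subr_gt0.
  rewrite ler_pdivrMr // in Hk0.
  have : k0%:R <= k%:R :> R by rewrite ler_nat.
  by rewrite -natr1; nra.
exists E => // k.
have -> : binser s al k = binser s 1 k * al ^+ k by rewrite /binser expr1n mulr1.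
rewrite absvalM // absvalX // exprMn mulrA.
have N0 := absval_ge0 aN; apply: ler_pM; rewrite ?exprn_ge0 //.
by rewrite lerXn2r ?nnegrE.
Qed.

Lemma arch_moment_subexp m (al s : 'I_m -> F) j (A r : R) : 1 <= A -> (forall i, N (al i) <= A) ->
  (forall n, \sum_i s i != - (n.+2)%:R) -> 1 < r ->
  exists2 E, 0 <= E & forall k, N (moment al s j k) <= E * (r * A) ^+ k.
Proof.
move=> A1 alA bmN r1.
have [q q1 Eq] := real_root 1 r1.
have /choice[e He] i : exists E, 0 <= E /\ forall k, N (binser (s i) (al i) k) <= E * (q * A) ^+ k.
  by have [E ? ?] := arch_binser_subexp (s i) (alA i) q1; exists E.
have /choice[e' He'] i : exists E, 0 <= E /\ forall k, N (binser (- (1 + s i)) (al i) k) <= E * (q * A) ^+ k.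
  by have [E ? ?] := arch_binser_subexp (- (1 + s i)) (alA i) q1; exists E.
pose B := \sum_i s i + j.+1%:R.
have BN k : (0 < k)%N -> B + k%:R != 0.
  move=> k0; rewrite /B -addrA -natrD addSn -addnS -(prednK k0) !addnS.
  by rewrite addr_eq0.
(* For k >= |B| + 1 one has |B + k| >= 1, so the ratio B / (B + k) is at most |B|; the finitely many
   earlier ratios are simply added. *)
have [k0 Hk0] := nat_above (N B + 1).
have [c c0 Hc] : exists2 c, 0 <= c & forall k, N (pochK B k / pochK (B + 1) k) <= c.
  exists (N B + \sum_(k < k0) N (pochK B k / pochK (B + 1) k)).
    by rewrite addr_ge0 ?absval_ge0 // sumr_ge0 // => k _; rewrite absval_ge0.
  move=> k; case: (ltnP k k0) => kk.
    rewrite (bigD1 (Ordinal kk)) //= addrCA lerDl addr_ge0 ?absval_ge0 // sumr_ge0 // => i _.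
    by rewrite absval_ge0.
  apply: (@le_trans _ _ (N B)); last by rewrite lerDl sumr_ge0 // => i _; rewrite absval_ge0.
  have /(congr1 N) := pochK_ratio k BN; rewrite absvalM // => E.
  rewrite -[leRHS]E ler_peMl ?absval_ge0 //.
  have := absval_le_add aN (B + k%:R) (- B); rewrite [B + _]addrC addrK Nnat absvalN //.
  have : k0%:R <= k%:R :> R by rewrite ler_nat.
  by rewrite [_ + B]addrC; lra.
have [E E0 HE] := @poly_subexp R (m + m).+1 1 1 q ler01 ler01 q1.
have Pe : 0 <= \prod_i e i by apply: prodr_ge0 => i _; case: (He i).
have Pe' : 0 <= \prod_i e' i by apply: prodr_ge0 => i _; case: (He' i).
exists (E * (\prod_i e i * \prod_i e' i * c)); first by rewrite !mulr_ge0.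
move=> k.
have q0 : 0 <= q by rewrite (le_trans ler01) // ltW.
have rho1 : 1 <= q * A by rewrite mulr_ege1 // ltW.
apply: (@le_trans _ _ (kap R false k.+1 ^+ (m + m).+1 * (\prod_i e i * \prod_i e' i * c) * (q * A) ^+ k)).
  apply: (@moment_bound _ _ N false aN) => //.
  - by move=> i; case: (He i).
  - by move=> i; case: (He' i).
  - by move=> i k' _; case: (He i).
  - by move=> i k' _; case: (He' i).
have -> : (r * A) ^+ k = q ^+ k * (q * A) ^+ k by rewrite -exprMn -Eq expr2 mulrA.
have := HE k; rewrite mul1r natr1 /kap => h.
set P := \prod_i _ * _ * _; set Y := (q * A) ^+ k.
have -> : E * P * (q ^+ k * Y) = (E * q ^+ k) * (P * Y) by ring.
by rewrite -mulrA ler_wpM2r // !mulr_ge0 // exprn_ge0 // (le_trans ler01).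
Qed.

End ArchimedeanMoment.

(** * Binomial coefficients and moments at a finite place *)

Section FiniteBinomial.
Variables (R : realType) (K : fieldExtType rat) (w : K -> R).
Hypothesis pw : place_fin w.

(* The local factor at w of mu(x), for x of denominator q. *)
Definition Mfin (q : nat) : R :=
  (w q%:R * \prod_(p <- primes q) (w p%:R) `^ (1 / (p%:R - 1)))^-1.

Lemma fin_natE p k : prime p -> w p%:R < 1 -> (0 < k)%N -> w k%:R = w p%:R ^+ logn p k.
Proof.
move=> pp wp k0; have [c cp Ek] := pfactor_coprime pp k0.
rewrite {1}Ek natrM (finM pw) natrX (finX pw).
suff -> : w c%:R = 1 by rewrite mul1r.
apply/eqP; rewrite eq_le (fin_nat_le1 pw) /= leNgt (fin_nat_lt1 pw _ pp wp).
by rewrite -prime_coprime.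
Qed.

Lemma fin_other p q : prime p -> prime q -> p != q -> w p%:R < 1 -> w q%:R = 1.
Proof.
move=> pp pq npq wp; rewrite (fin_natE pp wp) ?prime_gt0 // lognE pp prime_gt0 //=.
by rewrite dvdn_prime2 // (negPf npq) expr0.
Qed.

Lemma primes_index p q : prime p -> (0 < q)%N -> (p %| q)%N -> p \in primes q.
Proof. by move=> pp q0 pq; rewrite mem_primes pp q0 pq. Qed.

Lemma Mfin_unit q : (0 < q)%N -> w q%:R = 1 -> Mfin q = 1.
Proof.
move=> q0 wq; rewrite /Mfin wq mul1r big1_seq ?invr1 // => p /andP[_].
rewrite mem_primes => /and3P[pp _ pq]; suff -> : w p%:R = 1 by rewrite powR1.
apply/eqP; rewrite eq_le (fin_nat_le1 pw) /= leNgt; apply/negP => wp.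
by have := fin_nat_lt1 pw q pp wp; rewrite wq ltxx pq.
Qed.

Lemma Mfin_dvd p q : prime p -> w p%:R < 1 -> (0 < q)%N -> (p %| q)%N ->
  Mfin q = (w q%:R * (w p%:R) `^ (1 / (p%:R - 1)))^-1.
Proof.
move=> pp wp q0 pq; rewrite /Mfin (bigD1_seq p) ?primes_index ?primes_uniq //=.
rewrite big1_seq ?mulr1 // => q' /andP[nq]; rewrite mem_primes => /and3P[pq' _ _].
by rewrite (fin_other pp pq') ?powR1 // eq_sym.
Qed.

Lemma nat_neq0 k : (0 < k)%N -> k%:R != 0 :> K.
Proof. by case: k => // k _; apply: natr_neq0. Qed.

Lemma fin_nat_gt0 k : (0 < k)%N -> 0 < w k%:R.
Proof. by move=> k0; apply: (fin_gt0 pw); apply: nat_neq0. Qed.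

Lemma fin_root_le1 p : prime p -> (w p%:R) `^ (1 / (p%:R - 1)) <= 1.
Proof.
move=> pp; have p1 : (1 : R) < p%:R by rewrite ltr1n prime_gt1.
have E1 : 1 `^ (1 / (p%:R - 1)) = 1 :> R by rewrite powR1.
rewrite -[leRHS]E1 ge0_ler_powR ?nnegrE ?(fin_ge0 pw) ?(fin_nat_le1 pw) //.
by rewrite divr_ge0 // subr_ge0 ltW.
Qed.

Lemma fin_rootX p : prime p -> ((w p%:R) `^ (1 / (p%:R - 1))) ^+ p.-1 = w p%:R.
Proof.
move=> pp; have p1 : (1 : R) < p%:R by rewrite ltr1n prime_gt1.
rewrite -powR_mulrn ?powR_ge0 // -powRrM.
have -> : p.-1%:R = p%:R - 1 :> R by rewrite -subn1 natrB ?prime_gt0.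
by rewrite mul1r mulVf ?powRr1 ?(fin_ge0 pw) // subr_eq0 gt_eqF.
Qed.

Lemma Mfin_ge1 q : (0 < q)%N -> 1 <= Mfin q.
Proof.
move=> q0; have [p pp wp] := fin_above pw.
have wp0 := fin_nat_gt0 (prime_gt0 pp); have wq0 := fin_nat_gt0 q0.
case: (boolP (p %| q)%N) => pq; last first.
  rewrite Mfin_unit //; apply/eqP; rewrite eq_le (fin_nat_le1 pw) /= leNgt.
  by rewrite (fin_nat_lt1 pw _ pp wp).
rewrite (Mfin_dvd pp wp q0 pq) invf_ge1 ?mulr_gt0 ?powR_gt0 //.
by rewrite mulr_ile1 ?powR_ge0 ?(ltW wq0) ?(fin_nat_le1 pw) ?fin_root_le1.
Qed.

Lemma prod_intr k (f : 'I_k -> int) : \prod_i ((f i)%:~R : K) = (\prod_i f i)%:~R.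
Proof. by rewrite rmorph_prod. Qed.

Lemma fin_dvdz (x y : int) : (x %| y)%Z -> w y%:~R <= w x%:~R.
Proof.
move=> /dvdzP[z ->]; rewrite intrM (finM pw) ler_piMl ?(fin_ge0 pw) //.
exact: fin_int_le1.
Qed.

Lemma pochK_frac (z : int) (q : nat) k : (0 < q)%N ->
  pochK (- (z%:~R / q%:R : K)) k = (\prod_(i < k) (- z + q%:Z * i%:Z))%:~R / q%:R ^+ k.
Proof.
move=> q0; have qn := nat_neq0 q0.
have -> : (q%:R : K) ^+ k = \prod_(i < k) q%:R by rewrite prodr_const card_ord.
rewrite -prod_intr /pochK -prodf_div; apply: eq_bigr => i _; rewrite intrD intrM rmorphN /=.
by field.
Qed.

(** Let p be the prime below w. If p divides q, the numerator is integral, the denominators give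
    |q|^(-k), and Legendre's formula bounds 1/|k!| by |p|^(-k/(p-1)). If not, the p-part of k!
    divides the numerator, a product over an arithmetic progression, and the coefficient is
    integral. *)
Lemma fin_binser_le (z : int) (q : nat) k : (0 < q)%N ->
  w (binser (z%:~R / q%:R) (-1) k) <= Mfin q ^+ k.
Proof.
move=> q0; have [p pp wp] := fin_above pw.
have qn := fin_nat_gt0 q0; have kn : 0 < w (k`!)%:R by rewrite fin_nat_gt0 ?fact_gt0.
rewrite /binser !(finM pw) (finX pw) (finN pw) (fin1 pw) expr1n mulr1 (finV pw).
rewrite ler_pdivrMr // pochK_frac // (finM pw) (finV pw) (finX pw).
rewrite ler_pdivrMr ?exprn_gt0 //.
case: (boolP (p %| q)%N) => pq.
  rewrite (le_trans (fin_int_le1 pw _)) // (Mfin_dvd pp wp q0 pq).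
  have wp0 := fin_nat_gt0 (prime_gt0 pp).
  set t := _ `^ _; have t0 : 0 < t by exact: powR_gt0.
  have tk : t ^+ k <= w (k`!)%:R.
    rewrite (fin_natE pp wp) ?fact_gt0 // -(fin_rootX pp) -/t -exprM.
    by apply: ler_wiXn2l; [exact: ltW|exact: fin_root_le1|exact: logn_fact_le].
  have -> : (w q%:R * t)^-1 ^+ k * w (k`!)%:R * w q%:R ^+ k = w (k`!)%:R / t ^+ k.
    by rewrite exprVn exprMn; field; rewrite !expf_neq0 ?gt_eqF.
  by rewrite ler_pdivlMr ?exprn_gt0 // mul1r.
have wq : w q%:R = 1.
  by apply/eqP; rewrite eq_le (fin_nat_le1 pw) /= leNgt (fin_nat_lt1 pw _ pp wp).
rewrite Mfin_unit // wq !expr1n mul1r mulr1 (fin_natE pp wp) ?fact_gt0 //.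
have cp : coprimez p q%:Z by rewrite coprimezE /= prime_coprime.
apply: (le_trans (fin_dvdz (dvdz_prod_progression (- z) k pp cp))).
by rewrite -(finX pw) rmorphXn.
Qed.

End FiniteBinomial.

Section FiniteMoment.
Variables (R : realType) (K : fieldExtType rat) (w : K -> R).
Hypothesis pw : place_fin w.
Variables (m : nat) (al : 'I_m -> K) (z : 'I_m -> int) (q : 'I_m -> nat).
Hypothesis q0 : forall i, (0 < q i)%N.
Let s i : K := (z i)%:~R / (q i)%:R.
Variables (u : int) (D : nat).
Hypothesis D0 : (0 < D)%N.
Hypothesis bmE : \sum_i s i = u%:~R / D%:R.
Hypothesis bmN : forall n, \sum_i s i != - (n.+2)%:R.
Variables (A M : R).
Hypothesis A1 : 1 <= A.
Hypothesis alA : forall i, w (al i) <= A.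
Hypothesis M1 : 1 <= M.
Hypothesis qM : forall i, Mfin w (q i) <= M.

Lemma fin_binser_al_le (y : int) i k : w (binser (y%:~R / (q i)%:R) (al i) k) <= (M * A) ^+ k.
Proof.
have -> : binser (y%:~R / (q i)%:R) (al i) k = binser (y%:~R / (q i)%:R) (-1) k * (- al i) ^+ k.
  by rewrite /binser -[RHS]mulrA -exprMn mulrNN mul1r.
rewrite (finM pw) (finX pw) (finN pw) exprMn.
apply: ler_pM; rewrite ?exprn_ge0 ?(fin_ge0 pw) //.
  rewrite (le_trans (fin_binser_le pw y k (q0 i))) // lerXn2r ?nnegrE //.
    by rewrite (le_trans ler01) // Mfin_ge1.
  by rewrite (le_trans ler01).
by rewrite lerXn2r ?nnegrE ?(fin_ge0 pw) ?alA // (le_trans ler01).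
Qed.

(** At a place where D is a unit the Pochhammer ratio is B / (B + k) with B = b_{m-1} + j + 1, and D
    (B + k) = u + D (j + 1 + k) divides L. The index starts at 2 since j + 1 >= 1 and only k >= 1
    produces a denominator. *)
Lemma fin_moment_explicit j n L : w D%:R = 1 -> (0 < L)%N ->
  (forall k : nat, (2 <= k <= n.+1)%N -> (`|(u + D%:Z * k%:Z)%R| %| L)%N) ->
  w (moment al s j n) <= (w L%:R)^-1 * (M * A) ^+ n.
Proof.
move=> wD L0 HL; have M0 := le_trans ler01 M1; have A0 := le_trans ler01 A1.
have Dn := nat_neq0 K D0; have wL0 := fin_nat_gt0 pw L0.
have c1 : 1 <= (w L%:R)^-1 by rewrite invf_ge1 // (fin_nat_le1 pw).
have -> : (w L%:R)^-1 * (M * A) ^+ n = kap R true n.+1 ^+ (m + m).+1 *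
    ((\prod_(i < m) 1) * (\prod_(i < m) 1) * (w L%:R)^-1) * (M * A) ^+ n.
  by rewrite /kap expr1n !big1 // !mul1r.
apply: (@moment_bound _ _ w true (fin_absval pw)) => //.
- by move=> _; apply: fin_ultra.
- by rewrite mulr_ege1.
- by rewrite (le_trans ler01).
- by move=> i k _; rewrite mul1r; apply: fin_binser_al_le.
- move=> i k _; rewrite mul1r.
  have -> : - (1 + s i) = (- ((q i)%:Z + z i))%:~R / (q i)%:R.
    rewrite /s rmorphN rmorphD /=; field; exact: nat_neq0.
  exact: fin_binser_al_le.
- move=> k jk; set B := _ + _.
  have BN k' : (0 < k')%N -> B + k'%:R != 0.
    move=> k'0; rewrite /B -addrA -natrD addSn -addnS -(prednK k'0) !addnS.
    by rewrite addr_eq0.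
  case: k jk => [|k] jk; first by rewrite !pochK0 divr1 (fin1 pw).
  have EB (k' : nat) : B + k'%:R = (u + D%:Z * (j.+1 + k')%N%:Z)%:~R / D%:R.
    by rewrite /B bmE intrD intrM -!pmulrn natrD; field.
  have /(congr1 w) := pochK_ratio k.+1 BN.
  rewrite (finM pw); set ra := w (pochK _ _ / _) => E.
  have wB : w B <= 1.
    by have := EB 0%N; rewrite addr0 => ->; rewrite (finM pw) (finV pw) wD invr1 mulr1 (fin_int_le1 pw).
  have wBk : w L%:R <= w (B + k.+1%:R).
    rewrite EB (finM pw) (finV pw) wD invr1 mulr1.
    have := HL (j.+1 + k.+1)%N; rewrite (_ : (2 <= _ <= _)%N); last by lia.
    move=> /(_ isT) h; apply: (fin_dvdz pw (x := _) (y := L%:Z)).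
    by rewrite dvdzE.
  rewrite -[leRHS]mul1r ler_pdivlMr //.
  apply: le_trans wB; rewrite -E mulrC ler_wpM2r //; exact: fin_ge0.
Qed.

Lemma fin_coef_prod (r : seq K) h : (forall x, x \in r -> w x <= A) -> (h <= size r)%N ->
  w (\prod_(x <- r) ('X - x%:P))`_h <= A ^+ (size r - h).
Proof.
have A0 := le_trans ler01 A1.
elim: r h => [|x r IH] h Hr /=; first by rewrite leqn0 => /eqP ->; rewrite big_nil coef1 expr0 (fin1 pw).
have Hr' y : y \in r -> w y <= A by move=> yr; apply: Hr; rewrite inE yr orbT.
move=> hr; rewrite big_cons mulrBl coefB coefXM coefCM.
have H1 : w (x * (\prod_(y <- r) ('X - y%:P))`_h) <= A ^+ ((size r).+1 - h).
  case: (leqP h (size r)) => hs.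
    rewrite (finM pw) subSn // exprS; apply: ler_pM; rewrite ?(fin_ge0 pw) ?Hr ?inE ?eqxx //.
    by rewrite IH.
  by rewrite nth_default ?size_prod_XsubC // mulr0 (fin0 pw) exprn_ge0.
apply: (fin_le_sub pw) => //; case: h hr {H1} => [|h] hr /=; first by rewrite (fin0 pw) exprn_ge0.
by rewrite subSS; apply: IH.
Qed.

Lemma fin_apol_coef h : (h <= m)%N -> w (apol al)`_h <= A ^+ (m - h).
Proof.
move=> hm; rewrite /apol -(big_map al xpredT (fun x => 'X - x%:P)).
have Em : size [seq al i | i <- index_enum 'I_m] = m by rewrite size_map size_index_enum_ord.
rewrite -[in X in _ <= X]Em; apply: fin_coef_prod; last by rewrite Em.
by move=> x /mapP[i _ ->].
Qed.

Lemma fin_bpol_coef S h : (forall i, w (s i) <= S) -> 0 <= S -> (h <= m.-1)%N ->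
  w (bpol al s)`_h <= S * A ^+ (m.-1 - h).
Proof.
move=> HS S0 hm; rewrite /bpol coef_sum; apply: (fin_sum_le pw).
  by rewrite mulr_ge0 // exprn_ge0 // (le_trans ler01).
move=> i _; rewrite coefZ (finM pw) ler_pM ?(fin_ge0 pw) // (prod_other al (fun x => 'X - x%:P)).
rewrite -(card_other al i); apply: fin_coef_prod; last by rewrite card_other.
by move=> x /mapP[l _ ->].
Qed.

(** At a place dividing D, the Stokes relation for X^k is a recurrence for the moments whose leading
    coefficient k + m + u/D has absolute value 1/|D|, as u/D dominates the integer. Dividing by it
    gains |D| at each step, while the other coefficients are at most S A^(n-i). *)
Lemma fin_moment_recurrence j S : (2 <= m)%N -> (j.+1 < m)%N -> w u%:~R = 1 ->
  (forall i, w (s i) <= S) -> 1 <= S -> (w D%:R)^-1 <= S -> w D%:R < 1 ->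
  exists2 E, 1 <= E & forall n, w (moment al s j n) <= E * (S * w D%:R * A) ^+ n.
Proof.
move=> m2 jm wu HS S1 DS wD1; have A0 := le_trans ler01 A1; have S0 := le_trans ler01 S1.
have wD0 := fin_nat_gt0 pw D0.
pose d := (w D%:R)^-1; have d1 : 1 < d by rewrite invf_gt1.
have SD1 : 1 <= S * w D%:R by move: DS; rewrite -div1r ler_pdivrMr.
pose rho := S * w D%:R * A; have rho1 : 1 <= rho by rewrite mulr_ege1.
pose E := 1 + \sum_(i < m) w (moment al s j i).
have E1 : 1 <= E by rewrite lerDl sumr_ge0 // => i _; rewrite (fin_ge0 pw).
have E0 := le_trans ler01 E1.
exists E => //; elim/ltn_ind => n IH.
case: (ltnP n m.-1) => nm.
  have nm' : (n < m)%N by apply: leq_trans nm (leq_pred _).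
  rewrite (@le_trans _ _ E) // ?ler_peMr ?exprn_ege1 //.
  rewrite /E (bigD1 (Ordinal nm')) //= addrCA lerDl addr_ge0 // sumr_ge0 // => i _.
  by rewrite (fin_ge0 pw).
pose k := (n - m.-1)%N; pose G := stokes al s 'X^k.
have G0 : phi (moment al s j) G = 0 by apply: phi_stokes0 => // k'; apply: nat_neq0.
have sX : size ('X^k : {poly K}) = k.+1 by rewrite size_polyXn.
have sG : (size G <= n.+1)%N.
  by apply: leq_trans (size_stokes_le al s m2 _) _; rewrite sX /k; move: nm m2; clear; lia.
have Gn : G`_n = (k + m)%:R + u%:~R / D%:R.
  have := stokes_lead al s m2 (monic_neq0 (monicXn K k)).
  rewrite sX (_ : (k.+1 + m).-2 = n); last by rewrite /k; move: nm m2; clear; lia.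
  by rewrite /= lead_coefXn !mulr1 bmE.
have wGn : w G`_n = d.
  have Dn := nat_neq0 K D0.
  have wuD : w (u%:~R / D%:R) = d by rewrite (finM pw) (finV pw) wu mul1r.
  by rewrite Gn (fin_addl pw) wuD // (le_lt_trans (fin_nat_le1 pw _)).
rewrite (phi_wide _ sG) big_ord_recr /= in G0.
have {}G0 : G`_n * moment al s j n = - \sum_(i < n) G`_i * moment al s j i.
  by apply/eqP; rewrite -addr_eq0 addrC; apply/eqP.
have dn0 : 0 < d by exact: lt_trans d1.
rewrite -(ler_pM2l dn0) -wGn -(finM pw) G0 (finN pw).
have -> : w G`_n * (E * (S * w D%:R * A) ^+ n) = E * (d * rho ^+ n) by rewrite wGn mulrCA.
have dr : 0 <= d * rho ^+ n by rewrite mulr_ge0 ?exprn_ge0 // ltW // (lt_le_trans ltr01).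
apply: (fin_sum_le pw) => [|i _]; first exact: mulr_ge0.
have i_n := ltn_ord i.
rewrite (finM pw); apply: (@le_trans _ _ ((S * A ^+ (n - i)) * (E * rho ^+ i))).
  apply: ler_pM; rewrite ?(fin_ge0 pw) //; last exact: IH.
  rewrite /G /stokes coefD coef_deriv; apply: (fin_le_add pw).
    rewrite -mulr_natl (finM pw) ler_pM ?(fin_ge0 pw) ?(le_trans (fin_nat_le1 pw _)) //.
    rewrite coefMXn; case: ifP => ik; first by rewrite (fin0 pw) exprn_ge0.
    have -> : (n - i = m - (i.+1 - k))%N by move: ik i_n nm m2; rewrite /k; clear; lia.
    by apply: fin_apol_coef; move: ik i_n nm m2; rewrite /k; clear; lia.
  rewrite coefMXn; case: ifP => ik; first by rewrite (fin0 pw) mulr_ge0 // exprn_ge0.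
  have -> : (n - i = m.-1 - (i - k))%N by move: ik i_n nm m2; rewrite /k; clear; lia.
  by apply: fin_bpol_coef => //; move: ik i_n nm m2; rewrite /k; clear; lia.
rewrite mulrCA ler_wpM2l //.
have -> : d * rho ^+ n = S * (S * w D%:R) ^+ n.-1 * A ^+ n.
  rewrite /rho exprMn mulrA; congr (_ * _); rewrite -{1}(ltn_predK i_n).
  by rewrite exprS /d mulrA; congr (_ * _); field; rewrite gt_eqF.
have -> : S * A ^+ (n - i) * rho ^+ i = S * (S * w D%:R) ^+ i * A ^+ n.
  have -> : A ^+ n = A ^+ (n - i) * A ^+ i by rewrite -exprD subnK // ltnW.
  by rewrite /rho exprMn; ring.
rewrite ler_wpM2r ?exprn_ge0 // ler_wpM2l ?exprn_ge0 //; apply: ler_weXn2l => //; move: i_n; clear; lia.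
Qed.

End FiniteMoment.

(** * Least common multiples of arithmetic progressions *)

Section Primorial.
Local Open Scope nat_scope.

Lemma prod_primes_dvd (r : seq nat) N : uniq r -> all prime r -> {in r, forall p, p %| N} ->
  \prod_(p <- r) p %| N.
Proof.
elim: r => [|p r IH] /=; first by rewrite big_nil dvd1n.
move=> /andP[pr ur] /andP[pp ar] H; rewrite big_cons Gauss_dvd.
  by rewrite H ?mem_head //= IH // => q qr; rewrite H // inE qr orbT.
rewrite big_seq; elim/big_ind: _ => [|x y cx cy|q qr]; first exact: coprimen1.
  by rewrite coprimeMr cx.
rewrite prime_coprime // dvdn_prime2 ?(allP ar _ qr) //.
by apply: contra pr => /eqP E; rewrite E.
Qed.

Lemma prime_dvd_fact p n : prime p -> p %| n`! -> p <= n.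
Proof.
move=> pp; elim: n => [|n IH]; first by rewrite fact0 dvdn1 => /eqP p1; rewrite p1 in pp.
rewrite factS Euclid_dvdM // => /orP[/dvdn_leq -> //|/IH h].
exact: leq_trans h _.
Qed.

Definition primorial n := \prod_(0 <= p < n.+1 | prime p) p.

(** The two equal middle coefficients both occur in the expansion of 2^(2k+1). *)
Lemma central_bin_le k : 'C(k.*2.+1, k) <= 4 ^ k.
Proof.
have H : 2 * 'C(k.*2.+1, k) <= 2 ^ k.*2.+1.
  rewrite -[2 ^ _]/((1 + 1) ^ k.*2.+1) expnDn.
  have k1 : k < k.*2.+2 by lia.
  have k2 : k.+1 < k.*2.+2 by lia.
  rewrite (bigD1 (Ordinal k1)) //= (bigD1 (Ordinal k2)) /=; last by rewrite -val_eqE /=; lia.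
  rewrite !exp1n !muln1 mul2n -addnn leq_add2l.
  have -> : 'C(k.*2.+1, k) = 'C(k.*2.+1, k.+1).
    by rewrite -bin_sub; [congr ('C(_, _)); lia|lia].
  exact: leq_addr.
by move: H; rewrite expnS leq_pmul2l // -muln2 mulnC expnM.
Qed.

(** Erdos's induction: for n = 2k + 1 the primes in (k + 1, 2k + 1] divide the middle binomial
    coefficient, and an even n > 2 adds no prime. *)
Lemma primorial_le n : primorial n <= 4 ^ n.
Proof.
elim/ltn_ind: n => -[|[|[|n]]] IH.
- by rewrite /primorial big_mkcond /= !big_nat_recl // big_geq.
- by rewrite /primorial big_mkcond /= !big_nat_recl // big_geq.
- by rewrite /primorial big_mkcond /= !big_nat_recl // big_geq.
case: (boolP (odd n.+3)) => on; last first.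
  rewrite /primorial big_mkcond big_nat_recr //= -big_mkcond /=.
  rewrite ifN ?muln1; last first.
    by apply/negP => pp; have := odd_prime_gt2 (p := n.+3); have := even_prime pp; case; [lia|move=> h; rewrite h in on].
  by rewrite (leq_trans (IH n.+2 (ltnSn _))) // leq_exp2l.
pose k := n.+3./2; have Ek : n.+3 = k.*2.+1 by rewrite -[LHS]odd_double_half on.
have kn : k.+1 < n.+3 by move: Ek; clear; lia.
rewrite /primorial (@big_cat_nat _ _ _ k.+2) //=; last by lia.
rewrite Ek (_ : 4 ^ k.*2.+1 = 4 ^ k.+1 * 4 ^ k); last by rewrite -expnD; congr (_ ^ _); lia.
apply: leq_mul; first exact: IH.
apply: leq_trans (central_bin_le k).
apply: dvdn_leq; first by rewrite bin_gt0; lia.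
rewrite -big_filter; apply: prod_primes_dvd.
- by rewrite filter_uniq // iota_uniq.
- exact: filter_all.
- move=> p; rewrite mem_filter mem_index_iota => /andP[pp /andP[p1 p2]].
  have : p %| (k.*2.+1)`! by rewrite dvdn_fact // prime_gt0 //=; lia.
  rewrite -(@bin_fact k.*2.+1 k); last by lia.
  rewrite Euclid_dvdM // => /orP[//|]; rewrite Euclid_dvdM // => /orP[] h; have := prime_dvd_fact pp h; move: p1; clear; lia.
Qed.

End Primorial.

Section LcmProgression.
Variables (R : realType) (u : int) (D : nat).
Hypothesis D0 : (0 < D)%N.
Hypothesis cuD : coprime `|u| D.
Let r (k : nat) : nat := `|(u + D%:Z * k%:Z)%R|%N.
Hypothesis r0 : forall k, (2 <= k)%N -> (0 < r k)%N.

(** The range starts at 2: the terms k = 0 and k = 1 do not occur in the moments, and they may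
    vanish, as b_{m-1} = 0 and b_{m-1} = -1 are allowed. *)
Definition lcm_progression n := \big[lcmn/1%N]_(2 <= k < n.+1) `|(u + D%:Z * k%:Z)%R|%N.

Lemma lcm_progression_gt0 n : (0 < lcm_progression n)%N.
Proof.
rewrite /lcm_progression big_seq; elim/big_ind: _ => // [x y x0 y0|k].
  by rewrite lcmn_gt0 x0.
by rewrite mem_index_iota => /andP[k2 _]; apply: r0.
Qed.

Lemma dvdn_lcm_progression n k : (2 <= k <= n)%N -> (r k %| lcm_progression n)%N.
Proof.
move=> kn; rewrite /lcm_progression (big_rem k) /= ?dvdn_lcml // mem_index_iota ltnS.
exact: kn.
Qed.

Lemma logn_lcm_progression p n : (logn p (lcm_progression n) = 0)%N \/
  exists2 k, (2 <= k <= n)%N & logn p (lcm_progression n) = logn p (r k).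
Proof.
rewrite /lcm_progression -(big_map r xpredT id).
have : all (fun x => [exists k : 'I_n.+1, (2 <= k)%N && (x == r k)]) [seq r k | k <- index_iota 2 n.+1].
  apply/allP => x /mapP[k]; rewrite mem_index_iota => /andP[k2 kn] ->.
  by apply/existsP; exists (Ordinal kn); rewrite /= k2 eqxx.
elim: [seq r k | k <- index_iota 2 n.+1] => [|x l IH] /=; first by rewrite big_nil logn1; left.
move=> /andP[/existsP[k /andP[k2 /eqP ->]] al]; rewrite big_cons.
have kn : (2 <= k <= n)%N by rewrite k2 -ltnS ltn_ord.
have l0 : (0 < \big[lcmn/1%N]_(i <- l) i)%N.
  rewrite big_seq; elim/big_ind: _ => // [y z y0 z0|y yl]; first by rewrite lcmn_gt0 y0.
  by have /existsP[k' /andP[k'2 /eqP ->]] := allP al _ yl; apply: r0.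
rewrite logn_lcm ?r0 // /maxn; case: ltnP => h; last by right; exists k.
by case: (IH al) => [E|[k' ? E]]; [left|right; exists k'].
Qed.

Lemma ln_nat_logn N B : (0 < N)%N -> (N < B)%N ->
  ln (N%:R : R) = \sum_(0 <= p < B) (logn p N)%:R * ln p%:R.
Proof.
move=> N0 NB; rewrite (@big_cat_nat _ _ _ N.+1) //= [X in _ + X]big_nat_cond [X in _ + X]big1 ?addr0.
  rewrite -{1}(partnT N0) /partn natr_prod ln_prod => [|p _].
    apply: eq_bigr => p _; case: (posnP p) => [->|p0]; first by rewrite lognE expn0 ln1 mul0r.
    by rewrite natrX lnXn ?ltr0n // mulr_natl.
  by rewrite ltr0n; case: p => [|p]; rewrite ?expn_gt0 // lognE.
move=> p /andP[/andP[Np _] _]; rewrite lognE; case: ifP => [/and3P[_ _ /(dvdn_leq N0)]|_]; last by rewrite mul0r.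
by rewrite leqNgt Np.
Qed.

Lemma sum_below k B (f : nat -> R) : (k <= B)%N ->
  \sum_(0 <= p < B) (if (p < k)%N then f p else 0) = \sum_(0 <= p < k) f p.
Proof.
move=> kB; rewrite (@big_cat_nat _ _ _ k) //= [X in _ + X]big_nat_cond [X in _ + X]big1 ?addr0.
  by rewrite !big_mkord; apply: eq_bigr => i _; rewrite ltn_ord.
by move=> p /andP[/andP[kp _] _]; rewrite ltnNge kp.
Qed.

Lemma ln_nat_ge0 N : 0 <= ln (N%:R : R).
Proof. by case: N => [|N]; [rewrite ln0|rewrite ln_ge0 // ler1n]. Qed.

Definition ln_mu (q : nat) : R := ln q%:R + \sum_(p <- primes q) ln p%:R / (p%:R - 1).

Lemma logn_r_le p k : (r k > 0)%N -> (logn p (r k))%:R * ln p%:R <= ln ((r k)%:R : R).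
Proof.
move=> rk; case: (posnP p) => [->|p0]; first by rewrite lognE mul0r ln_nat_ge0.
rewrite mulr_natl -lnXn ?ltr0n // -natrX ler_ln ?posrE ?ltr0n ?expn_gt0 ?p0 // ler_nat.
by apply: dvdn_leq => //; apply: pfactor_dvdnn.
Qed.

Let U := `|u|%N.

Lemma progression_term_le k : (r k <= D * (k + U))%N.
Proof. by rewrite /r /U; nia. Qed.

(** Chebyshev's method in three ranges. A prime p <= s contributes at most the logarithm of the
    largest term, whose square root is below s + 1. For s < p <= n the exponent is at most 1, as p^2
    exceeds every term, and the primorial gives n ln 4. Primes above n are counted in the product P
    of all terms, from which the part of (n - 1)! prime to D is removed. *)
Lemma ln_lcm_progression_le n s : (2 <= n)%N -> (D * (n + U) < s.+1 ^ 2)%N ->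
  ln ((lcm_progression n)%:R : R) <= s.+1%:R * ln (D * (n + U))%:R + n%:R * ln 4
    + U.+1%:R * ln (n + U)%:R + n%:R * ln_mu D.
Proof.
move=> n2 Hs; set L := lcm_progression n; set H := (D * (n + U))%N; pose J := n.-1.
pose P := (\prod_(i < J) r i.+2)%N.
have P0 : (0 < P)%N by rewrite /P; apply: prodn_gt0 => i; apply: r0.
have L0 : (0 < L)%N by exact: lcm_progression_gt0.
pose B := (L + P + J`! + n + s + D).+1.
have LB : (L < B)%N by rewrite /B; lia.
have PB : (P < B)%N by rewrite /B; lia.
have JB : (J`! < B)%N by rewrite /B; lia.
have rP k : (2 <= k <= n)%N -> (r k %| P)%N.
  move=> kn; have kJ : (k.-2 < J)%N by rewrite /J; lia.
  rewrite /P (bigD1 (Ordinal kJ)) //= (_ : k.-2.+2 = k) ?dvdn_mulr //; lia.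
have rH k : (2 <= k <= n)%N -> (r k <= H)%N.
  by move=> /andP[_ kn]; rewrite (leq_trans (progression_term_le k)) // /H leq_mul2l leq_add2r kn orbT.
have lnH0 : 0 <= ln (H%:R : R) by exact: ln_nat_ge0.
have LP p : (logn p L <= logn p P)%N.
  case: (logn_lcm_progression p n) => [->//|[k kn ->]].
  by apply: dvdn_leq_log => //; apply: rP.
have JP p : prime p -> ~~ (p %| D)%N -> (logn p J`! <= logn p P)%N.
  move=> pp pD; rewrite -pfactor_dvdn //.
  have cp : coprimez p D%:Z by rewrite coprimezE /= prime_coprime.
  have := dvdz_prod_progression (u + D%:Z * 2) J pp cp.
  rewrite dvdzE abszX /= (big_morph absz abszM (erefl _)).
  suff -> : (\prod_(i < J) `|(u + D%:Z * 2 + D%:Z * i%:Z)%R| = P)%N by [].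
  apply: eq_bigr => i _; rewrite /r; congr absz.
  by rewrite -addrA -mulrDr -PoszD add2n.
(* The excess of P over J!, nonnegative because J! divides P away from D. Its total is about n ln
   mu(D): P is about D^n J!, and each p dividing D accounts for at most n ln p / (p - 1) in ln
   J!. *)
pose F p := (logn p P)%:R * ln p%:R - (if (p %| D)%N then 0 else (logn p J`!)%:R * ln p%:R) : R.
have F0 p : 0 <= F p.
  rewrite /F; case: ifP => pD; first by rewrite subr0 mulr_ge0 // ln_nat_ge0.
  rewrite -mulrBl mulr_ge0 ?ln_nat_ge0 // subr_ge0 ler_nat.
  case: (boolP (prime p)) => pp; first by rewrite JP // pD.
  by rewrite lognE (negPf pp).
have pointwise p : (logn p L)%:R * ln p%:R <=
    (if (p < s.+1)%N then ln H%:R else 0) + (if (p < n.+1)%N && prime p then ln p%:R else 0) + F p.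
  case: (boolP (prime p)) => pp; last first.
    rewrite lognE (negPf pp) mul0r andbF addr0 addr_ge0 //; by case: ifP.
  have lnp : 0 <= ln (p%:R : R) by exact: ln_nat_ge0.
  case: ltnP => ps.
    rewrite -addrA ler_wpDr //; first by rewrite addr_ge0 //; case: ifP.
    case: (logn_lcm_progression p n) => [->|[k kn ->]]; first by rewrite mul0r.
    have rk : (0 < r k)%N by apply: r0; case/andP: kn.
    rewrite (le_trans (logn_r_le p rk)) // ler_ln ?posrE ?ltr0n ?ler_nat ?rH //.
    by rewrite (leq_trans rk) // rH.
  rewrite add0r andbT; case: ltnP => pn.
    rewrite ler_wpDr // ler_piMl // lern1.
    case: (logn_lcm_progression p n) => [->//|[k kn ->]].
    rewrite leqNgt; apply/negP => h.
    have rk : (0 < r k)%N by apply: r0; case/andP: kn.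
    have : (p ^ 2 <= H)%N.
      by apply: leq_trans (rH k kn); apply: dvdn_leq => //; rewrite pfactor_dvdn.
    rewrite leqNgt (leq_trans Hs) // leq_exp2r //.
  rewrite add0r /F; have -> : logn p J`! = 0%N.
    rewrite lognE pp fact_gt0 /=; case: ifP => // /(prime_dvd_fact pp).
    by move: pn; rewrite /J; clear; lia.
  by rewrite mul0r if_same subr0 ler_wpM2r // ler_nat.
rewrite (ln_nat_logn L0 LB).
apply: (@le_trans _ _ (\sum_(0 <= p < B) ((if (p < s.+1)%N then ln H%:R else 0) +
   (if (p < n.+1)%N && prime p then ln p%:R else 0) + F p))).
  by apply: ler_sum => p _; apply: pointwise.
rewrite 2!big_split /=.
have -> : \sum_(0 <= p < B) F p = \sum_(0 <= p < B) (logn p P)%:R * ln p%:R -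
    \sum_(0 <= p < B) (if (p %| D)%N then 0 else (logn p J`!)%:R * ln p%:R).
  by rewrite -sumrB.
rewrite (@sum_below s.+1 B (fun=> ln (H%:R : R))); last by rewrite /B; lia.
rewrite sumr_const_nat subn0 -[_ *+ s.+1]mulr_natl.
have S2 : \sum_(0 <= p < B) (if (p < n.+1)%N && prime p then ln p%:R else 0) <= n%:R * ln (4 : R).
  rewrite (eq_bigr (fun p => if (p < n.+1)%N then (if prime p then ln (p%:R : R) else 0) else 0)); last first.
    by move=> p _; case: ltnP.
  rewrite sum_below; last by rewrite /B; lia.
  rewrite -big_mkcond -big_filter -ln_prod; last first.
    by move=> p; rewrite mem_filter => /andP[pp _]; rewrite ltr0n prime_gt0.
  rewrite big_filter -natr_prod mulr_natl -lnXn // -natrX.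
  have := primorial_le n; rewrite /primorial => h.
  rewrite ler_ln ?posrE ?ltr0n ?expn_gt0 ?ler_nat // prodn_cond_gt0 // => p pp; exact: prime_gt0.
rewrite -(ln_nat_logn P0 PB).
have S3 : ln (J`!)%:R - n%:R * \sum_(p <- primes D) ln p%:R / (p%:R - 1) <=
   \sum_(0 <= p < B) (if (p %| D)%N then 0 else (logn p J`!)%:R * ln p%:R) :> R.
  rewrite (ln_nat_logn (fact_gt0 J) JB) lerBlDr.
  have -> : \sum_(p <- primes D) ln (p%:R : R) / (p%:R - 1) =
      \sum_(0 <= p < B | p \in primes D) ln p%:R / (p%:R - 1).
    rewrite -[RHS]big_filter; apply: perm_big; apply: uniq_perm; rewrite ?primes_uniq ?filter_uniq ?iota_uniq //.
    move=> p; rewrite mem_filter mem_index_iota; case: (boolP (p \in primes D)) => // pD.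
    rewrite mem_primes in pD; case/and3P: pD => _ _ /(dvdn_leq D0).
    by rewrite /B /=; move=> h; symmetry; apply/idP; lia.
  rewrite mulr_sumr [X in _ + X]big_mkcond -big_split /=; apply: ler_sum => p _.
  case: (boolP (prime p)) => pp; last first.
    by rewrite lognE (negPf pp) !mul0r if_same add0r mem_primes (negPf pp).
  have lnp : 0 <= ln (p%:R : R) by exact: ln_nat_ge0.
  rewrite mem_primes pp D0 /=; case: ifP => pD; last by rewrite addr0.
  rewrite add0r mulrCA [leLHS]mulrC ler_wpM2l //.
  have p1 : (1 : R) < p%:R by rewrite ltr1n prime_gt1.
  rewrite ler_pdivlMr ?subr_gt0 //.
  have -> : p%:R - 1 = p.-1%:R :> R by rewrite -subn1 natrB ?prime_gt0.
  rewrite -natrM ler_nat mulnC (leq_trans (logn_fact_le J pp)) // /J; exact: leq_pred.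
have S4 : ln P%:R <= n%:R * ln D%:R + ln (J`!)%:R + U.+1%:R * ln (n + U)%:R :> R.
  have PQ : (P <= D ^ n * (J`! * (n + U) ^ U.+1))%N.
    have h1 (k : nat) : (\prod_(i < k) r i.+2 <= D ^ k * (k + U.+1)`!)%N.
      elim: k => [|k IH]; first by rewrite big_ord0 expn0 mul1n fact_gt0.
      rewrite big_ord_recr /= expnSr addSn factS.
      have -> : (D ^ k * D * ((k + U.+1).+1 * (k + U.+1)`!) = D ^ k * (k + U.+1)`! * (D * (k + U.+1).+1))%N by ring.
      apply: leq_mul => //; apply: leq_trans (progression_term_le _) _; rewrite leq_mul2l; apply/orP; right; lia.
    have h2 (t : nat) : ((J + t)`! <= J`! * (J + t) ^ t)%N.
      elim: t => [|t IH]; first by rewrite addn0 expn0 muln1.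
      rewrite addnS factS expnS mulnCA leq_mul2l /=; apply: (leq_trans IH).
      by case: t {IH} => [|t]; rewrite ?expn0 // leq_mul2l leq_exp2r // leqnSn orbT.
    apply: (leq_trans (h1 J)); apply: leq_mul.
      by case: (posnP D) D0 => // _ _; rewrite leq_pexp2l // /J leq_pred.
    have := h2 U.+1; rewrite (_ : (J + U.+1 = n + U)%N) //; move: n2; rewrite /J; clear; lia.
  have pos : (0 < D ^ n * (J`! * (n + U) ^ U.+1))%N.
    by rewrite !muln_gt0 !expn_gt0 D0 fact_gt0 addn_gt0 (ltnW n2).
  apply: (@le_trans _ _ (ln (D ^ n * (J`! * (n + U) ^ U.+1))%:R)).
    by rewrite ler_ln ?posrE ?ltr0n // ler_nat.
  have Dr : (0 : R) < D%:R by rewrite ltr0n.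
  have Jr : (0 : R) < J`!%:R by rewrite ltr0n fact_gt0.
  have nr : (0 : R) < (n + U)%:R by rewrite ltr0n addn_gt0 (ltnW n2).
  rewrite !natrM !natrX !lnM ?posrE ?mulr_gt0 ?exprn_gt0 // !lnXn // -[_ *+ n]mulr_natl -[_ *+ U.+1]mulr_natl.
  by rewrite addrA.
rewrite /ln_mu; move: S2 S3 S4; rewrite mulrDr; set a := \sum_(0 <= p < B) _; set b := \sum_(0 <= p < B) _.
lra.
Qed.

Lemma ln_le_linear (e : R) : 0 < e -> exists C, forall x : R, 0 < x -> ln x <= C + e * x.
Proof.
move=> e0; exists (- ln e) => x x0.
have := le_ln1Dx (x := e * x - 1); rewrite addrCA subrr addr0 lnM ?posrE // => h.
have : ln e + ln x <= e * x - 1 by apply: h; rewrite ltrBrDl subrr mulr_gt0.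
by lra.
Qed.

(** With t = H^(1/4) the error term (s + 1) ln H is at most 2 t^2 times 4 t, hence o(t^4) = o(H),
    and H is linear in n. The other error term is a multiple of a logarithm. *)
Lemma ln_lcm_progression_asymptotic (e : R) : 0 < e -> exists C, forall n, (2 <= n)%N ->
  ln ((lcm_progression n)%:R : R) <= C + n%:R * (ln 4 + ln_mu D + e).
Proof.
move=> e0; pose c := D%:R : R; have c0 : 0 < c by rewrite ltr0n.
have c1 : 1 <= c by rewrite ler1n.
pose e1 := e / (2 * c).
have e10 : 0 < e1 by rewrite divr_gt0 // mulr_gt0.
pose e2 := e / (2 * U.+1%:R).
have U0 : (0 : R) < U.+1%:R by rewrite ltr0n.
have e20 : 0 < e2 by rewrite divr_gt0 // mulr_gt0.
have [C1 HC1] := ln_le_linear e20.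
have H3 (t : R) : 1 <= t -> 8 * t ^+ 3 <= 8 * (8 / e1) ^+ 3 + e1 * t ^+ 4.
  move=> t1; have t0 : 0 <= t by exact: le_trans t1.
  have k0 : 0 <= 8 / e1 by rewrite divr_ge0 // ltW.
  case: (lerP t (8 / e1)) => h.
    apply: (@le_trans _ _ (8 * (8 / e1) ^+ 3)); first by rewrite ler_wpM2l // lerXn2r ?nnegrE.
    by rewrite lerDl mulr_ge0 ?exprn_ge0 // ltW.
  apply: (@le_trans _ _ (e1 * t ^+ 4)); last by rewrite lerDr mulr_ge0 // exprn_ge0.
  rewrite [t ^+ 4]exprS mulrA; apply: ler_wpM2r; first exact: exprn_ge0.
  by rewrite ltr_pdivrMr // in h; rewrite mulrC ltW.
exists (8 * (8 / e1) ^+ 3 + e1 * (c * U%:R) + U.+1%:R * (C1 + e2 * U%:R)) => n n2.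
pose H := (D * (n + U))%N.
have H1 : (0 < H)%N by rewrite /H muln_gt0 D0 addn_gt0 (ltnW n2).
have [s /andP[sH Hs]] : exists s : nat, (s ^ 2 <= H < s.+1 ^ 2)%N.
  have ex : exists s : nat, (s ^ 2 <= H)%N by exists 0%N.
  have ub s : (s ^ 2 <= H)%N -> (s <= H)%N by move=> h; apply: leq_trans h; case: s => // s; apply: leq_pmulr.
  case: (ex_maxnP ex ub) => s sH smax; exists s; rewrite sH /= ltnNge; apply/negP => /smax.
  by rewrite ltnn.
apply: (le_trans (ln_lcm_progression_le n2 Hs)); rewrite -/H.
have h2 : U.+1%:R * ln ((n + U)%:R : R) <= U.+1%:R * (C1 + e2 * U%:R) + n%:R * (e / 2).
  have -> : e / 2 = U.+1%:R * e2 by rewrite /e2; field; rewrite nat1r pnatr_eq0.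
  rewrite [n%:R * _]mulrCA -mulrDr ler_wpM2l ?(ltW U0) //.
  have : (0 : R) < (n + U)%:R by rewrite ltr0n addn_gt0 (ltnW n2).
  move=> /HC1; have -> : e2 * (n + U)%:R = n%:R * e2 + e2 * U%:R by rewrite natrD; ring.
  by rewrite [n%:R * e2 + _]addrC addrA.
have h1 : s.+1%:R * ln (H%:R : R) <= 8 * (8 / e1) ^+ 3 + e1 * (c * U%:R) + n%:R * (e / 2).
  pose t := Num.sqrt (Num.sqrt (H%:R : R)).
  have HR : (1 : R) <= H%:R by rewrite ler1n.
  have t4 : t ^+ 4 = H%:R by rewrite (exprM t 2 2) /t !sqr_sqrtr ?sqrtr_ge0 ?ler0n.
  have t1 : 1 <= t by rewrite /t -[leLHS]sqrtr1 ler_wsqrtr // -[leLHS]sqrtr1 ler_wsqrtr.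
  have t0 : 0 < t by exact: lt_le_trans t1.
  have st : s%:R <= t ^+ 2.
    rewrite -(ler_pXn2r (n := 2)) ?nnegrE ?exprn_ge0 ?(ltW t0) // -exprM t4 -natrX ler_nat.
    by [].
  have lnt : ln (H%:R : R) <= 4 * t.
    rewrite -t4 lnXn // -[_ *+ 4]mulr_natl ler_wpM2l //.
    have := @le_ln1Dx R (t - 1); rewrite addrCA subrr addr0 => h.
    by rewrite (le_trans (h _)) ?ltrBrDr ?addNr // lerBlDr lerDl.
  apply: (@le_trans _ _ (8 * t ^+ 3)).
    have : s.+1%:R <= 2 * t ^+ 2.
      by rewrite -natr1 [2]mulr2n mulrDl mul1r lerD // exprn_ege1.
    have lnH0 : 0 <= ln (H%:R : R) by exact: ln_nat_ge0.
    move=> s2; apply: (@le_trans _ _ (2 * t ^+ 2 * (4 * t))).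
      by apply: ler_pM.
    by rewrite le_eqVlt; apply/orP; left; apply/eqP; ring.
  apply: (le_trans (H3 t t1)); rewrite t4 /H natrM natrD -/c.
  have -> : n%:R * (e / 2) = e1 * (c * n%:R) by rewrite /e1; field; rewrite gt_eqF.
  by rewrite mulrDr mulrDr; lra.
rewrite !mulrDr; lra.
Qed.

End LcmProgression.

(** * Linear forms and their remainders *)

Section LinearForm.
Variables (F : fieldType) (m : nat) (al s : 'I_m -> F) (beta lam0 : F) (lam : 'I_m.-1 -> F).

(** The number x_{n,l}: in the supposed relation 1 becomes P(beta) and f_j(beta) becomes the value
    at beta of the companion polynomial of P, encoded by [dseq]. *)
Definition pade_form n l : F := lam0 * (pade al s n l).[beta] +
  \sum_j lam j * phi (dseq (moment al s j) beta) (pade al s n l).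

Lemma horner_phi (P : {poly F}) x : P.[x] = phi (fun i => x ^+ i) P.
Proof. by rewrite horner_coef. Qed.

Variables (R : realType) (N : F -> R) (ult : bool).
Hypothesis aN : absval N.
Hypothesis Nult : ult -> forall x y, N (x + y) <= Num.max (N x) (N y).
Hypothesis charF : forall n, n.+1%:R != 0 :> F.
Hypothesis m2 : (2 <= m)%N.
Hypothesis al_inj : injective al.
Hypothesis s_neq : forall i n, s i != - (n.+1)%:R.
Hypothesis bm_neq : forall n, \sum_i s i != - (n.+2)%:R.

Lemma absval_add x y c : 0 <= c -> N x <= c -> N y <= c -> N (x + y) <= kap R ult 2 * c.
Proof.
move=> c0 xc yc; have -> : x + y = \sum_(i < 2) [:: x; y]`_i by rewrite !big_ord_recr big_ord0 /= add0r.
by apply: absval_sum => // -[[|[|//]] i2].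
Qed.

Lemma pade_form_bound n l (B X C c p : R) : (l < m)%N -> 1 <= B -> N beta <= B -> 1 <= X -> 1 <= C ->
  0 <= p -> 0 <= c -> N lam0 <= c -> (forall j, N (lam j) <= c) ->
  pbound N B (pade al s n l) p ->
  (forall j h, (j.+1 < m)%N -> (h <= n * m.-1 + m)%N -> N (moment al s j h) <= C * X ^+ h) ->
  N (pade_form n l) <= kap R ult 2 * (kap R ult m *
     (c * (kap R ult (n * m.-1 + m) * C * X ^+ (n * m.-1 + m) * p))).
Proof.
move=> lm B1 bB X1 C1 p0 c0 l0c lc HP Hmom; set k := (n * m.-1 + m)%N.
have km : (0 < k)%N by rewrite addn_gt0 (ltnW m2) orbT.
have szP : (size (pade al s n l) <= k)%N by rewrite size_pade // -addnS leq_add2l.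
have K1 : 1 <= kap R ult k by move: (kapS_ge1 R ult k.-1); rewrite prednK.
have M1 : 1 <= kap R ult m by move: (kapS_ge1 R ult m.-1); rewrite prednK // ltnW.
have C0 := le_trans ler01 C1; have X0 := le_trans ler01 X1; have K0 := le_trans ler01 K1.
have XK1 : 1 <= kap R ult k * C * X ^+ k by rewrite !mulr_ege1 // exprn_ege1.
have T0 : 0 <= c * (kap R ult k * C * X ^+ k * p) by rewrite !mulr_ge0 // exprn_ge0.
have N0 := absval_ge0 aN.
apply: absval_add; first by rewrite mulr_ge0 // (le_trans ler01).
  rewrite absvalM //; apply: (@le_trans _ _ (c * (kap R ult k * C * X ^+ k * p))); last by rewrite ler_peMl.
  apply: ler_pM => //; rewrite horner_phi (@le_trans _ _ (1 * p)) //; last by rewrite ler_wpM2r.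
  apply: HP => // i; rewrite mul1r absvalX // lerXn2r ?nnegrE //.
  exact: le_trans ler01 B1.
apply: (@le_trans _ _ (kap R ult m.-1 * (c * (kap R ult k * C * X ^+ k * p)))); last first.
  by rewrite ler_wpM2r // kap_le // leq_pred.
apply: absval_sum => // j; rewrite absvalM //; apply: ler_pM => //.
have jm : (j.+1 < m)%N by have := ltn_ord j; rewrite -ltnS prednK // ltnW.
apply: (pboundW aN B1 HP) => [|i iP]; first by rewrite !mulr_ge0 // exprn_ge0.
have ik : (i <= k)%N by exact: ltnW (leq_trans iP szP).
apply: (@le_trans _ _ (kap R ult i * C * X ^+ i * B ^+ i)).
  by apply: (dseq_bound aN Nult B1) => // h hi; apply: Hmom => //; exact: leq_trans (ltnW hi) ik.
rewrite ler_wpM2r ?exprn_ge0 // ?(le_trans ler01 B1) //.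
apply: ler_pM; rewrite ?mulr_ge0 ?exprn_ge0 ?kap_ge0 //; last by rewrite ler_weXn2l.
by rewrite ler_wpM2r // kap_le.
Qed.

(** By [phi_pade] only C(n + i, n) phi(X^(i+l) a^n) has to be bounded; the binomial coefficient
    costs 2^(n+i) at an archimedean place and nothing at a finite one. *)
Lemma remainder_coef_bound n l i j (A : 'I_m -> R) (X E : R) : (j.+1 < m)%N ->
  1 <= X -> 0 <= E -> (forall h, 1 <= A h) -> (forall h, N (al h) <= A h) ->
  (forall k, N k%:R <= k%:R) -> (ult -> forall k, N k%:R <= 1) ->
  (forall h, N (moment al s j h) <= E * X ^+ h) ->
  N (phi (moment al s j) ('X^(n + i) * pade al s n l)) <=
  kap R ult 2 ^+ (n + i) * (E * X ^+ (i + l) * (kap R ult 2 * X * cofactor_bound ult X A) ^+ n).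
Proof.
move=> jm X1 E0 A1 alA Nnat Nnat1 Hmom; have X0 := le_trans ler01 X1.
rewrite phi_pade // !(absvalM aN) (absvalX aN) (absvalN aN) (absval1 aN) expr1n mul1r.
have B0 : 0 <= cofactor_bound ult X A by rewrite (le_trans ler01) // cofactor_bound_ge1.
have ap : pbound N X (apol al ^+ n) ((kap R ult 2 * X * cofactor_bound ult X A) ^+ n).
  apply: (pboundXn aN X1); first by apply: mulr_ge0 => //; apply: mulr_ge0 => //; apply: kap_ge0.
  exact: (pbound_apol aN Nult X1 m2 A1 alA).
apply: ler_pM; rewrite ?(absval_ge0 aN) //.
  have := kapS_ge1 R ult 1; rewrite /kap; move: Nnat1; case: ult => [/(_ isT) H|_] _.
    by rewrite expr1n.
  rewrite (le_trans (Nnat _)) // -natrX ler_nat.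
  rewrite -[(2 ^ _)%N]/((1 + 1) ^ (n + i))%N expnDn.
  have ni : (n < (n + i).+1)%N by rewrite ltnS leq_addr.
  by rewrite (bigD1 (Ordinal ni)) //= !exp1n !muln1 leq_addr.
rewrite addKn phi_mul.
have -> : phi (fun i0 => phi (fun h => moment al s j (i0 + h)%N) (apol al ^+ n)) 'X^(i + l) =
  phi (fun h => moment al s j (i + l + h)%N) (apol al ^+ n) by rewrite phiXn.
apply: ap => [|h]; first by rewrite mulr_ge0 // exprn_ge0.
by rewrite -mulrA -exprD; apply: Hmom.
Qed.

End LinearForm.

Section GeometricSeries.
Variables (R : realType) (F : fieldType) (N : F -> R).
Hypothesis aN : absval N.
Variables (t : nat -> F) (E q : R).
Hypothesis E0 : 0 <= E.
Hypothesis q01 : 0 < q < 1.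

Lemma absval_le_sum (I : Type) (r : seq I) (P : pred I) (f : I -> F) :
  N (\sum_(i <- r | P i) f i) <= \sum_(i <- r | P i) N (f i).
Proof.
elim/big_rec2: _ => [|i y x _ h]; first by rewrite absval0.
by rewrite (le_trans (absval_le_add aN _ _)) // lerD2l.
Qed.

Lemma geometric_partial_le k : \sum_(i < k) q ^+ i <= (1 - q)^-1.
Proof.
case/andP: q01 => q0 q1; have p : 0 < 1 - q by rewrite subr_gt0.
rewrite -[leRHS]mul1r ler_pdivlMr // mulrC -opprB mulNr -subrX1 opprB lerBlDr lerDl.
by rewrite exprn_ge0 // ltW.
Qed.

Lemma geometric_tail n0 a b : (forall k, (n0 <= k)%N -> N (t k) <= E * q ^+ (k - n0)) ->
  (n0 <= a)%N -> (a <= b)%N -> N (\sum_(a <= k < b) t k) <= E / (1 - q) * q ^+ (a - n0).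
Proof.
move=> Ht na ab; case/andP: q01 => q0 q1; have p : 0 < 1 - q by rewrite subr_gt0.
rewrite (le_trans (absval_le_sum _ _ _)) //.
apply: (@le_trans _ _ (\sum_(a <= k < b) E * q ^+ (k - n0))).
  by apply: ler_sum_nat => k /andP[ak _]; apply: Ht; apply: leq_trans ak.
rewrite -{1}[a]add0n big_addn big_mkord.
rewrite (eq_bigr (fun k : 'I_(b - a) => E * q ^+ (a - n0) * q ^+ k)); last first.
  by move=> k _; rewrite -mulrA -exprD; congr (_ * _ ^+ _); rewrite addnC addnBAC.
rewrite -mulr_sumr [leRHS]mulrAC ler_wpM2l ?mulr_ge0 ?exprn_ge0 ?(ltW q0) //.
exact: geometric_partial_le.
Qed.

Lemma geometric_small e : 0 < e -> exists k0, forall k, (k0 <= k)%N -> q ^+ k < e.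
Proof.
move=> e0; case/andP: q01 => q0 q1.
have r1 : 1 < q^-1 by rewrite invf_gt1.
have [C C0 HC] := @poly_subexp R 1 1 0 q^-1 ler01 (lexx 0) r1.
have [k0 Hk0] := nat_above (C / e + 1).
exists k0.+1 => k kk; have := HC k; rewrite expr1 mul1r addr0 exprVn => h.
have qk : 0 < q ^+ k by exact: exprn_gt0.
rewrite ler_pdivlMr // in h.
have k1 : C / e < k%:R.
  by apply: (@lt_le_trans _ _ k0.+1%:R); [rewrite -natr1; move: Hk0; lra|rewrite ler_nat].
rewrite ltr_pdivrMr // in k1.
have k0' : (0 : R) < k%:R by rewrite ltr0n; apply: leq_trans kk.
by rewrite -(ltr_pM2l k0'); apply: le_lt_trans h _.
Qed.

Lemma geometric_cauchy : (forall k, N (t k) <= E * q ^+ k) ->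
  cauchy_abs N (fun n => \sum_(k < n) t k).
Proof.
move=> Ht e e0; case/andP: (q01) => q0 q1; have p : 0 < 1 - q by rewrite subr_gt0.
have e'0 : 0 < e / (E / (1 - q) + 1) by rewrite divr_gt0 // ltr_wpDl // divr_ge0 // ltW.
have [k0 Hk0] := geometric_small e'0.
have c0 : 0 < E / (1 - q) + 1 by rewrite ltr_wpDl // divr_ge0 // ltW.
have main n p' : (k0 <= n)%N -> (n <= p')%N -> N (\sum_(k < p') t k - \sum_(k < n) t k) < e.
  move=> kn np; rewrite -!(big_mkord xpredT t) (@big_cat_nat _ _ _ n) //= addrAC subrr add0r.
  have Ht0 k : (0 <= k)%N -> N (t k) <= E * q ^+ (k - 0) by rewrite subn0.
  apply: le_lt_trans (geometric_tail Ht0 (leq0n n) np) _.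
  rewrite subn0; have := Hk0 n kn; rewrite ltr_pdivlMr // => h.
  apply: le_lt_trans h; rewrite mulrC ler_wpM2l ?exprn_ge0 ?(ltW q0) // lerDl //.
exists k0 => n p' kn kp; case: (leqP p' n) => h; first by apply: main.
by rewrite -(absvalN aN) opprB; apply: main => //; apply: ltnW.
Qed.

End GeometricSeries.

Section RemainderLimit.
Variables (R : realType) (F L : fieldType) (NL : L -> R) (iota : {rmorphism F -> L}).
Hypothesis aNL : absval NL.
Variables (u : nat -> F) (beta : F).
Hypothesis beta0 : beta != 0.
Variable l : L.
Hypothesis Hl : cvg_abs NL (fun n => iota (\sum_(k < n) u k * beta ^- k.+1)) l.

Lemma shifted_partial_sum i n : \sum_(k < n) u (i + k)%N * beta ^- k.+1 =
  beta ^+ i * (\sum_(k < i + n) u k * beta ^- k.+1) - dseq u beta i.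
Proof.
rewrite big_split_ord /= mulrDr /dseq.
have -> : beta ^+ i * (\sum_(k < i) u k * beta ^- k.+1) = \sum_(h < i) u h * beta ^+ (i.-1 - h).
  rewrite mulr_sumr; apply: eq_bigr => h _; rewrite mulrCA; congr (_ * _).
  have hi := ltn_ord h.
  have -> : beta ^+ i = beta ^+ h.+1 * beta ^+ (i.-1 - h).
    by rewrite -exprD addSn subnKC ?(ltn_predK hi) // -ltnS (ltn_predK hi).
  by rewrite mulrAC mulfV ?mul1r ?expf_neq0.
rewrite addrAC subrr add0r mulr_sumr; apply: eq_bigr => k _; rewrite mulrCA; congr (_ * _).
by rewrite -addnS exprD invfM mulrA mulfV ?mul1r ?expf_neq0.
Qed.

(** Finite form, at beta, of P f - Q = sum_k phi(X^k P) z^(-k-1). The truncation point of f moves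
    with the degree i, which is harmless in the limit. *)
Lemma remainder_partial_sum (P : {poly F}) M :
  \sum_(k < M) phi u ('X^k * P) * beta ^- k.+1 =
  \sum_(i < size P) P`_i * beta ^+ i * (\sum_(k < i + M) u k * beta ^- k.+1) - phi (dseq u beta) P.
Proof.
have -> : \sum_(i < size P) P`_i * beta ^+ i * (\sum_(k < i + M) u k * beta ^- k.+1) - phi (dseq u beta) P
   = \sum_(i < size P) P`_i * (\sum_(k < M) u (i + k)%N * beta ^- k.+1).
  rewrite /phi -sumrB; apply: eq_bigr => i _; rewrite shifted_partial_sum mulrBr mulrA //.
under [RHS]eq_bigr do rewrite mulr_sumr.
rewrite exchange_big /=; apply: eq_bigr => k _; rewrite mulrC phi_mul phiXn mulr_sumr.
by rewrite /phi; apply: eq_bigr => i _; rewrite addnC mulrC mulrA.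
Qed.

Lemma remainder_le (P : {poly F}) C :
  (forall M, NL (iota (\sum_(k < M) phi u ('X^k * P) * beta ^- k.+1)) <= C) ->
  NL (iota P.[beta] * l - iota (phi (dseq u beta) P)) <= C.
Proof.
move=> HC; apply/ler_addgt0Pr => e e0.
pose S := \sum_(i < size P) NL (iota (P`_i * beta ^+ i)).
have S0 : 0 <= S by apply: sumr_ge0 => i _; apply: absval_ge0.
have S1 : 0 < S + 1 by rewrite ltr_wpDl.
have [n0 Hn0] := Hl (e := e / (S + 1)) (divr_gt0 e0 S1).
pose T M := \sum_(k < M) phi u ('X^k * P) * beta ^- k.+1.
have E : iota P.[beta] * l - iota (phi (dseq u beta) P) =
    iota (T n0) + \sum_(i < size P) iota (P`_i * beta ^+ i) * (l - iota (\sum_(k < i + n0) u k * beta ^- k.+1)).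
  rewrite /T remainder_partial_sum rmorphB rmorph_sum horner_coef rmorph_sum mulr_suml /=.
  rewrite [iota (\sum_(i < _) _)]rmorph_sum addrAC -big_split /=; congr (_ - _); apply: eq_bigr => i _.
  by rewrite (rmorphM iota (P`_i * beta ^+ i)) mulrBr addrC subrK.
rewrite E (le_trans (absval_le_add aNL _ _)) //; apply: lerD; first exact: HC.
rewrite (le_trans (absval_le_sum aNL _ _ _)) //.
apply: (@le_trans _ _ (S * (e / (S + 1)))).
  rewrite /S mulr_suml; apply: ler_sum => i _; rewrite absvalM // ler_wpM2l ?(absval_ge0 aNL) //.
  by rewrite -(absvalN aNL) opprB ltW // Hn0 // leq_addl.
rewrite mulrCA ler_piMr ?(ltW e0) // ler_pdivrMr // mul1r lerDl //.
Qed.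

End RemainderLimit.

(** * Local bounds for the linear forms *)

Definition bigmax1 (R : realType) (K : Type) (w : K -> R) (g : seq K) : R := \big[Num.max/1]_(x <- g) w x.

Lemma ln_mul (R : realType) (x y : R) : 0 < x -> 0 < y -> ln (x * y) = ln x + ln y.
Proof. by move=> x0 y0; rewrite lnM ?posrE. Qed.

Lemma ln_expn (R : realType) (x : R) n : 0 < x -> ln (x ^+ n) = n%:R * ln x.
Proof. by move=> x0; rewrite lnXn // mulr_natl. Qed.

Section MuSums.
Variables (R : realType) (K : fieldExtType rat).
Implicit Type w : K -> R.

Lemma ln_Mfin w q : place_fin w -> (0 < q)%N ->
  ln (Mfin w q) = - ln (w q%:R) + \sum_(p <- primes q) (1 / (p%:R - 1)) * - ln (w p%:R).
Proof.
move=> pw q0; have wq := fin_nat_gt0 pw q0.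
have pos : 0 < \prod_(p <- primes q) (w p%:R) `^ (1 / (p%:R - 1)).
  rewrite big_seq prodr_gt0 // => p; rewrite mem_primes => /and3P[pp _ _].
  by rewrite powR_gt0 // fin_nat_gt0 // prime_gt0.
rewrite /Mfin lnV ?posrE ?mulr_gt0 // lnM ?posrE // opprD; congr (_ + _).
rewrite ln_prod => [|p]; last first.
  by rewrite mem_primes => /and3P[pp _ _]; rewrite powR_gt0 // fin_nat_gt0 // prime_gt0.
rewrite -sumrN; apply: eq_bigr => p _; by rewrite ln_powR mulrN.
Qed.

Lemma sum_ln_Mfin (S : seq (K -> R)) q : (0 < q)%N -> (forall w, w \in S -> place_fin w) ->
  \sum_(w <- S) ln (Mfin w q) = \sum_(w <- S) - ln (w q%:R) +
    \sum_(p <- primes q) (1 / (p%:R - 1)) * \sum_(w <- S) - ln (w p%:R).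
Proof.
move=> q0 pS; rewrite big_seq (eq_bigr (fun w => - ln (w q%:R) + \sum_(p <- primes q) (1 / (p%:R - 1)) * - ln (w p%:R))); last first.
  by move=> w /pS pw; apply: ln_Mfin.
rewrite -big_seq big_split /=; congr (_ + _).
by rewrite exchange_big; apply: eq_bigr => p _; rewrite mulr_sumr.
Qed.

Lemma sum_ln_Mfin_le (S : seq (K -> R)) q : (0 < q)%N -> uniq S -> (forall w, w \in S -> place_fin w) ->
  \sum_(w <- S) ln (Mfin w q) <= ln_mu R q.
Proof.
move=> q0 uS pS; rewrite sum_ln_Mfin //; apply: lerD; first exact: ln_nat_place_le.
rewrite big_seq [leRHS]big_seq; apply: ler_sum => p; rewrite mem_primes => /and3P[pp _ _].
rewrite mul1r mulrC ler_wpM2r ?invr_ge0 ?subr_ge0 ?ler1n ?prime_gt0 //.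
by apply: ln_nat_place_le => //; apply: prime_gt0.
Qed.

Lemma sum_ln_Mfin_ge (S : seq (K -> R)) q : (0 < q)%N -> uniq S -> (forall w, w \in S -> place_fin w) ->
  (forall w, place_fin w -> w q%:R < 1 -> w \in S) -> ln_mu R q <= \sum_(w <- S) ln (Mfin w q).
Proof.
move=> q0 uS pS HS; rewrite sum_ln_Mfin //; apply: lerD; first exact: ln_nat_place_ge.
rewrite big_seq [leRHS]big_seq; apply: ler_sum => p; rewrite mem_primes => /and3P[pp _ pq].
rewrite mul1r mulrC ler_wpM2l ?invr_ge0 ?subr_ge0 ?ler1n ?prime_gt0 //.
apply: ln_nat_place_ge => //; first exact: prime_gt0.
by move=> w pw wp; apply: HS => //; rewrite (fin_nat_lt1 pw _ pp wp).
Qed.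

Lemma ln_mu_ge0 q : (0 < q)%N -> 0 <= ln_mu R q.
Proof.
move=> q0; rewrite /ln_mu addr_ge0 ?ln_nat_ge0 // big_seq sumr_ge0 // => p.
rewrite mem_primes => /and3P[pp _ _]; by rewrite divr_ge0 ?ln_nat_ge0 // subr_ge0 ler1n prime_gt0.
Qed.

Lemma ln_muE (x : rat) : ln (mu R x) = ln_mu R `|denq x|.
Proof.
have q0 : (0 < `|denq x|)%N by rewrite absz_gt0 denq_eq0.
have pos : 0 < \prod_(p <- primes `|denq x|) (p%:R : R) `^ (1 / (p%:R - 1)).
  rewrite big_seq prodr_gt0 // => p; rewrite mem_primes => /and3P[pp _ _].
  by rewrite powR_gt0 // ltr0n prime_gt0.
rewrite /mu (_ : (denq x)%:~R = `|denq x|%N%:R :> R); last by rewrite pmulrn absz_denq.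
rewrite lnM ?posrE ?ltr0n // /ln_mu; congr (_ + _).
rewrite ln_prod => [|p]; last first.
  by rewrite mem_primes => /and3P[pp _ _]; rewrite powR_gt0 // ltr0n prime_gt0.
by apply: eq_bigr => p _; rewrite ln_powR mul1r mulrC.
Qed.

End MuSums.

Section PlaceBounds.
Variables (R : realType) (K : fieldExtType rat) (m : nat).
Variables (al : 'I_m -> K) (s : 'I_m -> rat) (u : int) (D : nat).
Variables (beta lam0 : K) (lam : 'I_m.-1 -> K).
Let sK i : K := (s i)%:A.
Let q i : nat := `|denq (s i)|%N.
Hypothesis m2 : (2 <= m)%N.
Hypothesis al_inj : injective al.
Hypothesis s_neq : forall i (n : nat), s i != - (n.+1)%:R.
Hypothesis D0 : (0 < D)%N.
Hypothesis cuD : coprime `|u| D.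
Hypothesis bmE : \sum_i sK i = u%:~R / D%:R.
Hypothesis bm_neq : forall n, \sum_i sK i != - (n.+2)%:R.
Local Notation form n l := (pade_form al sK beta lam0 lam n l).
Local Notation L n := (lcm_progression u D n).
Let lams := lam0 :: [seq lam j | j : 'I_m.-1].
Let als := [seq al i | i : 'I_m].

Lemma denq_abs_gt0 i : (0 < q i)%N.
Proof. by rewrite absz_gt0 denq_eq0. Qed.

Lemma rat_algE (x : rat) : x%:A = (numq x)%:~R / (`|denq x|%N)%:R :> K.
Proof.
rewrite -{1}(divq_num_den x) -[_%:A]/(in_alg K _) fmorph_div !rmorph_int /=.
by rewrite pmulrn absz_denq.
Qed.

Lemma sK_E i : sK i = (numq (s i))%:~R / (q i)%:R.
Proof. exact: rat_algE. Qed.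

Lemma sK_neq i n : sK i != - (n.+1)%:R.
Proof.
rewrite -subr_eq0 opprK /sK -[_%:A]/(in_alg K _) -(rmorph_nat (in_alg K)) -rmorphD fmorph_eq0.
by rewrite addr_eq0 s_neq.
Qed.

Lemma K_charF n : n.+1%:R != 0 :> K.
Proof. exact: nat_neq0. Qed.

Lemma progression_gt0 k : (2 <= k)%N -> (0 < `|(u + D%:Z * k%:Z)%R|)%N.
Proof.
move=> k2; rewrite absz_gt0; apply/negP => /eqP E.
have Dn := nat_neq0 K D0.
have := bm_neq k.-2; rewrite (_ : k.-2.+2 = k); last by case: k k2 E => [|[]].
rewrite bmE -subr_eq0 opprK => /negP; apply.
have -> : u%:~R / D%:R + k%:R = (u + D%:Z * k%:Z)%:~R / D%:R :> K.
  by rewrite rmorphD rmorphM /= -!pmulrn; field.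
by rewrite E mul0r.
Qed.

Lemma progression_lcm_gt0 n : (0 < L n)%N.
Proof. by apply: lcm_progression_gt0 => k; apply: progression_gt0. Qed.

Section Finite.
Variable w : K -> R.
Hypothesis pw : place_fin w.
Let aw := fin_absval pw.
Local Notation B := (bigmax1 w [:: beta]).
Local Notation A := (bigmax1 w als).
Local Notation Ai i := (bigmax1 w [:: al i]).

Definition Mw : R := \prod_i Mfin w (q i).

Lemma Mfin_le_Mw i : Mfin w (q i) <= Mw.
Proof.
rewrite /Mw (bigD1 i) //= ler_peMr ?(le_trans ler01) ?Mfin_ge1 ?denq_abs_gt0 //.
by elim/big_ind: _ => // [x y x1 y1|l _]; [rewrite mulr_ege1|apply: Mfin_ge1; rewrite ?denq_abs_gt0].
Qed.

Lemma Mw_ge1 : 1 <= Mw.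
Proof.
by rewrite /Mw; elim/big_ind: _ => // [x y x1 y1|l _]; [rewrite mulr_ege1|apply: Mfin_ge1; rewrite ?denq_abs_gt0].
Qed.

Lemma fin_pade_pbound n l : pbound w B (pade al sK n l)
  (B ^+ l * (Mw * (B ^+ m.-1 * \prod_i Ai i)) ^+ n).
Proof.
have B1 : 1 <= B by exact: bigmax_ge1.
have A1 i : 1 <= Ai i by exact: bigmax_ge1.
have alA i : w (al i) <= Ai i by apply: bigmax_ge; rewrite inE.
have M1 := Mw_ge1; have B0 := le_trans ler01 B1; have M0 := le_trans ler01 M1.
have W1 := cofactor_bound_ge1 true B1 A1.
have WE : cofactor_bound true B (fun i => Ai i) = B ^+ m.-1 * \prod_i Ai i.
  by rewrite /cofactor_bound /kap mul1r.
have := @pade_bound R K w true aw (fun _ => fin_ultra pw) B B1 K_charF m al sK (fun i => Ai i)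
  m2 al_inj A1 alA n l (Mw * cofactor_bound true B (fun i => Ai i)) B (fun=> 1).
rewrite /kap !expr1n !mul1r big1 // mulr1 WE; apply => //.
- by rewrite mulr_gt0 ?(lt_le_trans ltr01) // -WE.
- by rewrite -WE ler_wpM2l // ler_peMl // (le_trans ler01).
- move=> i k kn; rewrite -WE mul1r [leRHS]exprMn ler_wpM2r ?exprn_ge0 ?(le_trans ler01 W1) //.
  have -> : sK i + n%:R = (numq (s i) + (q i)%:Z * n%:Z)%:~R / (q i)%:R.
    rewrite sK_E rmorphD rmorphM /= -!pmulrn; field; exact: nat_neq0 (denq_abs_gt0 i).
  rewrite (le_trans (fin_binser_le pw _ _ (denq_abs_gt0 i))) // lerXn2r ?nnegrE //.
    by rewrite (le_trans ler01) // Mfin_ge1 // denq_abs_gt0.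
  exact: Mfin_le_Mw.
Qed.

(** The explicit bound, away from D, and the recurrence bound, above D, brought to one form. That E
    = 1 outside the finitely many places above D matters later: these constants are summed over a
    set of places that depends on n. *)
Lemma fin_moment : exists E, [/\ 1 <= E, (w D%:R = 1 -> E = 1), Mfin w D <= Mw &
  forall j n k, (j.+1 < m)%N -> (n <= k)%N ->
    w (moment al sK j n) <= E * (w (L k.+1)%:R)^-1 * (A * (Mw / Mfin w D)) ^+ n].
Proof.
have A1 : 1 <= A by exact: bigmax_ge1.
have alA i : w (al i) <= A by apply: bigmax_ge; apply: map_f; rewrite mem_enum.
have A0 := le_trans ler01 A1.
have wL k : 1 <= (w (L k)%:R)^-1.
  by rewrite invf_ge1 ?(fin_nat_gt0 pw) ?progression_lcm_gt0 // (fin_nat_le1 pw).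
have bmE' : \sum_i (numq (s i))%:~R / (q i)%:R = u%:~R / D%:R :> K.
  by rewrite -bmE; apply: eq_bigr => i _; rewrite sK_E.
have sKE : sK = (fun i => (numq (s i))%:~R / (q i)%:R) by apply/funext => i; rewrite sK_E.
have bmN' n : \sum_i (numq (s i))%:~R / (q i)%:R != - (n.+2)%:R :> K.
  by rewrite bmE' -bmE.
have wD0 := fin_nat_gt0 pw D0.
case: (eqVneq (w D%:R) 1) => wD.
  exists 1; split=> // [|j n k jm nk]; first by rewrite Mfin_unit // Mw_ge1.
  rewrite Mfin_unit // divr1 mul1r [A * _]mulrC sKE.
  apply: (fin_moment_explicit pw denq_abs_gt0 D0 bmE' bmN' A1 alA Mw_ge1 Mfin_le_Mw _ wD (progression_lcm_gt0 _)).
  move=> k' /andP[k'2 k'n]; apply: dvdn_lcm_progression; rewrite k'2 (leq_trans k'n) //.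
have wD1 : w D%:R < 1 by rewrite lt_neqAle wD (fin_nat_le1 pw).
have [p pp wp] := fin_above pw.
have pD : (p %| D)%N by rewrite -(fin_nat_lt1 pw D pp wp).
have wu : w u%:~R = 1.
  apply/eqP; rewrite eq_le (fin_int_le1 pw) /= leNgt (fin_int_lt1 pw u pp wp).
  apply/negP; rewrite dvdzE /= => pu.
  have : (p %| gcdn `|u| D)%N by rewrite dvdn_gcd pu.
  by rewrite (eqP cuD) dvdn1 => /eqP p1; rewrite p1 in pp.
pose S := \prod_i (w (q i)%:R)^-1.
have q1 i : 1 <= (w (q i)%:R)^-1 by rewrite invf_ge1 ?(fin_nat_gt0 pw) ?denq_abs_gt0 // (fin_nat_le1 pw).
have S1 : 1 <= S by rewrite /S; elim/big_ind: _ => // x y x1 y1; rewrite mulr_ege1.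
have qS i : (w (q i)%:R)^-1 <= S.
  rewrite /S (bigD1 i) //= ler_peMr ?(le_trans ler01) //.
  by elim/big_ind: _ => // x y x1 y1; rewrite mulr_ege1.
have sS i : w ((numq (s i))%:~R / (q i)%:R) <= S.
  by rewrite (finM pw) (finV pw) (le_trans _ (qS i)) // ler_piMl ?(fin_int_le1 pw) // (le_trans ler01).
have wbm : w (u%:~R / D%:R) = (w D%:R)^-1 by rewrite (finM pw) (finV pw) wu mul1r.
have DS : (w D%:R)^-1 <= S.
  rewrite -wbm -bmE'; apply: (fin_sum_le pw); first exact: le_trans S1.
  by move=> i _; apply: sS.
(* b_{m-1} is the sum of the s_i and is not integral at w, so some s_i is not integral either. *)
have [i0 pq] : exists i, (p %| q i)%N.
  apply: contrapT => H; have : w (u%:~R / D%:R) <= 1.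
    rewrite -bmE'; apply: (fin_sum_le pw) => // i _.
    have wq : w (q i)%:R = 1.
      apply/eqP; rewrite eq_le (fin_nat_le1 pw) /= leNgt (fin_nat_lt1 pw _ pp wp).
      by apply/negP => h; apply: H; exists i.
    by rewrite (finM pw) (finV pw) wq invr1 mulr1 (fin_int_le1 pw).
  by rewrite wbm leNgt invf_gt1 // wD1.
set t := (w p%:R) `^ (1 / (p%:R - 1)).
have t0 : 0 < t by rewrite powR_gt0 // (fin_nat_gt0 pw) // prime_gt0.
have t1 : t <= 1 by exact: fin_root_le1.
have MD : Mfin w D = (w D%:R * t)^-1 by rewrite (Mfin_dvd pw pp wp).
have Mq i : (w (q i)%:R)^-1 <= Mfin w (q i).
  case: (boolP (p %| q i)%N) => h.
    rewrite (Mfin_dvd pw pp wp) ?denq_abs_gt0 // lef_pV2 ?posrE ?mulr_gt0 ?(fin_nat_gt0 pw) ?denq_abs_gt0 //.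
    by rewrite -/t ler_piMr // (fin_ge0 pw).
  have wq : w (q i)%:R = 1.
    by apply/eqP; rewrite eq_le (fin_nat_le1 pw) /= leNgt (fin_nat_lt1 pw _ pp wp).
  by rewrite wq invr1 Mfin_ge1 // denq_abs_gt0.
(* The factor p^(1/(p-1)) of mu(s_{i0}) pays for the same factor in mu(D); one index with p dividing
   its denominator is enough. *)
have MS : S / t <= Mw.
  rewrite /S /Mw (bigD1 i0) // [leRHS](bigD1 i0) //= (Mfin_dvd pw pp wp) ?denq_abs_gt0 // -/t invfM.
  rewrite mulrAC ler_wpM2l ?mulr_ge0 ?invr_ge0 ?(ltW t0) ?(fin_ge0 pw) //.
  apply: ler_prod => i _; rewrite Mq invr_ge0 (fin_ge0 pw) //.
have SM : S * w D%:R <= Mw / Mfin w D.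
  rewrite MD invrK; apply: (@le_trans _ _ (S / t * (w D%:R * t))); last first.
    by rewrite ler_wpM2r // mulr_ge0 ?(ltW wD0) ?(ltW t0).
  by rewrite mulrACA mulVf ?mulr1 // gt_eqF.
have SD1 : 1 <= S * w D%:R by move: DS; rewrite -div1r ler_pdivrMr.
have MDM : Mfin w D <= Mw.
  have MD0 : 0 < Mfin w D by rewrite (lt_le_trans ltr01) // Mfin_ge1.
  by rewrite -[leLHS]mul1r -ler_pdivlMr // (le_trans SD1).
have /choice[E HE] (j : 'I_m.-1) : exists E, 1 <= E /\
    forall n, w (moment al sK j n) <= E * (S * w D%:R * A) ^+ n.
  have jm : (j.+1 < m)%N by have := ltn_ord j; rewrite -ltnS prednK // ltnW.
  have [E E1 H] := fin_moment_recurrence pw D0 bmE' bmN' A1 alA m2 jm wu sS S1 DS wD1.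
  by exists E; split=> //; rewrite sKE.
have sumE0 (P : pred 'I_m.-1) : 0 <= \sum_(j | P j) E j.
  by apply: sumr_ge0 => j _; apply: le_trans ler01 _; case: (HE j).
exists (1 + \sum_j E j); split=> //; first by rewrite lerDl.
  by move=> wDe; rewrite wDe ltxx in wD1.
move=> j n k jm nk; have jm' : (j < m.-1)%N by rewrite -ltnS prednK // ltnW.
have [Ej1 Hj] := HE (Ordinal jm').
have SA0 : 0 <= S * w D%:R * A by rewrite mulr_ge0 // (le_trans ler01).
have h1 : E (Ordinal jm') <= 1 + \sum_j E j by rewrite (bigD1 (Ordinal jm')) //= addrCA lerDl addr_ge0.
have h2 : (S * w D%:R * A) ^+ n <= (A * (Mw / Mfin w D)) ^+ n.
  have h3 : S * w D%:R * A <= A * (Mw / Mfin w D) by rewrite mulrC ler_wpM2l.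
  by rewrite lerXn2r ?nnegrE // (le_trans SA0).
apply: (le_trans (Hj n)); apply: ler_pM => //; first exact: le_trans ler01 Ej1.
  by rewrite exprn_ge0.
by rewrite (le_trans h1) // ler_peMr // addr_ge0.
Qed.

(** Per step, the Pade polynomial contributes B^(m-1) prod_i Ai Mw, and the moments, of order n (m -
    1), contribute the (m - 1)-st power of A Mw / Mfin w D. *)
Lemma fin_form_ln : exists E, [/\ 0 <= E, (w D%:R = 1 -> E = 0) &
  forall n l, (l < m)%N -> form n l != 0 ->
    ln (w (form n l)) <= hv w lams + m%:R * hv w [:: beta] + m%:R * (hv w als + ln Mw) + E
      - ln (w (L (n * m.-1 + m).+1)%:R)
      + n%:R * ((m%:R - 1) * hv w [:: beta] + \sum_i hv w [:: al i] + m%:R * hv w als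
                + m%:R * ln Mw - (m%:R - 1) * ln (Mfin w D))].
Proof.
have [E [E1 ED MD HE]] := fin_moment; exists (ln E); split; first exact: ln_ge0.
  by move=> /ED ->; rewrite ln1.
move=> n l lm f0; set k := (n * m.-1 + m)%N.
have B1 : 1 <= B by exact: bigmax_ge1.
have A1 : 1 <= A by exact: bigmax_ge1.
have Ai1 i : 1 <= Ai i by exact: bigmax_ge1.
have Lc1 : 1 <= bigmax1 w lams by exact: bigmax_ge1.
have MD1 : 1 <= Mfin w D by exact: Mfin_ge1.
have M1 := Mw_ge1.
have X1 : 1 <= A * (Mw / Mfin w D).
  by rewrite mulr_ege1 // ler_pdivlMr ?mul1r // (lt_le_trans ltr01).
have wL : 1 <= (w (L k.+1)%:R)^-1.
  by rewrite invf_ge1 ?(fin_nat_gt0 pw) ?progression_lcm_gt0 // (fin_nat_le1 pw).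
have wL0 : 0 < w (L k.+1)%:R by rewrite (fin_nat_gt0 pw) // progression_lcm_gt0.
have gt0 (x : R) : 1 <= x -> 0 < x by exact: lt_le_trans.
have P1 : 1 <= \prod_i Ai i by elim/big_ind: _ => // x y x1 y1; rewrite mulr_ege1.
have BM1 : 1 <= B ^+ m.-1 * \prod_i Ai i by rewrite mulr_ege1 // exprn_ege1.
have p1 : 1 <= B ^+ l * (Mw * (B ^+ m.-1 * \prod_i Ai i)) ^+ n.
  by rewrite mulr_ege1 ?exprn_ege1 // mulr_ege1.
have H : w (form n l) <= kap R true 2 * (kap R true m * (bigmax1 w lams *
    (kap R true k * (E * (w (L k.+1)%:R)^-1) * (A * (Mw / Mfin w D)) ^+ k *
    (B ^+ l * (Mw * (B ^+ m.-1 * \prod_i Ai i)) ^+ n)))).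
  apply: (@pade_form_bound K m al sK beta lam0 lam R w true aw (fun _ => fin_ultra pw) K_charF m2 bm_neq n l B) => //.
  - by apply: bigmax_ge; rewrite inE.
  - by rewrite mulr_ege1.
  - exact: ltW (gt0 _ p1).
  - exact: ltW (gt0 _ Lc1).
  - by apply: bigmax_ge; rewrite inE eqxx.
  - by move=> j; apply: bigmax_ge; rewrite inE map_f ?orbT // mem_enum.
  - exact: fin_pade_pbound.
  - by move=> j h jm hk; apply: HE.
rewrite /kap !mul1r in H.
have w0 : 0 < w (form n l) by rewrite (fin_gt0 pw).
have EX : ln ((A * (Mw / Mfin w D)) ^+ k) = k%:R * (ln A + (ln Mw - ln (Mfin w D))).
  have Eq : ln (Mw / Mfin w D) = ln Mw - ln (Mfin w D) by rewrite ln_div ?posrE ?gt0.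
  have Mq0 : 0 < Mw / Mfin w D by rewrite divr_gt0 // gt0.
  by rewrite (ln_expn _ (gt0 _ X1)) (ln_mul (gt0 _ A1) Mq0) Eq.
have EP : ln (B ^+ l * (Mw * (B ^+ m.-1 * \prod_i Ai i)) ^+ n) =
    l%:R * ln B + n%:R * (ln Mw + (m.-1%:R * ln B + \sum_i ln (Ai i))).
  have B0 := gt0 _ B1; have M0 := gt0 _ M1; have P0 := gt0 _ P1; have BM0 := gt0 _ BM1.
  have Bl0 k' : 0 < B ^+ k' by exact: exprn_gt0.
  have MB0 : 0 < Mw * (B ^+ m.-1 * \prod_i Ai i) by exact: mulr_gt0.
  rewrite ln_mul ?exprn_gt0 // !(ln_expn _ B0) (ln_expn _ MB0) (ln_mul M0 BM0) (ln_mul (Bl0 _) P0) (ln_expn _ B0).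
  have EPi : ln (\prod_i Ai i) = \sum_i ln (Ai i) by rewrite ln_prod // => i _; apply: gt0.
  by rewrite EPi.
have EC : ln (E * (w (L k.+1)%:R)^-1) = ln E - ln (w (L k.+1)%:R).
  by rewrite ln_div ?posrE // gt0.
have C1 : 1 <= E * (w (L k.+1)%:R)^-1 by rewrite mulr_ege1.
have Xk1 : 1 <= (A * (Mw / Mfin w D)) ^+ k by rewrite exprn_ege1.
have {}H : ln (w (form n l)) <= ln (bigmax1 w lams) + (ln E - ln (w (L k.+1)%:R) +
    k%:R * (ln A + (ln Mw - ln (Mfin w D))) + (l%:R * ln B + n%:R * (ln Mw + (m.-1%:R * ln B + \sum_i ln (Ai i))))).
  have CX0 := mulr_gt0 (gt0 _ C1) (gt0 _ Xk1); have CXp0 := mulr_gt0 CX0 (gt0 _ p1).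
  rewrite -EX -EP -EC -(ln_mul (gt0 _ C1) (gt0 _ Xk1)) -(ln_mul CX0 (gt0 _ p1)) -(ln_mul (gt0 _ Lc1) CXp0).
  by rewrite ler_ln ?posrE //; apply: mulr_gt0 (gt0 _ Lc1) CXp0.
apply: (le_trans H).
have mE : m.-1%:R = m%:R - 1 :> R by rewrite -subn1 natrB // ltnW.
rewrite /k natrD natrM mE {H EX}.
have b0 : 0 <= ln B by exact: ln_ge0.
have a0 : 0 <= ln A by exact: ln_ge0.
have d0 : 0 <= ln (Mfin w D) by exact: ln_ge0.
have lb : l%:R * ln B <= m%:R * ln B by rewrite ler_wpM2r // ler_nat ltnW.
have md : 0 <= m%:R * ln (Mfin w D) by rewrite mulr_ge0.
have na : 0 <= n%:R * ln A by rewrite mulr_ge0.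
rewrite /hv -/(bigmax1 w [:: beta]) -/(bigmax1 w als) -/(bigmax1 w lams).
rewrite (eq_bigr (fun i => ln (Ai i))) //.
move: (ln B) (ln A) (ln (Mfin w D)) (ln Mw) (ln E) (ln (w _)) (ln (bigmax1 w lams)) (\sum_i _) (m%:R : R) (n%:R : R) (l%:R : R) lb md na.
move=> b a d M e wl lc S' x y z {}lb {}md {}na; lra.
Qed.

End Finite.

(** Start from 1 + x <= exp x at x = 1/32 and square five times, rounding down to fractions with
    small denominators. The bound 8/3 is what [arch_constant] needs. *)
Lemma expR1_ge : 8 / 3 <= expR 1 :> R.
Proof.
have E : expR 1 = expR (2 ^- 5) ^+ 32 :> R.
  by rewrite -expRM_natl; congr expR; field.
have h0 : 33 / 32 <= expR (2 ^- 5) :> R by apply: le_trans (expR_ge1Dx _); lra.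
have sq (x y z : R) : 0 <= x -> x <= y -> z <= x ^+ 2 -> z <= y ^+ 2.
  by move=> x0 xy zx; rewrite (le_trans zx) // lerXn2r ?nnegrE // (le_trans x0).
rewrite E (_ : 32 = 2 * (2 * (2 * (2 * 2))))%N // !exprM.
have h1 : 151 / 142 <= expR (2 ^- 5) ^+ 2 :> R by apply: (sq _ _ _ _ h0); lra.
have h2 : 147 / 130 <= expR (2 ^- 5) ^+ 2 ^+ 2 :> R by apply: (sq _ _ _ _ h1); lra.
have h3 : 179 / 140 <= expR (2 ^- 5) ^+ 2 ^+ 2 ^+ 2 :> R by apply: (sq _ _ _ _ h2); lra.
have h4 : 85 / 52 <= expR (2 ^- 5) ^+ 2 ^+ 2 ^+ 2 ^+ 2 :> R by apply: (sq _ _ _ _ h3); lra.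
by apply: (sq _ _ _ _ h4); lra.
Qed.

(* The minimum over t of (1 + t)^(k + 1) 2^k / t is attained at t = 1 / k;
   t = 1 / 4 is good enough for k >= 4. *)
Lemma arch_constant (k : nat) : (0 < k)%N ->
  exists t : R, [/\ 0 < t, t <= 1 & k.+1%:R * ln (1 + t) + k%:R * ln 2 - ln t <= ln 4 + k%:R].
Proof.
move=> k0.
have main (t : R) : 0 < t -> (1 + t) / t * (2 * (1 + t)) ^+ k <= 4 * (8 / 3) ^+ k ->
    k.+1%:R * ln (1 + t) + k%:R * ln 2 - ln t <= ln 4 + k%:R.
  move=> t0 h; have t1 : 0 < 1 + t by rewrite addr_gt0.
  have e : (0 : R) < 8 / 3 by lra.
  have : ln ((1 + t) / t * (2 * (1 + t)) ^+ k) <= ln (4 * expR 1 ^+ k).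
    rewrite ler_ln ?posrE ?mulr_gt0 ?exprn_gt0 ?mulr_gt0 ?invr_gt0 ?expR_gt0 //.
    by rewrite (le_trans h) // ler_wpM2l // lerXn2r ?nnegrE ?(ltW e) ?expR_ge0 // expR1_ge.
  have E1 : ln ((2 * (1 + t)) ^+ k) = k%:R * (ln 2 + ln (1 + t)).
    by rewrite lnXn ?mulr_gt0 // lnM ?posrE // mulr_natl.
  have E2 : ln (expR 1 ^+ k) = k%:R :> R by rewrite -expRM_natl expRK mulr1.
  rewrite lnM ?posrE ?divr_gt0 ?exprn_gt0 ?mulr_gt0 // ln_div ?posrE // E1.
  rewrite lnM ?posrE ?exprn_gt0 ?expR_gt0 // E2 -[k.+1%:R]natr1.
  by move: (ln (1 + t)) (ln 2) (ln 4) (ln t) (k%:R : R) => *; lra.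
case: (leqP k 2) => k2.
  exists 2^-1; split; [lra|lra|apply: main; first lra].
  by case: k k0 k2 => [|[|[|]]] // _ _; rewrite ?expr1 ?expr2; lra.
case: (leqP k 3) => k3.
  exists 3^-1; split; [lra|lra|apply: main; first lra].
  have -> : k = 3 by apply/eqP; rewrite eqn_leq k3.
  by rewrite !exprS expr0; lra.
exists 4^-1; split; [lra|lra|apply: main; first lra].
have -> : (1 + 4^-1) / 4^-1 = 5 :> R by field.
have -> : 2 * (1 + 4^-1) = 5 / 2 :> R by field.
rewrite -(subnK k3) !exprD; set e := (k - 4)%N.
have h : (5 / 2) ^+ e <= (8 / 3) ^+ e :> R by rewrite lerXn2r ?nnegrE //; lra.
have h0 : 0 <= (5 / 2) ^+ e :> R by rewrite exprn_ge0 //; lra.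
by rewrite !(exprS _ 3) !(exprS _ 2) !expr2; move: h h0; move: (_ ^+ e) (_ ^+ e) => x y; lra.
Qed.

Section Archimedean.
Variable N : K -> R.
Hypothesis aN : absval N.
Hypothesis Nnat : forall n, N n%:R = n%:R.
Local Notation B := (bigmax1 N [:: beta]).
Local Notation A := (bigmax1 N als).
Local Notation Ai i := (bigmax1 N [:: al i]).

Lemma arch_moments (r : R) : 1 < r -> exists2 E, 1 <= E &
  forall j h, (j.+1 < m)%N -> N (moment al sK j h) <= E * (r * A) ^+ h.
Proof.
move=> r1; have A1 : 1 <= A by exact: bigmax_ge1.
have alA i : N (al i) <= A by apply: bigmax_ge; apply: map_f; rewrite mem_enum.
have /choice[E HE] (j : 'I_m.-1) : exists E, 0 <= E /\
    forall h, N (moment al sK j h) <= E * (r * A) ^+ h.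
  by have [E E0 H] := arch_moment_subexp aN Nnat j A1 alA bm_neq r1; exists E.
have sumE0 (P : pred 'I_m.-1) : 0 <= \sum_(j | P j) E j by apply: sumr_ge0 => j _; case: (HE j).
exists (1 + \sum_j E j) => [|j h jm]; first by rewrite lerDl.
have jm' : (j < m.-1)%N by rewrite -ltnS prednK // ltnW.
have [Ej0 Hj] := HE (Ordinal jm').
rewrite (le_trans (Hj h)) // ler_wpM2r ?exprn_ge0 ?mulr_ge0 ?(le_trans ler01) // ?(ltW r1) //.
by rewrite (bigD1 (Ordinal jm')) //= addrCA lerDl addr_ge0.
Qed.

Lemma nat_ultF : false -> forall x y, N (x + y) <= Num.max (N x) (N y).
Proof. by []. Qed.

Lemma arch_pade_pbound (t : R) : 0 < t -> t <= 1 -> exists sig : nat, forall n l,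
  pbound N B (pade al sK n l) (n.+1%:R * (n.+1%:R ^+ l * (2 * B) ^+ l * (n.+1%:R ^+ m * ((1 + t) ^+ (n + sig)) ^+ m))
    * ((2 * B) ^+ m.-1 * (\prod_i Ai i) / t) ^+ n).
Proof.
move=> t0 t1; have [sig Hsig] := nat_above (\sum_i N (sK i)).
have B1 : 1 <= B by exact: bigmax_ge1.
have A1 i : 1 <= Ai i by exact: bigmax_ge1.
have alA i : N (al i) <= Ai i by apply: bigmax_ge; rewrite inE.
have B0 := le_trans ler01 B1.
have sN i : N (sK i) <= sig%:R.
  by rewrite (le_trans _ Hsig) // (bigD1 i) //= lerDl sumr_ge0 // => *; apply: absval_ge0.
exists sig => n l.
have W1 := cofactor_bound_ge1 false B1 A1; have W0 := le_trans ler01 W1.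
have := @pade_bound R K N false aN nat_ultF B B1 K_charF m al sK (fun i => Ai i)
  m2 al_inj A1 alA n l (cofactor_bound false B (fun i => Ai i) / t) (2 * B) (fun=> (1 + t) ^+ (n + sig)).
rewrite /kap prodr_const card_ord /cofactor_bound /kap; apply => //.
- by rewrite divr_gt0 // (lt_le_trans ltr01).
- by rewrite ler_peMl // ler1n.
- rewrite -!mulrA ler_wpM2l // ler_wpM2l // mulrA ler_pdivlMr // ler_piMr //.
- by move=> i; rewrite exprn_ge0 // addr_ge0 // ltW.
- by move=> i k kn; apply: arch_binser_exp.
Qed.

(** The numerical rate per step is (1 + t)^m 2^(m-1) / t, at most 4 e^(m-1) by [arch_constant] with
    k = m - 1. Half of the slack e pays for the growth of the moments beyond A^h, half for the
    powers of n + 1. *)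
Lemma arch_form_ln (e : R) : 0 < e -> exists C, forall n l, (l < m)%N -> form n l != 0 ->
  ln (N (form n l)) <= C + n%:R * (ln 4 + (m%:R - 1) + (m%:R - 1) * ln B + \sum_i ln (Ai i) + m%:R * ln A + e).
Proof.
move=> e0; have m0 : (0 < m)%N by exact: ltnW.
have [t [t0 t1 ht]] : exists t : R, [/\ 0 < t, t <= 1 &
    m%:R * ln (1 + t) + (m%:R - 1) * ln 2 - ln t <= ln 4 + (m%:R - 1)].
  have [|t [t0 t1 ht]] := @arch_constant m.-1; first by rewrite -ltnS prednK.
  have mE : m.-1%:R = m%:R - 1 :> R by rewrite -subn1 natrB.
  by exists t; split=> //; rewrite -mE; rewrite prednK // in ht.
have [sig HP] := arch_pade_pbound t0 t1.
have mR : (0 : R) < m%:R by rewrite ltr0n.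
pose d := expR (e / (2 * m%:R)); have d1 : 1 < d by rewrite expR_gt1 divr_gt0 // mulr_gt0.
have [E E1 HE] := arch_moments d1.
pose e2 := e / (2 * (2 * m%:R + 2)).
have e20 : 0 < e2 by rewrite divr_gt0 // mulr_gt0 // addr_gt0 // mulr_gt0.
have [C1 HC1] := ln_le_linear e20.
have B1 : 1 <= B by exact: bigmax_ge1.
have A1 : 1 <= A by exact: bigmax_ge1.
have Ai1 i : 1 <= Ai i by exact: bigmax_ge1.
have Lc1 : 1 <= bigmax1 N lams by exact: bigmax_ge1.
have gt0 (x : R) : 1 <= x -> 0 < x by exact: lt_le_trans.
have X1 : 1 <= d * A by rewrite mulr_ege1 // ltW.
have P1 : 1 <= \prod_i Ai i by elim/big_ind: _ => // x y x1 y1; rewrite mulr_ege1.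
have tt : 1 <= 1 + t by rewrite lerDl ltW.
have B21 : 1 <= 2 * B by rewrite mulr_ege1 // ler1n.
exists (ln 2 + 2 * ln m%:R + ln (bigmax1 N lams) + ln E + m%:R * (e / (2 * m%:R) + ln A) +
  m%:R * ln (2 * B) + m%:R * sig%:R * ln (1 + t) + (2 * m%:R + 2) * (C1 + e2)) => n l lm f0.
set k := (n * m.-1 + m)%N; have k0 : (0 < k)%N by rewrite addn_gt0 m0 orbT.
pose W := (2 * B) ^+ m.-1 * \prod_i Ai i.
have W1 : 1 <= W by rewrite mulr_ege1 // exprn_ege1.
have n1 : (1 : R) <= n.+1%:R by rewrite ler1n.
pose p1 := n.+1%:R ^+ l * (2 * B) ^+ l.
pose p2 := n.+1%:R ^+ m * ((1 + t) ^+ (n + sig)) ^+ m.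
have p11 : 1 <= p1 by rewrite mulr_ege1 // exprn_ege1.
have p21 : 1 <= p2 by rewrite mulr_ege1 // !exprn_ege1.
have Wt1 : 1 <= (W / t) ^+ n by rewrite exprn_ege1 // ler_pdivlMr // mul1r (le_trans t1).
have q1 : 1 <= n.+1%:R * (p1 * p2) by apply: mulr_ege1 => //; apply: mulr_ege1.
have p3 : 1 <= n.+1%:R * (p1 * p2) * (W / t) ^+ n by apply: mulr_ege1.
have kR : (1 : R) <= k%:R by rewrite ler1n.
have mR1 : (1 : R) <= m%:R by rewrite ler1n.
have Xk1 : 1 <= (d * A) ^+ k by rewrite exprn_ege1.
have H : N (form n l) <= kap R false 2 * (kap R false m * (bigmax1 N lams *
    (kap R false k * E * (d * A) ^+ k * (n.+1%:R * (p1 * p2) * (W / t) ^+ n)))).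
  pose H := @pade_form_bound K m al sK beta lam0 lam R N false aN nat_ultF K_charF m2 bm_neq n l B (d * A) E (bigmax1 N lams) (n.+1%:R * (p1 * p2) * (W / t) ^+ n).
  apply: H => //.
  - by apply: bigmax_ge; rewrite inE.
  - exact: ltW (gt0 _ p3).
  - exact: ltW (gt0 _ Lc1).
  - by apply: bigmax_ge; rewrite inE eqxx.
  - by move=> j; apply: bigmax_ge; rewrite inE map_f ?orbT // mem_enum.
  - by move=> j h jm hk; apply: HE.
rewrite /kap in H.
have N0 : 0 < N (form n l) by rewrite absval_gt0.
have Ed : ln d = e / (2 * m%:R) by rewrite /d expRK.
have mE : m.-1%:R = m%:R - 1 :> R by rewrite -subn1 natrB.
have EX : ln ((d * A) ^+ k) = (n%:R * (m%:R - 1) + m%:R) * (e / (2 * m%:R) + ln A).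
  rewrite (ln_expn _ (gt0 _ X1)) ln_mul ?gt0 ?(ltW d1) // Ed.
  by rewrite /k natrD natrM mE.
have EW : ln W = (m%:R - 1) * (ln 2 + ln B) + \sum_i ln (Ai i).
  have EPi : ln (\prod_i Ai i) = \sum_i ln (Ai i) by rewrite ln_prod // => i _; apply: gt0.
  by rewrite /W ln_mul ?exprn_gt0 ?gt0 // (ln_expn _ (gt0 _ B21)) EPi (ln_mul _ (gt0 _ B1)) // mE.
have Ep1 : ln p1 = l%:R * ln n.+1%:R + l%:R * ln (2 * B).
  by rewrite /p1 ln_mul ?exprn_gt0 ?gt0 // !ln_expn ?gt0.
have Ep2 : ln p2 = m%:R * ln n.+1%:R + m%:R * ((n%:R + sig%:R) * ln (1 + t)).
  by rewrite /p2 ln_mul ?exprn_gt0 ?gt0 // !ln_expn ?exprn_gt0 ?gt0 // natrD.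
have EWt : ln ((W / t) ^+ n) = n%:R * (ln W - ln t).
  have Wt0 : 0 < W / t by rewrite divr_gt0 // gt0.
  by rewrite (ln_expn _ Wt0) ln_div ?posrE // gt0.
have {}H : ln (N (form n l)) <= ln 2 + (ln m%:R + (ln (bigmax1 N lams) + ((ln k%:R + ln E + ln ((d * A) ^+ k)) +
     (ln n.+1%:R + (ln p1 + ln p2) + ln ((W / t) ^+ n))))).
  have h1 : 0 < k%:R * E by rewrite mulr_gt0 ?gt0.
  have h2 := mulr_gt0 h1 (gt0 _ Xk1).
  have h3 := mulr_gt0 (gt0 _ p11) (gt0 _ p21).
  have h4 := mulr_gt0 h2 (gt0 _ p3).
  have h5 := mulr_gt0 (gt0 _ Lc1) h4.
  have h6 := mulr_gt0 mR h5.
  rewrite -(ln_mul (gt0 _ p11) (gt0 _ p21)) -(ln_mul (gt0 _ n1) h3) -(ln_mul (gt0 _ q1) (gt0 _ Wt1)).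
  rewrite -(ln_mul (gt0 _ kR) (gt0 _ E1)) -(ln_mul h1 (gt0 _ Xk1)) -(ln_mul h2 (gt0 _ p3)).
  rewrite -(ln_mul (gt0 _ Lc1) h4) -(ln_mul mR h5) -(ln_mul _ h6) //.
  by rewrite ler_ln ?posrE // mulr_gt0.
have lnn : ln n.+1%:R <= C1 + e2 * n.+1%:R by apply: HC1; rewrite ltr0n.
have lnn0 : 0 <= ln (n.+1%:R : R) by exact: ln_ge0.
have lnk : ln k%:R <= ln m%:R + ln n.+1%:R :> R.
  rewrite -ln_mul ?ltr0n // -natrM ler_ln ?posrE ?ltr0n ?muln_gt0 ?m0 // ler_nat.
  by rewrite /k mulnS [X in (_ <= X)%N]addnC leq_add2r mulnC leq_mul2r leq_pred orbT.
have l0 : l%:R * ln (n.+1%:R : R) <= m%:R * ln n.+1%:R by rewrite ler_wpM2r // ler_nat ltnW.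
have l1 : l%:R * ln (2 * B) <= m%:R * ln (2 * B) by rewrite ler_wpM2r ?ln_ge0 // ler_nat ltnW.
have e2E : (2 * m%:R + 2) * (e2 * n.+1%:R) = n%:R * (e / 2) + (2 * m%:R + 2) * e2.
  rewrite /e2 -natr1; field; rewrite gt_eqF // ltr_wpDl //; exact: ltW.
have emE : n%:R * (m%:R - 1) * (e / (2 * m%:R)) <= n%:R * (e / 2).
  rewrite -mulrA ler_wpM2l // mulrA ler_pdivrMr ?mulr_gt0 //.
  have -> : e / 2 * (2 * m%:R) = e * m%:R by field.
  by rewrite mulrC ler_wpM2l ?(ltW e0) // gerBl.
have a0 : 0 <= ln A by exact: ln_ge0.
have na : 0 <= n%:R * ln A by rewrite mulr_ge0.
have big : (2 * m%:R + 2) * ln (n.+1%:R : R) <= (2 * m%:R + 2) * (C1 + e2 * n.+1%:R).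
  by rewrite ler_wpM2l // addr_ge0 // mulr_ge0 // ltW.
have nt : n%:R * (m%:R * ln (1 + t) + (m%:R - 1) * ln 2 - ln t) <= n%:R * (ln 4 + (m%:R - 1)).
  by rewrite ler_wpM2l.
rewrite EX Ep1 Ep2 EWt EW in H.
rewrite mulrDr e2E in big.
move: H lnk l0 l1 emE na big nt.
rewrite (ln_mul _ (gt0 _ B1)) //.
move: (ln (N (form n l))) (ln k%:R) (ln n.+1%:R) (ln m%:R) (ln A) (ln B) (ln 2) (ln 4) (ln t) (ln (1 + t)) (ln E)
 (\sum_i _) (ln (bigmax1 N lams)) (e / (2 * m%:R)) => x1 x2 x3 x4 x5 x6 x7 x8 x9 x10 x11 x12 x13 x14 H1 H2 H3 H4 H5 H6 H7 H8; lra.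
Qed.

End Archimedean.
End PlaceBounds.

(** * The distinguished place *)

Lemma bigmax1_ge1 (R : realType) (K : Type) (w : K -> R) g : 1 <= bigmax1 w g.
Proof. by rewrite /bigmax1; elim: g => [|x g IH]; rewrite ?big_nil // big_cons le_max IH orbT. Qed.

Lemma bigmax1_ge (R : realType) (K : eqType) (w : K -> R) (g : seq K) x : x \in g -> w x <= bigmax1 w g.
Proof.
rewrite /bigmax1; elim: g => // y g IH; rewrite inE big_cons le_max => /orP[/eqP ->|/IH ->]; first by rewrite lexx.
by rewrite orbT.
Qed.

Section DistinguishedPlace.
Variables (R : realType) (F L : fieldType) (m : nat) (al s : 'I_m -> F).
Variables (beta lam0 : F) (lam : 'I_m.-1 -> F).
Variables (w0 N : F -> R) (ult : bool) (theta : R) (NL : L -> R) (iota : {rmorphism F -> L}).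
Hypothesis charF : forall n, n.+1%:R != 0 :> F.
Hypothesis m2 : (2 <= m)%N.
Hypothesis al_inj : injective al.
Hypothesis bm_neq : forall n, \sum_i s i != - (n.+2)%:R.
Hypothesis aN : absval N.
Hypothesis Nult : ult -> forall x y, N (x + y) <= Num.max (N x) (N y).
Hypothesis Nnat : forall k, N k%:R <= k%:R.
Hypothesis Nnat1 : ult -> forall k, N k%:R <= 1.
Hypothesis theta0 : 0 < theta.
Hypothesis w0E : forall x, w0 x = N x `^ theta.
Hypothesis aNL : absval NL.
Hypothesis NLE : forall x, NL (iota x) = w0 x.
Hypothesis complete : forall u : nat -> L, cauchy_abs NL u -> exists l, cvg_abs NL u l.
Variable X0 : R.
Hypothesis X01 : 1 <= X0.
(** X0 is the growth rate of the moments. The factor 16 covers a factor 2 for sums and a ratio r <=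
    2, and it is the amount that V > 0 provides. *)
Hypothesis beta_big : 16 * X0 < N beta.
Hypothesis moments : forall r : R, 1 < r -> exists2 E, 1 <= E &
  forall j h, (j.+1 < m)%N -> N (moment al s j h) <= E * (r * X0) ^+ h.
Local Notation mom j := (moment al s j).
Local Notation form n l := (pade_form al s beta lam0 lam n l).
Local Notation Ai i := (bigmax1 N [:: al i]).

Lemma Nbeta_gt0 : 0 < N beta.
Proof. by apply: lt_trans beta_big; rewrite mulr_gt0 // (lt_le_trans ltr01). Qed.

Lemma beta_neq0 : beta != 0.
Proof. by rewrite -(absval_eq0 aN) gt_eqF // Nbeta_gt0. Qed.

Lemma powR_expn (x : R) k : 0 <= x -> (x ^+ k) `^ theta = (x `^ theta) ^+ k.
Proof.
move=> x0; elim: k => [|k IH]; first by rewrite !expr0 powR1.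
by rewrite !exprS powRM ?exprn_ge0 // IH.
Qed.

Lemma powR_theta_le (x y : R) : 0 <= x -> x <= y -> x `^ theta <= y `^ theta.
Proof. by move=> x0 xy; rewrite ge0_ler_powR ?nnegrE ?(ltW theta0) // (le_trans x0). Qed.

Lemma powR_theta_lt1 (x : R) : 0 < x -> x < 1 -> 0 < x `^ theta < 1.
Proof.
move=> x0 x1; rewrite powR_gt0 //= /powR gt_eqF // expR_lt1 pmulr_rlt0 //.
by rewrite ln_lt0 // x0.
Qed.

Lemma beta_series_converges : exists l : 'I_m.-1 -> L, forall j : 'I_m.-1,
  cvg_abs NL (fun n => iota (\sum_(k < n) mom j k * beta ^- k.+1)) (l j).
Proof.
have b0 := Nbeta_gt0.
have X00 : 0 < X0 by exact: lt_le_trans X01.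
have [E E1 HE] := moments (r := 2) (ltr1n R 2).
suff H (j : 'I_m.-1) : exists l, cvg_abs NL (fun n => iota (\sum_(k < n) mom j k * beta ^- k.+1)) l.
  by have /choice[l Hl] := H; exists l.
apply: complete.
have jm : (j.+1 < m)%N by have := ltn_ord j; rewrite -ltnS prednK // ltnW.
have -> : (fun n => iota (\sum_(k < n) mom j k * beta ^- k.+1)) =
    (fun n => \sum_(k < n) iota (mom j k * beta ^- k.+1)).
  by apply/funext => n; rewrite rmorph_sum.
pose q := 2 * X0 / N beta.
have q0 : 0 < q by rewrite divr_gt0 // mulr_gt0.
have q1 : q < 1 by rewrite ltr_pdivrMr // mul1r (le_lt_trans _ beta_big) // ler_pM2r // ler_nat.
have E0 : 0 <= E by exact: le_trans E1.
apply: (@geometric_cauchy R L NL aNL (fun k => iota (mom j k * beta ^- k.+1)) ((E / N beta) `^ theta) (q `^ theta)).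
- exact: powR_ge0.
- exact: powR_theta_lt1.
move=> k; have qk : 0 <= q ^+ k by rewrite exprn_ge0 // ltW.
have EN : 0 <= E / N beta by rewrite divr_ge0 // ltW.
rewrite NLE w0E -(powR_expn _ (ltW q0)) -(powRM _ EN qk).
apply: powR_theta_le; first exact: absval_ge0.
rewrite absvalM // absvalV // absvalX //.
have -> : E / N beta * q ^+ k = E * (2 * X0) ^+ k / N beta ^+ k.+1.
  by rewrite /q exprMn exprVn exprS; field; rewrite expf_neq0 gt_eqF.
by rewrite ler_wpM2r ?invr_ge0 ?exprn_ge0 ?(ltW b0) // HE.
Qed.

(** The coefficient of z^0 vanishes, so the two partial sums differ by a shift of one index. *)
Lemma fcoef_series (bm : F) (j : nat) l : bm = \sum_i s i ->
  cvg_abs NL (fun n => iota (\sum_(k < n) mom j k * beta ^- k.+1)) l ->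
  cvg_abs NL (fun n => iota (\sum_(k < n) fcoef al s bm j k * beta ^- k)) l.
Proof.
move=> -> H e e0; have [n0 Hn0] := H e e0; exists n0.+1 => -[//|n] nn.
rewrite big_ord_recl /= {1}/fcoef ltn0Sn mul0r add0r.
by apply: Hn0.
Qed.

Lemma pade_remainder_bound (e : R) (l : 'I_m.-1 -> L) : 0 < e ->
  (forall j : 'I_m.-1, cvg_abs NL (fun n => iota (\sum_(k < n) mom j k * beta ^- k.+1)) (l j)) ->
  exists2 G : R, 0 < G & forall n l0 (j : 'I_m.-1), (l0 < m)%N ->
    NL (iota (pade al s n l0).[beta] * l j - iota (phi (dseq (mom j) beta) (pade al s n l0))) <=
    G * ((kap R ult 2 ^+ m.+1 * (expR e * X0) ^+ m * (\prod_i Ai i) / N beta) `^ theta) ^+ n.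
Proof.
move=> e0 Hl; have b0 := Nbeta_gt0; have X00 : 0 < X0 by exact: lt_le_trans X01.
(* The ratio r = 1 + c has to be at most 2 for the remainder series to converge, and at most exp e
   for the announced rate. *)
pose c := Num.min 1 e.
have c0 : 0 < c by rewrite lt_min ltr01.
have c1 : c <= 1 by rewrite ge_min lexx.
have ce : c <= e by rewrite ge_min lexx orbT.
pose r := 1 + c; have r1 : 1 < r by rewrite ltrDl.
have r2 : r <= 2 by rewrite /r -[2]/(1 + 1) lerD2l.
have re : r <= expR e by rewrite (le_trans (expR_ge1Dx c)) // ler_expR.
have r0 : 0 < r by exact: lt_trans r1.
have [E E1 HE] := moments r1.
have [X1 EX1] : exists X1, X1 = r * X0 by exists (r * X0).
have X11 : 1 <= X1 by rewrite EX1 mulr_ege1 // ltW.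
have X10 : 0 < X1 by exact: lt_le_trans X11.
set k2 := kap R ult 2.
have k21 : 1 <= k2 by exact: kapS_ge1.
have k22 : k2 <= 2 by rewrite /k2 /kap; case: (ult); rewrite // ler1n.
have k20 : 0 < k2 by exact: lt_le_trans k21.
pose q := k2 * X1 / N beta.
have q0 : 0 < q by rewrite divr_gt0 // mulr_gt0.
have q1 : q < 1.
  rewrite ltr_pdivrMr // mul1r (le_lt_trans _ beta_big) // EX1 mulrA ler_pM2r //.
  apply: (@le_trans _ _ (2 * 2)); first by apply: ler_pM => //; exact: ltW.
  by rewrite -natrM ler_nat.
have /andP[qt0 qt1] := powR_theta_lt1 q0 q1.
have E0 : 0 < E by exact: lt_le_trans E1.
pose P := \prod_i Ai i.
have Ai1 i : 1 <= Ai i by exact: bigmax1_ge1.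
have alA i : N (al i) <= Ai i by apply: bigmax1_ge; rewrite inE.
have P1 : 1 <= P by rewrite /P; elim/big_ind: _ => // x y x1 y1; rewrite mulr_ege1.
have P0 : 0 < P by exact: lt_le_trans P1.
pose H0 := E * X1 ^+ m / N beta.
have H00 : 0 < H0 by rewrite divr_gt0 // mulr_gt0 // exprn_gt0.
pose Y := k2 ^+ m.+1 * X1 ^+ m * P / N beta.
have Y0 : 0 < Y by rewrite divr_gt0 // !mulr_gt0 ?exprn_gt0.
exists (H0 `^ theta / (1 - q `^ theta)); first by rewrite divr_gt0 ?powR_gt0 // subr_gt0.
move=> n l0 j lm; have jm : (j.+1 < m)%N by have := ltn_ord j; rewrite -ltnS prednK // ltnW.
set PP := pade al s n l0.
apply: (@le_trans _ _ (H0 `^ theta / (1 - q `^ theta) * (Y `^ theta) ^+ n)); last first.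
  rewrite ler_wpM2l ?divr_ge0 ?powR_ge0 ?subr_ge0 ?(ltW qt1) //.
  rewrite lerXn2r ?nnegrE ?powR_ge0 // powR_theta_le ?(ltW Y0) // /Y.
  rewrite ler_pM2r ?invr_gt0 // ler_pM2r // ler_pM2l ?exprn_gt0 //.
  by rewrite lerXn2r ?nnegrE ?mulr_ge0 ?expR_ge0 ?(ltW X10) ?(ltW X00) // EX1 ler_pM2r.
apply: (remainder_le aNL beta_neq0 (Hl j)) => M.
pose t k := phi (mom j) ('X^k * PP) * beta ^- k.+1.
(* Orthogonality removes the first n terms; the geometric decay of the remaining tail is the
   smallness of the remainder. *)
have t_small k : (k < n)%N -> t k = 0.
  by move=> kn; rewrite /t /PP phi_pade // bin_small // mulr0 !mul0r.
have Ht k : (n <= k)%N -> NL (iota (t k)) <= H0 `^ theta * (Y `^ theta) ^+ n * (q `^ theta) ^+ (k - n).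
  move=> nk; set i := (k - n)%N; have Ek : k = (n + i)%N by rewrite subnKC.
  have Yn0 : 0 <= Y ^+ n by rewrite exprn_ge0 // ltW.
  have qi0 : 0 <= q ^+ i by rewrite exprn_ge0 // ltW.
  have HY0 : 0 <= H0 * Y ^+ n by rewrite mulr_ge0 // ltW.
  rewrite NLE w0E -(powR_expn _ (ltW q0)) -(powR_expn _ (ltW Y0)) -(powRM _ (ltW H00) Yn0) -(powRM _ HY0 qi0).
  apply: powR_theta_le; first exact: absval_ge0.
  rewrite /t absvalM // absvalV // absvalX // Ek.
  have Hmom h : N (mom j h) <= E * X1 ^+ h by rewrite EX1; apply: HE.
  have := @remainder_coef_bound F m al s R N ult aN Nult charF m2 bm_neq n l0 i j (fun i => Ai i) X1 E
    jm X11 (ltW E0) Ai1 alA Nnat Nnat1 Hmom.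
  rewrite /cofactor_bound -/k2 -/P -/PP => h.
  apply: (@le_trans _ _ (k2 ^+ (n + i) * (E * X1 ^+ (i + m) * (k2 * X1 * ((k2 * X1) ^+ m.-1 * P)) ^+ n) / N beta ^+ (n + i).+1)).
    rewrite ler_pM2r ?invr_gt0 ?exprn_gt0 // (le_trans h) // ler_pM2l ?exprn_gt0 //.
    rewrite ler_wpM2r ?exprn_ge0 ?mulr_ge0 ?exprn_ge0 ?mulr_ge0 ?(ltW k20) ?(ltW X10) ?(ltW P0) //.
    by rewrite ler_pM2l // ler_weXn2l // leq_add2l ltnW.
  rewrite le_eqVlt; apply/orP; left; apply/eqP.
  have -> : k2 * X1 * ((k2 * X1) ^+ m.-1 * P) = k2 ^+ m * X1 ^+ m * P.
    by rewrite mulrA -exprS prednK ?exprMn // ltnW.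
  rewrite /H0 /Y /q !exprMn !exprVn !exprD exprS -!exprM.
  have bn : N beta != 0 by rewrite gt_eqF.
  rewrite mulSn !exprD; field; by rewrite bn !expf_neq0.
have -> : \sum_(k < M) phi (mom j) ('X^k * PP) * beta ^- k.+1 = \sum_(0 <= k < M) t k by rewrite big_mkord.
have G0 : 0 <= H0 `^ theta * (Y `^ theta) ^+ n by rewrite mulr_ge0 ?exprn_ge0 ?powR_ge0.
rewrite rmorph_sum [leRHS]mulrAC; case: (leqP M n) => Mn.
  rewrite big_nat_cond big1 ?absval0 // => [|k /andP[/andP[_ kM] _]].
    by rewrite divr_ge0 // subr_ge0 ltW.
  by rewrite /= t_small ?rmorph0 //; apply: leq_trans kM Mn.
rewrite (@big_cat_nat _ _ _ n) ?(ltnW Mn) //= big_nat_cond big1 => [|k /andP[/andP[_ kM] _]]; last first.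
  by rewrite t_small ?rmorph0.
have := geometric_tail aNL (t := fun k => iota (t k)) (q := q `^ theta) G0 _ Ht (leqnn n) (ltnW Mn).
by rewrite qt0 qt1 subnn expr0 mulr1 add0r; apply.
Qed.

(** Subtracting P(beta) times the vanishing relation turns the form into minus the combination, with
    coefficients lam_j, of the remainders P(beta) f_j(beta) - Q_j(beta). *)
Lemma form_small (e : R) (l : 'I_m.-1 -> L) : 0 < e ->
  (forall j : 'I_m.-1, cvg_abs NL (fun n => iota (\sum_(k < n) mom j k * beta ^- k.+1)) (l j)) ->
  iota lam0 + \sum_(j < m.-1) iota (lam j) * l j = 0 ->
  exists C, forall n l0, (l0 < m)%N -> form n l0 != 0 -> ln (w0 (form n l0)) <=
    C + n%:R * (theta * (m.+1%:R * ln (kap R ult 2) + m%:R * ln X0 + \sum_i ln (Ai i) - ln (N beta) + e)).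
Proof.
move=> e0 Hl rel; have b0 := Nbeta_gt0; have X00 : 0 < X0 by exact: lt_le_trans X01.
have m0 : (0 < m)%N by exact: ltnW.
have mR : (0 : R) < m%:R by rewrite ltr0n.
have e'0 : 0 < e / m%:R by rewrite divr_gt0.
have [G G0 HG] := pade_remainder_bound e'0 Hl.
pose S := \sum_j NL (iota (lam j)).
have S0 : 0 <= S by apply: sumr_ge0 => j _; apply: absval_ge0.
have S1 : 0 < S + 1 by rewrite ltr_wpDl.
set k2 := kap R ult 2 in HG *; have k20 : 0 < k2 by rewrite (lt_le_trans ltr01) // kapS_ge1.
set P := \prod_i Ai i in HG.
have Ai0 i : 0 < Ai i by rewrite (lt_le_trans ltr01) // bigmax1_ge1.
have P0 : 0 < P by rewrite /P; apply: prodr_gt0.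
set Y := k2 ^+ m.+1 * (expR (e / m%:R) * X0) ^+ m * P / N beta in HG.
have eX0 : 0 < expR (e / m%:R) * X0 by rewrite mulr_gt0 // expR_gt0.
have Y0 : 0 < Y by rewrite divr_gt0 // !mulr_gt0 ?exprn_gt0.
exists (ln ((S + 1) * G)) => n l0 lm f0.
have EY : ln Y = m.+1%:R * ln k2 + m%:R * ln X0 + \sum_i ln (Ai i) - ln (N beta) + e.
  have EPi : ln P = \sum_i ln (Ai i) by rewrite ln_prod.
  have A0 : 0 < k2 ^+ m.+1 by exact: exprn_gt0.
  have B0 : 0 < (expR (e / m%:R) * X0) ^+ m by exact: exprn_gt0.
  rewrite /Y ln_div ?posrE ?mulr_gt0 // (ln_mul (mulr_gt0 A0 B0) P0) (ln_mul A0 B0).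
  rewrite (ln_expn _ k20) (ln_expn _ eX0) (ln_mul (expR_gt0 _) X00) expRK EPi mulrDr.
  by rewrite mulrCA mulfV ?mulr1 ?gt_eqF //; ring.
have Ef : iota (form n l0) = - \sum_j iota (lam j) * (iota (pade al s n l0).[beta] * l j -
     iota (phi (dseq (mom j) beta) (pade al s n l0))).
  rewrite /pade_form rmorphD rmorphM rmorph_sum /=.
  have -> : iota lam0 = - \sum_(j < m.-1) iota (lam j) * l j by apply/eqP; rewrite -addr_eq0 rel.
  rewrite mulNr mulr_suml -!sumrN -big_split /=; apply: eq_bigr => j _.
  by rewrite rmorphM /=; ring.
have w0n : w0 (form n l0) <= (S + 1) * G * (Y `^ theta) ^+ n.
  rewrite -NLE Ef absvalN // (le_trans (absval_le_sum aNL _ _ _)) //.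
  have YG : 0 <= G * (Y `^ theta) ^+ n by rewrite mulr_ge0 ?(ltW G0) // exprn_ge0 // powR_ge0.
  apply: (@le_trans _ _ (S * (G * (Y `^ theta) ^+ n))); last first.
    by rewrite -mulrA ler_wpM2r // lerDl.
  rewrite /S mulr_suml; apply: ler_sum => j _; rewrite absvalM // ler_wpM2l ?(absval_ge0 aNL) //.
  exact: HG.
have w00 : 0 < w0 (form n l0) by rewrite -NLE absval_gt0 // fmorph_eq0.
have SG : 0 < (S + 1) * G by rewrite mulr_gt0.
have Yt : 0 < (Y `^ theta) ^+ n by rewrite exprn_gt0 // powR_gt0.
rewrite -ler_ln ?posrE ?mulr_gt0 // in w0n.
apply: (le_trans w0n); rewrite (ln_mul SG Yt) ln_expn ?powR_gt0 // ln_powR EY.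
by [].
Qed.

End DistinguishedPlace.

(** * Combination of the local bounds *)

Section Heights.
Variables (R : realType) (K : fieldExtType rat).
Local Notation Sinf := (Sinf R K).

Definition arch_theta (w : K -> R) : R :=
  (arch_deg R (arch_index w))%:R / (\dim (fullv : {vspace K}))%:R.

Lemma arch_theta_gt0 w : 0 < arch_theta w.
Proof. by rewrite divr_gt0 ?ltr0n ?arch_deg_gt0 ?dim_gt0. Qed.

Lemma arch_theta_le1 w : w \in Sinf -> arch_theta w <= 1.
Proof.
move=> ws; rewrite -(arch_weights R K) (bigD1_seq w) ?uniq_Sinf //= lerDl.
by apply: sumr_ge0 => v _; apply: ltW; apply: arch_theta_gt0.
Qed.

Lemma hv_arch w g : place_inf w -> hv w g = arch_theta w * ln (bigmax1 (arch_abs R (arch_index w)) g).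
Proof.
move=> pw; have t0 := ltW (arch_theta_gt0 w); set N := arch_abs R _.
have E : bigmax1 w g = (bigmax1 N g) `^ arch_theta w.
  rewrite /bigmax1; elim: g => [|x g IH]; first by rewrite !big_nil powR1.
  rewrite !big_cons IH; have -> : w x = N x `^ arch_theta w by rewrite {1}(arch_indexE pw).
  have N0 : 0 <= N x by exact: absval_ge0 (absval_arch_abs R _) _.
  have M0 : 0 <= \big[Num.max/1]_(j <- g) N j.
    by rewrite (le_trans ler01) //; exact: (bigmax1_ge1 N g).
  have mono : {in Num.nneg &, {homo (fun y : R => y `^ arch_theta w) : y z / y <= z}} by exact: ge0_ler_powR.
  case: (leP (N x) (\big[Num.max/1]_(j <- g) N j)) => h.
    by rewrite max_r // mono // nnegrE.
  by rewrite max_l // mono ?nnegrE // ltW.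
by rewrite /hv -/(bigmax1 w g) E ln_powR.
Qed.

Lemma hv_le_height w g : @places R K w -> hv w g <= height R g.
Proof.
case=> [pw|pw].
  have := @height_ge R K g [::] isT (fun _ h => False_ind _ (Bool.diff_false_true h)).
  rewrite big_nil addr0; apply: le_trans.
  rewrite (bigD1_seq w) ?uniq_Sinf //=; last exact/mem_Sinf.
  by rewrite lerDl sumr_ge0 // => v _; apply: hv_ge0.
have := @height_ge R K g [:: w] isT; rewrite big_seq1 => H; apply: le_trans (H _).
  by rewrite lerDr sumr_ge0 // => v _; apply: hv_ge0.
by move=> v; rewrite inE => /eqP ->.
Qed.

Lemma height_ge0 g : 0 <= height R (g : seq K).
Proof.
have := @height_ge R K g [::] isT (fun _ h => False_ind _ (Bool.diff_false_true h)).
by rewrite big_nil addr0; apply: le_trans; apply: sumr_ge0 => v _; apply: hv_ge0.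
Qed.

Lemma big_delta (T : eqType) (r : seq T) w (c : R) : uniq r ->
  \sum_(v <- r) (if v == w then c else 0) = if w \in r then c else 0.
Proof.
move=> ur; case: ifP => wr.
  by rewrite (bigD1_seq w) //= eqxx big1 ?addr0 // => v /negPf ->.
rewrite big_seq big1 // => v vr; case: eqP => // E; by rewrite -E vr in wr.
Qed.

(** phi(D) <= D, and the sum contains the term j = 1. Nothing else is kept of the last term of V. *)
Lemma unit_fraction_sum_ge1 D : (0 < D)%N ->
  1 <= D%:R / (totient D)%:R * \sum_(1 <= j < D.+1 | coprime j D) (j%:R)^-1 :> R.
Proof.
move=> D0; rewrite mulr_ege1 //.
  rewrite ler_pdivlMr ?ltr0n ?totient_gt0 // mul1r ler_nat totient_count_coprime.
  rewrite big_mkord; apply: (@leq_trans (\sum_(i < D) 1)); last by rewrite sum_nat_const card_ord muln1.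
  by apply: leq_sum => i _; apply: leq_b1.
rewrite big_ltn_cond ?ltnS // coprime1n invr1 lerDl sumr_ge0 // => j _.
Qed.

End Heights.

Lemma big_of_ln (R : realType) (K : eqType) (N : K -> R) x (X : R) : 1 <= X ->
  ln 16 + ln X < ln (bigmax1 N [:: x]) -> 16 * X < N x.
Proof.
move=> X1; have X0 : 0 < X by exact: lt_le_trans X1.
rewrite -ln_mul // ltr_ln ?posrE ?mulr_gt0 ?(lt_le_trans ltr01 (bigmax1_ge1 _ _)) //.
rewrite /bigmax1 big_cons big_nil lt_max => /orP[//|h]; exfalso.
have : 16 * X < X by exact: lt_le_trans h X1.
lra.
Qed.

Section Assembly.
Variables (R : realType) (K : fieldExtType rat) (m : nat).
Variables (al : 'I_m -> K) (s : 'I_m -> rat) (u : int) (D : nat) (beta : K).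
Let sK i : K := (s i)%:A.
Let q i : nat := `|denq (s i)|%N.
Hypothesis m2 : (2 <= m)%N.
Hypothesis al_inj : injective al.
Hypothesis s_neq : forall i (n : nat), s i != - (n.+1)%:R.
Hypothesis D0 : (0 < D)%N.
Hypothesis cuD : coprime `|u| D.
Hypothesis bmE : \sum_i sK i = u%:~R / D%:R.
Hypothesis bm_neq : forall n, \sum_i sK i != - (n.+2)%:R.
Variable w0 : K -> R.
Hypothesis hw0 : @places R K w0.
Hypothesis hV : 0 < Vv al s D w0 beta.
Variables (L : fieldType) (NL : L -> R) (iota : {rmorphism K -> L}).
Hypothesis completionL : completion w0 NL iota.
Let als := [seq al i | i : 'I_m].
Local Notation lcmD n := (lcm_progression u D n).
Local Notation Sinf := (Sinf R K).

Lemma ln_Mw (w : K -> R) : place_fin w -> ln (Mw s w) = \sum_i ln (Mfin w (q i)).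
Proof.
move=> pw; rewrite /Mw ln_prod // => i _.
by rewrite (lt_le_trans ltr01) // Mfin_ge1 // denq_abs_gt0.
Qed.

(** At one fixed place the lcm is as small as a single one of its terms, so it costs only a factor
    linear in n. This gives convergence at a finite w0, where the global lcm estimate would be too
    expensive. *)
Lemma fin_lcm_inv (w : K -> R) n : place_fin w -> (w (lcmD n)%:R)^-1 <= (D * (n + `|u|))%:R + 1.
Proof.
move=> pw; have [p pp wp] := fin_above pw.
have L0 := progression_lcm_gt0 D0 bmE bm_neq n.
rewrite (fin_natE pw pp wp L0).
case: (logn_lcm_progression (fun k => progression_gt0 D0 bmE bm_neq (k := k)) p n) => [->|[k kn ->]].
  by rewrite expr0 invr1 lerDr.
have rk : (0 < `|(u + D%:Z * k%:Z)%R|)%N by apply: (progression_gt0 D0 bmE bm_neq); case/andP: kn.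
rewrite -(fin_natE pw pp wp rk).
have := @ln_nat_place_le R K _ [:: w] rk isT; rewrite big_seq1 => H.
have wr := fin_nat_gt0 pw rk.
have {}H : (w (`|(u + D%:Z * k%:Z)%R|%N)%:R)^-1 <= (`|(u + D%:Z * k%:Z)%R|%N)%:R.
  rewrite -ler_ln ?posrE ?invr_gt0 ?ltr0n // lnV ?posrE //.
  by apply: H => v; rewrite inE => /eqP ->.
apply: (le_trans H); rewrite (le_trans (y := (D * (n + `|u|))%:R)) ?lerDl // ler_nat.
have := progression_term_le D0 cuD k; case/andP: kn => _ kn H'; apply: leq_trans H' _; rewrite leq_mul2l; lia.
Qed.

Lemma fin_moments (w : K -> R) (r : R) : place_fin w -> 1 < r -> exists2 E, 1 <= E &
  forall j h, (j.+1 < m)%N -> w (moment al sK j h) <=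
    E * (r * (bigmax1 w als * (Mw s w / Mfin w D))) ^+ h.
Proof.
move=> pw r1; have [E [E1 _ MD HE]] := fin_moment al m2 D0 cuD bmE bm_neq pw.
have [C C0 HC] := @poly_subexp R 1 D%:R (D * (1 + `|u|)%N + 1)%:R r (ler0n _ _) (ler0n _ _) r1.
exists (E * (C + 1)) => [|j h jm]; first by rewrite mulr_ege1 // lerDr.
move: (HE j h h jm (leqnn h)); move EX : (bigmax1 w als * _) => X {}HE.
have X0 : 0 <= X by rewrite -EX mulr_ge0 ?divr_ge0 // (le_trans ler01) ?bigmax1_ge1 ?Mw_ge1 ?Mfin_ge1.
have E0 := le_trans ler01 E1; have r0 : 0 <= r by rewrite (le_trans ler01) // ltW.
apply: (le_trans HE); rewrite exprMn.
have -> : E * (C + 1) * (r ^+ h * X ^+ h) = E * ((C + 1) * r ^+ h) * X ^+ h by ring.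
rewrite ler_wpM2r ?exprn_ge0 // ler_wpM2l // (le_trans (fin_lcm_inv _ pw)) //.
apply: (@le_trans _ _ (C * r ^+ h)); last by rewrite ler_wpM2r ?exprn_ge0 // lerDl.
apply: le_trans (HC h); rewrite expr1 -natrM -natrD natr1 ler_nat.
by nia.
Qed.

(** As h_v <= h, the terms of V in beta amount to at most h_v(beta), which therefore exceeds m times
    the sum of heights and constants; m >= 2 turns log 4 into log 16. *)
Lemma V_beta : hv w0 als + \sum_i ln_mu R (q i) + ln 16 < hv w0 [:: beta].
Proof.
have mR : 2 <= m%:R :> R by rewrite (ler_nat _ 2).
have h1 := hv_le_height [:: beta] hw0.
have h2 : 0 <= \sum_(i < m) height R [:: al i] by apply: sumr_ge0 => i _; apply: height_ge0.
have h3 := hv_le_height als hw0.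
have h4 : 0 <= \sum_i ln_mu R (q i) by apply: sumr_ge0 => i _; rewrite ln_mu_ge0 // denq_abs_gt0.
have h5 := unit_fraction_sum_ge1 R D0.
have h6 := height_ge0 R als.
have l4 : 0 <= ln 4 :> R by rewrite ln_ge0 // ler1n.
have l16 : ln 16 = 2 * ln 4 :> R.
  have -> : 16 = 4 ^+ 2 :> R by rewrite -natrX.
  by rewrite ln_expn.
have Emu : \sum_(i < m) ln (mu R (s i)) = \sum_i ln_mu R (q i).
  by apply: eq_bigr => i _; exact: ln_muE.
move: hV; rewrite /Vv Emu l16; move: h1 h2 h3 h4 h5 h6 l4.
move: (hv w0 [:: beta]) (height R [:: beta]) (\sum_(i < m) height R [:: al i]) (hv w0 als) (height R als)
  (\sum_i ln_mu R (q i)) (_ / _ * _) (ln 4) => b hb S a ha M T l4 h1 h2 h3 h4 h5 h6 h7 V.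
have k1 : (m%:R - 1) * b <= (m%:R - 1) * hb by rewrite ler_wpM2l // subr_ge0; lra.
have k2 : 2 * (ha + M + l4) <= m%:R * (ha + M + l4) by rewrite ler_wpM2r // !addr_ge0.
have k3 : (m%:R - 1) * 1 <= (m%:R - 1) * T by rewrite ler_wpM2l // subr_ge0; lra.
by lra.
Qed.

(** What a place pays per step beyond heights: a weighted share of the constant 4 e^(m-1) if
    archimedean, otherwise the denominators of the s_i minus the saving above D. *)
Definition local_term (w : K -> R) : R := if w \in Sinf then arch_theta w * (ln 4 + (m%:R - 1))
  else m%:R * ln (Mw s w) - (m%:R - 1) * ln (Mfin w D).

Lemma ln2_le1 : ln 2 <= 1 :> R.
Proof. by rewrite -[leRHS](@expRK R) ler_ln ?posrE ?expR_gt0 // (le_trans _ (expR_ge1Dx 1)). Qed.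

Lemma ln4E : ln 4 = 2 * ln 2 :> R.
Proof.
have -> : 4 = 2 ^+ 2 :> R by rewrite -natrX.
by rewrite ln_expn.
Qed.

(** At w0 the term (m - 1) h_w0(beta) of the general rate becomes -h_w0(beta): the gain is m
    h_w0(beta), the leading term of V. *)
Lemma distinguished_place :
  (exists l : 'I_m.-1 -> L, forall j : 'I_m.-1,
    cvg_abs NL (fun n => iota (\sum_(k < n) moment al sK j k * beta ^- k.+1)) (l j)) /\
  (forall (l : 'I_m.-1 -> L) lam0 (lam : 'I_m.-1 -> K) (e : R), 0 < e ->
    (forall j : 'I_m.-1, cvg_abs NL (fun n => iota (\sum_(k < n) moment al sK j k * beta ^- k.+1)) (l j)) ->
    iota lam0 + \sum_(j < m.-1) iota (lam j) * l j = 0 ->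
    exists C, forall n l0, (l0 < m)%N -> pade_form al sK beta lam0 lam n l0 != 0 ->
      ln (w0 (pade_form al sK beta lam0 lam n l0)) <= C + n%:R * (- hv w0 [:: beta] +
        \sum_i hv w0 [:: al i] + m%:R * hv w0 als + local_term w0 + e)).
Proof.
case: completionL => aNL NLE compl _; have Vb := V_beta.
have mu0 : 0 <= \sum_i ln_mu R (q i) by apply: sumr_ge0 => i _; rewrite ln_mu_ge0 // denq_abs_gt0.
have l16 : 0 <= ln 16 :> R by rewrite ln_ge0 // ler1n.
have charK n : n.+1%:R != 0 :> K by exact: nat_neq0.
case: (hw0) => pw.
  pose N := arch_abs R (arch_index w0); pose t := arch_theta w0.
  have ws : w0 \in Sinf by exact/mem_Sinf.
  have aN : absval N by exact: absval_arch_abs.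
  have Nnat n : N n%:R = n%:R by exact: arch_abs_nat.
  have t0 : 0 < t by exact: arch_theta_gt0.
  have t1 : t <= 1 by exact: arch_theta_le1.
  have w0E x : w0 x = N x `^ t by rewrite {1}(arch_indexE pw).
  have A1 : 1 <= bigmax1 N als by exact: bigmax1_ge1.
  have bb : 16 * bigmax1 N als < N beta.
    apply: big_of_ln => //; rewrite -(ltr_pM2l t0) -(hv_arch _ pw) mulrDr -(hv_arch als pw).
    have : t * ln 16 <= ln 16 by rewrite ler_piMl.
    lra.
  have Hm r : 1 < r -> exists2 E, 1 <= E & forall j h, (j.+1 < m)%N ->
      N (moment al sK j h) <= E * (r * bigmax1 N als) ^+ h.
    by move=> r1; apply: arch_moments.
  split; first exact: (beta_series_converges m2 aN t0 w0E aNL NLE compl A1 bb Hm).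
  move=> l lam0 lam e e0 Hl rel.
  have Nle k : N k%:R <= k%:R by rewrite Nnat.
  have [C HC] := form_small (ult := false) charK m2 bm_neq aN (fun h => False_ind _ (Bool.diff_false_true h)) Nle
    (fun h => False_ind _ (Bool.diff_false_true h)) t0 w0E aNL NLE A1 bb Hm e0 Hl rel.
  exists C => n l0 lm f0; apply: (le_trans (HC n l0 lm f0)).
  rewrite lerD2l ler_wpM2l // /local_term ws !(hv_arch _ pw) (eq_bigr _ (fun i _ => hv_arch [:: al i] pw)).
  rewrite -mulr_sumr /kap -/N -/t.
  have Nb : ln (bigmax1 N [:: beta]) = ln (N beta).
    rewrite /bigmax1 big_cons big_nil max_l // (le_trans _ (ltW bb)) // (le_trans A1) // ler_peMl //.
    - exact: le_trans A1.
    - by rewrite ler1n.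
  rewrite Nb ln4E -[m.+1%:R]natr1.
  (* The remainder costs (m + 1) ln 2, which stays within the archimedean share ln 4 + (m - 1)
     because ln 2 <= 1. *)
  have k1 : m%:R * ln 2 - ln 2 <= m%:R - 1 :> R.
    have -> : m%:R * ln 2 - ln 2 = (m%:R - 1) * ln 2 :> R by ring.
    by rewrite ler_piMr ?ln2_le1 // subr_ge0 ler1n ltnW.
  set S := \sum_i ln _; set a := ln (bigmax1 N als); set b := ln (N beta).
  have te : t * e <= e by rewrite ler_piMl // ltW.
  have tk : t * (m%:R * ln 2 - ln 2) <= t * (m%:R - 1) by rewrite ler_wpM2l // ltW.
  by rewrite !mulrDr in tk *; lra.
have wns : (w0 \in Sinf) = false.
  by apply/negP => /mem_Sinf h; apply: (place_inf_not_fin h pw).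
have aN := fin_absval pw.
have w0E x : w0 x = w0 x `^ 1 by rewrite powRr1 // (fin_ge0 pw).
have [_ [_ _ MD _]] := fin_moment al m2 D0 cuD bmE bm_neq pw.
have M1 := Mw_ge1 s pw; have MD1 := Mfin_ge1 pw D0.
have A1 : 1 <= bigmax1 w0 als by exact: bigmax1_ge1.
have gt0 (x : R) : 1 <= x -> 0 < x by exact: lt_le_trans.
have q1 : 1 <= Mw s w0 / Mfin w0 D by rewrite ler_pdivlMr ?mul1r // gt0.
have X1 : 1 <= bigmax1 w0 als * (Mw s w0 / Mfin w0 D) by rewrite mulr_ege1.
have lnX : ln (bigmax1 w0 als * (Mw s w0 / Mfin w0 D)) = hv w0 als + (ln (Mw s w0) - ln (Mfin w0 D)).
  by rewrite ln_mul ?gt0 // ln_div ?posrE ?gt0.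
have lnMD0 : 0 <= ln (Mfin w0 D) by exact: ln_ge0.
have lnMw : ln (Mw s w0) <= \sum_i ln_mu R (q i).
  rewrite ln_Mw //; apply: ler_sum => i _.
  have := @sum_ln_Mfin_le R K [:: w0] (q i) (denq_abs_gt0 s i) isT; rewrite big_seq1; apply=> v.
  by rewrite inE => /eqP ->.
have bb : 16 * (bigmax1 w0 als * (Mw s w0 / Mfin w0 D)) < w0 beta.
  have Vb' : hv w0 als + \sum_i ln_mu R (q i) + ln 16 < ln (bigmax1 w0 [:: beta]) by [].
  by apply: big_of_ln => //; rewrite lnX; lra.
have Hm r : 1 < r -> exists2 E, 1 <= E & forall j h, (j.+1 < m)%N ->
    w0 (moment al sK j h) <= E * (r * (bigmax1 w0 als * (Mw s w0 / Mfin w0 D))) ^+ h.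
  by move=> r1; apply: fin_moments.
split; first exact: (beta_series_converges m2 aN ltr01 w0E aNL NLE compl X1 bb Hm).
move=> l lam0 lam e e0 Hl rel.
have Nle k : w0 k%:R <= k%:R.
  by case: k => [|k]; [rewrite (fin0 pw)|rewrite (le_trans (fin_nat_le1 pw _)) // ler1n].
have [C HC] := form_small (ult := true) charK m2 bm_neq aN (fun _ => fin_ultra pw) Nle
    (fun _ => fin_nat_le1 pw) ltr01 w0E aNL NLE X1 bb Hm e0 Hl rel.
exists C => n l0 lm f0; apply: (le_trans (HC n l0 lm f0)).
rewrite lerD2l ler_wpM2l // /local_term wns mul1r lnX /kap ln1 mulr0 add0r.
have Nb : hv w0 [:: beta] = ln (w0 beta).
  rewrite /hv big_cons big_nil max_l // (le_trans _ (ltW bb)) // mulr_ege1 // ler1n //.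
have -> : \sum_(i < m) ln (bigmax1 w0 [:: al i]) = \sum_(i < m) hv w0 [:: al i] by [].
by rewrite Nb; lra.
Qed.

End Assembly.

(** The closing inequality of [combine_places], stated over plain variables so that linear
    arithmetic does not meet the sums over places. *)
Lemma bound_arithmetic (R : realFieldType) (n m m1 sz e x1 x2 x3 x4 x5 x6 g1 g2 d1 d2 H L CL l4 lD G hb V : R) :
  0 <= x1 + x2 ->
  x1 <= x3 + n * (g1 + d1 + sz * e) ->
  x2 <= x4 + x6 + n * (g2 + d2) ->
  x4 <= x5 ->
  x6 <= H + L ->
  L <= CL + (n * (m - 1) + m1) * (l4 + lD + e) ->
  n * (g1 + g2 + (d1 + d2) + (G + (m - 1) * (l4 + lD) - hb)) <= n * (G + (e - hb) - V) ->
  n * V <= x3 + x5 + H + CL + m1 * (l4 + lD + e) + n * ((sz + m) * e).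
Proof. lra. Qed.

Section Independence.
Variables (R : realType) (K : fieldExtType rat) (m : nat).
Variables (al : 'I_m -> K) (s : 'I_m -> rat) (u : int) (D : nat) (beta : K).
Let sK i : K := (s i)%:A.
Let q i : nat := `|denq (s i)|%N.
Hypothesis m2 : (2 <= m)%N.
Hypothesis al_inj : injective al.
Hypothesis s_neq : forall i (n : nat), s i != - (n.+1)%:R.
Hypothesis D0 : (0 < D)%N.
Hypothesis cuD : coprime `|u| D.
Hypothesis bmE : \sum_i sK i = u%:~R / D%:R.
Hypothesis bm_neq : forall n, \sum_i sK i != - (n.+2)%:R.
Let als := [seq al i | i : 'I_m].
Local Notation lcmD n := (lcm_progression u D n).
Local Notation Sinf := (Sinf R K).

Definition mu_sum : R := \sum_i ln_mu R (q i).

Definition growth (w : K -> R) : R := (m%:R - 1) * hv w [:: beta] + \sum_i hv w [:: al i]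
  + m%:R * hv w als + local_term s D w.

Lemma fin_notin_Sinf (w : K -> R) : place_fin w -> (w \in Sinf) = false.
Proof. by move=> pw; apply/negP => /mem_Sinf h; apply: (place_inf_not_fin h pw). Qed.

Lemma sum_ln_Mw_le S : uniq S -> (forall w : K -> R, w \in S -> place_fin w) ->
  \sum_(w <- S) ln (Mw s w) <= mu_sum.
Proof.
move=> uS pS; rewrite big_seq (eq_bigr (fun w => \sum_i ln (Mfin w (q i)))); last first.
  by move=> w /pS pw; rewrite ln_Mw.
rewrite -big_seq exchange_big; apply: ler_sum => i _ /=.
by apply: sum_ln_Mfin_le => //; apply: denq_abs_gt0.
Qed.

Lemma sum_hv_fin_le g S : uniq S -> (forall w : K -> R, w \in S -> place_fin w) ->
  \sum_(w <- S) hv w g <= height R g.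
Proof.
move=> uS pS; apply: le_trans (height_ge g uS pS).
by rewrite lerDr sumr_ge0 // => w _; apply: hv_ge0.
Qed.

(** [ln (Mfin w D)] enters with a negative sign, so its sum needs a lower bound: that is why S must
    contain every place above D. *)
Lemma growth_sum S : uniq S -> (forall w : K -> R, w \in S -> place_fin w) ->
  (forall w, place_fin w -> w D%:R < 1 -> w \in S) ->
  \sum_(w <- Sinf) growth w + \sum_(w <- S) growth w <=
  (m%:R - 1) * height R [:: beta] + \sum_i height R [:: al i] + m%:R * height R als
  + (ln 4 + (m%:R - 1)) + (m%:R * mu_sum - (m%:R - 1) * ln_mu R D).
Proof.
move=> uS pS HS; have m1 : 1 <= m%:R :> R by rewrite ler1n ltnW.
have h1 := height_ge [:: beta] uS pS.
have h2 : \sum_(w <- Sinf) \sum_i hv w [:: al i] + \sum_(w <- S) \sum_i hv w [:: al i] <= \sum_i height R [:: al i].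
  by rewrite [X in X + _]exchange_big [X in _ + X]exchange_big -big_split; apply: ler_sum => i _; apply: height_ge.
have h3 := height_ge als uS pS.
have h4 := sum_ln_Mw_le uS pS.
have h5 := sum_ln_Mfin_ge D0 uS pS HS.
have i1 : \sum_(w <- Sinf) local_term s D w = ln 4 + (m%:R - 1).
  rewrite big_seq (eq_bigr (fun w => arch_theta w * (ln 4 + (m%:R - 1)))); last first.
    by move=> w wS; rewrite /local_term wS.
  by rewrite -big_seq -mulr_suml arch_weights mul1r.
have i2 : \sum_(w <- S) local_term s D w = m%:R * (\sum_(w <- S) ln (Mw s w)) - (m%:R - 1) * (\sum_(w <- S) ln (Mfin w D)).
  rewrite big_seq (eq_bigr (fun w => m%:R * ln (Mw s w) - (m%:R - 1) * ln (Mfin w D))); last first.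
    by move=> w /pS pw; rewrite /local_term fin_notin_Sinf.
  by rewrite -big_seq big_split /= sumrN -!mulr_sumr.
rewrite /growth !big_split /= -!mulr_sumr i1 i2.
have k1 := ler_wpM2l (le_trans ler01 m1) h3.
have k2 : (m%:R - 1) * (\sum_(w <- Sinf) hv w [:: beta] + \sum_(w <- S) hv w [:: beta]) <= (m%:R - 1) * height R [:: beta].
  by rewrite ler_wpM2l // subr_ge0.
have k3 := ler_wpM2l (le_trans ler01 m1) h4.
have k4 : (m%:R - 1) * ln_mu R D <= (m%:R - 1) * \sum_(w <- S) ln (Mfin w D).
  by rewrite ler_wpM2l // subr_ge0.
lra.
Qed.

(** The two occurrences of [ln_mu R D] cancel and ln 4 occurs m times in all; the remaining m - 1 is
    absorbed by [unit_fraction_sum_ge1]. *)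
Lemma Vv_le (w0 : K -> R) : (m%:R - 1) * height R [:: beta] + \sum_i height R [:: al i] + m%:R * height R als
  + (ln 4 + (m%:R - 1)) + (m%:R * mu_sum - (m%:R - 1) * ln_mu R D)
  + (m%:R - 1) * (ln 4 + ln_mu R D) - m%:R * hv w0 [:: beta] <= - Vv al s D w0 beta.
Proof.
have Emu : \sum_(i < m) ln (mu R (s i)) = mu_sum by apply: eq_bigr => i _; exact: ln_muE.
have T1 := unit_fraction_sum_ge1 R D0; rewrite /Vv Emu -/als.
have k : (m%:R - 1) * 1 <= (m%:R - 1) * (D%:R / (totient D)%:R * \sum_(1 <= j < D.+1 | coprime j D) (j%:R)^-1) :> R.
  by rewrite ler_wpM2l // subr_ge0 ler1n ltnW.
lra.
Qed.

Section Relation.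
Variables (lam0 : K) (lam : 'I_m.-1 -> K).
Local Notation form n l := (pade_form al sK beta lam0 lam n l).
Let lams := lam0 :: [seq lam j | j : 'I_m.-1].

Lemma inf_form_ln (w : K -> R) (e : R) : place_inf w -> 0 < e -> exists C, forall n l, (l < m)%N -> form n l != 0 ->
  ln (w (form n l)) <= C + n%:R * (growth w + e).
Proof.
move=> pw e0; have ws : w \in Sinf by exact/mem_Sinf.
pose N := arch_abs R (arch_index w); pose t := arch_theta w.
have aN : absval N by exact: absval_arch_abs.
have Nnat n : N n%:R = n%:R by exact: arch_abs_nat.
have t0 : 0 < t by exact: arch_theta_gt0.
have t1 : t <= 1 by exact: arch_theta_le1.
have [C HC] := arch_form_ln beta lam0 lam m2 al_inj bm_neq aN Nnat e0.
exists (t * C) => n l lm f0; have H := HC n l lm f0.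
rewrite (ln_arch_place _ pw) -/N -/(arch_theta w) -/t.
apply: (le_trans (ler_wpM2l (ltW t0) H)); rewrite mulrDr lerD2l mulrCA ler_wpM2l //.
rewrite /growth /local_term ws !(hv_arch _ pw) (eq_bigr _ (fun i _ => hv_arch [:: al i] pw)) -mulr_sumr -/N -/t.
have te : t * e <= e by rewrite ler_piMl // ltW.
by rewrite !mulrDr; lra.
Qed.

(** The part of the finite bound that is not a multiple of n at a single place, but whose sum over
    places contains ln of the lcm and so still grows linearly. Being nonnegative, it may also be
    added at w0. *)
Definition fin_error n (w : K -> R) : R := hv w lams + m%:R * hv w [:: beta] + m%:R * (hv w als + ln (Mw s w))
  - ln (w (lcmD (n * m.-1 + m).+1)%:R).

Lemma fin_error_ge0 n (w : K -> R) : place_fin w -> 0 <= fin_error n w.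
Proof.
move=> pw; have L0 := progression_lcm_gt0 D0 bmE bm_neq (n * m.-1 + m).+1.
have := ln_le0 (fin_nat_le1 pw (lcmD (n * m.-1 + m).+1)).
have h1 := ln_ge0 (Mw_ge1 s pw).
move: (hv_ge0 w lams) (hv_ge0 w [:: beta]) (hv_ge0 w als) => h2 h3 h4 h5.
by rewrite /fin_error subr_ge0 (le_trans h5) // !addr_ge0 // mulr_ge0 // addr_ge0.
Qed.

Lemma fin_error_sum n S : uniq S -> (forall w : K -> R, w \in S -> place_fin w) ->
  \sum_(w <- S) fin_error n w <= height R lams + m%:R * height R [:: beta] + m%:R * (height R als + mu_sum)
    + ln (lcmD (n * m.-1 + m).+1)%:R.
Proof.
move=> uS pS; rewrite /fin_error !big_split /= -!mulr_sumr big_split /=.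
have L0 := progression_lcm_gt0 D0 bmE bm_neq (n * m.-1 + m).+1.
have h := ln_nat_place_le L0 uS pS.
by rewrite !lerD // ?ler_wpM2l // ?lerD // ?sum_hv_fin_le // sum_ln_Mw_le.
Qed.

(** The slack is counted as follows: one e for each archimedean place, m - 1 for the lcm, and one
    for w0 when it is finite. *)
Lemma combine_places (w0 : K -> R) (e : R) : @places R K w0 -> 0 < e ->
  ~ (lam0 = 0 /\ forall j, lam j = 0) ->
  (exists C, forall n l, (l < m)%N -> form n l != 0 ->
     ln (w0 (form n l)) <= C + n%:R * (growth w0 - m%:R * hv w0 [:: beta] + e)) ->
  Vv al s D w0 beta <= ((size Sinf)%:R + m%:R) * e.
Proof.
move=> hw0 e0 nz [C0 HC0].
set hb := m%:R * hv w0 [:: beta] in HC0.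
(* d and d' are the gain at w0 for archimedean and finite w0; d' includes the slack e, which finite
   places do not otherwise carry. *)
pose d (w : K -> R) : R := if w == w0 then - hb else 0.
pose d' (w : K -> R) : R := if w == w0 then e - hb else 0.
have [Ci HCi] : exists Ci : (K -> R) -> R, forall w, place_inf w -> forall n l, (l < m)%N -> form n l != 0 ->
    ln (w (form n l)) <= Ci w + n%:R * (growth w + d w + e).
  suff /choice[C HC] : forall w, exists C, place_inf w -> forall n l, (l < m)%N -> form n l != 0 ->
    ln (w (form n l)) <= C + n%:R * (growth w + d w + e) by exists C.
  move=> w; rewrite /d.
  have [->|ww] := eqVneq w w0; first by exists C0 => _; exact: HC0.
  have [pw|npw] := pselect (place_inf w); last by exists 0.
  by have [C HC] := inf_form_ln pw e0; exists C => _ n l lm f0; rewrite addr0; exact: HC.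
have [Cf HCf] : exists Cf : (K -> R) -> R, forall w, 0 <= Cf w /\ (place_fin w ->
    (w != w0 -> w D%:R = 1 -> Cf w = 0) /\ forall n l, (l < m)%N -> form n l != 0 ->
    ln (w (form n l)) <= Cf w + fin_error n w + n%:R * (growth w + d' w)).
  suff /choice[C HC] : forall w, exists C, 0 <= C /\ (place_fin w ->
    (w != w0 -> w D%:R = 1 -> C = 0) /\ forall n l, (l < m)%N -> form n l != 0 ->
    ln (w (form n l)) <= C + fin_error n w + n%:R * (growth w + d' w)) by exists C.
  move=> w; rewrite /d'.
  have [->|ww] := eqVneq w w0.
    exists (Num.max 0 C0); rewrite le_max lexx; split=> // pw; split=> // n l lm f0.
    apply: (le_trans (HC0 n l lm f0)); have -> : growth w0 - hb + e = growth w0 + (e - hb) by ring.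
    rewrite lerD2r (le_trans (y := Num.max 0 C0)) ?le_max ?lexx ?orbT //.
    by rewrite lerDl fin_error_ge0.
  have [pw|npw] := pselect (place_fin w); last by exists 0.
  have [E [E0 ED HE]] := fin_form_ln beta lam0 lam m2 al_inj D0 cuD bmE bm_neq pw.
  exists E; split=> // _; split=> [_ //|n l lm f0].
  apply: (le_trans (HE n l lm f0)).
  rewrite addr0 /growth /local_term fin_notin_Sinf // /fin_error -/als -/lams.
  rewrite le_eqVlt; apply/orP; left; apply/eqP; ring.
have [SD [uSD HSD]] := @places_dividing R K D D0.
(* The constants Cf vanish at the finite places outside S0, which is independent of n. The set S of
   the product formula depends on the value of the form, hence on n. *)
pose S0 := undup (w0 :: SD).
have [CL HCL] := ln_lcm_progression_asymptotic (R := R) D0 cuD (fun k => progression_gt0 D0 bmE bm_neq (k := k)) e0.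
pose c := \sum_(w <- Sinf) Ci w + \sum_(w <- S0) Cf w + (height R lams + m%:R * height R [:: beta] + m%:R * (height R als + mu_sum))
  + CL + m.+1%:R * (ln 4 + ln_mu R D + e).
apply: (@le_of_linear_bound R _ _ c 0) => n _.
have charK k : k.+1%:R != 0 :> K by exact: nat_neq0.
have [l Hl] := pade_nonvanishing charK m2 al_inj (fun i k => sK_neq K s_neq i k) bm_neq n beta nz.
have f0 : form n l != 0 by [].
have [M M0 HM] := product_formula R f0.
have [SM [uSM HSM]] := @places_dividing R K M M0.
have finP w : reflect (place_fin w) `[< @place_fin R K w >] by apply: asboolP.
pose S := undup ([seq w <- [:: w0] | `[< place_fin w >]] ++ SD ++ SM).
have uS : uniq S by exact: undup_uniq.
have pS w : w \in S -> place_fin w.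
  rewrite mem_undup !mem_cat mem_filter => /or3P[/andP[/asboolP //]|/HSD[]//|/HSM[]//].
have SDS w : place_fin w -> w D%:R < 1 -> w \in S.
  by move=> pw wD; rewrite mem_undup !mem_cat (_ : w \in SD) ?orbT //; apply/HSD.
have SMS w : place_fin w -> w M%:R < 1 -> w \in S.
  by move=> pw wD; rewrite mem_undup !mem_cat (_ : w \in SM) ?orbT //; apply/HSM.
have PF := HM S uS pS SMS.
have spl (r : seq (K -> R)) (f g : (K -> R) -> R) :
  \sum_(w <- r) (f w + g w) = \sum_(w <- r) f w + \sum_(w <- r) g w by rewrite big_split.
have B1 : \sum_(w <- Sinf) ln (w (form n l)) <= \sum_(w <- Sinf) Ci w +
    n%:R * (\sum_(w <- Sinf) growth w + \sum_(w <- Sinf) d w + (size Sinf)%:R * e).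
  apply: (@le_trans _ _ (\sum_(w <- Sinf) (Ci w + n%:R * (growth w + d w + e)))).
    by rewrite big_seq [leRHS]big_seq; apply: ler_sum => w /mem_Sinf pw; apply: HCi.
  rewrite (spl _ Ci (fun w => n%:R * (growth w + d w + e))) -mulr_sumr (spl _ (fun w => growth w + d w) (fun=> e)).
  by rewrite spl big_const_seq count_predT iter_addr_0 -[e *+ _]mulr_natl.
have B2 : \sum_(w <- S) ln (w (form n l)) <= \sum_(w <- S) Cf w + \sum_(w <- S) fin_error n w +
    n%:R * (\sum_(w <- S) growth w + \sum_(w <- S) d' w).
  apply: (@le_trans _ _ (\sum_(w <- S) (Cf w + fin_error n w + n%:R * (growth w + d' w)))).
    by rewrite big_seq [leRHS]big_seq; apply: ler_sum => w /pS pw; have [_ /(_ pw)[_ ]] := HCf w; apply.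
  by rewrite (spl _ (fun w => Cf w + fin_error n w) (fun w => n%:R * (growth w + d' w))) (spl _ Cf (fin_error n)) -mulr_sumr (spl _ growth d').
have B3 : \sum_(w <- S) Cf w <= \sum_(w <- S0) Cf w.
  have -> : \sum_(w <- S) Cf w = \sum_(w <- [seq w <- S | w \in S0]) Cf w.
    rewrite big_filter [RHS]big_mkcond; apply: eq_big_seq => w wS; case: ifP => // /negbT.
    rewrite mem_undup inE negb_or => /andP[ww wD].
    have [_ /(_ (pS _ wS))[H _]] := HCf w; apply: H => //; apply/eqP.
    rewrite eq_le (fin_nat_le1 (pS _ wS)) leNgt; apply/negP => h; move/negP: wD; apply.
    by apply/HSD; split=> //; exact: pS.
  apply: sum_subseq_le; [exact: filter_uniq|exact: undup_uniq| |by move=> w _; case: (HCf w)].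
  by move=> w; rewrite mem_filter => /andP[].
have B4 := fin_error_sum n uS pS.
have K2 : (2 <= (n * m.-1 + m).+1)%N by rewrite ltnS; apply: leq_trans (leq_addl _ _); exact: ltnW.
have B5 := HCL _ K2.
have B6 := growth_sum uS pS SDS.
have B7 := Vv_le w0.
have B8 : \sum_(w <- Sinf) d w + \sum_(w <- S) d' w <= e - hb.
  rewrite /d /d' !big_delta ?uniq_Sinf //; case: hw0 => pw.
    have -> : w0 \in Sinf by exact/mem_Sinf.
    case: ifP => [/pS h|_]; first by case: (place_inf_not_fin pw h).
    by rewrite addr0 lerDr ltW.
  rewrite fin_notin_Sinf //.
  have -> : w0 \in S by rewrite mem_undup !mem_cat mem_filter inE eqxx andbT (introT (finP _) pw).
  by rewrite add0r.
have EK : (n * m.-1 + m).+1%:R = n%:R * (m%:R - 1) + m.+1%:R :> R.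
  rewrite -addnS natrD natrM -subn1 natrB //; exact: ltnW.
rewrite EK in B5.
have n0 : 0 <= n%:R :> R by [].
have B9 := ler_wpM2l n0 (lerD (lerD B6 B8) B7).
rewrite -/hb in B7 B9.
rewrite {}/c; move: PF B1 B2 B3 B4 B5 B9; exact: bound_arithmetic.
Qed.

End Relation.

Lemma linear_independence (w0 : K -> R) (L : fieldType) (NL : L -> R) (iota : {rmorphism K -> L})
    (l : 'I_m.-1 -> L) (lam0 : K) (lam : 'I_m.-1 -> K) :
  @places R K w0 -> 0 < Vv al s D w0 beta -> completion w0 NL iota ->
  (forall j : 'I_m.-1, cvg_abs NL (fun n => iota (\sum_(k < n) moment al sK j k * beta ^- k.+1)) (l j)) ->
  iota lam0 + \sum_(j < m.-1) iota (lam j) * l j = 0 -> lam0 = 0 /\ forall j, lam j = 0.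
Proof.
move=> hw0 hV cL Hl rel; apply: contrapT => nz.
(* Small enough that the slack (size Sinf + m) e stays strictly below V. *)
pose e := Vv al s D w0 beta / ((size Sinf)%:R + m%:R + 1).
have p0 : 0 < (size Sinf)%:R + m%:R + 1 :> R by rewrite ltr_wpDl.
have e0 : 0 < e by rewrite divr_gt0.
have [_ H] := distinguished_place m2 D0 cuD bmE bm_neq hw0 hV cL.
have [C HC] := H l lam0 lam e e0 Hl rel.
have := combine_places hw0 e0 nz _; rewrite leNgt => /(_ _)/negP; apply.
  exists C => n l0 lm f0; apply: (le_trans (HC n l0 lm f0)); rewrite lerD2l ler_wpM2l //.
  by rewrite /growth -/als; lra.
have -> : Vv al s D w0 beta = ((size Sinf)%:R + m%:R + 1) * e by rewrite /e mulrC divfK // gt_eqF.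
by rewrite ltr_pM2r // ltrDl.
Qed.

End Independence.

(** A rational algebraic integer is an integer, so the denominator defined through algebraic
    integers is the usual one. *)
Lemma is_den_rat (K : fieldExtType rat) (x : rat) D : is_den (x%:A : K) D -> D = `|denq x|%N.
Proof.
case=> D0 aD Dmin.
have aE n : algint (n%:R * x%:A : K) -> exists z : int, n%:R * x = z%:~R.
  move=> h; apply: algint_rat; apply: (@algint_rmorph_inj _ _ (in_alg K)).
  have E : (n%:R * x)%:A = n%:R * x%:A :> K by rewrite -scalerA scaler_nat mulr_natl.
  by rewrite -E in h.
have q0 : (0 < `|denq x|)%N by rewrite absz_gt0 denq_eq0.
apply/eqP; rewrite eqn_leq; apply/andP; split.
  apply: Dmin => //; rewrite (rat_algE K x) mulrC divfK; first exact: algint_int.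
  by rewrite -[`|_|%N]prednK // nat_neq0.
have [z Ez] := aE _ aD; apply: dvdn_leq => //.
have E : (D%:Z * numq x = z * denq x)%R.
  apply: (@intr_inj rat); rewrite !rmorphM /= -Ez numqE; ring.
have : (`|denq x| %| `|numq x| * D)%N by rewrite mulnC -[D]/`|D%:Z|%N -abszM E abszM dvdn_mull.
by rewrite Gauss_dvdr // coprime_sym coprime_num_den.
Qed.

Theorem theorem1p1 (R : realType) (K : fieldExtType rat) (m : nat)
    (a b : {poly K}) (al : 'I_m -> K) (s : 'I_m -> rat) (D : nat)
    (w0 : K -> R) (beta : K) :
  (2 <= m)%N ->
  injective al ->
  a = \prod_(i < m) ('X - (al i)%:P) ->
  (size b <= m)%N ->
  (forall i, b.[al i] / (a^`()).[al i] = (s i)%:A) ->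
  (forall i (n : nat), s i != - (n.+1)%:R) ->
  (forall n : nat, b`_m.-1 != - (n.+2)%:R) ->
  is_den b`_m.-1 D ->
  places w0 ->
  beta != 0 ->
  0 < Vv al s D w0 beta ->
  forall (L : fieldType) (NL : L -> R) (iota : {rmorphism K -> L}),
    completion w0 NL iota ->
    exists l : 'I_m.-1 -> L,
      (forall j : 'I_m.-1,
         cvg_abs NL (fun n => iota (\sum_(k < n)
                    fcoef al (fun i => (s i)%:A) b`_m.-1 j k * beta ^- k))
              (l j)) /\
      (forall (lam0 : K) (lam : 'I_m.-1 -> K),
         iota lam0 + \sum_(j < m.-1) iota (lam j) * l j = 0 ->
         lam0 = 0 /\ forall j, lam j = 0).
Proof.
move=> m2 al_inj aE sb bs s_neq b_neq bD hw0 _ hV L NL iota cL.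
(* Interpolation at the m points al_i identifies b with [bpol], whose coefficient of X^(m-1) is the
   sum of the s_i; in particular b_{m-1} is rational. *)
have bmE : b`_m.-1 = \sum_i (s i)%:A.
  rewrite (@bpol_unique _ _ al al_inj (fun i => (s i)%:A) b) ?bpol_coef ?(ltnW m2) // => i.
  by rewrite /apol -aE bs.
have sumA : \sum_i (s i)%:A = (\sum_i s i)%:A :> K by rewrite scaler_suml.
have DE : D = `|denq (\sum_i s i)|%N by apply: (@is_den_rat K); rewrite -sumA -bmE.
have D0 : (0 < D)%N by case: bD.
have bm_neq n : \sum_i ((s i)%:A : K) != - (n.+2)%:R by rewrite -bmE.
have uE : \sum_i ((s i)%:A : K) = (numq (\sum_i s i))%:~R / D%:R by rewrite sumA rat_algE DE.
have cuD : coprime `|numq (\sum_i s i)| D by rewrite DE coprime_num_den.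
have [[l Hl] _] := distinguished_place m2 D0 cuD uE bm_neq hw0 hV cL.
exists l; split=> [j|lam0 lam rel].
  exact: (fcoef_series bmE (Hl j)).
exact: (linear_independence m2 al_inj s_neq D0 cuD uE bm_neq hw0 hV cL Hl rel).
Qed.
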